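(* Let $V$ be a grading-restricted vertex superalgebra, $g$ an automorphism of $V$ and $W$ a lower-bounded generalized $g$-twisted $V$-module. For $u, v\in V$ and $w\in W$, $$x_0^{-1}\delta\left(\frac{x_1- x_2}{x_0}\right)Y_{W}^{g}\left(\left(\frac{x_{1}-x_2}{x_0}\right)^{\mathcal{L}_{g}}u, x_{1}\right)(Y^{g})_{WV}^{W}(w, x_{2})v$$ $$- (-1)^{|u||w|}x_0^{-1}\delta\left(\frac{-x_{2}+x_1}{x_0}\right)(Y^{g})_{WV}^{W}(w, x_{2})Y_{V}\left(\left(\frac{-x_{2}+x_1}{x_{0}}\right)^{\mathcal{L}_{g}}u, x_1\right)v$$ $$= x_1^{-1}\delta\left(\frac{ x_2 + x_0}{x_1}\right)(Y^{g})_{WV}^{W}\left(Y_{W}^{g}\left(u, x_0\right)w, x_{2}\right)v.$$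
   Context: Conventions: $x,y,x_0,x_1,x_2$ and their logarithms are formal variables; $\delta(x)=\sum_{n\in\mathbb Z}x^n$. Expressions $(x_1-x_2)^n$, $(x_2+x_0)^n$ ($n\in\mathbb C$), $\log(x_1-x_2)=\log x_1+\log(1-x_2/x_1)$, etc. are expanded as power series in the second variable. For any operator or number $A$, $(-x_2+x_1)^A:=(x_2-x_1)^Ae^{\pi iA}$ (so $\log(-x_2+x_1)=\log(x_2-x_1)+\pi i$), expanded as a power series in $x_1$. For $z\in\mathbb C^\times$ and $p\in\mathbb Z$, $l_p(z)=\log|z|+i\arg z+2p\pi i$ with $0\le\arg z<2\pi$. $W\{x\}$ denotes formal series $\sum_{n\in\mathbb C}w_nx^n$, $w_n\in W$. Elements of $V$, $W$ are taken of pure parity, so $|\cdot|$ is defined. A grading-restricted vertex superalgebra is a $\frac{\mathbb Z}{2}$-graded complex vector space $V=\coprod_{n\in\frac{\mathbb Z}{2}}V_{(n)}$ with a linear map $Y_V:V\otimes V\to V[[x,x^{-1}]]$ and a vacuum $\mathbf 1\in V_{(0)}$ such that: (i) $\dim V_{(n)}<\infty$ and $V_{(n)}=0$ for $n$ sufficiently negative; with $L_V(0)v=nv$ for $v\in V_{(n)}$, $[L_V(0),Y_V(v,x)]=x\frac{d}{dx}Y_V(v,x)+Y_V(L_V(0)v,x)$; (ii) $Y_V(\mathbf 1,x)=1_V$ and $\lim_{x\to0}Y_V(u,x)\mathbf 1=u$; (iii) with $L_V(-1)v=\lim_{x\to0}\frac{d}{dx}Y_V(v,x)\mathbf 1$,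 $\frac{d}{dx}Y_V(v,x)=Y_V(L_V(-1)v,x)=[L_V(-1),Y_V(v,x)]$; (iv) duality: with $|u|=0$ for $u\in\coprod_{n\in\mathbb Z}V_{(n)}$ and $|u|=1$ for $u\in\coprod_{n\in\mathbb Z+\frac12}V_{(n)}$, for $v\in V$, $v'\in V'$ (graded dual) the series $\langle v',Y_V(u_1,z_1)Y_V(u_2,z_2)v\rangle$, $(-1)^{|u_1||u_2|}\langle v',Y_V(u_2,z_2)Y_V(u_1,z_1)v\rangle$, $\langle v',Y_V(Y_V(u_1,z_1-z_2)u_2,z_2)v\rangle$ converge absolutely in $|z_1|>|z_2|>0$, $|z_2|>|z_1|>0$, $|z_2|>|z_1-z_2|>0$, respectively, to a common rational function with only possible poles at $z_1=0,z_2=0,z_1=z_2$. An automorphism $g$ of $V$ is a weight-preserving invertible linear map with $gY_V(u,x)v=Y_V(gu,x)gv$. A generalized $g$-twisted $V$-module is a $\mathbb C\times\mathbb Z_2\times\mathbb C/\mathbb Z$-graded space $W=\coprod_{n\in\mathbb C,s\in\mathbb Z_2,\alpha\in P_W}W_{[n]}^{s;[\alpha]}$ (weight, fermion number, $g$-weight; $P_W\subset\{\alpha:0\le\Re(\alpha)<1\}$), $|w|=s$ for $w$ of fermion number $s$, with operators $L_W(0),L_W(-1)$, an action of $g$, and a linear map $Y_W^g:V\otimes W\to W\{x\}[\log x]$ such that, writing $(Y_W^g)^p(v,z)$ for the result of substituting $x^n=e^{nl_p(z)}$, $\log x=l_p(z)$: (1) $(Y_W^g)^{p+1}(gv,z)w=(Y_W^g)^p(v,z)w$;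 (2) $Y_W^g(\mathbf 1,x)w=w$; (3) duality: for $u,v\in V$, $w\in W$, $w'\in W'$ (graded dual) there is $f(z_1,z_2)=\sum_{i,j,k,l=0}^Na_{ijkl}z_1^{m_i}z_2^{n_j}(\log z_1)^k(\log z_2)^l(z_1-z_2)^{-t}$ ($m_i,n_j\in\mathbb C$, $t\in\mathbb Z_+$) such that for all $p\in\mathbb Z$ the series $\langle w',(Y_W^g)^p(u,z_1)(Y_W^g)^p(v,z_2)w\rangle$, $(-1)^{|u||v|}\langle w',(Y_W^g)^p(v,z_2)(Y_W^g)^p(u,z_1)w\rangle$, $\langle w',(Y_W^g)^p(Y_V(u,z_1-z_2)v,z_2)w\rangle$ converge absolutely in $|z_1|>|z_2|>0$, $|z_2|>|z_1|>0$, $|z_2|>|z_1-z_2|>0$, and their sums equal the branch $f^{p,p}$ (obtained with $z_i^{m}=e^{ml_p(z_i)}$, $\log z_i=l_p(z_i)$) in $|z_1|>|z_2|>0$, in $|z_2|>|z_1|>0$, and in $|z_2|>|z_1-z_2|>0$, $|\arg z_1-\arg z_2|<\frac\pi2$, respectively; (4) $L_W(0)-n$ is nilpotent on each element of $W_{[n]}$; $[L_W(0),Y_W^g(v,x)]=x\frac d{dx}Y_W^g(v,x)+Y_W^g(L_V(0)v,x)$; $g-e^{2\pi i\alpha}$ is nilpotent on each element of $W^{[\alpha]}$; $gY_W^g(u,x)w=Y_W^g(gu,x)gw$; $|Y_W^g(u,x)w|=|u|+|w|$; (5) $\frac d{dx}Y_W^g(v,x)=[L_W(-1),Y_W^g(v,x)]$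 (then also $=Y_W^g(L_V(-1)v,x)$). Here $W_{[n]}=\coprod_{s,\alpha}W_{[n]}^{s;[\alpha]}$ and $W^{[\alpha]}=\coprod_{n,s}W_{[n]}^{s;[\alpha]}$. It is lower-bounded if for some $B\in\mathbb R$, $W_{[n]}=0$ whenever $\Re(n)<B$. $V^{[\alpha]}$ is the generalized eigenspace of $g$ on $V$ with eigenvalue $e^{2\pi i\alpha}$, $0\le\Re(\alpha)<1$. On $V$, $\mathcal S_g$ acts on $V^{[\alpha]}$ as multiplication by $\alpha$, $\mathcal N_g=\frac1{2\pi i}\log(e^{-2\pi i\mathcal S_g}g)$ is nilpotent on each $V_{(n)}$, and $\mathcal L_g=\mathcal S_g+\mathcal N_g$, so $g=e^{2\pi i\mathcal L_g}$. For $u\in V^{[\alpha]}$, $\left(\frac{x_1-x_2}{x_0}\right)^{\mathcal L_g}u=(x_1-x_2)^{\alpha}x_0^{-\alpha}e^{(\log(x_1-x_2)-\log x_0)\mathcal N_g}u$, and $\left(\frac{-x_2+x_1}{x_0}\right)^{\mathcal L_g}u=(-x_2+x_1)^{\alpha}x_0^{-\alpha}e^{(\log(-x_2+x_1)-\log x_0)\mathcal N_g}u$, extended linearly in $u$. Twist vertex operator map: $(Y^g)_{WV}^W:W\otimes V\to W\{x\}[\log x]$, $$(Y^{g})_{WV}^{W}(w, x)v=(-1)^{|v||w|}e^{xL_{W}(-1)}Y_{W}^{g}(v, y)w\big|_{y^{n}=e^{\pi ni}x^{n},\; \log y=\log x+\pi i}.$$ *)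

(* Defs.v *)
From mathcomp Require Import all_boot all_order all_algebra.
From mathcomp Require Import finmap.
From mathcomp Require Import all_classical all_reals all_analysis.
From mathcomp Require Import complex.

Set Implicit Arguments.
Unset Strict Implicit.
Unset Printing Implicit Defensive.
Import Order.TTheory GRing.Theory Num.Theory.
Local Open Scope classical_set_scope.
Local Open Scope complex_scope.
Local Open Scope ring_scope.

(** * Complex numbers *)

Section ComplexNumbers.
Context {R : realType}.
Local Notation C := R[i].

Definition cmod (z : C) : R := complex.Re `|z|.

Definition cexp (z : C) : C :=
  (expR (complex.Re z))%:C * (cos (complex.Im z) +i* sin (complex.Im z)).

Definition pi_i : C := 0 +i* pi.

(* The argument in [0, 2 pi[ of a nonzero complex number. *)
Definition carg (z : C) : R :=
  let t := acos (complex.Re z / cmod z) in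
  if 0 <= complex.Im z then t else 2 * pi - t.

Definition lp (p : int) (z : C) : C :=
  ln (cmod z) +i* (carg z + 2 * p%:~R * pi).

Definition cpow (p : int) (z m : C) : C := cexp (m * lp p z).

(* The index set is arbitrary (in particular it may be C * C): only countably
   many terms of an absolutely convergent family are nonzero. *)
Definition abs_converges (I : choiceType) (f : I -> C) : Prop :=
  summable [set: I] (fun i => (cmod (f i))%:E).

Definition abs_sums_to (I : choiceType) (f : I -> C) (s : C) : Prop :=
  abs_converges f /\
  forall eps : R, 0 < eps -> exists A : {fset I}, forall B : {fset I},
    (A `<=` B)%fset -> cmod (\sum_(i <- B) f i - s) < eps.

Definition strip : set C := [set a | 0 <= complex.Re a < 1].

Definition binC (a : C) (m : nat) : C :=
  (\prod_(j < m) (a - j%:R)) / (m`!)%:R.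

End ComplexNumbers.

(** * Direct sums, graded duals and generalized eigenspaces *)

Section LinearAlgebra.
Context {R : realType}.
Local Notation C := R[i].
Context {V : lmodType C}.

Definition subspace (U : set V) : Prop :=
  U 0 /\ forall (a : C) x y, U x -> U y -> U (a *: x + y).

Definition finite_dim (U : set V) : Prop :=
  exists s : seq V, (forall x, x \in s -> U x) /\
    forall v, U v -> exists a : nat -> C, v = \sum_(i < size s) a i *: s`_i.

Definition decomposition (I : choiceType) (D : set I) (U : I -> set V)
    (v : V) (c : I -> V) : Prop :=
  [/\ finite_set [set i | c i != 0],
      forall i, D i -> U i (c i),
      forall i, ~ D i -> c i = 0 &
      v = \sum_(i \in [set: I]) c i].

(* V is the coproduct of the subspaces U i, i in D. *)
Definition direct_sum (I : choiceType) (D : set I) (U : I -> set V) : Prop :=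
  (forall i, D i -> subspace (U i)) /\
  forall v, exists! c, decomposition D U v c.

(* The coproduct of the U i, i in D, inside V. *)
Definition coprod (I : choiceType) (D : set I) (U : I -> set V) : set V :=
  [set v | exists c, decomposition D U v c].

(* component D U v i is the i-th component of v if V is the coproduct of the
   U i, i in D. *)
Definition component (I : choiceType) (D : set I) (U : I -> set V) (v : V) :
    I -> V :=
  xget (fun=> 0) [set c | decomposition D U v c].

Definition graded_dual (I : choiceType) (D : set I) (U : I -> set V)
    (f : {scalar V}) : Prop :=
  exists2 F : set I, finite_set F &
    forall i v, D i -> ~ F i -> U i v -> f v = 0.

(* Generalized eigenspace of T for the eigenvalue e^{2 pi i a}. *)
Definition geneig (T : V -> V) (a : C) : set V :=
  [set v | exists k : nat,
    iter k (fun x => T x - cexp (2 * pi_i * a) *: x) v = 0].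

(* e^{z S_T}, where S_T acts on the generalized eigenspace of T for the
   eigenvalue e^{2 pi i a}, 0 <= Re a < 1, as multiplication by a. *)
Definition expS (T : V -> V) (z : C) (v : V) : V :=
  \sum_(a \in [set: C]) cexp (z * a) *: component strip (geneig T) v a.

(* (2 pi i)^-1 log (e^{- 2 pi i S_T} T), for a locally unipotent
   e^{- 2 pi i S_T} T. *)
Definition nilN (T : V -> V) (v : V) : V :=
  (2 * pi_i)^-1 *: \sum_(k \in [set k : nat | (0 < k)%N])
    ((-1) ^+ k.+1 / k%:R) *: iter k (fun x => expS T (- (2 * pi_i)) (T x) - x) v.

End LinearAlgebra.

(** * Grading-restricted vertex superalgebras *)

Section VertexSuperalgebras.
Context {R : realType}.
Local Notation C := R[i].

(* |u| = s for u in the span of the V_(h/2) with h = s mod 2. *)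
Definition half_parity (V : lmodType C) (gr : int -> set V) (s : bool) :
    set V :=
  coprod [set h : int | odd `|h|%N = s] gr.

Definition rational2 (P : {poly {poly C}}) (r s t : nat) (z1 z2 : C) : C :=
  P.[z1%:P].[z2] / (z1 ^+ r * z2 ^+ s * (z1 - z2) ^+ t).

(* Vgr h is V_(h/2), and YV v n w is the coefficient of x^n in Y_V(v,x)w. *)
Record vertex_superalgebra (V : lmodType C) := VertexSuperalgebra {
  Vgr : int -> set V;
  Vgr_direct : direct_sum [set: int] Vgr;
  Vgr_findim : forall h, finite_dim (Vgr h);
  Vgr_lower : exists N : int, forall h, h < N -> Vgr h `<=` [set 0];
  YV : V -> int -> V -> V;
  YV_linearl : forall n w, linear (fun v => YV v n w);
  YV_linearr : forall v n, linear (YV v n);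
  vac : V;
  vac_gr : Vgr 0 vac;
  LV0 : {linear V -> V};
  LV0_gr : forall h v, Vgr h v -> LV0 v = (h%:~R / 2) *: v;
  LV0_comm : forall v n w,
    LV0 (YV v n w) - YV v n (LV0 w) = n%:~R *: YV v n w + YV (LV0 v) n w;
  YV_vac : forall n w, YV vac n w = if n == 0 then w else 0;
  YV_creation : forall u (n : int), n <= 0 ->
    YV u n vac = if n == 0 then u else 0;
  LVm1 : V -> V := fun v => YV v 1 vac;
  LVm1_deriv : forall v n w, (n + 1)%:~R *: YV v (n + 1) w = YV (LVm1 v) n w;
  LVm1_comm : forall v n w,
    YV (LVm1 v) n w = LVm1 (YV v n w) - YV v n (LVm1 w);
  YV_duality : forall (s1 s2 : bool) (u1 u2 v : V) (v' : {scalar V}),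
    half_parity Vgr s1 u1 -> half_parity Vgr s2 u2 ->
    graded_dual [set: int] Vgr v' ->
    exists (P : {poly {poly C}}) (r s t : nat),
    [/\ forall z1 z2 : C, 0 < cmod z2 -> cmod z2 < cmod z1 ->
          abs_sums_to (fun mn : int * int =>
            v' (YV u1 mn.1 (YV u2 mn.2 v)) * z1 ^ mn.1 * z2 ^ mn.2)
          (rational2 P r s t z1 z2),
        forall z1 z2 : C, 0 < cmod z1 -> cmod z1 < cmod z2 ->
          abs_sums_to (fun mn : int * int => (-1) ^+ (s1 && s2) *
            v' (YV u2 mn.2 (YV u1 mn.1 v)) * z1 ^ mn.1 * z2 ^ mn.2)
          (rational2 P r s t z1 z2) &
        forall z1 z2 : C, 0 < cmod (z1 - z2) -> cmod (z1 - z2) < cmod z2 ->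
          abs_sums_to (fun mn : int * int =>
            v' (YV (YV u1 mn.1 u2) mn.2 v) * (z1 - z2) ^ mn.1 * z2 ^ mn.2)
          (rational2 P r s t z1 z2)]
}.

Definition Vparity (V : lmodType C) (VA : vertex_superalgebra V) (s : bool) :
    set V :=
  half_parity (Vgr VA) s.

Record automorphism (V : lmodType C) (VA : vertex_superalgebra V) :=
  Automorphism {
  aut :> {linear V -> V};
  aut_bij : bijective aut;
  aut_gr : forall h v, Vgr VA h v -> Vgr VA h (aut v);
  aut_Y : forall u n v, aut (YV VA u n v) = YV VA (aut u) n (aut v)
}.

End VertexSuperalgebras.

(** * Generalized twisted modules *)

Section TwistedModules.
Context {R : realType}.
Local Notation C := R[i].

(* The branch f^{p,p} of
   f(z1,z2) = \sum_{i,j,k,l=0}^N a_{ijkl} z1^{m_i} z2^{n_j}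
                (log z1)^k (log z2)^l (z1-z2)^{-t}. *)
Definition branch_pp (N : nat) (a : nat -> nat -> nat -> nat -> C)
    (m n : nat -> C) (t : nat) (p : int) (z1 z2 : C) : C :=
  \sum_(i < N.+1) \sum_(j < N.+1) \sum_(k < N.+1) \sum_(l < N.+1)
    a i j k l * cpow p z1 (m i) * cpow p z2 (n j) *
    lp p z1 ^+ k * lp p z2 ^+ l * (z1 - z2) ^- t.

(* Elements of C/Z are represented in the strip 0 <= Re < 1. *)
Definition Wpart (W : lmodType C) (PW : set C) (gr : C * bool * C -> set W)
    (Q : set (C * bool * C)) : set W :=
  coprod [set i | PW i.2 /\ Q i] gr.

(* Wgr (n, s, a) is W_[n]^{s;[a]}, and YW v n k w is the coefficient of
   x^n (log x)^k in Y_W^g(v,x)w.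
   In the duality axiom the terms of a series in z1, z2 are indexed by the
   powers of the variables; for fixed powers, the polynomials in log z1 and
   log z2 are finite sums, evaluated first. *)
Record twisted_module (V : lmodType C) (VA : vertex_superalgebra V)
    (g : automorphism VA) (W : lmodType C) := TwistedModule {
  PW : set C;
  PW_strip : PW `<=` strip;
  Wgr : C * bool * C -> set W;
  Wgr_direct : direct_sum [set i | PW i.2] Wgr;
  LW0 : {linear W -> W};
  LWm1 : {linear W -> W};
  gW : {linear W -> W};
  YW : V -> C -> nat -> W -> W;
  YW_linearl : forall n k w, linear (fun v => YW v n k w);
  YW_linearr : forall v n k, linear (YW v n k);
  YW_log : forall v w, exists K : nat, forall n k, (K <= k)%N -> YW v n k w = 0;
  Wdual : set {scalar W} := graded_dual [set i | PW i.2] Wgr;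
  YW_equivariance : forall (p : int) (z : C) (v : V) (w : W) (w' : {scalar W}),
    z != 0 -> Wdual w' ->
    \sum_(nk \in [set: C * nat])
      w' (YW (g v) nk.1 nk.2 w) * cpow (p + 1) z nk.1 * lp (p + 1) z ^+ nk.2 =
    \sum_(nk \in [set: C * nat])
      w' (YW v nk.1 nk.2 w) * cpow p z nk.1 * lp p z ^+ nk.2;
  YW_vac : forall n k w,
    YW (vac VA) n k w = if (n == 0) && (k == 0%N) then w else 0;
  YW_duality : forall (s1 s2 : bool) (u v : V) (w : W) (w' : {scalar W}),
    Vparity VA s1 u -> Vparity VA s2 v -> Wdual w' ->
    exists (N : nat) (a : nat -> nat -> nat -> nat -> C) (m n : nat -> C)
           (t : nat), (0 < t)%N /\
    forall p : int,
    let f := branch_pp N a m n t p in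
    let series12 z1 z2 (e : C * C) :=
      \sum_(k \in [set: nat * nat])
        w' (YW u e.1 k.1 (YW v e.2 k.2 w)) *
        cpow p z1 e.1 * lp p z1 ^+ k.1 * cpow p z2 e.2 * lp p z2 ^+ k.2 in
    let series21 z1 z2 (e : C * C) :=
      (-1) ^+ (s1 && s2) * \sum_(k \in [set: nat * nat])
        w' (YW v e.2 k.2 (YW u e.1 k.1 w)) *
        cpow p z1 e.1 * lp p z1 ^+ k.1 * cpow p z2 e.2 * lp p z2 ^+ k.2 in
    let series_it z1 z2 (e : int * C) :=
      \sum_(k \in [set: nat])
        w' (YW (YV VA u e.1 v) e.2 k w) *
        (z1 - z2) ^ e.1 * cpow p z2 e.2 * lp p z2 ^+ k in
    [/\ forall z1 z2 : C, 0 < cmod z2 -> cmod z2 < cmod z1 ->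
          abs_sums_to (series12 z1 z2) (f z1 z2),
        forall z1 z2 : C, 0 < cmod z1 -> cmod z1 < cmod z2 ->
          abs_sums_to (series21 z1 z2) (f z1 z2),
        forall z1 z2 : C, 0 < cmod (z1 - z2) -> cmod (z1 - z2) < cmod z2 ->
          abs_converges (series_it z1 z2) &
        forall z1 z2 : C, 0 < cmod (z1 - z2) -> cmod (z1 - z2) < cmod z2 ->
          `|carg z1 - carg z2| < pi / 2 ->
          abs_sums_to (series_it z1 z2) (f z1 z2)];
  LW0_nilpotent : forall n w, Wpart PW Wgr [set i | i.1.1 = n] w ->
    exists k : nat, iter k (fun x => LW0 x - n *: x) w = 0;
  LW0_comm : forall v n k w,
    LW0 (YW v n k w) - YW v n k (LW0 w) =
    n *: YW v n k w + (k.+1)%:R *: YW v n k.+1 w + YW (LV0 VA v) n k w;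
  gW_geneig : forall a, Wpart PW Wgr [set i | i.2 = a] `<=` geneig gW a;
  gW_Y : forall u n k w, gW (YW u n k w) = YW (g u) n k (gW w);
  YW_parity : forall (s t : bool) u w n k,
    Vparity VA s u -> Wpart PW Wgr [set i | i.1.2 = t] w ->
    Wpart PW Wgr [set i | i.1.2 = s (+) t] (YW u n k w);
  LWm1_comm : forall v n k w,
    (n + 1) *: YW v (n + 1) k w + (k.+1)%:R *: YW v (n + 1) k.+1 w =
    LWm1 (YW v n k w) - YW v n k (LWm1 w)
}.

Definition Wparity (V : lmodType C) (VA : vertex_superalgebra V)
    (g : automorphism VA) (W : lmodType C) (M : twisted_module g W)
    (s : bool) : set W :=
  Wpart (PW M) (Wgr M) [set i | i.1.2 = s].

Definition lower_bounded (V : lmodType C) (VA : vertex_superalgebra V)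
    (g : automorphism VA) (W : lmodType C) (M : twisted_module g W) : Prop :=
  exists B : R, forall n : C, complex.Re n < B ->
    Wpart (PW M) (Wgr M) [set i | i.1.1 = n] `<=` [set 0].

End TwistedModules.

(** * Formal calculus in x_0, x_1, x_2 and their logarithms *)

Section FormalCalculus.
Context {R : realType}.
Local Notation C := R[i].

(* The pair (a, k) stands for \prod_i x_i^{a_i} (log x_i)^{k_i}; the addition
   of pairs is the multiplication of monomials. *)
Definition monomial : Type := ({ffun 'I_3 -> C} * {ffun 'I_3 -> nat})%type.

Definition xmon (i : 'I_3) (a : C) : monomial :=
  ([ffun j => if j == i then a else 0], 0).
Definition lmon (i : 'I_3) : monomial :=
  (0, [ffun j => if j == i then 1%N else 0%N]).

(* coef F is meaningful only if defined F holds. The combinators below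
   accumulate in the field defined the finiteness of all the sums from which
   the coefficients are computed; a sum \sum_(i \in A) with infinite support
   would be 0 by convention. *)
Record fexpr (A : Type) := FExpr {
  coef :> monomial -> A;
  defined : Prop
}.

Definition fmono (A : nmodType) (a : A) (e : monomial) : fexpr A :=
  {| coef := fun m => if m == e then a else 0; defined := True |}.

Definition fcst (A : nmodType) (a : A) : fexpr A := fmono a 0.

Definition fadd (A : nmodType) (F G : fexpr A) : fexpr A :=
  {| coef := fun m => F m + G m; defined := defined F /\ defined G |}.

Definition fsub (A : zmodType) (F G : fexpr A) : fexpr A :=
  {| coef := fun m => F m - G m; defined := defined F /\ defined G |}.

Definition fmap (A B : Type) (phi : A -> B) (F : fexpr A) : fexpr B :=
  {| coef := fun m => phi (F m); defined := defined F |}.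

Definition fsum (I : choiceType) (A : nmodType) (F : I -> fexpr A) : fexpr A :=
  {| coef := fun m => \sum_(i \in [set: I]) F i m;
     defined := (forall i, defined (F i)) /\
       forall m, finite_set [set i | F i m != 0] |}.

(* Extension of a bilinear operation with values in formal series: the image
   of F = \sum_p a_p X^p and G = \sum_q b_q X^q is
   \sum_{p,q} op(a_p, b_q) X^{p+q}. *)
Definition fbil (A B : Type) (D : nmodType) (op : A -> B -> fexpr D)
    (F : fexpr A) (G : fexpr B) : fexpr D :=
  {| coef := fun m =>
       \sum_(t \in [set t : monomial * monomial * monomial |
                      t.1.1 + t.1.2 + t.2 = m])
         op (F t.1.1) (G t.1.2) t.2;
     defined :=
       [/\ defined F, defined G, forall p q, defined (op (F p) (G q)) &
           forall m, finite_set [set t : monomial * monomial * monomial |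
             t.1.1 + t.1.2 + t.2 = m /\ op (F t.1.1) (G t.1.2) t.2 != 0]] |}.

Definition fmul (F G : fexpr C) : fexpr C := fbil (fun a b => fcst (a * b)) F G.

Definition fscale (A : lmodType C) (F : fexpr C) (G : fexpr A) : fexpr A :=
  fbil (fun a b => fcst (a *: b)) F G.

Definition fpow (F : fexpr C) (k : nat) : fexpr C := iter k (fmul F) (fcst 1).

Definition xpow (i : 'I_3) (a : C) : fexpr C := fmono 1 (xmon i a).
Definition flog (i : 'I_3) : fexpr C := fmono 1 (lmon i).

(* (x_i + c x_j)^a and log(x_i + c x_j), expanded in powers of x_j. *)
Definition binpow (i j : 'I_3) (c a : C) : fexpr C :=
  fsum (fun m : nat =>
    fmono (binC a m * c ^+ m) (xmon i (a - m%:R) + xmon j m%:R)).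

Definition binlog (i j : 'I_3) (c : C) : fexpr C :=
  fadd (flog i) (fsum (fun m : nat =>
    fmono ((-1) ^+ m * c ^+ m.+1 / m.+1%:R)
          (xmon i (- m.+1%:R) + xmon j m.+1%:R))).

(* A binomial is given by its complex powers and its logarithm. *)
Record binomial := Binomial {
  bpow : C -> fexpr C;
  blog : fexpr C
}.

Definition bsub (i j : 'I_3) : binomial :=
  {| bpow := binpow i j (-1); blog := binlog i j (-1) |}.

Definition badd (i j : 'I_3) : binomial :=
  {| bpow := binpow i j 1; blog := binlog i j 1 |}.

(* - x_i + x_j, with (- x_i + x_j)^A = (x_i - x_j)^A e^{pi i A}. *)
Definition bnegadd (i j : 'I_3) : binomial :=
  {| bpow := fun a => fmul (binpow i j (-1) a) (fcst (cexp (pi_i * a)));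
     blog := fadd (binlog i j (-1)) (fcst pi_i) |}.

(* x_k^{-1} delta(b / x_k) *)
Definition fdelta (k : 'I_3) (b : binomial) : fexpr C :=
  fsum (fun n : int => fmul (xpow k (- n%:~R - 1)) (bpow b n%:~R)).

(* (b / x_k)^{L_T} u, with L_T = S_T + N_T *)
Definition fpowL (V : lmodType C) (T : V -> V) (k : 'I_3) (b : binomial)
    (u : V) : fexpr V :=
  fsum (fun al : C * nat =>
    fscale (fmul (fmul (bpow b al.1) (xpow k (- al.1)))
                 (fmul (fcst ((al.2`!)%:R)^-1)
                       (fpow (fsub (blog b) (flog k)) al.2)))
           (fcst (iter al.2 (nilN T) (component strip (geneig T) u al.1)))).

(* e^{x_i L} F *)
Definition fexpL (W : lmodType C) (L : W -> W) (i : 'I_3) (F : fexpr W) :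
    fexpr W :=
  fsum (fun j : nat =>
    fscale (fmono ((j`!)%:R)^-1 (xmon i j%:R)) (fmap (iter j L) F)).

End FormalCalculus.

Arguments monomial : clear implicits.
Arguments fexpr : clear implicits.

(** * Vertex operators as formal series *)

Section VertexOperators.
Context {R : realType}.
Local Notation C := R[i].
Context {V W : lmodType C} (VA : vertex_superalgebra V).

(* Y_V(v, x_i)w *)
Definition YVser (i : 'I_3) (v w : V) : fexpr R V :=
  fsum (fun n : int => fmono (YV VA v n w) (xmon i n%:~R)).

Context {g : automorphism VA} (M : twisted_module g W).

(* Y_W^g(v, x_i)w *)
Definition YWser (i : 'I_3) (v : V) (w : W) : fexpr R W :=
  fsum (fun nk : C * nat =>
    fscale (fmul (xpow i nk.1) (fpow (flog i) nk.2))
           (fcst (YW M v nk.1 nk.2 w))).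

(* Y_W^g(v, y)w with y^n = e^{pi i n} x_i^n and log y = log x_i + pi i *)
Definition YWneg (i : 'I_3) (v : V) (w : W) : fexpr R W :=
  fsum (fun nk : C * nat =>
    fscale (fmul (fmono (cexp (pi_i * nk.1)) (xmon i nk.1))
                 (fpow (fadd (flog i) (fcst pi_i)) nk.2))
           (fcst (YW M v nk.1 nk.2 w))).

Definition Vpart_of (s : bool) (v : V) : V :=
  \sum_(h \in [set h : int | odd `|h|%N = s])
    component [set: int] (Vgr VA) v h.

Definition Wpart_of (s : bool) (w : W) : W :=
  \sum_(i \in [set i : C * bool * C | i.1.2 = s])
    component [set i | PW M i.2] (Wgr M) w i.

(* (Y^g)_{WV}^W(w, x_i)v: the sign (-1)^{|v||w|} of the formula for w and v of
   pure parity is extended bilinearly through their parity components. *)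
Definition twist (i : 'I_3) (w : W) (v : V) : fexpr R W :=
  fsum (fun st : bool * bool =>
    fscale (fcst ((-1) ^+ (st.1 && st.2)))
      (fexpL (LWm1 M) i (YWneg i (Vpart_of st.1 v) (Wpart_of st.2 w)))).

End VertexOperators.

Definition x0 : 'I_3 := @Ordinal 3 0 isT.
Definition x1 : 'I_3 := @Ordinal 3 1 isT.
Definition x2 : 'I_3 := @Ordinal 3 2 isT.

(* Main.v *)
Require Import Defs.
From HB Require Import structures.
From mathcomp Require Import all_boot all_order all_algebra.
From mathcomp Require Import finmap.
From mathcomp Require Import all_classical all_reals all_analysis.
From mathcomp Require Import complex.
From mathcomp Require Import ring lra zify.
Set Implicit Arguments.
Unset Strict Implicit.
Unset Printing Implicit Defensive.
Import Order.TTheory GRing.Theory Num.Theory.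
Local Open Scope classical_set_scope.
Local Open Scope complex_scope.
Local Open Scope ring_scope.

(** The identity is compared coefficient by coefficient, and every coefficient turns out to be
    a Borcherds identity for the modes of Y_W (theorem borcherds), summed against powers of
    L_W(-1).

    The Borcherds identity comes from duality. Equivariance under the powers of g shows that
    the powers of log x in Y_W(u, x) are governed by the nilpotent part N of g (YW_logE), and
    that for u of g-weight al only powers in -al + Z occur (YW_support_geneig). Hence, along
    z2 = 1 and z1 = x > 0, the function x |-> < w', Y_W(x^{al + N} u, x) Y_W(v, 1) w > is free of
    logarithms and has integral powers of x in its expansions at infinity, at 0 and at 1, which
    are the three series of the duality axiom. By duality it is an exponential polynomial in
    ln x divided by a power of x - 1. An exponential polynomial with a Laurent expansion at
    infinity is a Laurent polynomial, so this is a rational function, and the residue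
    theorem for its poles infinity, 0 and 1 (laurent_residues) is the Borcherds identity paired
    with w'; the operator binomials binom(-1 - a0 + N, i) on its right-hand side are the
    expansion of x^{- a0 - 1 + N} at x = 1. All three expansions are handled as asymptotic
    expansions in a positive real variable, whose uniqueness replaces analytic continuation.

    The passage to formal series rests on representing a series as a locally finite family of
    monomials (rep). Each side of the identity is such a family, which proves that it is well
    defined, and the coefficient at x_0^a0 x_1^a1 x_2^a2 (log x_0)^k0 (log x_1)^k1 (log x_2)^k2 is
    a finite sum over the fiber of this monomial. The power a0 selects one g-weight of u. All
    sides vanish unless k1 = 0 and a1 is an integer: on the first side because
    (x_1 - x_2)^{L_g} cancels the logarithms and the nonintegral powers of Y_W(u, x_1). In the
    remaining case k0 and k2 only replace u and v by multiples of N^k0 u and N^k2 e^{- pi i N} v.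
    Moving the powers of L_W(-1) in e^{x_2 L_W(-1)} to the left (YW_Ld) and collecting binomial
    coefficients by the Vandermonde identity for operators (ob_binC, ob_cancel), the three sides
    become the three sums of the Borcherds identity with parameters a0, a1, a2 - j, applied
    under (-1)^j L_W(-1)^j / j! and multiplied by one common phase (value1_int, value2, value3).
    *)

(** * Complex exponentials, powers and arguments *)

Section ComplexNumbers.
Context {R : realType}.
Local Notation C := R[i].
Implicit Types (x y z : C).

Lemma cmodP z : `|z| = (cmod z)%:C.
Proof. by rewrite /cmod normc_def. Qed.

Lemma cmod_ge0 z : 0 <= cmod z.
Proof. by rewrite -ler0c -cmodP normr_ge0. Qed.

Lemma cmodM x y : cmod (x * y) = cmod x * cmod y.
Proof. by apply: (@complexI R); rewrite rmorphM -!cmodP normrM. Qed.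

Lemma cmodD x y : cmod (x + y) <= cmod x + cmod y.
Proof. by rewrite -lecR rmorphD -!cmodP ler_normD. Qed.

Lemma cmodN x : cmod (- x) = cmod x.
Proof. by rewrite /cmod normrN. Qed.

Lemma cmodB x y : cmod (x - y) <= cmod x + cmod y.
Proof. by rewrite -[cmod y]cmodN; apply: cmodD. Qed.

Lemma cmod0 : cmod (0 : C) = 0.
Proof. by rewrite /cmod normr0. Qed.

Lemma cmod1 : cmod (1 : C) = 1.
Proof. by rewrite /cmod normr1. Qed.

Lemma cmod_eq0 z : (cmod z == 0) = (z == 0).
Proof. by rewrite -[z == 0]normr_eq0 cmodP eq_complex /= eqxx andbT. Qed.

Lemma cmod_gt0 z : (0 < cmod z) = (z != 0).
Proof. by rewrite lt_def cmod_ge0 andbT cmod_eq0. Qed.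

Lemma cmod_real (a : R) : cmod a%:C = `|a|.
Proof.
rewrite /cmod normc_def /= expr0n /= addr0 sqrtr_sqr //.
Qed.

Lemma cmodX z n : cmod (z ^+ n) = cmod z ^+ n.
Proof. by elim: n => [|n IHn]; rewrite ?expr0 ?cmod1// !exprS cmodM IHn. Qed.

Lemma cmodV z : cmod z^-1 = (cmod z)^-1.
Proof. by apply: (@complexI R); rewrite fmorphV -!cmodP normfV. Qed.

Lemma cmodXz z (n : int) : cmod (z ^ n) = cmod z ^ n.
Proof.
by case: n => n; rewrite ?NegzE -?exprnN -?exprnP ?cmodV cmodX.
Qed.

Lemma cmod_sum (I : Type) (s : seq I) (P : pred I) (F : I -> C) :
  cmod (\sum_(i <- s | P i) F i) <= \sum_(i <- s | P i) cmod (F i).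
Proof.
elim/big_rec2 : _ => [|i a b _ H]; first by rewrite cmod0.
by apply: (le_trans (cmodD _ _)); rewrite lerD2l.
Qed.

Lemma Re_le_cmod z : `|complex.Re z| <= cmod z.
Proof. by rewrite -lecR -cmodP normc_ge_Re. Qed.

Lemma Im_le_cmod z : `|complex.Im z| <= cmod z.
Proof.
have -> : complex.Im z = - complex.Re (z * 'i%C) by rewrite ReiNIm opprK.
rewrite normrN (le_trans (Re_le_cmod _))// cmodM.
by rewrite [cmod 'i]/cmod normc_def /= expr0n expr1n add0r sqrtr1 mulr1.
Qed.

Lemma cmod_le_ReIm z : cmod z <= `|complex.Re z| + `|complex.Im z|.
Proof.
have {1}-> : z = (complex.Re z)%:C + (complex.Im z)%:C * 'i.
  by rewrite [LHS]complexE mulrC.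
apply: (le_trans (cmodD _ _)); rewrite cmodM !cmod_real.
by rewrite [cmod 'i]/cmod normc_def /= expr0n expr1n add0r sqrtr1 mulr1.
Qed.

Lemma cexpD x y : cexp (x + y) = cexp x * cexp y.
Proof.
case: x y => [a b] [c d]; rewrite /cexp /= expRD cosD sinD.
apply/eqP; rewrite eq_complex /=; apply/andP; split; apply/eqP; ring.
Qed.

Lemma cexp0 : cexp (0 : C) = 1.
Proof. by rewrite /cexp /= expR0 cos0 sin0 mul1r. Qed.

Lemma cexp_neq0 z : cexp z != 0.
Proof.
apply/eqP => z0; have := cexpD z (- z).
by rewrite subrr cexp0 z0 mul0r => /eqP; rewrite oner_eq0.
Qed.

Lemma cexpN z : cexp (- z) = (cexp z)^-1.
Proof.
apply: (mulfI (cexp_neq0 z)).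
by rewrite -cexpD subrr cexp0 divff ?cexp_neq0.
Qed.

Lemma cmod_cexp z : cmod (cexp z) = expR (complex.Re z).
Proof.
rewrite /cexp cmodM cmod_real ger0_norm ?expR_ge0//.
by rewrite [X in _ * X]/cmod normc_def /= cos2Dsin2 sqrtr1 mulr1.
Qed.

Lemma cexpMn z n : cexp (n%:R * z) = cexp z ^+ n.
Proof.
elim: n => [|n IHn]; first by rewrite mul0r cexp0.
by rewrite -natr1 mulrDl mul1r cexpD IHn exprSr.
Qed.

Lemma cexpMz z (n : int) : cexp (n%:~R * z) = cexp z ^ n.
Proof.
case: n => n; first exact: cexpMn.
by rewrite NegzE mulrNz mulNr cexpN cexpMn -exprnN.
Qed.

Lemma cexp_real (a : R) : cexp a%:C = (expR a)%:C.
Proof. by rewrite /cexp /= cos0 sin0 mulr1. Qed.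

Lemma cexp_pii : cexp (pi_i : C) = -1.
Proof.
rewrite /cexp /= expR0 mul1r cospi sinpi.
by apply/eqP; rewrite eq_complex /= oppr0 !eqxx.
Qed.

Lemma cexp_pii_int (n : int) : cexp (pi_i * n%:~R : C) = (-1) ^ n.
Proof. by rewrite mulrC cexpMz cexp_pii. Qed.

Lemma cexp_2pii_int (n : int) : cexp (2 * pi_i * n%:~R : C) = 1.
Proof. by rewrite mulrC cexpMz cexpMn cexp_pii sqrrN expr1n exp1rz. Qed.

Lemma pii_neq0 : (pi_i : C) != 0.
Proof. by rewrite eq_complex /= eqxx/= gt_eqF// pi_gt0. Qed.

Lemma cexp_2pii_eq1 x : cexp (2 * pi_i * x) = 1 -> exists n : int, x = n%:~R.
Proof.
case: x => a b; have -> : 2 * pi_i * (a +i* b) = (- (2 * pi * b)) +i* (2 * pi * a).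
  apply/eqP; rewrite eq_complex /=; apply/andP; split; apply/eqP; ring.
move=> E; have b0 : b = 0.
  have := congr1 (@cmod R) E; rewrite cmod_cexp cmod1 -[RHS]expR0.
  move=> /expR_inj H; have /eqP : 2 * pi * b = 0 :> R by apply: oppr_inj; rewrite oppr0; exact: H.
  by rewrite !mulf_eq0 pnatr_eq0 (gt_eqF (pi_gt0 R)) => /eqP.
exists (Num.floor a).
move: E; rewrite b0 mulr0 oppr0 /cexp /= expR0 mul1r => -[cE sE].
have : cos (2 * pi * (a - (Num.floor a)%:~R)) = 1.
  have := cexp_2pii_int (- Num.floor a).
  have -> : 2 * pi_i * (- Num.floor a)%:~R = 0 +i* (2 * pi * (- Num.floor a)%:~R) :> C.
    rewrite (_ : (- Num.floor a)%:~R = ((- Num.floor a)%:~R : R)%:C :> C); last first.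
      by rewrite rmorph_int.
    apply/eqP; rewrite eq_complex /=; apply/andP; split; apply/eqP; ring.
  rewrite /cexp /= expR0 mul1r => -[c2 s2].
  by rewrite mulrBr -mulrN -mulrNz cosD cE sE c2 mul0r mulr1 subr0.
set t := a - _ => ct.
have /andP[t0 t1] : 0 <= t < 1.
  by have := Num.Theory.floor_itv a; rewrite /t intrD; lra.
have s0 : sin (pi * t) = 0.
  have : cos (pi * t + pi * t) = 1 by rewrite -ct; congr cos; ring.
  rewrite cosD => c1; have := cos2Dsin2 (pi * t) => c2.
  have /eqP : sin (pi * t) * sin (pi * t) = 0 by rewrite !expr2 in c2; lra.
  by rewrite -expr2 sqrf_eq0 => /eqP.
have t00 : t = 0.
  apply/eqP/negP => /negP tn0; have tp : 0 < t by rewrite lt_def tn0.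
  suff : 0 < sin (pi * t) by rewrite s0 ltxx.
  by apply: sin_gt0_pi; rewrite ?mulr_gt0 ?pi_gt0// gtr_pMr ?pi_gt0.
apply/eqP; rewrite (_ : (Num.floor a)%:~R = ((Num.floor a)%:~R : R)%:C :> C); last first.
  by rewrite rmorph_int.
by rewrite eq_complex /= eqxx andbT -subr_eq0 -/t t00.
Qed.

(** Polar form: the argument divided by 2 pi gives the real part, the logarithm of the
    modulus the imaginary part. *)
Lemma cexp_strip z : z != 0 -> exists2 a, strip a & cexp (2 * pi_i * a) = z.
Proof.
move=> z0; have m0 : 0 < cmod z by rewrite cmod_gt0.
pose c := complex.Re z / cmod z; pose s := complex.Im z / cmod z.
have zE : z = (cmod z)%:C * (c +i* s).
  apply/eqP; rewrite eq_complex /= !mul0r subr0 addr0 /c /s.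
  have m1 : cmod z != 0 by rewrite gt_eqF.
  by apply/andP; split; apply/eqP; field.
have cs : c ^+ 2 + s ^+ 2 = 1.
  have : (cmod z) ^+ 2 = complex.Re z ^+ 2 + complex.Im z ^+ 2.
    by rewrite /cmod normc_def /= sqr_sqrtr// addr_ge0 ?sqr_ge0.
  move=> E; rewrite /c /s !expr_div_n -mulrDl -E divff//.
  by rewrite expf_eq0/= gt_eqF.
have [t /andP[t0 t1] [ct st]] : exists2 t, 0 <= t < 2 * pi & cos t = c /\ sin t = s.
  have c1 : -1 <= c <= 1.
    by rewrite -ler_norml -(ler_pXn2r (n := 2)) ?nnegrE// expr1n real_normK ?num_real// -cs lerDl sqr_ge0.
  have sE : s ^+ 2 = sin (acos c) ^+ 2.
    have := cos2Dsin2 (acos c); rewrite acosK; last by rewrite in_itv.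
    lra.
  have sp : 0 <= sin (acos c) by rewrite sin_acos ?sqrtr_ge0.
  have [s0|s0] := leP 0 s.
    exists (acos c); first by rewrite acos_ge0//=; have := acos_lepi c1; have := pi_gt0 R; lra.
    split; first by rewrite acosK.
    by apply/eqP; rewrite -(eqrXn2 (n := 2))// sE.
  exists (2 * pi - acos c).
    have := acos_lepi c1; have := pi_gt0 R => p0 lp.
    suff : 0 < acos c by lra.
    rewrite lt_def acos_ge0// andbT; apply/eqP => a0.
    by move: sE; rewrite a0 sin0 expr0n/= => /eqP; rewrite sqrf_eq0 => /eqP s00; lra.
  have -> : 2 * pi - acos c = - acos c + pi *+ 2 by rewrite mulr2n; ring.
  rewrite (cosD2pi) sinD2pi cosN sinN acosK//; split => //.
  apply/eqP; rewrite -(opprK s) eqr_opp -(eqrXn2 (n := 2))//; last lra.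
  by rewrite sqrrN sE.
exists ((t / (2 * pi)) +i* (- ln (cmod z) / (2 * pi))).
  rewrite /strip /= divr_ge0//=; last by rewrite mulr_ge0 ?pi_ge0.
  by rewrite ltr_pdivrMr ?mul1r// mulr_gt0 ?pi_gt0.
rewrite [RHS]zE /cexp.
have -> : 2 * pi_i * ((t / (2 * pi)) +i* (- ln (cmod z) / (2 * pi))) = ln (cmod z) +i* t.
  have : pi != 0 :> R by rewrite gt_eqF ?pi_gt0.
  rewrite /pi_i; move: (pi : R) => p p0.
  by apply/eqP; rewrite eq_complex /=; apply/andP; split; apply/eqP; field.
by rewrite /= lnK ?posrE// ct st.
Qed.

(** The strip is a fundamental domain for the translation by 1, which is the period of
    a |-> e^{2 pi i a}. *)
Lemma strip_inj x y : strip x -> strip y ->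
  cexp (2 * pi_i * x) = cexp (2 * pi_i * y) -> x = y.
Proof.
move=> /andP[x0 x1] /andP[y0 y1] E.
have [|n nE] := @cexp_2pii_eq1 (x - y).
  by rewrite mulrBr cexpD cexpN E divff ?cexp_neq0.
have nR : complex.Re (x - y) = n%:~R by rewrite nE -(rmorph_int (real_complex R)).
have rE : complex.Re (x - y) = complex.Re x - complex.Re y by case: x {E nE nR x0 x1} y {y0 y1} => [a b] [c d].
have : n = 0.
  have : (-1 < n%:~R :> R) by rewrite -nR rE; lra.
  have : (n%:~R < 1 :> R) by rewrite -nR rE; lra.
  rewrite ltrz1 -(ltr_int R) -[-1]/(- 1%:~R) -mulrNz !ltr_int; lia.
by move=> n0; move/eqP: nE; rewrite n0 subr_eq0 => /eqP.
Qed.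

End ComplexNumbers.

(** * Binomial coefficients and exponential polynomials in an integer *)

Section Binomials.
Context {R : realType}.
Local Notation C := R[i].

(** Binomial coefficients are needed with a complex number, a formal variable or the
    nilpotent operator N on top; all three are specializations of a polynomial on top. *)
Definition binp (p : {poly C}) (i : nat) : {poly C} :=
  (i`!%:R)^-1 *: \prod_(j < i) (p - (j%:R)%:P).

Lemma factC_neq0 n : (n`!)%:R != 0 :> C.
Proof. by rewrite pnatr_eq0 -lt0n fact_gt0. Qed.

Lemma natS_neq0 n : n.+1%:R != 0 :> C.
Proof. by rewrite pnatr_eq0. Qed.

Lemma binp0 p : binp p 0 = 1.
Proof. by rewrite /binp big_ord0 fact0 invr1 scale1r. Qed.

Lemma binpS p i : (i.+1)%:R *: binp p i.+1 = (p - (i%:R)%:P) * binp p i.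
Proof.
rewrite /binp scalerA factS natrM invfM mulrA divff ?natS_neq0// mul1r.
by rewrite big_ord_recr/= -scalerAr mulrC.
Qed.

Lemma binp_vandermonde p q s :
  \sum_(i < s.+1) binp p i * binp q (s - i) = binp (p + q) s.
Proof.
elim: s => [|s IHs]; first by rewrite big_ord1 !binp0 mulr1.
apply: (scalerI (natS_neq0 s)); rewrite binpS -IHs scaler_sumr.
have E1 : \sum_(i < s.+2) i%:R *: (binp p i * binp q (s.+1 - i)) =
   \sum_(i < s.+1) (p - (i%:R)%:P) * (binp p i * binp q (s - i)).
  rewrite big_ord_recl scale0r add0r; apply: eq_bigr => i _.
  by rewrite lift0 scalerAl binpS subSS mulrA.
have E2 : \sum_(i < s.+2) (s.+1 - i)%N%:R *: (binp p i * binp q (s.+1 - i)) =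
   \sum_(i < s.+1) (q - ((s - i)%N%:R)%:P) * (binp p i * binp q (s - i)).
  rewrite big_ord_recr /= subnn scale0r addr0; apply: eq_bigr => i _.
  have il : (i <= s)%N by rewrite -ltnS.
  by rewrite subSn// scalerAr binpS mulrCA.
transitivity (\sum_(i < s.+2) i%:R *: (binp p i * binp q (s.+1 - i)) +
  \sum_(i < s.+2) (s.+1 - i)%N%:R *: (binp p i * binp q (s.+1 - i))).
  rewrite -big_split; apply: eq_bigr => i _ /=.
  by rewrite -scalerDl -natrD subnKC// -ltnS.
rewrite E1 E2 -big_split mulr_sumr; apply: eq_bigr => i _ /=.
rewrite -mulrDl; congr (_ * _).
have il : (i <= s)%N by rewrite -ltnS.
have <- : (i%:R)%:P + ((s - i)%N%:R)%:P = (s%:R)%:P :> {poly C}.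
  by rewrite -polyCD -natrD subnKC.
ring.
Qed.

Lemma binpC (c : C) i : binp c%:P i = (binC c i)%:P.
Proof.
rewrite /binp /binC mulrC -mul_polyC polyCM; congr (_ * _).
by rewrite rmorph_prod; apply: eq_bigr => j _; rewrite /= polyCB.
Qed.

Lemma binC0 (c : C) : binC c 0 = 1.
Proof. by apply: polyC_inj; rewrite -binpC binp0. Qed.

Lemma binCS (c : C) i : i.+1%:R * binC c i.+1 = (c - i%:R) * binC c i.
Proof.
apply: polyC_inj; rewrite [in RHS]polyCM -binpC polyCB -binpS binpC.
by rewrite -mul_polyC -polyCM.
Qed.

Lemma binC_vandermonde (p q : C) s :
  \sum_(i < s.+1) binC p i * binC q (s - i) = binC (p + q) s.
Proof.
apply: polyC_inj; rewrite -[RHS]binpC polyCD -binp_vandermonde rmorph_sum.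
by apply: eq_bigr => i _; rewrite !binpC /= polyCM.
Qed.

Lemma binC_nat (n i : nat) : binC (n%:R : C) i = 'C(n, i)%:R.
Proof.
elim: i => [|i IHi]; first by rewrite binC0 bin0.
apply: (mulfI (natS_neq0 i)); rewrite binCS IHi -natrM mul_bin_left.
have [le_in|lt_ni] := leqP i n; first by rewrite natrM natrB.
by rewrite bin_small// !mulr0 muln0.
Qed.

Lemma binC_pascal (z : C) i : binC (z + 1) i.+1 = binC z i.+1 + binC z i.
Proof.
rewrite -binC_vandermonde big_ord_recr/= subnn binC0 mulr1 big_ord_recr/=.
rewrite subSn// subnn (binC_nat 1 1) binn mulr1 big1 ?add0r 1?addrC// => j _.
by rewrite (binC_nat 1) bin_small ?mulr0//; have := ltn_ord j; lia.
Qed.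

Lemma binC_neg (c : C) i : binC (- c - 1) i = (-1) ^+ i * binC (c + i%:R) i.
Proof.
rewrite /binC mulrA; congr (_ / _).
rewrite (reindex_inj rev_ord_inj)/= -[in (-1) ^+ i](card_ord i).
rewrite -prodr_const -big_split /=; apply: eq_bigr => j _.
rewrite natrB// -natr1; ring.
Qed.

(** With the formal variable X replaced by N this is the expansion of binom(a + N, i) in
    powers of N; with X replaced by a logarithm it is the expansion of
    (1 + t)^a log(1 + t)^k / k!. *)
Definition bet (a : C) (k i : nat) : C := (binp (a%:P + 'X) i)`_k.

Lemma bet0 a k : bet a k 0 = (k == 0%N)%:R.
Proof. by rewrite /bet binp0 coef1. Qed.

Lemma betS a k i : i.+1%:R * bet a k i.+1 =
  (a - i%:R) * bet a k i + (if k is k'.+1 then bet a k' i else 0).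
Proof.
rewrite /bet -coefZ binpS addrAC -polyCB mulrDl coefD mul_polyC coefZ.
by rewrite coefXM; case: k.
Qed.

Lemma bet_binC a i : bet a 0 i = binC a i.
Proof.
elim: i => [|i IHi]; first by rewrite bet0 binC0.
by apply: (mulfI (natS_neq0 i)); rewrite betS binCS IHi addr0.
Qed.

Lemma bet0_0 i : bet 0 0 i = (i == 0%N)%:R.
Proof.
elim: i => [|i IHi]; first by rewrite bet0.
apply: (mulfI (natS_neq0 i)); rewrite betS IHi mulr0 addr0 sub0r.
by case: i {IHi} => [|i]; rewrite ?oppr0 ?mul0r ?mulr0.
Qed.

Lemma bet01 m : bet 0 1 m.+1 = (-1) ^+ m / m.+1%:R.
Proof.
elim: m => [|m IHm].
  apply: (mulfI (natS_neq0 0)); rewrite betS !bet0 /= mulr0 add0r expr0 mulrC.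
  by rewrite divfK ?natS_neq0.
apply: (mulfI (natS_neq0 m.+1)); rewrite betS IHm bet0_0 /= addr0 sub0r.
by rewrite [RHS]mulrC !divfK ?natS_neq0// mulNr mulrC divfK ?natS_neq0// exprS mulN1r.
Qed.

Lemma bet_big a k i : (i < k)%N -> bet a k i = 0.
Proof.
elim: i k => [|i IHi] k ik; first by rewrite bet0 gtn_eqF.
apply: (mulfI (natS_neq0 i)); rewrite betS IHi ?(ltnW ik)// mulr0 add0r mulr0.
by case: k ik => // k ik; rewrite IHi.
Qed.

(** Evaluation at X = m recovers the ordinary binomial coefficient. This is how g^m becomes a
    polynomial in m. *)
Lemma bet_eval (x : C) K i : (i < K)%N ->
  \sum_(k < K) bet 0 k i * x ^+ k = binC x i.
Proof.
move=> iK; transitivity (binp (0%:P + 'X) i).[x].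
  rewrite (@horner_coef_wide _ K)//.
  apply/leq_sizeP => j Kj; exact/bet_big/(leq_trans iK).
rewrite add0r /binp /binC hornerZ horner_prod mulrC; congr (_ * _).
by apply: eq_bigr => j _; rewrite hornerXsubC.
Qed.

End Binomials.

Section ExponentialPolynomials.
Context {R : realType}.
Local Notation C := R[i].

Lemma geometric_unbounded (q K : R) : 1 < q -> exists m : nat, K < q ^+ m.
Proof.
move=> q1; have [d d0 qE] : exists2 d, 0 < d & q = 1 + d.
  by exists (q - 1); rewrite ?subr_gt0// addrC subrK.
have bern m : 1 + m%:R * d <= q ^+ m.
  elim: m => [|m IHm]; first by rewrite mul0r addr0 expr0.
  have md : 0 <= m%:R * d by rewrite mulr_ge0 ?ler0n// ltW.
  have : q * (1 + m%:R * d) <= q * q ^+ m by rewrite ler_wpM2l// qE ltW// ltr_wpDr// ltW.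
  rewrite -exprS; apply: le_trans; rewrite qE -natr1; nra.
have [m mK] : exists m : nat, K / d < m%:R.
  exists (Num.truncn (`|K / d|)).+1.
  exact/(le_lt_trans (ler_norm _))/truncnS_gt.
exists m; apply: lt_le_trans (bern m).
by move: mK; rewrite ltr_pdivrMr// => mK; lra.
Qed.

Lemma poly_nat_roots (p : {poly C}) : (forall m : nat, p.[m%:R] = 0) -> p = 0.
Proof.
move=> p0; apply/eqP; apply: contraT => pn0.
have := @max_poly_roots _ p [seq (m%:R : C) | m <- iota 0 (size p)] pn0.
rewrite size_map size_iota ltnn; apply => //.
  by apply/allP => _ /mapP[m _ ->]; rewrite /root p0.
by rewrite map_inj_uniq ?iota_uniq// => m n /eqP; rewrite eqr_nat => /eqP.
Qed.

(** A finite sum of polynomials times distinct geometric sequences cannot be small compared to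
    all of these sequences. The difference operator S(m) |-> S(m + 1) - lam_i S(m) lowers the
    degree of the i-th polynomial and preserves the hypotheses, so that induction on the total
    degree leaves one geometric sequence with a constant coefficient. *)
Lemma exp_poly_eq0 n (lam : 'I_n -> C) (Q : 'I_n -> {poly C}) (rho K : R) :
  injective lam -> 0 < rho -> (forall i, rho < cmod (lam i)) ->
  (forall m : nat, cmod (\sum_i lam i ^+ m * (Q i).[m%:R]) <= K * rho ^+ m) ->
  forall i, Q i = 0.
Proof.
move=> lam_inj rho0 lam_gt.
have [k] := ubnP (\sum_i size (Q i))%N.
elim: k Q K => // k IHk Q K szQ bnd.
have [/forallP Q0 i|] := boolP [forall i, Q i == 0]; first exact/eqP.
rewrite negb_forall => /existsP[i0 Qi0].
pose Q' i := lam i *: (Q i \Po ('X + 1%:P)) - lam i0 *: Q i.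
have szc i : size (Q i \Po ('X + 1%:P)) = size (Q i).
  by rewrite size_comp_poly2// size_XaddC.
have lcc i : lead_coef (Q i \Po ('X + 1%:P)) = lead_coef (Q i).
  by rewrite lead_coef_comp ?size_XaddC// lead_coefXaddC expr1n mulr1.
have szQ'i i : (size (Q' i) <= size (Q i))%N.
  apply: (leq_trans (size_polyD _ _)); rewrite geq_max size_polyN.
  by rewrite !(leq_trans (size_scale_leq _ _)) ?szc.
have lcQ' i : (Q' i)`_(size (Q i)).-1 = (lam i - lam i0) * lead_coef (Q i).
  rewrite /Q' coefB !coefZ -[in X in _ * X - _]szc.
  by rewrite -[(Q i \Po _)`_ _]/(lead_coef _) lcc mulrBl.
have Q'0 : forall i, Q' i = 0.
  apply: (IHk Q' (K * rho + cmod (lam i0) * K)).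
    apply: leq_trans (_ : (\sum_i size (Q i) <= k)%N) => //.
    rewrite (bigD1 i0)//= [X in (_ <= X)%N](bigD1 i0)//= -addSn.
    apply: leq_add; last by apply: leq_sum.
    have : (size (Q' i0) <= (size (Q i0)).-1)%N.
      apply/leq_sizeP => j; rewrite leq_eqVlt => /predU1P[<-|lj].
        by rewrite lcQ' subrr mul0r.
      by apply/nth_default/(leq_trans (szQ'i i0)); case: (size _) lj.
    by rewrite -ltnS prednK// lt0n size_poly_eq0.
  move=> m.
  have -> : \sum_i lam i ^+ m * (Q' i).[m%:R] =
     \sum_i lam i ^+ m.+1 * (Q i).[m.+1%:R] -
     lam i0 * \sum_i lam i ^+ m * (Q i).[m%:R].
    rewrite mulr_sumr -sumrB; apply: eq_bigr => i _.
    rewrite /Q' hornerD hornerN !hornerZ horner_comp hornerD hornerX hornerC.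
    by rewrite natr1 exprS; ring.
  apply: (le_trans (cmodB _ _)); rewrite cmodM mulrDl.
  apply: lerD; first by apply: le_trans (bnd m.+1) _; rewrite exprS mulrA.
  by rewrite -mulrA ler_wpM2l ?cmod_ge0.
have Q0 i : i != i0 -> Q i = 0.
  move=> ii0; have := lcQ' i; rewrite Q'0 coef0 => /esym/eqP.
  rewrite mulf_eq0 subr_eq0 (inj_eq lam_inj) (negPf ii0) lead_coef_eq0.
  by move/eqP.
have lam0 : lam i0 != 0 by rewrite -cmod_gt0 (lt_trans rho0).
have Qc : Q i0 = (Q i0).[0]%:P.
  apply/eqP; rewrite -subr_eq0; apply/eqP/poly_nat_roots => m.
  rewrite hornerD hornerN hornerC; apply/eqP; rewrite subr_eq0; apply/eqP.
  elim: m => // m <-; have /eqP := Q'0 i0.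
  rewrite /Q' -scalerBr scaler_eq0 (negPf lam0)/= subr_eq0 => /eqP/(congr1 (horner^~ m%:R)).
  by rewrite horner_comp hornerD hornerX hornerC natr1.
have c0 : (Q i0).[0] != 0.
  by apply: contraNneq Qi0 => c0; rewrite Qc c0.
exfalso; have q1 : 1 < cmod (lam i0) / rho by rewrite ltr_pdivlMr// mul1r.
have [m] := geometric_unbounded (K / cmod (Q i0).[0]) q1.
rewrite expr_div_n ltr_pdivrMr ?cmod_gt0// mulrAC ltr_pdivlMr ?exprn_gt0//.
apply/negP; rewrite -leNgt; apply: le_trans (bnd m).
rewrite (bigD1 i0)//= big1 ?addr0; last by move=> i /Q0 ->; rewrite horner0 mulr0.
by rewrite cmodM cmodX {2}Qc hornerC.
Qed.

End ExponentialPolynomials.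

(** * Asymptotic expansions at zero *)

Section Asymptotics.
Context {R : realType}.
Local Notation C := R[i].
Implicit Types (F G : R -> C) (a b c : nat -> C).

(** F(t) = sum_(i < M) c_i t^i + O(t^M) as t tends to 0 from above; one
   constant K bounds both the error and the size of the neighbourhood. *)
Definition asyn (M : nat) F c : Prop := exists K : R, 1 <= K /\
  forall t : R, 0 < t -> t * K < 1 ->
    cmod (F t - \sum_(i < M) c i * (t%:C) ^+ i) <= K * t ^+ M.

Lemma asyn_eqf M F G c (K0 : R) : (forall t, 0 < t -> t * K0 < 1 -> F t = G t) ->
  asyn M F c -> asyn M G c.
Proof.
move=> FG [K [K1 H]]; exists (K + `|K0|); split; first by rewrite ler_wpDr.
move=> t t0 tK.
have tK1 : t * K < 1 by apply: le_lt_trans tK; rewrite ler_pM2l// lerDl.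
have tK0 : t * K0 < 1.
  by apply: le_lt_trans tK; rewrite ler_pM2l// (le_trans (ler_norm _))// lerDr; lra.
rewrite -FG//; apply: (le_trans (H t t0 tK1)).
by rewrite ler_wpM2r ?lerDl// exprn_ge0// ltW.
Qed.

Lemma asyn_eqc M F a b : (forall i, (i < M)%N -> a i = b i) -> asyn M F a -> asyn M F b.
Proof.
move=> ab [K [K1 H]]; exists K; split=> // t t0 tK.
by under eq_bigr => i _ do rewrite -ab//; exact: H.
Qed.

Lemma asynD M F G a b : asyn M F a -> asyn M G b ->
  asyn M (fun t => F t + G t) (fun i => a i + b i).
Proof.
move=> [K [K1 H]] [L [L1 H']]; exists (K + L); split; first lra.
move=> t t0 tKL; have tK : t * K < 1 by nra. have tL : t * L < 1 by nra.
under eq_bigr do rewrite mulrDl.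
rewrite big_split/= opprD addrACA (le_trans (cmodD _ _))// mulrDl.
by rewrite lerD ?H ?H'.
Qed.

Lemma asynZ M F c (z : C) : asyn M F c ->
  asyn M (fun t => z * F t) (fun i => z * c i).
Proof.
move=> [K [K1 H]]; exists (K * (1 + cmod z)).
have z0 := cmod_ge0 z; split; first by nra.
move=> t t0 tK; have tK1 : t * K < 1 by apply: le_lt_trans tK; rewrite ler_pM2l//; nra.
under eq_bigr do rewrite -mulrA.
rewrite -mulr_sumr -mulrBr cmodM (le_trans (ler_wpM2l z0 (H t t0 tK1)))//.
have : 0 <= K * t ^+ M by rewrite mulr_ge0 ?exprn_ge0 ?ltW//; lra.
nra.
Qed.

Lemma asyn0 M : asyn M (fun=> 0) (fun=> 0).
Proof.
exists 1; split => // t t0 _; rewrite big1 ?subr0 ?cmod0 ?mul1r ?exprn_ge0 ?ltW//.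
by move=> i _; rewrite mul0r.
Qed.

Definition cshift c : nat -> C := fun i => if i is i'.+1 then c i' else 0.

Lemma asyn_shift M F c : asyn M F c ->
  asyn M.+1 (fun t => t%:C * F t) (cshift c).
Proof.
move=> [K [K1 H]]; exists K; split=> // t t0 tK.
rewrite big_ord_recl mul0r add0r.
under eq_bigr do rewrite lift0 exprS mulrCA.
by rewrite -mulr_sumr -mulrBr cmodM cmod_real gtr0_norm// exprS mulrCA ler_pM2l// H.
Qed.

Lemma asyn_unshift M F c : asyn M.+1 F c ->
  asyn M (fun t => (F t - c 0%N) / t%:C) (fun i => c i.+1).
Proof.
move=> [K [K1 H]]; exists K; split=> // t t0 tK.
have tn0 : t%:C != 0 :> C by rewrite eq_complex /= eqxx andbT gt_eqF.
rewrite -(@ler_pM2l _ t)// mulrCA -exprS; apply: le_trans (H t t0 tK).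
rewrite -{1}(gtr0_norm t0) -cmod_real -cmodM mulrBr mulrC divfK//.
rewrite mulr_sumr big_ord_recl expr0 mulr1 opprD addrA.
by under eq_bigr do rewrite mulrCA -exprS.
Qed.

Lemma asyn_le M F c : asyn M.+1 F c -> asyn M F c.
Proof.
move=> [K [K1 H]]; exists (K + cmod (c M)); have := cmod_ge0 (c M) => c0.
split; first lra.
move=> t t0 tK; have tK1 : t * K < 1 by nra.
have := H t t0 tK1; rewrite big_ord_recr/= => H1.
have -> : F t - \sum_(i < M) c i * t%:C ^+ i =
  (F t - (\sum_(i < M) c i * t%:C ^+ i + c M * t%:C ^+ M)) + c M * t%:C ^+ M.
  ring.
rewrite (le_trans (cmodD _ _))// mulrDl lerD//.
  apply: (le_trans H1); rewrite exprS ler_wpM2l//; first lra.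
  by rewrite ler_piMl ?exprn_ge0 ?(ltW t0)//; nra.
by rewrite cmodM cmodX cmod_real gtr0_norm.
Qed.

Definition cprod a b : nat -> C := fun n => \sum_(i < n.+1) a i * b (n - i)%N.

Lemma asynM M F G a b : asyn M F a -> asyn M G b ->
  asyn M (fun t => F t * G t) (cprod a b).
Proof.
elim: M F a => [|M IHM] F a.
  move=> [K [K1 H]] [L [L1 H']]; exists (K * L); split; first by nra.
  move=> t t0 tKL; have tK : t * K < 1.
    by apply: le_lt_trans tKL; rewrite ler_pM2l// ler_peMr//; lra.
  have tL : t * L < 1 by apply: le_lt_trans tKL; rewrite ler_pM2l// ler_peMl//; lra.
  have := H t t0 tK; have := H' t t0 tL; rewrite !big_ord0 !subr0 expr0 !mulr1 => h1 h2.
  by rewrite cmodM ler_pM ?cmod_ge0.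
move=> Fa Gb; have H1 := IHM _ _ (asyn_unshift Fa) (asyn_le Gb).
have H2 := asynD (asynZ (a 0%N) Gb) (asyn_shift H1).
apply: (asyn_eqf (K0 := 0) _ (asyn_eqc _ H2)).
  move=> t t0 _; have tn0 : t%:C != 0 :> C by rewrite eq_complex /= eqxx andbT gt_eqF.
  by field.
move=> [|n] _ /=; rewrite /cprod; first by rewrite big_ord1 addr0 subn0.
by rewrite [RHS]big_ord_recl subn0.
Qed.

Definition asy F c := forall M, asyn M F c.

Lemma asy_eqf F G c (K0 : R) : (forall t, 0 < t -> t * K0 < 1 -> F t = G t) ->
  asy F c -> asy G c.
Proof. by move=> FG H M; apply: asyn_eqf FG (H M). Qed.

Lemma asy_eqc F a b : a =1 b -> asy F a -> asy F b.
Proof. by move=> ab H M; apply: asyn_eqc (H M) => i _. Qed.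

Lemma asyD F G a b : asy F a -> asy G b ->
  asy (fun t => F t + G t) (fun i => a i + b i).
Proof. by move=> Fa Gb M; apply: asynD. Qed.

Lemma asyZ F c (z : C) : asy F c -> asy (fun t => z * F t) (fun i => z * c i).
Proof. by move=> Fc M; apply: asynZ. Qed.

Lemma asyM F G a b : asy F a -> asy G b ->
  asy (fun t => F t * G t) (cprod a b).
Proof. by move=> Fa Gb M; apply: asynM. Qed.

Lemma asy_shift F c : asy F c -> asy (fun t => t%:C * F t) (cshift c).
Proof. by move=> Fc [|M]; [apply/asyn_le/asyn_shift|apply: asyn_shift]. Qed.

Lemma asy_const (z : C) : asy (fun=> z) (fun i => if i == 0%N then z else 0).
Proof.
move=> M; exists (1 + cmod z); have z0 := cmod_ge0 z; split; first lra.
case: M => [|M] t t0 tK; first by rewrite big_ord0 subr0 expr0; lra.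
rewrite big_ord_recl /= big1 ?addr0 ?expr0 ?mulr1 ?subrr ?cmod0; last first.
  by move=> i _; rewrite mul0r.
by rewrite mulr_ge0 ?exprn_ge0 ?(ltW t0)//; lra.
Qed.

(** The first coefficient that differs would be the leading one of an expansion of zero. *)
Lemma asy_uniq F a b : asy F a -> asy F b -> a =1 b.
Proof.
move=> Fa Fb n; have [m] := ubnP n; elim: m n => // m IHm n nm.
have E : asy (fun=> 0) (fun i => a i - b i).
  apply: (@asy_eqf (fun t => F t + (-1) * F t) _ _ 0).
    by move=> *; rewrite mulN1r subrr.
  by apply: asy_eqc (asyD Fa (asyZ (-1) Fb)) => i; rewrite mulN1r.
have [K [K1 H]] := E n.+1.
apply/eqP; rewrite -subr_eq0 -cmod_eq0; apply/eqP.
set d := cmod _; have d0 : 0 <= d := cmod_ge0 _.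
apply/eqP; rewrite eq_le d0 andbT leNgt; apply/negP => dp.
pose t := d / (2 * K * (1 + d)).
have Kd : 0 < 2 * K * (1 + d) by rewrite mulr_gt0//; lra.
have t0 : 0 < t by rewrite divr_gt0.
have tE : t * K * (2 * (1 + d)) = d by rewrite /t; field; rewrite !gt_eqF//; lra.
have tK : t * K < 1 by nra.
have := H t t0 tK; rewrite big_ord_recr/= big1 ?add0r ?sub0r; last first.
  move=> i _; rewrite IHm ?subrr ?mul0r//.
  by apply: leq_trans (ltn_ord i) _; rewrite -ltnS.
rewrite cmodN cmodM cmodX cmod_real gtr0_norm// exprS mulrA ler_pM2r ?exprn_gt0//.
rewrite -/d; nra.
Qed.

End Asymptotics.

(** * Expansions of powers and logarithms of 1 + t *)

Section BinomialExpansions.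
Context {R : realType}.
Local Notation C := R[i].

Lemma Re_add (x y : C) : complex.Re (x + y) = complex.Re x + complex.Re y.
Proof. by case: x y => ? ? []. Qed.

Lemma Im_add (x y : C) : complex.Im (x + y) = complex.Im x + complex.Im y.
Proof. by case: x y => ? ? []. Qed.

Lemma Re_mul (x y : C) : complex.Re (x * y) =
  complex.Re x * complex.Re y - complex.Im x * complex.Im y.
Proof. by case: x y => ? ? []. Qed.

Lemma Im_mul (x y : C) : complex.Im (x * y) =
  complex.Re x * complex.Im y + complex.Im x * complex.Re y.
Proof. by case: x y => ? ? []. Qed.

Definition cder (F : R -> C) (t : R) (d : C) : Prop :=
  is_derive t 1 (fun s => complex.Re (F s)) (complex.Re d) /\
  is_derive t 1 (fun s => complex.Im (F s)) (complex.Im d).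

Lemma cder_eqf F G t d : F =1 G -> cder F t d -> cder G t d.
Proof. by move=> /funext ->. Qed.

Lemma cder_const (z : C) t : cder (fun=> z) t 0.
Proof. by split; apply: is_derive_eq. Qed.

Lemma cderD F G t d e : cder F t d -> cder G t e -> cder (fun s => F s + G s) t (d + e).
Proof.
move=> [F1 F2] [G1 G2]; split.
  rewrite (_ : (fun s => _) = (fun s => complex.Re (F s)) \+ (fun s => complex.Re (G s))).
    by rewrite Re_add; apply: is_deriveD.
  by apply/funext => s; rewrite Re_add.
rewrite (_ : (fun s => _) = (fun s => complex.Im (F s)) \+ (fun s => complex.Im (G s))).
  by rewrite Im_add; apply: is_deriveD.
by apply/funext => s; rewrite Im_add.
Qed.

Lemma cderM F G t d e : cder F t d -> cder G t e ->
  cder (fun s => F s * G s) t (d * G t + F t * e).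
Proof.
move=> [F1 F2] [G1 G2]; split.
  rewrite (_ : (fun s => _) = (fun s => complex.Re (F s)) * (fun s => complex.Re (G s))
     - (fun s => complex.Im (F s)) * (fun s => complex.Im (G s))).
    apply: is_derive_eq; rewrite Re_add !Re_mul /GRing.scale/=.
    move: (complex.Re (F t)) (complex.Im (F t)) (complex.Re (G t)) (complex.Im (G t)).
    by move: (complex.Re d) (complex.Im d) (complex.Re e) (complex.Im e) => *; ring.
  by apply/funext => s; rewrite Re_mul.
rewrite (_ : (fun s => _) = (fun s => complex.Re (F s)) * (fun s => complex.Im (G s))
     + (fun s => complex.Im (F s)) * (fun s => complex.Re (G s))).
  apply: is_derive_eq; rewrite Im_add !Im_mul /GRing.scale/=.
  move: (complex.Re (F t)) (complex.Im (F t)) (complex.Re (G t)) (complex.Im (G t)).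
  by move: (complex.Re d) (complex.Im d) (complex.Re e) (complex.Im e) => *; ring.
by apply/funext => s; rewrite Im_mul.
Qed.

Lemma cderZ (z : C) F t d : cder F t d -> cder (fun s => z * F s) t (z * d).
Proof. by move=> H; have := cderM (cder_const z t) H; rewrite mul0r add0r. Qed.

Lemma cder_sum n (F : 'I_n -> R -> C) t d : (forall i, cder (F i) t (d i)) ->
  cder (fun s => \sum_(i < n) F i s) t (\sum_(i < n) d i).
Proof.
elim: n F d => [|n IHn] F d H.
  by rewrite big_ord0; apply: cder_eqf (cder_const 0 t) => s; rewrite big_ord0.
rewrite big_ord_recr; apply: cder_eqf (cderD (IHn _ _ (fun i => H (widen_ord (leqnSn n) i))) (H ord_max)).
by move=> s; rewrite big_ord_recr.
Qed.

Lemma cder_real (h : R -> R) (t d : R) : is_derive t 1 h d -> cder (fun s => (h s)%:C) t d%:C.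
Proof. by move=> H; split => //=; apply: is_derive_cst. Qed.

Lemma cderX F t d n : cder F t d ->
  cder (fun s => F s ^+ n) t (n%:R * d * F t ^+ n.-1).
Proof.
move=> H; elim: n => [|n IHn]; first by rewrite mul0r mul0r; apply: cder_const.
apply: (@cder_eqf (fun s => F s * F s ^+ n)); first by move=> s; rewrite exprS.
have := cderM H IHn; congr cder.
by case: n {IHn} => [|n] /=; rewrite ?expr0 ?exprS -?natr1; ring.
Qed.

Lemma cder_cexp (a : C) (h : R -> R) (t d : R) : is_derive t 1 h d ->
  cder (fun s => cexp (a * (h s)%:C)) t (a * d%:C * cexp (a * (h t)%:C)).
Proof.
case: a => p q H; have Hp : is_derive t 1 (fun s => p * h s) (p * d).
  rewrite (_ : (fun s => _) = cst p * h); last by apply/funext.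
  by apply: is_derive_eq; rewrite /GRing.scale/= mulr0 addr0.
have Hq : is_derive t 1 (fun s => q * h s) (q * d).
  rewrite (_ : (fun s => _) = cst q * h); last by apply/funext.
  by apply: is_derive_eq; rewrite /GRing.scale/= mulr0 addr0.
have E1 : is_derive t 1 (fun s => expR (p * h s)) (expR (p * h t) * (p * d)).
  have := @is_derive1_comp R (@expR R) (fun s => p * h s) t _ _ (is_derive_expR _) Hp.
  by [].
have E2 : is_derive t 1 (fun s => cos (q * h s)) (- sin (q * h t) * (q * d)).
  by have := @is_derive1_comp R (@cos R) (fun s => q * h s) t _ _ (is_derive_cos _) Hq.
have E3 : is_derive t 1 (fun s => sin (q * h s)) (cos (q * h t) * (q * d)).
  by have := @is_derive1_comp R (@sin R) (fun s => q * h s) t _ _ (is_derive_sin _) Hq.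
have cE s : cexp ((p +i* q) * (h s)%:C) =
   (expR (p * h s) * cos (q * h s)) +i* (expR (p * h s) * sin (q * h s)).
  have -> : (p +i* q) * (h s)%:C = (p * h s) +i* (q * h s).
    by apply/eqP; rewrite eq_complex /=; apply/andP; split; apply/eqP; ring.
  by rewrite /cexp; apply/eqP; rewrite eq_complex /=; apply/andP; split; apply/eqP; ring.
split.
  rewrite (_ : (fun s => _) = (fun s => expR (p * h s)) * (fun s => cos (q * h s))).
    apply: is_derive_eq; rewrite cE /GRing.scale/=.
    by move: (expR _) (cos _) (sin _) => *; ring.
  by apply/funext => s; rewrite cE.
rewrite (_ : (fun s => _) = (fun s => expR (p * h s)) * (fun s => sin (q * h s))).
  apply: is_derive_eq; rewrite cE /GRing.scale/=.
  by move: (expR _) (cos _) (sin _) => *; ring.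
by apply/funext => s; rewrite cE.
Qed.

Lemma mvt_bound (h dh : R -> R) (t K : R) : 0 < t -> 0 <= K -> h 0 = 0 ->
  (forall s, 0 <= s <= t -> is_derive s 1 h (dh s)) ->
  (forall s, 0 < s < t -> `|dh s| <= K) -> `|h t| <= K * t.
Proof.
move=> t0 K0 h0 hd hK.
have [||c] := @MVT R h dh 0 t t0.
- by move=> s; rewrite in_itv/= => /andP[s0 st]; apply: hd; rewrite !ltW.
- apply: derivable_within_continuous => s; rewrite in_itv/= => st.
  by have [] := hd s st.
rewrite in_itv/= h0 !subr0 => /hK cK ->.
by rewrite normrM (gtr0_norm t0) ler_pM2r.
Qed.

(** (1 + t)^a ln(1 + t)^k / k! *)
Definition Gfun (a : C) (k : nat) (t : R) : C :=
  cexp (a * (ln (1 + t))%:C) * ((ln (1 + t))%:C ^+ k / (k`!)%:R).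

Lemma cder_Gfun a k (t : R) : -1 < t -> cder (Gfun a k) t
  (((1 + t)^-1)%:C * (a * Gfun a k t + if k is k'.+1 then Gfun a k' t else 0)).
Proof.
move=> t1; have Hl : is_derive t 1 (fun s => ln (1 + s)) (1 + t)^-1.
  have H1 : is_derive t 1 (fun s : R => 1 + s) 1.
    rewrite (_ : (fun s : R => 1 + s) = cst 1 + id)//.
    by apply: is_derive_eq; rewrite add0r.
  have t2 : 0 < 1 + t by lra.
  have := @is_derive1_comp R (@ln R) (fun s => 1 + s) t _ _ (is_derive1_ln t2) H1.
  by rewrite mulr1.
have := cderM (cder_cexp a Hl) (cderZ ((k`!)%:R^-1) (cderX k (cder_real Hl))).
move=> H; have -> : ((1 + t)^-1)%:C * (a * Gfun a k t + (if k is k'.+1 then Gfun a k' t else 0)) =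
  a * ((1 + t)^-1)%:C * cexp (a * (ln (1 + t))%:C) *
  ((k`!)%:R^-1 * (ln (1 + t))%:C ^+ k) + cexp (a * (ln (1 + t))%:C) *
  ((k`!)%:R^-1 * (k%:R * ((1 + t)^-1)%:C * (ln (1 + t))%:C ^+ k.-1)).
  rewrite /Gfun; case: k {H} => [|k] /=; first by rewrite fact0 expr0; ring.
  move: (cexp (a * (ln (1 + t))%:C)) ((1 + t)^-1%:C : C) ((ln (1 + t))%:C : C) => E i l.
  rewrite factS natrM; have := @factC_neq0 R k; have := @natS_neq0 R k.
  by move: (k.+1%:R) (k`!%:R) => x y x0 y0; field; rewrite x0 y0.
apply: cder_eqf H => s; rewrite /Gfun mulrC [in RHS]mulrC; congr (_ * _).
exact: mulrC.
Qed.

Lemma Gfun0 a k : Gfun a k 0 = (k == 0%N)%:R.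
Proof.
rewrite /Gfun addr0 ln1 mulr0 cexp0 mul1r.
by case: k => [|k]; rewrite ?expr0 ?fact0 ?divr1// expr0n/= mul0r.
Qed.

Lemma asyn_Gfun M a k : asyn M (Gfun a k) (bet a k).
Proof.
elim: M k => [|M IHM] k.
  exists (expR `|complex.Re a|); split; first by rewrite -expR0 ler_expR.
  move=> t t0 tK; rewrite big_ord0 subr0 expr0 mulr1.
  have t1 : t < 1.
    by apply: le_lt_trans tK; rewrite ler_peMr ?(ltW t0)// -expR0 ler_expR.
  have l0 : 0 <= ln (1 + t) by rewrite ln_ge0// lerDl ltW.
  have l1 : ln (1 + t) <= 1 by apply: le_trans (le_ln1Dx _) _; lra.
  rewrite /Gfun cmodM cmod_cexp -[leRHS]mulr1 ler_pM ?expR_ge0 ?cmod_ge0//.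
    rewrite ler_expR Re_mul /= mulr0 subr0 (le_trans (ler_norm _))// normrM.
    by rewrite (ger0_norm l0) ler_piMr.
  rewrite cmodM cmodX cmodV !cmod_real ger0_norm//.
  rewrite (_ : cmod _ = (k`!)%:R); last first.
    by rewrite -(rmorph_nat (real_complex R)) cmod_real normr_nat.
  rewrite ler_pdivrMr ?ltr0n ?fact_gt0// mul1r (@le_trans _ _ 1)//.
    exact: exprn_ile1.
  by rewrite ler1n fact_gt0.
pose Gm := if k is k'.+1 then Gfun a k' else fun=> 0.
pose bm := if k is k'.+1 then bet a k' else fun=> 0.
have [L [L1 HL]] : asyn M Gm bm.
  by rewrite /Gm /bm; case: (k) => [|k']; [exact: asyn0 | exact: IHM].
have [K [K1 HK]] := IHM k.
pose b := bet a k; pose K2 := cmod a * K + L + M%:R * cmod (b M).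
have K20 : 0 <= K2 by rewrite !addr_ge0 ?mulr_ge0 ?cmod_ge0//; lra.
exists (K + L + 2 * K2); split; first lra.
move=> t t0 tK.
have tK1 : t * K < 1 by apply: le_lt_trans tK; rewrite ler_pM2l//; lra.
have tL1 : t * L < 1 by apply: le_lt_trans tK; rewrite ler_pM2l//; lra.
pose F s := Gfun a k s - \sum_(i < M.+1) b i * s%:C ^+ i.
pose d s := ((1 + s)^-1)%:C * (a * (Gfun a k s - \sum_(i < M) b i * s%:C ^+ i)
   + (Gm s - \sum_(i < M) bm i * s%:C ^+ i) - M%:R * b M * s%:C ^+ M).
have Fd s : 0 <= s -> cder F s (d s).
  move=> s0; have s1 : -1 < s by lra.
  have Hs i : cder (fun s => b i * s%:C ^+ i) s (b i * (i%:R * s%:C ^+ i.-1)).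
    apply: cderZ; have := cderX i (cder_real (is_derive_id s 1)).
    by rewrite mulr1.
  have := cderD (cder_Gfun a k s1) (cderZ (-1) (cder_sum (fun i : 'I_M.+1 => Hs i))).
  have -> : ((1 + s)^-1)%:C * (a * Gfun a k s + (if k is k'.+1 then Gfun a k' s else 0)) +
     -1 * (\sum_(i < M.+1) b i * (i%:R * s%:C ^+ i.-1)) = d s.
    have sn0 : (1 + s)%:C != 0 :> C.
      by rewrite eq_complex /= eqxx andbT gt_eqF//; lra.
    have invE : (1 + s)%:C * ((1 + s)^-1)%:C = 1 :> C.
      by rewrite -rmorphM /= divff ?rmorph1// gt_eqF//; lra.
    have -> : (if k is k'.+1 then Gfun a k' s else 0) = Gm s by rewrite /Gm; case: (k).
    apply: (mulfI sn0); rewrite /d mulrDr [X in X + _]mulrA invE mul1r.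
    rewrite [RHS]mulrA invE mul1r mulN1r mulrN.
    suff -> : (1 + s)%:C * (\sum_(i < M.+1) b i * (i%:R * s%:C ^+ i.-1)) =
      a * (\sum_(i < M) b i * s%:C ^+ i) + \sum_(i < M) bm i * s%:C ^+ i + M%:R * b M * s%:C ^+ M.
      ring.
    rewrite rmorphD rmorph1 mulrDl mul1r [X in X + _]big_ord_recl/= mul0r mulr0 add0r.
    rewrite [X in _ + _ * X = _]big_ord_recr/= mulrDr addrA; congr (_ + _); last first.
      case: (M) => [|M'] /=; first by rewrite !mul0r !mulr0.
      by rewrite exprS !mulrA; congr (_ * _); ring.
    rewrite !mulr_sumr -!big_split/=; apply: eq_bigr => i _; rewrite add0n.
    rewrite [b (bump _ _) * _]mulrA [b _ * _]mulrC /b betS.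
    have -> : (if k is k'.+1 then bet a k' i else 0) = bm i by rewrite /bm; case: (k).
    have E : s%:C * (i%:R * s%:C ^+ i.-1) = i%:R * s%:C ^+ i :> C.
      by case: (i : nat) => [|i'] /=; rewrite ?mul0r ?mulr0// mulrCA -exprS.
    rewrite [s%:C * _]mulrCA E; move: (s%:C ^+ i) => x; ring.
  by apply: cder_eqf => s'; rewrite mulN1r.
have F0 : F 0 = 0.
  rewrite /F Gfun0 big_ord_recl big1 ?addr0 ?expr0 ?mulr1.
    by rewrite /b bet0 subrr.
  by move=> i _; rewrite lift0 expr0n mulr0.
have dK s : 0 < s < t -> cmod (d s) <= K2 * t ^+ M.
  move=> /andP[s0 st].
  have sK1 : s * K < 1 by apply: lt_trans tK1; rewrite ltr_pM2r//; lra.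
  have sL1 : s * L < 1 by apply: lt_trans tL1; rewrite ltr_pM2r//; lra.
  have := HK s s0 sK1; have := HL s s0 sL1; rewrite -/b => h1 h2.
  have sM : s ^+ M <= t ^+ M by rewrite lerXn2r ?nnegrE ?ltW//; exact: lt_trans st.
  apply: (@le_trans _ _ (K2 * s ^+ M)); last by rewrite ler_wpM2l.
  rewrite /d cmodM cmod_real ger0_norm ?invr_ge0; last lra.
  rewrite -[leRHS]mul1r ler_pM ?cmod_ge0 ?invr_ge0//; first lra.
    by rewrite invf_le1; lra.
  rewrite /K2 !mulrDl (le_trans (cmodB _ _))// lerD//.
    rewrite (le_trans (cmodD _ _))// lerD// cmodM -mulrA ler_wpM2l ?cmod_ge0//.
  rewrite !cmodM cmodX cmod_real (gtr0_norm s0).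
  by rewrite -(rmorph_nat (real_complex R)) cmod_real normr_nat.
have tM0 : 0 <= K2 * t ^+ M by rewrite mulr_ge0// exprn_ge0// ltW.
have H1 : `|complex.Re (F t)| <= K2 * t ^+ M * t.
  apply: (@mvt_bound (fun s => complex.Re (F s)) (fun s => complex.Re (d s)) _ _ t0 tM0); first by rewrite F0.
    by move=> s /andP[s0 _]; have [] := Fd s s0.
  by move=> s /dK; apply: le_trans; apply: Re_le_cmod.
have H2 : `|complex.Im (F t)| <= K2 * t ^+ M * t.
  apply: (@mvt_bound (fun s => complex.Im (F s)) (fun s => complex.Im (d s)) _ _ t0 tM0); first by rewrite F0.
    by move=> s /andP[s0 _]; have [] := Fd s s0.
  by move=> s /dK; apply: le_trans; apply: Im_le_cmod.
rewrite -/b -/(F t) (le_trans (cmod_le_ReIm _))// (le_trans (lerD H1 H2))//.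
rewrite -mulrA -exprSr.
have : 0 <= t ^+ M.+1 by rewrite exprn_ge0 ?ltW.
by move: (t ^+ M.+1) => T T0; nra.
Qed.

(** The coefficients of (1 + t)^a ln(1 + t)^k / k! satisfy the recursion given by its
    derivative, which lowers k or a; the remainders are bounded by the mean value inequality. *)
Lemma asy_Gfun a k : asy (Gfun a k) (bet a k).
Proof. by move=> M; apply: asyn_Gfun. Qed.

End BinomialExpansions.

(** * Exponential polynomials of a real variable *)

Section ExponentialPolynomialFunctions.
Context {R : realType}.
Local Notation C := R[i].

Lemma cexp_neq1 (ds : seq C) : (forall d, d \in ds -> d != 0) ->
  exists2 h : R, 0 < h & forall d, d \in ds -> cexp (d * h%:C) != 1.
Proof.
move=> ds0; pose S := \sum_(d <- ds) `|complex.Im d|.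
have S0 : 0 <= S by rewrite sumr_ge0.
have h0 : 0 < (1 + S)^-1 by rewrite invr_gt0; lra.
exists (1 + S)^-1 => // d dds; apply/eqP => E.
have Red : complex.Re d = 0.
  have := congr1 (@cmod R) E; rewrite cmod_cexp cmod1 -[RHS]expR0 => /expR_inj.
  by rewrite Re_mul /= mulr0 subr0 => /eqP; rewrite mulf_eq0 (gt_eqF h0) orbF => /eqP.
have dE : d * (1 + S)^-1%:C = 0 +i* (complex.Im d / (1 + S)).
  case: d Red {E dds} => a b /= ->; apply/eqP; rewrite eq_complex /=.
  by apply/andP; split; apply/eqP; ring.
have Im0 : complex.Im d != 0.
  by have := ds0 d dds; rewrite eq_complex Red eqxx.
have : sin `|complex.Im d / (1 + S)| = 0.
  move: E; rewrite dE /cexp /= expR0 mul1r => -[_ s0].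
  by case: (ger0P (complex.Im d / (1 + S))) => _; rewrite ?sinN s0 ?oppr0.
have q0 : complex.Im d / (1 + S) != 0 by rewrite mulf_neq0// gt_eqF.
apply/eqP; rewrite gt_eqF// sin_gt0_pi// normr_gt0 q0/=.
rewrite normrM (gtr0_norm h0) ltr_pdivrMr; last lra.
have dS : `|complex.Im d| <= S.
  by rewrite /S (big_rem d)//= lerDl sumr_ge0.
have := pi_ge2 R; nra.
Qed.

(** An entry (mu, k, c) of the list stands for c e^{mu y} y^k. Lists with repeated exponents are
    allowed, so that sums and products of such functions need no normalization; the part of
    exponent mu is collected by the next definition. *)
Definition ep (s : seq (C * nat * C)) (y : C) : C :=
  \sum_(p <- s) p.2 * cexp (p.1.1 * y) * y ^+ p.1.2.

Definition ep_part (s : seq (C * nat * C)) (mu y : C) : C :=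
  \sum_(p <- s | p.1.1 == mu) p.2 * y ^+ p.1.2.

Lemma ep_partE (s : seq (C * nat * C)) (mus : seq C) y : uniq mus ->
  (forall p, p \in s -> p.1.1 \in mus) ->
  ep s y = \sum_(mu <- mus) cexp (mu * y) * ep_part s mu y.
Proof.
move=> u H; rewrite /ep /ep_part.
rewrite [LHS]big_seq [LHS](eq_bigr (fun p => \sum_(mu <- mus | p.1.1 == mu)
    cexp (mu * y) * (p.2 * y ^+ p.1.2))); last first.
  move=> p ps; have fE : [seq mu <- mus | p.1.1 == mu] = [:: p.1.1].
    rewrite (eq_filter (a2 := pred1 p.1.1)); last by move=> z /=; rewrite eq_sym.
    by rewrite filter_pred1_uniq ?H.
  by rewrite -big_filter fE big_seq1; ring.
rewrite -big_seq (exchange_big_dep predT)//=; apply: eq_bigr => mu _.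
by rewrite mulr_sumr.
Qed.

Lemma ep_small (s : seq (C * nat * C)) (M K y1 : R) : (forall p, p \in s -> - M < complex.Re p.1.1) ->
  (forall y, y1 <= y -> cmod (ep s y%:C) <= K * expR (- M * y)) ->
  forall mu y, ep_part s mu y = 0.
Proof.
move=> sM bnd; pose mus := undup [seq p.1.1 | p <- s].
have musP p : p \in s -> p.1.1 \in mus by move=> ps; rewrite mem_undup; apply/mapP; exists p.
pose ds := [seq d <- [seq x - y | x <- mus, y <- mus] | d != 0].
have [|h h0 hP] := @cexp_neq1 ds; first by move=> d; rewrite mem_filter => /andP[].
pose mu_ (i : 'I_(size mus)) := mus`_i.
pose lam i := cexp (mu_ i * h%:C).
have mu_in i : mu_ i \in mus by apply: mem_nth.
pose Q i : {poly C} := \sum_(p <- s | p.1.1 == mu_ i)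
  (p.2 * cexp (mu_ i * y1%:C)) *: (y1%:C%:P + h%:C *: 'X) ^+ p.1.2.
have Q0 : forall i, Q i = 0.
  apply: (@exp_poly_eq0 R _ lam Q (expR (- M * h)) (K * expR (- M * y1))).
  - move=> i j; rewrite /lam => E; apply/val_inj/eqP.
    suff : mu_ i == mu_ j by rewrite nth_uniq ?undup_uniq.
    rewrite -subr_eq0; apply: contraT => ne0; have := hP (mu_ i - mu_ j).
    have dd : mu_ i - mu_ j \in ds.
      by rewrite mem_filter ne0; apply/allpairsP; exists (mu_ i, mu_ j); split; [exact: mu_in|exact: mu_in|].
    move=> /(_ dd); by rewrite mulrBl cexpD cexpN E divff ?cexp_neq0 ?eqxx.
  - exact: expR_gt0.
  - move=> i; have : mu_ i \in mus by apply: mem_nth.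
    rewrite mem_undup => /mapP[p ps pE]; rewrite cmod_cexp ltr_expR Re_mul /= mulr0 subr0.
    by rewrite ltr_pM2r// pE sM.
  - move=> m; have y1m : y1 <= y1 + m%:R * h by rewrite lerDl mulr_ge0// ltW.
    have := bnd _ y1m; congr (_ <= _); last first.
      by rewrite -mulrA -expRM_natl -expRD; congr (_ * expR _); ring.
    rewrite (ep_partE _ (undup_uniq _) musP) (big_nth 0) big_mkord.
    congr cmod; apply: eq_bigr => i _; rewrite -/mus -/(mu_ i) /lam -cexpMn /Q.
    rewrite horner_sum /ep_part !mulr_sumr; apply: eq_bigr => p _.
    rewrite hornerZ horner_exp hornerD hornerC hornerZ hornerX.
    rewrite rmorphD rmorphM rmorph_nat mulrDr cexpD [m%:R * h%:C]mulrC /=.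
    rewrite (_ : mu_ i * (h%:C * m%:R) = m%:R * (mu_ i * h%:C)); last by ring.
    move: (_ ^+ _) => z; ring.
move=> mu y; have [mum|mum] := boolP (mu \in mus); last first.
  rewrite /ep_part big_seq_cond big1// => p /andP[/musP ps /eqP pmu].
  by rewrite -pmu ps in mum.
have ilt : (index mu mus < size mus)%N by rewrite index_mem.
have muE : mu_ (Ordinal ilt) = mu by rewrite /mu_ /= nth_index.
have hn0 : h%:C != 0 :> C by rewrite eq_complex /= eqxx andbT gt_eqF.
have := congr1 (horner^~ ((y - y1%:C) / h%:C)) (Q0 (Ordinal ilt)).
rewrite horner0 /Q horner_sum muE => E.
apply: (mulfI (cexp_neq0 (mu * y1%:C))); rewrite mulr0 -[RHS]E /ep_part mulr_sumr.
apply: eq_bigr => p _; rewrite hornerZ horner_exp hornerD hornerC hornerZ hornerX.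
by rewrite [h%:C * _]mulrC divfK// addrC subrK; ring.
Qed.

(** Restriction to an arithmetic progression reduces this to sequences, where distinct
    geometric growth rates cannot cancel; the step of the progression is chosen so that distinct
    exponents mu have distinct e^{mu h}. *)
Lemma ep_small_eq0 (s : seq (C * nat * C)) (M K y1 : R) : (forall p, p \in s -> - M < complex.Re p.1.1) ->
  (forall y, y1 <= y -> cmod (ep s y%:C) <= K * expR (- M * y)) ->
  forall y, ep s y = 0.
Proof.
move=> sM bnd y; rewrite (@ep_partE s (undup [seq p.1.1 | p <- s]) y (undup_uniq _)).
  by rewrite big1// => mu _; rewrite (ep_small sM bnd) mulr0.
by move=> p ps; rewrite mem_undup; apply/mapP; exists p.
Qed.

End ExponentialPolynomialFunctions.

(** * Laurent asymptotics *)

Section LaurentAsymptotics.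
Context {R : realType}.
Local Notation C := R[i].
Implicit Types (F G : R -> C) (a b c : int -> C).

(** An expansion in integral powers of t, bounded below. The two-sided index is convenient
    because the three expansions of a correlation function are indexed by modes. *)
Definition lasy F c : Prop := exists J : nat,
  (forall j : int, j < - J%:Z -> c j = 0) /\
  asy (fun t => t%:C ^+ J * F t) (fun i => c (i%:Z - J%:Z)).

Lemma lasy_raise F c (J : nat) : (forall j : int, j < - J%:Z -> c j = 0) ->
  asy (fun t => t%:C ^+ J * F t) (fun i => c (i%:Z - J%:Z)) ->
  forall n, asy (fun t => t%:C ^+ (J + n) * F t) (fun i => c (i%:Z - (J + n)%N%:Z)).
Proof.
move=> c0 H; elim=> [|n IHn]; first by rewrite addn0.
apply: (@asy_eqf _ (fun t => t%:C * (t%:C ^+ (J + n) * F t)) _ _ 0).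
  by move=> t _ _; rewrite addnS exprS mulrA.
apply: asy_eqc (asy_shift IHn) => -[|i] /=.
  by rewrite c0//; lia.
by congr c; lia.
Qed.

Lemma lasy_common F G a b : lasy F a -> lasy G b -> exists J : nat,
  [/\ forall j : int, j < - J%:Z -> a j = 0 /\ b j = 0,
     asy (fun t => t%:C ^+ J * F t) (fun i => a (i%:Z - J%:Z)) &
     asy (fun t => t%:C ^+ J * G t) (fun i => b (i%:Z - J%:Z))].
Proof.
move=> [J [J0 HJ]] [L [L0 HL]]; exists (J + L)%N; split.
- by move=> j jJ; split; [apply: J0|apply: L0]; lia.
- exact: lasy_raise.
- by rewrite addnC; exact: lasy_raise.
Qed.

Lemma lasy_uniq F a b : lasy F a -> lasy F b -> a =1 b.
Proof.
move=> Fa Fb; have [J [J0 HJ HL] j] := lasy_common Fa Fb.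
have [jJ|Jj] := ltrP j (- J%:Z); first by have [-> ->] := J0 j jJ.
have := asy_uniq HJ HL (absz (j + J%:Z)).
by rewrite (_ : (absz (j + J%:Z))%:Z - J%:Z = j)//; lia.
Qed.

Lemma lasy_eqf F G c (K0 : R) : (forall t, 0 < t -> t * K0 < 1 -> F t = G t) ->
  lasy F c -> lasy G c.
Proof.
move=> FG [J [J0 HJ]]; exists J; split=> //.
by apply: (asy_eqf (K0 := K0) _ HJ) => t t0 tK; rewrite (FG t t0 tK).
Qed.

Lemma lasy_eqc F a b : a =1 b -> lasy F a -> lasy F b.
Proof. by move=> /funext ->. Qed.

Lemma lasyD F G a b : lasy F a -> lasy G b ->
  lasy (fun t => F t + G t) (fun j => a j + b j).
Proof.
move=> Fa Gb; have [J [J0 HJ HL]] := lasy_common Fa Gb; exists J; split.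
  by move=> j /J0[-> ->]; rewrite addr0.
apply: (@asy_eqf _ (fun t => t%:C ^+ J * F t + t%:C ^+ J * G t) _ _ 0).
  by move=> t _ _; rewrite mulrDr.
exact: asyD.
Qed.

Lemma lasyZ F c (z : C) : lasy F c -> lasy (fun t => z * F t) (fun j => z * c j).
Proof.
move=> [J [J0 HJ]]; exists J; split; first by move=> j /J0 ->; rewrite mulr0.
apply: (@asy_eqf _ (fun t => z * (t%:C ^+ J * F t)) _ _ 0).
  by move=> t _ _; rewrite mulrCA.
exact: asyZ.
Qed.

Lemma lasyB F G a b : lasy F a -> lasy G b ->
  lasy (fun t => F t - G t) (fun j => a j - b j).
Proof.
move=> Fa Gb; apply: (@lasy_eqf (fun t => F t + -1 * G t) _ _ 0).
  by move=> t _ _; rewrite mulN1r.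
by apply: lasy_eqc (lasyD Fa (lasyZ (-1) Gb)) => j; rewrite mulN1r.
Qed.

Lemma lasy0 : lasy (fun=> 0) (fun=> 0).
Proof.
exists 0%N; split=> //; apply: (@asy_eqf _ (fun=> 0) _ _ 0).
  by move=> *; rewrite mulr0.
by move=> M; apply: asyn0.
Qed.

Lemma lasy_sum (I : Type) (s : seq I) (F : I -> R -> C) (c : I -> int -> C) :
  (forall i, lasy (F i) (c i)) ->
  lasy (fun t => \sum_(i <- s) F i t) (fun n => \sum_(i <- s) c i n).
Proof.
move=> H; elim: s => [|i s IHs].
  apply: (@lasy_eqf (fun=> 0) _ _ 0); first by move=> *; rewrite big_nil.
  by apply: lasy_eqc lasy0 => n; rewrite big_nil.
apply: (@lasy_eqf (fun t => F i t + \sum_(j <- s) F j t) _ _ 0).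
  by move=> *; rewrite big_cons.
by apply: lasy_eqc (lasyD (H i) IHs) => n; rewrite big_cons.
Qed.

Lemma realC_neq0 (t : R) : 0 < t -> t%:C != 0 :> C.
Proof. by move=> t0; rewrite eq_complex /= eqxx andbT gt_eqF. Qed.

Lemma lasy_mulV F c : lasy F c -> lasy (fun t => (t%:C)^-1 * F t) (fun j => c (j + 1)).
Proof.
move=> [J [J0 HJ]]; exists J.+1; split; first by move=> j jJ; apply: J0; lia.
apply: (@asy_eqf _ (fun t => t%:C ^+ J * F t) _ _ 0).
  by move=> t t0 _; rewrite exprSr -mulrA mulVKf ?realC_neq0.
by apply: asy_eqc HJ => i; congr c; lia.
Qed.

Lemma lasy_mul F c : lasy F c -> lasy (fun t => t%:C * F t) (fun j => c (j - 1)).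
Proof.
move=> [J [J0 HJ]]; exists J; split; first by move=> j jJ; apply: J0; lia.
apply: (@asy_eqf _ (fun t => t%:C * (t%:C ^+ J * F t)) _ _ 0).
  by move=> t t0 _; rewrite mulrCA.
apply: asy_eqc (asy_shift HJ) => -[|i] /=; last by congr c; lia.
by rewrite J0//; lia.
Qed.

Lemma lasy_asy F (c : nat -> C) : asy F c ->
  lasy F (fun j => if j is Posz i then c i else 0).
Proof.
move=> H; exists 0%N; split; first by case=> // j; lia.
apply: (@asy_eqf _ F _ _ 0); first by move=> *; rewrite expr0 mul1r.
by apply: asy_eqc H => i; rewrite subr0.
Qed.

Lemma lasy_one : lasy (fun=> 1) (fun j => (j == 0)%:R).
Proof.
have := lasy_asy (asy_const (1 : C)); apply: lasy_eqc => -[[|i]|i] //.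
Qed.

Lemma lasy_monomial (n : int) : lasy (fun t => t%:C ^ n) (fun j => (j == n)%:R).
Proof.
have pos m : lasy (fun t => t%:C ^ m%:Z) (fun j => (j == m%:Z)%:R).
  elim: m => [|m IHm]; first exact: lasy_one.
  apply: (@lasy_eqf (fun t => t%:C * t%:C ^ m%:Z) _ _ 0).
    by move=> t t0 _; rewrite exprSz.
  by apply: lasy_eqc (lasy_mul IHm) => j; congr (nat_of_bool _)%:R; lia.
case: n => n; first exact: pos.
rewrite NegzE; elim: n => [|n IHn].
  apply: (@lasy_eqf (fun t => (t%:C)^-1 * 1) _ _ 0).
    by move=> t t0 _; rewrite mulr1 exprN1.
  by apply: lasy_eqc (lasy_mulV lasy_one) => j; congr (nat_of_bool _)%:R; lia.
apply: (@lasy_eqf (fun t => (t%:C)^-1 * t%:C ^ (- n.+1%:Z)) _ _ 0).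
  move=> t t0 _; rewrite -exprN1 -expfzDr ?realC_neq0//; congr (_ ^ _); lia.
by apply: lasy_eqc (lasy_mulV IHn) => j; congr (nat_of_bool _)%:R; lia.
Qed.

Definition binZ (z : C) (e : int) : C := if e is Posz i then binC z i else 0.

Lemma cexp_ln (x : R) (n : int) : 0 < x -> cexp (n%:~R * (ln x)%:C) = x%:C ^ n.
Proof. by move=> x0; rewrite cexpMz cexp_real lnK. Qed.

Lemma lasy_binomial (n : int) : lasy (fun t => (1 + t)%:C ^ n) (binZ n%:~R).
Proof.
apply: (@lasy_eqf (Gfun n%:~R 0) _ _ 0).
  by move=> t t0 _; rewrite /Gfun cexp_ln ?expr0 ?fact0 ?divr1 ?mulr1//; lra.
by apply: lasy_eqc (lasy_asy (asy_Gfun _ 0)) => -[i|i] //=; rewrite bet_binC.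
Qed.

End LaurentAsymptotics.

(** * The residue identity *)

Section ResidueIdentity.
Context {R : realType}.
Local Notation C := R[i].
Implicit Types (A B D : int -> C).

(** Coefficients of (1 - y)^(-a-1) in powers of y. *)
Definition nbin (a : int) (i : nat) : C := binC (a%:~R + i%:R) i.

Lemma nbin0 a : nbin a 0 = 1. Proof. exact: binC0. Qed.

Lemma nbinS a i : nbin a i.+1 - nbin a i = nbin (a - 1) i.+1.
Proof.
rewrite /nbin -natr1 addrA binC_pascal addrK; congr binC.
by rewrite intrB; ring.
Qed.

Definition Dl A : int -> C := fun k => A (k - 1) - A k.

Lemma sum_nbin_DlA (a1 x : int) A I :
  \sum_(i < I.+1) nbin a1 i * Dl A (x + 1 + i%:Z) =
  \sum_(i < I.+1) nbin (a1 - 1) i * A (x + i%:Z) - nbin a1 I * A (x + 1 + I%:Z).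
Proof.
elim: I => [|I IHI].
  rewrite !big_ord1 !nbin0 /Dl !mul1r; congr (A _ - A _); lia.
rewrite big_ord_recr/= IHI [in RHS]big_ord_recr/= -nbinS /Dl.
rewrite (_ : x + 1 + I.+1%:Z - 1 = x + I.+1%:Z); last lia.
rewrite (_ : x + 1 + I%:Z = x + I.+1%:Z); [ring|lia].
Qed.

Lemma sum_nbin_DlB (a1 q : int) B I :
  \sum_(i < I.+1) nbin a1 i * Dl B (q - i%:Z) =
  nbin a1 I * B (q - I.+1%:Z) - \sum_(i < I.+1) nbin (a1 - 1) i * B (q - i%:Z).
Proof.
elim: I => [|I IHI].
  by rewrite !big_ord1 !nbin0 /Dl !mul1r /= !subr0.
rewrite big_ord_recr/= IHI [in RHS]big_ord_recr/= -nbinS /Dl.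
rewrite (_ : q - I.+1%:Z - 1 = q - I.+2%:Z); [ring|lia].
Qed.

Definition residue_rel (A B D : int -> C) (q a1 : int) (I : nat) : Prop :=
  \sum_(i < I) nbin a1 i * A (q + a1 + 1 + i%:Z) +
  (-1) ^ a1 * \sum_(i < I) nbin a1 i * B (q - i%:Z) =
  \sum_(i < I) binC ((-1 - q)%:~R) i * D (a1 - i%:Z).

Definition residues A B D : Prop := forall q a1, exists I0 : nat,
  forall I, (I0 <= I)%N -> residue_rel A B D q a1 I.

(** Multiplication by x - 1 acts on the expansions at infinity and at 0 by the same difference
    operator and shifts the expansion at 1, so it only shifts the parameter a1; hence a pole at
    x = 1 may be cleared. *)
Lemma residues_mul A B D (JA JB : int) : (forall j, JA < j -> A j = 0) ->
  (forall j, j < JB -> B j = 0) ->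
  residues (Dl A) (Dl B) (fun e => D (e - 1)) -> residues A B D.
Proof.
move=> A0 B0 H q a1; have [I0 HI] := H q (a1 + 1).
exists (I0 + (absz (JA - q - a1)%R) + (absz (q - JB)%R))%N.+1 => -[|I]// II0.
have := HI I.+1; rewrite /residue_rel => H1; have {}H1 := H1 ltac:(lia); move: H1.
rewrite (_ : q + (a1 + 1) + 1 = (q + a1 + 1) + 1); last lia.
rewrite sum_nbin_DlA sum_nbin_DlB A0 ?B0 ?mulr0; try lia.
rewrite subr0 sub0r addrK mulrN (_ : (-1) ^ (a1 + 1) = - (-1) ^ a1 :> C); last first.
  by rewrite expfzDr ?oppr_eq0 ?oner_eq0// expr1z mulrN1.
rewrite mulNr opprK => ->; apply: eq_bigr => i _; congr (_ * D _); lia.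
Qed.

Lemma residues_lin (I : Type) (s : seq I) (c : I -> C) (A B D : I -> int -> C) :
  (forall i, residues (A i) (B i) (D i)) ->
  residues (fun j => \sum_(i <- s) c i * A i j) (fun j => \sum_(i <- s) c i * B i j)
    (fun j => \sum_(i <- s) c i * D i j).
Proof.
move=> H q a1; elim: s => [|k s [I0 IHs]].
  exists 0%N => I2 _; rewrite /residue_rel !big1 ?mulr0 ?addr0// => i _.
  - by rewrite big_nil mulr0.
  - by rewrite big_nil mulr0.
  - by rewrite big_nil mulr0.
have [I1 H1] := H k q a1; exists (maxn I0 I1) => J; rewrite geq_max => /andP[/IHs h0 /H1 h1].
rewrite /residue_rel.
have E (f : nat -> C) (X : I -> int -> C) (z : nat -> int) :
  \sum_(i < J) f i * (\sum_(i0 <- k :: s) c i0 * X i0 (z i)) =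
  c k * (\sum_(i < J) f i * X k (z i)) + \sum_(i < J) f i * (\sum_(i0 <- s) c i0 * X i0 (z i)).
  rewrite mulr_sumr -big_split; apply: eq_bigr => i _ /=.
  by rewrite big_cons mulrDr mulrCA.
rewrite (E _ _ (fun i => q + a1 + 1 + i%:Z)) (E _ _ (fun i => q - i%:Z)).
rewrite (E _ _ (fun i => a1 - i%:Z)) -h0 -h1; ring.
Qed.

Lemma sum_nbin_delta (f : nat -> C) (z : nat -> int) (n : nat) I : (n < I)%N ->
  forall j : int, (forall i, (z i == j) = (i == n)) ->
  \sum_(i < I) f i * (z i == j)%:R = f n.
Proof.
move=> nI j zj; rewrite (bigD1 (Ordinal nI))//= zj eqxx mulr1 big1 ?addr0// => i.
by rewrite zj -val_eqE /= => /negPf ->; rewrite mulr0.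
Qed.

(** For Phi = x^n the identity is a relation between binomial coefficients: the expansions at
    infinity and at 0 are a single term each, the one at 1 is a binomial series. *)
Lemma residues_monomial (j : int) :
  residues (fun k => (k == j)%:R) (fun k => (k == j)%:R) (binZ j%:~R).
Proof.
move=> q a1; exists ((absz (j - q - a1)%R) + (absz (q - j)%R) + absz a1)%N.+2 => I HI.
rewrite /residue_rel; pose n : int := j - 1 - q.
have -> : \sum_(i < I) nbin a1 i * (q + a1 + 1 + i%:Z == j)%:R =
   (if n < a1 then 0 else binC (n%:~R) (absz (n - a1)%R)).
  case: ltrP => na.
    by rewrite big1// => i _; rewrite (_ : _ == _ = false) ?mulr0//; lia.
  rewrite (@sum_nbin_delta (nbin a1) (fun i => q + a1 + 1 + i%:Z) (absz (n - a1)%R)); [|lia|by move=> i; lia].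
  rewrite /nbin; congr binC; rewrite -[X in _ + X]/((Posz `|n - a1|)%:~R) -intrD.
  by congr (_%:~R); lia.
have -> : \sum_(i < I) nbin a1 i * (q - i%:Z == j)%:R =
   (if n < 0 then nbin a1 (absz (- 1 - n)%R) else 0).
  case: ltrP => n0.
    by rewrite (@sum_nbin_delta (nbin a1) (fun i => q - i%:Z) (absz (- 1 - n)%R))//; [lia|by move=> i; lia].
  by rewrite big1// => i _; rewrite (_ : _ == _ = false) ?mulr0//; lia.
have -> : \sum_(i < I) binC (-1 - q)%:~R i * binZ j%:~R (a1 - i%:Z) = binZ n%:~R a1 :> C.
  case: a1 HI => [a|a] HI; last first.
    by rewrite big1// => i _; rewrite (_ : Negz a - i%:Z = Negz (a + i)) ?mulr0//; lia.
  rewrite /= /n (_ : (j - 1 - q)%:~R = (-1 - q)%:~R + j%:~R :> C); last first.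
    by rewrite -intrD; congr (_%:~R); lia.
  rewrite -binC_vandermonde [LHS](bigID (fun i : 'I_I => (i < a.+1)%N))/=.
  rewrite [X in _ + X]big1 ?addr0; last first.
    move=> i; rewrite -leqNgt => ai.
    by rewrite (_ : Posz a - i%:Z = Negz (i - a).-1) ?mulr0//; lia.
  have aI : (a.+1 <= I)%N by lia.
  rewrite [RHS](big_ord_widen _ (fun i => binC (-1 - q)%:~R i * binC j%:~R (a - i)) aI).
  apply: eq_bigr => i ia; congr (_ * _).
  by rewrite (_ : Posz a - i%:Z = Posz (a - i))//; lia.
have n1 (m : nat) : (Negz m)%:~R = - m%:R - 1 :> C by rewrite NegzE mulrNz -pmulrn -natr1 opprD.
clear HI; clearbody n; case: n a1 => m [a|a] /=.
- rewrite mulr0 addr0; case: ltrP => ma; first by rewrite binC_nat bin_small//; lia.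
  rewrite (_ : absz (Posz m - Posz a)%R = (m - a)%N); last lia.
  by rewrite !binC_nat bin_sub//; lia.
- by rewrite mulr0 addr0 binC_nat bin_small//; lia.
- rewrite add0r n1 binC_neg /nbin subn1 /=.
  by rewrite addrC -!natrD !binC_nat -bin_sub ?leq_addr// addKn addnC.
- rewrite subn1 /= /nbin !n1; case: ltrP => ma.
    rewrite add0r (_ : - a%:R - 1 + m%:R = (m - a.+1)%N%:R); last first.
      by rewrite natrB -?natr1; [ring|lia].
    by rewrite binC_nat bin_small ?mulr0//; lia.
  have am : (m <= a)%N by lia.
  rewrite (_ : (absz (Negz m - Negz a)%R) = (a - m)%N); last lia.
  rewrite (_ : - a%:R - 1 + m%:R = - (a - m)%N%:R - 1); last by rewrite natrB//; ring.
  rewrite !binC_neg -!natrD subnKC// subnK// !binC_nat bin_sub// mulrA -mulrDl.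
  rewrite (_ : _ + _ = 0) ?mul0r// NegzE -exprnN -[(-1) ^- _]exprVn invrN1.
  have -> : (-1) ^+ a.+1 = - ((-1) ^+ (a - m) * (-1) ^+ m) :> C.
    by rewrite exprS mulN1r -exprD subnK.
  by rewrite mulNr -mulrA -exprD addnn -mul2n exprM sqrrN !expr1n mulr1 subrr.
Qed.

Lemma ln_expRN (y : R) : ln (expR (- y))^-1 = y.
Proof. by rewrite -expRN opprK expRK. Qed.

(** Subtracting enough terms of the expansion at infinity leaves an exponential polynomial in
    ln x that decays faster than all of its exponents allow, hence zero. *)
Lemma ep_laurent (Phi : R -> C) s A :
  lasy (fun t => Phi t^-1) (fun j => A (- j)) ->
  (forall x : R, 0 < x -> x != 1 -> Phi x = ep s (ln x)%:C) ->
  exists (M : nat) (n : nat -> int) (a : nat -> C), forall x : R, 0 < x -> x != 1 ->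
    Phi x = \sum_(i < M) a i * x%:C ^ n i.
Proof.
move=> [J [J0 HJ]] Phi_ep.
pose S : R := \sum_(p <- s) `|complex.Re p.1.1|.
have S0 : 0 <= S by rewrite sumr_ge0.
pose M := (J + (Num.truncn S).+1)%N.
have MS : J%:R + S < M%:R :> R by rewrite natrD ltrD2l truncnS_gt.
pose n (i : nat) : int := J%:Z - i%:Z.
have nE i : - (i%:Z - J%:Z) = n i by rewrite opprB.
pose s' := s ++ [seq ((n i)%:~R : C, 0%N, - A (n i)) | i <- iota 0 M].
have ep' y : ep s' y = ep s y - \sum_(i < M) A (n i) * cexp ((n i)%:~R * y).
  rewrite /ep big_cat big_map /=; congr (_ + _); rewrite -sumrN.
  rewrite -(big_mkord xpredT (fun i => - (A (n i) * cexp ((n i)%:~R * y)))).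
  by rewrite /index_iota subn0; apply: eq_bigr => i _; rewrite expr0 mulr1 mulNr.
have [K [K1 HK]] := HJ M.
have K0 : 0 < K by lra.
have ep'0 : forall y, ep s' y = 0.
  apply: (@ep_small_eq0 _ s' (M%:R - J%:R) K (ln (K + 1) + 1)).
    move=> p; rewrite mem_cat => /orP[ps|/mapP[i iM ->]].
      have : `|complex.Re p.1.1| <= S by rewrite /S (big_rem p)//= lerDl sumr_ge0.
      by rewrite ler_norml => /andP[h _]; lra.
    rewrite /= -(rmorph_int (real_complex R)) /= /n intrB.
    move: iM; rewrite mem_iota add0n => /andP[_ iM].
    have : (i%:R < M%:R :> R) by rewrite ltr_nat.
    by rewrite -!pmulrn; lra.
  move=> y yK; pose t := expR (- y).
  have t0 : 0 < t by apply: expR_gt0.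
  have y0 : 0 < y.
    by apply: lt_le_trans yK; rewrite ltr_wpDl// ln_ge0//; lra.
  have tK : t * K < 1.
    rewrite -(ltr_pM2l (expR_gt0 y)) mulr1 mulrA -expRD subrr expR0 mul1r.
    have <- : expR (ln K) = K by rewrite lnK.
    rewrite ltr_expR; apply: lt_le_trans yK.
    have : ln K <= ln (K + 1) by rewrite ler_ln ?posrE//; lra.
    lra.
  have tV : t^-1 != 1.
    by rewrite invr_eq1 -expR0 (inj_eq (@expR_inj R)) oppr_eq0 gt_eqF.
  have := HK t t0 tK; rewrite Phi_ep ?invr_gt0// ln_expRN => H.
  have tJ : t%:C ^+ J * cexp (J%:R * y%:C) = 1 :> C.
    rewrite cexpMn cexp_real -exprMn -rmorphM /= /t -expRD addNr expR0 rmorph1.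
    by rewrite expr1n.
  have -> : ep s' y%:C = cexp (J%:R * y%:C) *
     (t%:C ^+ J * ep s y%:C - \sum_(i < M) A (- (i%:Z - J%:Z)) * t%:C ^+ i).
    rewrite ep' mulrBr mulrA [cexp _ * _]mulrC tJ mul1r; congr (_ - _).
    rewrite mulr_sumr; apply: eq_bigr => i _; rewrite nE [RHS]mulrCA; congr (_ * _).
    have -> : t%:C = cexp (- y%:C) :> C by rewrite /t -rmorphN cexp_real.
    rewrite -cexpMn -cexpD; congr cexp.
    by rewrite /n intrB -!pmulrn; ring.
  rewrite cmodM cmod_cexp -(rmorph_nat (real_complex R)) -rmorphM /=.
  have -> : K * expR (- (M%:R - J%:R) * y) = expR (J%:R * y) * (K * t ^+ M).
    rewrite /t -expRM_natl mulrCA -expRD; congr (_ * expR _); ring.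
  by rewrite ler_pM2l ?expR_gt0.
exists M, n, (fun i => A (n i)) => x x0 x1.
rewrite Phi_ep//; have := ep'0 (ln x)%:C; rewrite ep' => /eqP; rewrite subr_eq0 => /eqP ->.
by apply: eq_bigr => i _; rewrite cexp_ln.
Qed.

(** The coefficient form of the residue theorem on the Riemann sphere for
    Phi(x) x^{-q-1} (x - 1)^{-a1-1} dx, whose poles are infinity, 0 and 1. Clearing the pole of Phi
    at 1 by induction on T, Phi becomes a Laurent polynomial, and by linearity a monomial. *)
Lemma laurent_residues T (Phi : R -> C) s A B D :
  lasy (fun t => Phi t^-1) (fun j => A (- j)) -> lasy Phi B ->
  lasy (fun t => Phi (1 + t)) D ->
  (forall x : R, 0 < x -> x != 1 -> (x%:C - 1) ^+ T * Phi x = ep s (ln x)%:C) ->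
  residues A B D.
Proof.
elim: T Phi A B D => [|T IHT] Phi A B D HA HB HD Hs.
  have [M [n [a PhiE]]] : exists (M : nat) (n : nat -> int) (a : nat -> C),
    forall x : R, 0 < x -> x != 1 -> Phi x = \sum_(i < M) a i * x%:C ^ n i.
    by apply: (ep_laurent (s := s) HA) => x x0 x1; rewrite -Hs// expr0 mul1r.
  have near1 (t : R) : 0 < t -> t * 1 < 1 -> [/\ t != 1, t^-1 != 1 & 1 + t != 1].
    move=> t0; rewrite mulr1 => t1; rewrite invr_eq1 (lt_eqF t1); split=> //.
    by rewrite gt_eqF//; lra.
  have AE : A = fun j => \sum_(i <- iota 0 M) a i * (j == n i)%:R.
    apply/funext => j; rewrite -[in LHS](opprK j).
    pose b (j : int) := \sum_(i <- iota 0 M) a i * (j == - n i)%:R.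
    rewrite (@lasy_uniq _ _ (fun j => A (- j)) b HA) /b; last first.
      apply: (@lasy_eqf _ (fun t => \sum_(i <- iota 0 M) a i * t%:C ^ (- n i)) _ _ 1).
        move=> t t0 t1; have [_ t2 _] := near1 t t0 t1.
        rewrite PhiE ?invr_gt0// -(big_mkord xpredT (fun i => a i * _ ^ n i)).
        rewrite /index_iota subn0; apply: eq_bigr => i _.
        by rewrite fmorphV -exprz_inv.
      by apply: lasy_sum => i; apply/lasyZ/lasy_monomial.
    by apply: eq_bigr => i _; rewrite eqr_opp.
  have BE : B = fun j => \sum_(i <- iota 0 M) a i * (j == n i)%:R.
    apply/funext; apply: (lasy_uniq HB).
    apply: (@lasy_eqf _ (fun t => \sum_(i <- iota 0 M) a i * t%:C ^ n i) _ _ 1).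
      move=> t t0 t1; have [t2 _ _] := near1 t t0 t1.
      by rewrite PhiE// -(big_mkord xpredT (fun i => a i * _ ^ n i)) /index_iota subn0.
    by apply: lasy_sum => i; apply/lasyZ/lasy_monomial.
  have DE : D = fun j => \sum_(i <- iota 0 M) a i * binZ (n i)%:~R j.
    apply/funext; apply: (lasy_uniq HD).
    apply: (@lasy_eqf _ (fun t => \sum_(i <- iota 0 M) a i * (1 + t)%:C ^ n i) _ _ 1).
      move=> t t0 t1; have [_ _ t2] := near1 t t0 t1.
      rewrite PhiE//; last lra.
      by rewrite -(big_mkord xpredT (fun i => a i * _ ^ n i)) /index_iota subn0.
    by apply: lasy_sum => i; apply/lasyZ/lasy_binomial.
  by rewrite AE BE DE; apply: residues_lin => i; apply: residues_monomial.
have [JA [JA0 _]] := HA; have [JB [JB0 _]] := HB.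
apply: (residues_mul (JA := JA%:Z) (JB := - JB%:Z)).
- by move=> j jJ; rewrite -(opprK j) JA0//; lia.
- exact: JB0.
apply: (IHT (fun x => (x%:C - 1) * Phi x)).
- apply: (@lasy_eqf _ (fun t => (t%:C)^-1 * Phi t^-1 - Phi t^-1) _ _ 0).
    by move=> t t0 _; rewrite fmorphV mulrBl mul1r.
  apply: lasy_eqc (lasyB (lasy_mulV HA) HA) => j; rewrite /Dl.
  by congr (A _ - _); lia.
- apply: (@lasy_eqf _ (fun t => t%:C * Phi t - Phi t) _ _ 0).
    by move=> t t0 _; rewrite mulrBl mul1r.
  exact: (lasyB (lasy_mul HB) HB).
- apply: (@lasy_eqf _ (fun t => t%:C * Phi (1 + t)) _ _ 0).
    by move=> t t0 _; rewrite rmorphD rmorph1 addrAC subrr add0r.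
  exact: (lasy_mul HD).
- by move=> x x0 x1; rewrite mulrA -exprSr Hs.
Qed.


End ResidueIdentity.

(** * Absolutely convergent Laurent series *)

Section AbsoluteSums.
Context {R : realType}.
Local Notation C := R[i].

(** A bound on all finite partial sums of moduli is the form in which absolute convergence is
    used; it passes to sums and subfamilies without discussing summability in the extended reals. *)
Definition wsums (I : choiceType) (f : I -> C) (s : C) : Prop :=
  (exists K : R, forall L : seq I, uniq L -> \sum_(i <- L) cmod (f i) <= K) /\
  (forall eps : R, 0 < eps -> exists A : {fset I}, forall B : {fset I},
    (A `<=` B)%fset -> cmod (\sum_(i <- B) f i - s) < eps).

Lemma abs_sums_wsums (I : choiceType) (f : I -> C) s : abs_sums_to f s -> wsums f s.
Proof.
move=> [Hf Hs]; split=> //; exists (fine (\esum_(i in [set: I]) `| (cmod (f i))%:E|))%E.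
move=> L uL; rewrite -lee_fin fineK; last by rewrite -summableE.
apply: esum_ge; exists [set` L]; first by split => //; apply: finite_seq.
rewrite -fsbig_seq// -sumEFin; apply: lee_sum => i _.
by rewrite /= lee_fin ler_norm.
Qed.

Lemma wsumsZ (I : choiceType) (f : I -> C) s (z : C) : wsums f s ->
  wsums (fun i => z * f i) (z * s).
Proof.
move=> [[K HK] Hs]; split.
  exists (cmod z * K) => L uL; under eq_bigr do rewrite cmodM.
  by rewrite -mulr_sumr ler_wpM2l ?cmod_ge0 ?HK.
move=> eps e0; have z0 := cmod_ge0 z.
have [|A HA] := Hs (eps / (1 + cmod z)); first by rewrite divr_gt0//; lra.
exists A => B AB; rewrite -mulr_sumr -mulrBr cmodM.
have := HA B AB; rewrite ltr_pdivlMr; last lra.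
have := cmod_ge0 (\sum_(i <- B) f i - s); nra.
Qed.

Lemma wsumsD (I : choiceType) (f g : I -> C) s r : wsums f s -> wsums g r ->
  wsums (fun i => f i + g i) (s + r).
Proof.
move=> [[K HK] Hs] [[L HL] Hr]; split.
  exists (K + L) => l ul; apply: le_trans (_ : \sum_(i <- l) (cmod (f i) + cmod (g i)) <= _).
    by apply: ler_sum => i _; apply: cmodD.
  by rewrite big_split lerD ?HK ?HL.
move=> eps e0; have e2 : 0 < eps / 2 by rewrite divr_gt0.
have [A HA] := Hs _ e2; have [B HB] := Hr _ e2.
exists (A `|` B)%fset => D ABD; rewrite big_split /= opprD addrACA.
apply: le_lt_trans (cmodD _ _) _; rewrite (splitr eps) ltrD//.
  by apply: HA; apply: fsubset_trans ABD; apply: fsubsetUl.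
by apply: HB; apply: fsubset_trans ABD; apply: fsubsetUr.
Qed.

Lemma wsums0 (I : choiceType) : wsums (fun _ : I => 0) 0.
Proof.
split; first by exists 0 => L _; rewrite big1// => i _; rewrite cmod0.
by move=> eps e0; exists fset0 => B _; rewrite big1// subrr cmod0.
Qed.

Lemma wsums_sum (I : choiceType) (J : Type) (s : seq J) (f : J -> I -> C) (r : J -> C) :
  (forall j, wsums (f j) (r j)) ->
  wsums (fun i => \sum_(j <- s) f j i) (\sum_(j <- s) r j).
Proof.
move=> H; elim: s => [|j s IHs].
  rewrite big_nil (_ : (fun i => _) = (fun=> 0)); first exact: wsums0.
  by apply/funext => i; rewrite big_nil.
rewrite big_cons (_ : (fun i => _) = (fun i => f j i + \sum_(j <- s) f j i)).
  exact: wsumsD.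
by apply/funext => i; rewrite big_cons.
Qed.

Lemma wsums_tail (I : choiceType) (f : I -> C) s (L : seq I) (Bd : R) : wsums f s ->
  uniq L -> (forall L', uniq L' -> (forall i, i \in L' -> i \notin L) ->
    \sum_(i <- L') cmod (f i) <= Bd) ->
  cmod (s - \sum_(i <- L) f i) <= Bd.
Proof.
move=> [_ Hs] uL HB; apply/ler_addgt0Pr => eps e0.
have [A HA] := Hs eps e0.
pose S := (A `|` [fset i in L])%fset.
have AS : (A `<=` S)%fset by apply: fsubsetUl.
have SE : \sum_(i <- S) f i = \sum_(i <- L) f i + \sum_(i <- S | i \notin L) f i.
  rewrite (bigID (fun i => i \in L))/=; congr (_ + _); rewrite -big_filter.
  apply/perm_big/uniq_perm => //; first by rewrite filter_uniq ?fset_uniq.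
  by move=> i; rewrite mem_filter !inE; case: (i \in L); rewrite //= orbT.
have -> : s - \sum_(i <- L) f i = \sum_(i <- S | i \notin L) f i - (\sum_(i <- S) f i - s).
  by rewrite SE; ring.
apply: (le_trans (cmodB _ _)); apply: lerD; last exact/ltW/HA.
rewrite (le_trans (cmod_sum _ _ _))// -big_filter HB ?filter_uniq ?fset_uniq//.
by move=> i; rewrite mem_filter => /andP[].
Qed.

Lemma cmod_monomial_le (c : C) (t h : R) (j e : int) : 0 < t -> 0 < h -> t <= h ->
  e <= j -> cmod (c * t%:C ^ j) <= cmod (c * h%:C ^ j) * (t / h) ^ e.
Proof.
move=> t0 h0 th ej; have q0 : 0 < t / h by rewrite divr_gt0.
have hn0 : h != 0 by rewrite gt_eqF.
have E (x : R) : 0 < x -> cmod (c * x%:C ^ j) = cmod c * x ^ j.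
  by move=> x0; rewrite cmodM cmodXz cmod_real gtr0_norm.
apply: (@le_trans _ _ (cmod c * t ^ j)); first by rewrite (E t t0).
apply: (@le_trans _ _ (cmod c * h ^ j * (t / h) ^ e)); last by rewrite (E h h0).
rewrite -mulrA ler_wpM2l ?cmod_ge0//.
have -> : t ^ j = h ^ j * (t / h) ^ j by rewrite -expfzMl mulrC divfK.
rewrite ler_wpM2l ?exprz_ge0 ?(ltW h0)//.
have jE : j = e + (absz (j - e))%:Z by clear -ej; lia.
rewrite {1}jE expfzDr ?(gt_eqF q0)// ler_piMr ?exprz_ge0 ?(ltW q0)//.
by rewrite -exprnP exprn_ile1 ?(ltW q0)// ler_pdivrMr ?mul1r.
Qed.

Lemma expr_exprz (x : C) (J i : nat) (e : int) : x != 0 -> J%:Z + e = i%:Z ->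
  x ^+ J * x ^ e = x ^+ i.
Proof. by move=> x0 H; rewrite [x ^+ J]exprnP -expfzDr// H. Qed.

Lemma expr_exprzR (x : R) (J i : nat) (e : int) : x != 0 -> J%:Z + e = i%:Z ->
  x ^+ J * x ^ e = x ^+ i.
Proof. by move=> x0 H; rewrite [x ^+ J]exprnP -expfzDr// H. Qed.

(** Absolute convergence at one value of t bounds the coefficients geometrically, hence the tail
    of the series by a power of t. The family may have extra indices as long as their terms
    vanish, which is how series indexed by complex exponents become Laurent series. *)
Lemma wsums_lasy (I : choiceType) (F : R -> I -> C) (Psi : R -> C) (iota_ : int -> I)
    (c : int -> C) (J : nat) : injective iota_ ->
  (forall t, 0 < t < 1 -> wsums (F t) (Psi t)) ->
  (forall t j, 0 < t < 1 -> F t (iota_ j) = c j * t%:C ^ j) ->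
  (forall t i, 0 < t < 1 -> (forall j, i != iota_ j) -> F t i = 0) ->
  (forall j : int, j < - J%:Z -> c j = 0) -> lasy Psi c.
Proof.
move=> inj_iota HF Fiota F0 c0; exists J; split=> // M.
have [h [h0 h1 hE]] : exists h : R, [/\ 0 < h, h < 1 & h^-1 = 2].
  by exists 2^-1; rewrite invr_gt0 invf_lt1// invrK; split; lra.
have hh : 0 < h < 1 by rewrite h0.
have [[K HK] _] := HF _ hh.
have K0 : 0 <= K by have := HK [::] isT; rewrite big_nil.
have [e eE] : exists e : int, J%:Z + e = M%:Z by exists (M%:Z - J%:Z); rewrite addrC subrK.
have e20 : 0 < (2 : R) ^ e by rewrite exprz_gt0.
exists (2 + K * 2 ^ e); split; first by nra.
move=> t t0 tK; have th : t < h.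
  have h2E : h * 2 = 1 by rewrite -hE divff ?gt_eqF.
  have : t * 2 < 1 by apply: le_lt_trans tK; rewrite ler_pM2l// lerDl mulr_ge0// ltW.
  lra.
have h2 : 0 < t < 1 by rewrite t0/= (lt_trans th).
have tn0 := realC_neq0 t0.
pose L := [seq iota_ (i%:Z - J%:Z) | i <- iota 0 M].
have uL : uniq L.
  rewrite map_inj_in_uniq ?iota_uniq// => i j _ _ /inj_iota ij.
  by apply/eqP; rewrite -eqz_nat; apply/eqP; clear -ij; lia.
have -> : t%:C ^+ J * Psi t - \sum_(i < M) c (i%:Z - J%:Z) * t%:C ^+ i =
   t%:C ^+ J * (Psi t - \sum_(i <- L) F t i).
  rewrite mulrBr big_map -[M in iota 0 M]subn0 -[iota _ _]/(index_iota 0 M) big_mkord.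
  congr (_ - _); rewrite mulr_sumr; apply: eq_bigr => i _; rewrite Fiota// mulrCA.
  by rewrite (expr_exprz (i := i)) // addrC subrK.
rewrite cmodM cmodX cmod_real (gtr0_norm t0).
have -> : (2 + K * 2 ^ e) * t ^+ M = t ^+ J * (2 * t ^ e + K * (t / h) ^ e).
  rewrite -(expr_exprzR (x := t) _ eE) ?gt_eqF// hE expfzMl; ring.
rewrite ler_pM2l ?exprn_gt0//.
have te0 : 0 <= (t / h) ^ e by rewrite exprz_ge0// divr_ge0// ltW.
apply: le_trans (_ : K * (t / h) ^ e <= _); last first.
  by rewrite lerDr mulr_ge0// exprz_ge0// ltW.
apply: wsums_tail (HF t h2) uL _ => L' uL' L'L.
apply: le_trans (_ : \sum_(i <- L') cmod (F h i) * (t / h) ^ e <= _); last first.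
  by rewrite -mulr_suml ler_wpM2r ?HK.
rewrite big_seq [leRHS]big_seq; apply: ler_sum => i iL'.
have [H|/existsNP[j /negP]] := pselect (forall j, i != iota_ j).
  by rewrite (F0 t)// cmod0 mulr_ge0// cmod_ge0.
rewrite negbK => /eqP ij; rewrite ij (Fiota t)// (Fiota h)//.
have [jJ|Jj] := ltrP j (- J%:Z).
  have z : c j * t%:C ^ j = 0 by rewrite (c0 _ jJ) mul0r.
  apply: (@le_trans _ _ 0); first by rewrite z cmod0.
  by rewrite mulr_ge0// cmod_ge0.
apply: cmod_monomial_le => //; first exact: ltW.
rewrite leNgt; apply/negP => je.
have := L'L i iL'; rewrite ij => /negP; apply; apply/mapP.
exists (absz (j + J%:Z)); first by rewrite mem_iota /=; clear -je eE Jj; lia.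
by congr iota_; clear -Jj; lia.
Qed.

End AbsoluteSums.

(** * Separating functionals and polynomials in an operator *)

Section SeparatingFunctionals.
Context {R : realType}.
Local Notation C := R[i].
Context {V : lmodType C}.
Implicit Types (U A : set V).
Local Notation subspace := Defs.subspace.

Lemma subspaceD U x y : subspace U -> U x -> U y -> U (x + y).
Proof. by move=> [_ H] Ux Uy; have := H 1 x y Ux Uy; rewrite scale1r. Qed.

Lemma subspaceZ U a x : subspace U -> U x -> U (a *: x).
Proof. by move=> [U0 H] Ux; have := H a x 0 Ux U0; rewrite addr0. Qed.

Lemma subspaceN U x : subspace U -> U x -> U (- x).
Proof. by move=> sU Ux; rewrite -scaleN1r; apply: subspaceZ. Qed.

Lemma subspaceB U x y : subspace U -> U x -> U y -> U (x - y).
Proof. by move=> sU Ux Uy; apply: subspaceD => //; apply: subspaceN. Qed.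

Lemma subspace_sum U (I : Type) (s : seq I) (P : pred I) (F : I -> V) : subspace U ->
  (forall i, P i -> U (F i)) -> U (\sum_(i <- s | P i) F i).
Proof.
by move=> sU H; elim/big_ind : _ => //; [case: sU|move=> *; apply: subspaceD].
Qed.

(** Zorn's lemma for the subspaces that contain U and avoid x. *)
Lemma maximal_avoiding U x : subspace U -> ~ U x ->
  exists A, [/\ subspace A, U `<=` A, ~ A x & forall y, exists a, A (y - a *: x)].
Proof.
move=> sU Ux; pose P A := A = set0 \/ [/\ subspace A, U `<=` A & ~ A x].
have [F FP Ftot|A [PA Amax]] := @Zorn_bigcup V P.
  have [[X FX X0]|F0] := pselect (exists2 X, F X & X !=set0); last first.
    left; apply/seteqP; split=> // y [X FX Xy]; case: F0; exists X => //.
    by exists y.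
  have good Y : F Y -> Y !=set0 -> [/\ subspace Y, U `<=` Y & ~ Y x].
    by move=> /FP[->|//] [].
  have [sX UX Xx] := good X FX X0; right; split.
  - split; first by exists X => //; case: sX.
    move=> a y z [Y FY Yy] [Z FZ Zz].
    have [sY _ _] := good Y FY (ex_intro _ _ Yy).
    have [sZ _ _] := good Z FZ (ex_intro _ _ Zz).
    have [YZ|ZY] := Ftot Y Z FY FZ.
      by exists Z => //; apply: sZ.2 => //; apply: YZ.
    by exists Y => //; apply: sY.2 => //; apply: ZY.
  - by move=> y Uy; exists X => //; apply: UX.
  - move=> [Y FY Yx]; have [_ _] := good Y FY (ex_intro _ _ Yx); exact.
have U0 : U 0 by case: sU.
have {PA}[sA UA Ax] : [/\ subspace A, U `<=` A & ~ A x].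
  case: PA => // A0; have PU : P U by right; split.
  case: (Amax U) => //; rewrite A0; split=> // H.
  by have := H 0 U0.
exists A; split=> // y; have [Ay|Ay] := pselect (A y).
  by exists 0; rewrite scale0r subr0.
pose B := [set z | exists b, A (z - b *: y)].
have sB : subspace B.
  split; first by exists 0; rewrite scale0r subr0; apply: UA.
  move=> a z z' [b Hb] [b' Hb']; exists (a * b + b').
  have := sA.2 a _ _ Hb Hb'; congr A.
  by rewrite scalerBr scalerDl scalerA opprD !addrA; congr (_ - _); rewrite addrAC.
have AB : A `<=` B by move=> z Az; exists 0; rewrite scale0r subr0.
have : ~ P B.
  apply: Amax; split=> // BA; apply: Ay; apply: BA; exists 1.
  by rewrite scale1r subrr; case: sA.
have [[b Hb] _|Bx []] := pselect (B x); last first.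
  by right; split=> //; apply: subset_trans AB.
have b0 : b != 0.
  by apply: contra_notN Ax => /eqP b0; move: Hb; rewrite b0 scale0r subr0.
exists b^-1; have := subspaceZ (- b^-1) sA Hb.
by rewrite scalerBr scalerA mulNr mulVf// !scaleNr scale1r opprK addrC.
Qed.

(** A maximal subspace avoiding x has codimension one, and the coefficient of x modulo this
    subspace is the functional. *)
Lemma separating_functional U x : subspace U -> ~ U x ->
  exists f : {scalar V}, f x = 1 /\ forall u, U u -> f u = 0.
Proof.
move=> sU Ux; have [A [sA UA Ax H]] := maximal_avoiding sU Ux.
have [f fP] := choice H.
have uniqA y a b : A (y - a *: x) -> A (y - b *: x) -> a = b.
  move=> Ha Hb; apply/eqP; rewrite -subr_eq0; apply: contra_notT Ax => ab0.
  have := subspaceZ (a - b)^-1 sA (subspaceB sA Hb Ha).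
  have -> : y - b *: x - (y - a *: x) = (a - b) *: x.
    by rewrite opprB [y - _]addrC addrACA subrr addr0 addrC scalerBl.
  by rewrite scalerA mulVf// scale1r.
have lf : linear_for *%R f.
  move=> a y z; apply: (uniqA (a *: y + z)) (fP _) _.
  have := sA.2 a _ _ (fP y) (fP z); congr A.
  by rewrite scalerBr scalerDl scalerA opprD !addrA; congr (_ - _); rewrite addrAC.
pose F : {scalar V} := HB.pack f (GRing.isLinear.Build _ _ _ _ _ lf).
exists F; split.
  by apply: (uniqA x) (fP x) _; rewrite scale1r subrr; case: sA.
by move=> u Uu; apply: (uniqA u) (fP u) _; rewrite scale0r subr0; apply: UA.
Qed.

Lemma functional_ext (x y : V) : (forall f : {scalar V}, f x = f y) -> x = y.
Proof.
move=> H; apply/eqP; rewrite -subr_eq0; apply/negP => /negP xy.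
have [||f [fx _]] := @separating_functional [set 0] (x - y).
- split=> // a _ _ -> ->; rewrite scaler0 addr0 //.
- by move/eqP: xy.
by move: fx; rewrite raddfB /= H subrr => /eqP; rewrite eq_sym oner_eq0.
Qed.

End SeparatingFunctionals.

Section PolynomialAction.
Context {R : realType}.
Local Notation C := R[i].
Context {V : lmodType C}.
Implicit Types (T : {linear V -> V}) (p q : {poly C}).
Local Notation subspace := Defs.subspace.

Definition pact T p (v : V) : V := \sum_(i < size p) p`_i *: iter i T v.

Lemma iter_linear T k a u v : iter k T (a *: u + v) = a *: iter k T u + iter k T v.
Proof. by elim: k => //= k ->; rewrite linearP. Qed.

Lemma pactE T p v n : (size p <= n)%N -> pact T p v = \sum_(i < n) p`_i *: iter i T v.
Proof.
move=> pn; rewrite /pact (big_ord_widen n (fun i => p`_i *: iter i T v) pn).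
rewrite big_mkcond/=; apply: eq_bigr => i _; case: ltnP => // ip.
by rewrite nth_default// scale0r.
Qed.

Lemma pact_linear T p : linear (pact T p).
Proof.
move=> a u v; rewrite /pact scaler_sumr -big_split; apply: eq_bigr => i _ /=.
by rewrite iter_linear scalerDr !scalerA mulrC.
Qed.

HB.instance Definition _ T p := GRing.isLinear.Build C V V *:%R (pact T p) (pact_linear T p).

Lemma pactD T p q v : pact T (p + q) v = pact T p v + pact T q v.
Proof.
pose n := maxn (size p) (size q).
rewrite (@pactE _ p _ n) ?leq_maxl// (@pactE _ q _ n) ?leq_maxr//.
rewrite (@pactE _ _ _ n) ?size_polyD// -big_split.
by apply: eq_bigr => i _; rewrite coefD scalerDl.
Qed.

Lemma pactZ T a p v : pact T (a *: p) v = a *: pact T p v.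
Proof.
rewrite (@pactE _ _ _ (size p)) ?size_scale_leq// scaler_sumr.
by apply: eq_bigr => i _; rewrite coefZ scalerA.
Qed.

Lemma pact0 T v : pact T 0 v = 0.
Proof. by rewrite /pact size_poly0 big_ord0. Qed.

Lemma pactC T a v : pact T a%:P v = a *: v.
Proof. by rewrite (@pactE _ _ _ 1) ?size_polyC_leq1// big_ord1 coefC. Qed.

Lemma pact1 T v : pact T 1 v = v.
Proof. by rewrite -polyC1 pactC scale1r. Qed.

Lemma pactXM T p v : pact T ('X * p) v = T (pact T p v).
Proof.
rewrite (@pactE _ _ _ (size p).+1); last first.
  by rewrite (leq_trans (size_polyMleq _ _))// size_polyX.
rewrite big_ord_recl coefXM scale0r add0r /pact linear_sum.
by apply: eq_bigr => i _; rewrite coefXM /= linearZ.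
Qed.

Lemma pactX T v : pact T 'X v = T v.
Proof. by rewrite -[X in pact T X]mulr1 pactXM pact1. Qed.

Lemma pactM T p q v : pact T (p * q) v = pact T p (pact T q v).
Proof.
elim/poly_ind: p => [|p c IHp]; first by rewrite mul0r !pact0.
rewrite mulrDl mulrAC -[p * q * 'X]mulrC !pactD mul_polyC pactXM IHp pactZ.
by rewrite [p * 'X]mulrC pactXM pactC.
Qed.

Lemma pact_sum T (I : Type) (s : seq I) (P : pred I) (F : I -> {poly C}) v :
  pact T (\sum_(i <- s | P i) F i) v = \sum_(i <- s | P i) pact T (F i) v.
Proof.
by elim/big_rec2: _ => [|i x y _ <-]; rewrite ?pact0// pactD.
Qed.

Lemma pact_comm T p q v : pact T p (pact T q v) = pact T q (pact T p v).
Proof. by rewrite -!pactM mulrC. Qed.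

Lemma pact_iter T lam k v :
  pact T (('X - lam%:P) ^+ k) v = iter k (fun x => T x - lam *: x) v.
Proof.
elim: k => [|k IHk] /=; first by rewrite expr0 pact1.
by rewrite exprS pactM IHk pactD pactX -polyCN pactC scaleNr.
Qed.

Lemma pact_subspace T U p v : subspace U -> (forall u, U u -> U (T u)) -> U v -> U (pact T p v).
Proof.
move=> sU UT Uv; apply: subspace_sum => // i _; apply: subspaceZ => //.
by elim: (i : nat) => //= k; apply: UT.
Qed.

(** Written with the same iteration as the generalized eigenspaces, so that both agree by
    computation for l = e^{2 pi i a}; the eigenvalue 0 is excluded only later. *)
Definition gker T (lam : C) (v : V) : Prop :=
  exists k, iter k (fun x => T x - lam *: x) v = 0.

Lemma gkerP T lam v : gker T lam v <-> exists k, pact T (('X - lam%:P) ^+ k) v = 0.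
Proof. by split => -[k]; rewrite -?pact_iter => H; exists k; rewrite ?pact_iter// -pact_iter. Qed.

Lemma pact_dvd T p q v : p %| q -> pact T p v = 0 -> pact T q v = 0.
Proof. by move=> /dvdpP[r ->] pv; rewrite pactM pv raddf0. Qed.

Lemma pact_coprime T p q v : coprimep p q -> pact T p v = 0 -> pact T q v = 0 -> v = 0.
Proof.
move=> /Bezout_eq1_coprimepP[[a b] /= E] pv qv.
by rewrite -[LHS](pact1 T) -E pactD !pactM pv qv !raddf0 addr0.
Qed.

Lemma coprimep_XsubC_exp (a b : C) k l : a != b ->
  coprimep (('X - a%:P) ^+ k) (('X - b%:P) ^+ l).
Proof.
by move=> ab; rewrite coprimep_expl// coprimep_expr// coprimep_XsubC root_XsubC eq_sym.
Qed.

(** A vector killed by two coprime polynomials in T vanishes. *)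
Lemma gker_indep T (I : choiceType) (s : seq I) (lam : I -> C) (c : I -> V) :
  uniq s -> {in s &, injective lam} -> (forall i, i \in s -> gker T (lam i) (c i)) ->
  \sum_(i <- s) c i = 0 -> forall i, i \in s -> c i = 0.
Proof.
move=> us inj_lam Hc sum0 i si.
have [k kP] : exists k : I -> nat, forall j, j \in s ->
    pact T (('X - (lam j)%:P) ^+ k j) (c j) = 0.
  have : forall j, exists k, j \in s -> pact T (('X - (lam j)%:P) ^+ k) (c j) = 0.
    move=> j; have [js|_] := boolP (j \in s); last by exists 0%N.
    by have /gkerP[k Hk] := Hc j js; exists k.
  by move=> /choice[k Hk]; exists k.
pose P := \prod_(j <- rem i s) ('X - (lam j)%:P) ^+ k j.
apply: (@pact_coprime T (('X - (lam i)%:P) ^+ k i) P); last 2 first.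
- exact: kP.
- have : pact T P (\sum_(j <- s) c j) = 0 by rewrite sum0 raddf0.
  rewrite (big_rem i)//= raddfD/= raddf_sum big_seq big1 ?addr0// => j js.
  have js' : j \in s by apply: mem_rem js.
  apply: (@pact_dvd T (('X - (lam j)%:P) ^+ k j)); last exact: kP.
  by rewrite /P (big_rem j)//= dvdp_mulIl.
rewrite /P big_seq; elim/big_ind : _ => [|p q Hp Hq|j js]; first exact: coprimep1.
  by rewrite coprimepMr Hp.
apply: coprimep_XsubC_exp; apply: contraTneq js => E.
have := rem_filter i us; move=> ->; rewrite mem_filter /=.
have [js|] := boolP (j \in s); last by rewrite andbF.
by rewrite (inj_lam _ _ si js E) eqxx.
Qed.

Lemma gker_decomp_prod T (s : seq C) (k : C -> nat) v : uniq s ->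
  pact T (\prod_(z <- s) ('X - z%:P) ^+ k z) v = 0 ->
  exists q : C -> {poly C}, v = \sum_(r <- s) pact T (q r) v /\
    forall r, r \in s -> gker T r (pact T (q r) v).
Proof.
elim: s v => [|r s IHs] v /=.
  by rewrite big_nil pact1 => _ ->; exists (fun=> 0); rewrite big_nil.
move=> /andP[rs us]; rewrite big_cons; set P := \prod_(z <- s) _ => PrP.
have cop : coprimep (('X - r%:P) ^+ k r) P.
  rewrite /P big_seq; elim/big_ind : _ => [|p q Hp Hq|j js]; first exact: coprimep1.
    by rewrite coprimepMr Hp.
  by apply: coprimep_XsubC_exp; apply: contraNneq rs => ->.
have [[a b] /= E] := Bezout_eq1_coprimepP _ _ cop.
have [|q [qE qk]] := IHs (pact T (a * ('X - r%:P) ^+ k r) v) us.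
  by rewrite -pactM mulrC -mulrA pactM PrP raddf0.
exists (fun z => if z == r then b * P else q z * (a * ('X - r%:P) ^+ k r)).
have neq z : z \in s -> (z == r) = false by move=> zs; apply: contraNF rs => /eqP <-.
split.
  rewrite big_cons eqxx -[LHS](pact1 T) -E addrC pactD; congr (_ + _).
  by rewrite {1}qE [LHS]big_seq [RHS]big_seq; apply: eq_bigr => z zs; rewrite neq// pactM.
move=> z; rewrite inE; have [->|zr] := eqVneq z r; last first.
  by move=> /= zs; rewrite pactM; apply: qk.
by move=> _; apply/gkerP; exists (k r); rewrite -pactM mulrCA pactM PrP raddf0.
Qed.

(** The polynomial splits, and Bezout identities between powers of distinct linear factors
    yield projections that are polynomials in T. They are exposed because such projections
    preserve every T-stable subspace. *)
Lemma gker_decomp T p v : p != 0 -> pact T p v = 0 ->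
  exists (rs : seq C) (q : C -> {poly C}), [/\ uniq rs,
    v = \sum_(r <- rs) pact T (q r) v & forall r, r \in rs -> gker T r (pact T (q r) v)].
Proof.
move=> p0 pv; have [rs prs] := closed_field_poly_normal p.
have [|q [qE qk]] := @gker_decomp_prod T (undup rs) (fun z => count_mem z rs) v (undup_uniq rs).
  move: pv; rewrite prs pactZ => /eqP.
  rewrite scaler_eq0 lead_coef_eq0 (negPf p0)/= => /eqP <-.
  by rewrite (prodr_undup_exp_count rs xpredT (fun z => 'X - z%:P)).
by exists (undup rs), q; split; rewrite ?undup_uniq.
Qed.

(** The iterates of v under T are linearly dependent. *)
Lemma finite_dim_annihilated T (U : set V) v : finite_dim U -> (forall u, U u -> U (T u)) ->
  U v -> exists2 p : {poly C}, p != 0 & pact T p v = 0.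
Proof.
move=> [s [_ Us]] UT Uv; pose d := size s.
have Uk k : U (iter k T v) by elim: k => //= k; apply: UT.
have [a aP] := choice (fun k => Us _ (Uk k)).
pose A : 'M[C]_(d.+1, d) := \matrix_(i, j) a i j.
have [x x0 xA] : exists2 x : 'rV[C]_d.+1, x != 0 & x *m A = 0.
  have : kermx A != 0.
    by rewrite -mxrank_eq0 mxrank_ker subn_eq0 -ltnNge ltnS rank_leq_col.
  move=> /rowV0Pn[x xk x0]; exists x => //; exact/sub_kermxP.
exists (\poly_(i < d.+1) x 0 (inord i)).
  apply: contraNneq x0 => p0; apply/eqP/rowP => i; rewrite mxE.
  by have /polyP/(_ i) := p0; rewrite coef_poly ltn_ord coef0 inord_val.
rewrite (@pactE _ _ _ d.+1) ?size_poly//.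
under eq_bigr => i _ do rewrite coef_poly ltn_ord inord_val aP scaler_sumr.
rewrite exchange_big big1// => j _.
under eq_bigr do rewrite scalerA.
rewrite -scaler_suml; have /rowP/(_ j) := xA; rewrite !mxE.
by under eq_bigr do rewrite mxE; move=> ->; rewrite scale0r.
Qed.

End PolynomialAction.

(** * Direct sums *)

Section FiniteSupportSums.

Lemma finite_set_seq (I : choiceType) (P : set I) : finite_set P ->
  exists s : seq I, uniq s /\ forall i, i \in s <-> P i.
Proof.
move=> /finite_fsetP[s ->]; exists s; split; first exact: fset_uniq.
by move=> i; split.
Qed.

Lemma seq_finite_set (I : choiceType) (P : set I) (s : seq I) :
  (forall i, P i -> i \in s) -> finite_set P.
Proof. by move=> H; apply: sub_finite_set (finite_seq s) => i /H. Qed.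

Lemma fsbig_seqE (I : choiceType) (A : nmodType) (P : set I) (f : I -> A) (s : seq I) :
  uniq s -> (forall i, i \in s -> P i) -> (forall i, P i -> f i != 0 -> i \in s) ->
  \sum_(i \in P) f i = \sum_(i <- s) f i.
Proof.
move=> us sP Ps; rewrite (fsbigE s)//.
  rewrite big_mkcond big_seq [RHS]big_seq; apply: eq_bigr => i si.
  by rewrite mem_set//; apply: sP.
by move=> i Pi; apply: contraNeq; apply: Ps.
Qed.

Lemma fsbigT_seqE (I : choiceType) (A : nmodType) (f : I -> A) (s : seq I) :
  uniq s -> (forall i, f i != 0 -> i \in s) ->
  \sum_(i \in [set: I]) f i = \sum_(i <- s) f i.
Proof. by move=> us Hs; apply: fsbig_seqE => // i _; apply: Hs. Qed.

Lemma finite_set_seq2 (I : choiceType) (P Q : set I) : finite_set P -> finite_set Q ->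
  exists s : seq I, [/\ uniq s, forall i, P i -> i \in s & forall i, Q i -> i \in s].
Proof.
move=> fP fQ; have fPQ : finite_set (P `|` Q) by rewrite finite_setU.
have [s [us sP]] := finite_set_seq fPQ.
by exists s; split=> // i H; apply/sP; [left|right].
Qed.

End FiniteSupportSums.

Section DirectSums.
Context {R : realType}.
Local Notation C := R[i].
Context {V : lmodType C} {I : choiceType} {D : set I} {U : I -> set V}.
Hypothesis ds : direct_sum D U.
Local Notation subspace := Defs.subspace.
Local Notation cmp := (component D U).

Lemma componentP v : decomposition D U v (cmp v).
Proof.
have [c [Hc _]] := ds.2 v; rewrite /component.
by case: xgetP => [c' -> //|/(_ c)].
Qed.

Lemma component_uniq v c : decomposition D U v c -> cmp v = c.
Proof.
move=> Hc; have [c0 [_ H]] := ds.2 v.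
by rewrite -(H _ Hc) -(H _ (componentP v)).
Qed.

Lemma component_finite v : finite_set [set i | cmp v i != 0].
Proof. by have [] := componentP v. Qed.

Lemma component_in v i : D i -> U i (cmp v i).
Proof. by have [_ H _ _] := componentP v; apply: H. Qed.

Lemma component_out v i : ~ D i -> cmp v i = 0.
Proof. by have [_ _ H _] := componentP v; apply: H. Qed.

Lemma component_D v i : cmp v i != 0 -> D i.
Proof. by apply: contra_neqP => /component_out. Qed.

Lemma component_sum v (s : seq I) : uniq s -> (forall i, cmp v i != 0 -> i \in s) ->
  v = \sum_(i <- s) cmp v i.
Proof. by move=> us H; have [_ _ _ {1}->] := componentP v; apply: fsbigT_seqE. Qed.

Lemma component_decomp v : exists s : seq I, [/\ uniq s,
  forall i, i \in s -> D i & v = \sum_(i <- s) cmp v i].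
Proof.
have [s [us sP]] := finite_set_seq (component_finite v); exists s; split=> //.
  by move=> i /sP /component_D.
by apply: component_sum => // i /sP.
Qed.

Lemma component_linear i : linear (fun v => cmp v i).
Proof.
move=> a u v; suff -> : cmp (a *: u + v) = fun i => a *: cmp u i + cmp v i by [].
apply: component_uniq.
have [s [us Hu Hv]] := finite_set_seq2 (component_finite u) (component_finite v).
have H j : a *: cmp u j + cmp v j != 0 -> j \in s.
  have [->|/Hu//] := eqVneq (cmp u j) 0; rewrite scaler0 add0r; exact: Hv.
split.
- exact: seq_finite_set H.
- by move=> j Dj; apply: (ds.1 j Dj).2; apply: component_in.
- by move=> j Dj; rewrite !component_out// scaler0 addr0.
- rewrite (fsbigT_seqE us H) big_split -scaler_sumr /=.
  by rewrite -(component_sum us Hu) -(component_sum us Hv).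
Qed.

Lemma componentD u v i : cmp (u + v) i = cmp u i + cmp v i.
Proof. by have := component_linear i 1 u v; rewrite !scale1r. Qed.

Lemma component0 i : cmp 0 i = 0.
Proof. by apply: (addIr (cmp 0 i)); rewrite -componentD !add0r. Qed.

Lemma componentZ a u i : cmp (a *: u) i = a *: cmp u i.
Proof. by have := component_linear i a u 0; rewrite component0 !addr0. Qed.

Lemma component_bigsum (J : Type) (s : seq J) (P : pred J) (F : J -> V) i :
  cmp (\sum_(j <- s | P j) F j) i = \sum_(j <- s | P j) cmp (F j) i.
Proof. by elim/big_rec2 : _ => [|j x y _ <-]; rewrite ?component0// componentD. Qed.

Lemma component_homog v i j : D i -> U i v -> cmp v j = if j == i then v else 0.
Proof.
move=> Di Uv; suff -> : cmp v = fun j => if j == i then v else 0 by [].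
have H k : (if k == i then v else 0) != 0 -> k \in [:: i].
  by case: ifP => [/eqP -> _|_]; rewrite ?mem_head ?eqxx.
apply: component_uniq; split.
- exact: seq_finite_set H.
- by move=> k Dk; case: eqVneq => [->//|_]; case: (ds.1 k Dk).
- by move=> k; case: eqVneq => [->|].
- by rewrite (fsbigT_seqE _ H)// big_seq1 eqxx.
Qed.

Lemma coprodP (D' : set I) v : D' `<=` D ->
  coprod D' U v <-> forall i, ~ D' i -> cmp v i = 0.
Proof.
move=> D'D; split=> [[c [fc Uc c0 vE]] i D'i|H].
  have -> : cmp v = c by apply: component_uniq; split=> // j Dj;
    [have [/Uc//|/c0 ->] := pselect (D' j); case: (ds.1 j Dj)|apply: c0 => /D'D].
  exact: c0.
exists (cmp v); have [f1 f2 f3 f4] := componentP v; split=> //.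
by move=> i /D'D; apply: f2.
Qed.

Lemma coprod_subspace (D' : set I) : D' `<=` D -> subspace (coprod D' U).
Proof.
move=> D'D; split; first by apply/coprodP => // i _; rewrite component0.
move=> a u v /(coprodP _ D'D) Hu /(coprodP _ D'D) Hv; apply/coprodP => // i D'i.
by rewrite component_linear Hu// Hv// scaler0 addr0.
Qed.

Lemma coprod_homog (D' : set I) i v : D' `<=` D -> D' i -> U i v -> coprod D' U v.
Proof.
move=> D'D D'i Uv; apply/coprodP => // j D'j.
rewrite (component_homog _ (D'D _ D'i) Uv); case: eqVneq => // ji.
by move: D'j; rewrite ji.
Qed.

Lemma coprod_decomp (D' : set I) v : D' `<=` D -> coprod D' U v ->
  exists s : seq I, [/\ uniq s, forall i, i \in s -> D' i & v = \sum_(i <- s) cmp v i].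
Proof.
move=> D'D /(coprodP _ D'D) H.
have [s [us sP]] := finite_set_seq (component_finite v); exists s; split=> //.
  by move=> i /sP /=; apply: contra_neqP => /H.
by apply: component_sum => // i /sP.
Qed.

End DirectSums.

Lemma direct_sum_intro {R : realType} {V : lmodType R[i]} {I : choiceType}
    (D : set I) (U : I -> set V) :
  (forall i, D i -> Defs.subspace (U i)) ->
  (forall v, exists c, decomposition D U v c) ->
  (forall (s : seq I) (c : I -> V), uniq s -> (forall i, i \in s -> D i /\ U i (c i)) ->
     \sum_(i <- s) c i = 0 -> forall i, i \in s -> c i = 0) ->
  direct_sum D U.
Proof.
move=> sU ex indep; split=> // v; have [c Hc] := ex v; exists c; split=> // c' Hc'.
have [f1 f2 f3 f4] := Hc; have [g1 g2 g3 g4] := Hc'.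
have [s [us Hs Hs']] := finite_set_seq2 f1 g1.
apply/funext => i; apply/eqP; rewrite -subr_eq0; apply/eqP.
have [is_|is_] := boolP (i \in s); last first.
  have z (d : I -> V) : (forall j, d j != 0 -> j \in s) -> d i = 0.
    by move=> H; apply/eqP; apply: contraNT is_; apply: H.
  by rewrite !z// subrr.
have [Di|Di] := pselect (D i); last by rewrite f3// g3// subrr.
apply: (indep [seq j <- s | `[< D j >]] (fun j => c j - c' j)); rewrite ?filter_uniq//.
- move=> j; rewrite mem_filter => /andP[/asboolP Dj _]; split=> //.
  have [U0 Ul] := sU j Dj; rewrite addrC -scaleN1r; apply: Ul; [exact: g2|exact: f2].
- rewrite big_filter sumrB.
  have E (d : I -> V) : (forall j, ~ D j -> d j = 0) ->
      \sum_(j <- s | `[< D j >]) d j = \sum_(j <- s) d j.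
    move=> H; rewrite [RHS](bigID (fun j => `[< D j >]))/= [X in _ + X]big1 ?addr0//.
    by move=> j /asboolPn /H.
  by rewrite !E// -(fsbigT_seqE us Hs) -(fsbigT_seqE us Hs') -f4 -g4 subrr.
- by rewrite mem_filter is_ andbT; apply/asboolP.
Qed.

(** * The nilpotent part of a locally finite automorphism *)

Section CauchyProducts.
Context {R : realType}.
Local Notation C := R[i].

(** Both sides are expansions of (1 + t)^(a + b) ln(1 + t)^(k + l) / (k! l!), so uniqueness of
    asymptotic expansions replaces a combinatorial proof. *)
Lemma cprod_bet (a b : C) k l :
  cprod (bet a k) (bet b l) =1 (fun n => 'C(k + l, k)%:R * bet (a + b) (k + l) n).
Proof.
apply: (asy_uniq (asyM (asy_Gfun a k) (asy_Gfun b l))).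
apply: (asy_eqf (K0 := 0) _ (asyZ _ (asy_Gfun (a + b) (k + l)))) => t _ _.
rewrite /Gfun mulrDl cexpD exprD.
have := bin_fact (leq_addr l k); rewrite addKn => /(congr1 (fun n => n%:R : C)).
rewrite !natrM => E; have k0 := @factC_neq0 R k; have l0 := @factC_neq0 R l.
have kl0 := @factC_neq0 R (k + l).
have -> : 'C(k + l, k)%:R = (k + l)`!%:R / (k`!%:R * l`!%:R) :> C.
  by rewrite -E mulfK// mulf_neq0.
move: (_ ^+ k) (_ ^+ l) (cexp _) (cexp _) => x y z w.
by field; rewrite k0 l0 kl0.
Qed.

End CauchyProducts.

Lemma sum_shift (A : nmodType) K i (f : nat -> A) : (i <= K)%N ->
  \sum_(m < K | (i <= m)%N) f m = \sum_(l < K - i) f (l + i)%N.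
Proof.
move=> iK; rewrite -(big_mkord (fun m => (i <= m)%N) f).
rewrite (big_cat_nat (n := i))//= [X in X + _]big_nat_cond big1 ?add0r; last first.
  by move=> m /andP[/andP[_ mi] im]; rewrite leqNgt mi in im.
rewrite -{1}(add0n i) big_addn big_mkord.
by apply: eq_bigl => l; rewrite leq_addl.
Qed.

Section LinearIterates.
Context {R : realType}.
Local Notation C := R[i].
Context {V : lmodType C}.

Lemma iter_lin (F : V -> V) k : linear F -> linear (iter k F).
Proof. by move=> lF; elim: k => //= k IHk a u v /=; rewrite (IHk a u v) (lF a). Qed.

Lemma lin0 (W : lmodType C) (F : V -> W) : linear F -> F 0 = 0.
Proof. by move=> lF; have := lF (-1) 0 0; rewrite scaler0 addr0 scaleN1r addNr. Qed.

Lemma linD (W : lmodType C) (F : V -> W) u v : linear F -> F (u + v) = F u + F v.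
Proof. by move=> lF; have := lF 1 u v; rewrite !scale1r. Qed.

Lemma linZ (W : lmodType C) (F : V -> W) a u : linear F -> F (a *: u) = a *: F u.
Proof. by move=> lF; have := lF a u 0; rewrite (lin0 lF) !addr0. Qed.

Lemma linB (W : lmodType C) (F : V -> W) u v : linear F -> F (u - v) = F u - F v.
Proof. by move=> lF; rewrite -scaleN1r linD// linZ// scaleN1r. Qed.

Lemma lin_sum (W : lmodType C) (F : V -> W) (I : Type) (s : seq I) (P : pred I) (f : I -> V) :
  linear F -> F (\sum_(i <- s | P i) f i) = \sum_(i <- s | P i) F (f i).
Proof. by move=> lF; elim/big_rec2 : _ => [|i x y _ <-]; rewrite ?lin0// linD. Qed.

Lemma iter_zero (F : V -> V) k l v : linear F -> (k <= l)%N -> iter k F v = 0 -> iter l F v = 0.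
Proof.
move=> lF kl Fk; rewrite -(subnK kl) iterD Fk; elim: (l - k)%N => //= n ->; exact: lin0.
Qed.

Lemma nilp_common (I : eqType) (s : seq I) (F : V -> V) (f : I -> V) : linear F ->
  (forall i, i \in s -> exists k, iter k F (f i) = 0) ->
  exists k, forall i, i \in s -> iter k F (f i) = 0.
Proof.
move=> lF; elim: s => [|i s IHs] H; first by exists 0%N.
have [k Hk] := H i (mem_head _ _).
have [|l Hl] := IHs; first by move=> j js; apply: H; rewrite inE js orbT.
exists (maxn k l) => j; rewrite inE => /predU1P[->|js].
  exact: iter_zero (leq_maxl _ _) Hk.
exact: iter_zero (leq_maxr _ _) (Hl j js).
Qed.

End LinearIterates.

Section LocallyFiniteOperators.
Context {R : realType}.
Local Notation C := R[i].
Context {V : lmodType C} (T : {linear V -> V}).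
Hypothesis Tinj : injective T.
Hypothesis Tlf : forall v, exists2 p : {poly C}, p != 0 & pact T p v = 0.
Local Notation subspace := Defs.subspace.
Local Notation lam a := (cexp (2 * pi_i * a)).

Lemma gker_subspace (l : C) : subspace (gker T l).
Proof.
split; first by exists 0%N.
move=> a u v /gkerP[k Hk] /gkerP[m Hm]; apply/gkerP; exists (k + m)%N.
by rewrite linearP exprD /= !pactM Hm (pact_comm _ _ _ u) Hk !raddf0 ?scaler0 ?addr0.
Qed.

Lemma gker0_eq0 v : gker T 0 v -> v = 0.
Proof.
move=> [k]; elim: k => //= k IHk H; apply: IHk; apply: Tinj.
by move: H; rewrite scale0r subr0 raddf0.
Qed.

Lemma geneig_decomp v : exists c, decomposition strip (geneig T) v c /\
  forall U, subspace U -> (forall u, U u -> U (T u)) -> U v -> forall a, U (c a).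
Proof.
have [p p0 pv] := Tlf v; have [rs [q [urs vE qk]]] := gker_decomp p0 pv.
pose c a := if `[< strip a >] && (lam a \in rs) then pact T (q (lam a)) v else 0.
have [al alP] : exists al : C -> C, forall r, r != 0 -> strip (al r) /\ lam (al r) = r.
  have : forall r : C, exists a, r != 0 -> strip a /\ lam a = r.
    move=> r; have [->|r0] := eqVneq r 0; first by exists 0.
    by have [a sa aE] := cexp_strip r0; exists a.
  by move=> /choice[al H]; exists al.
pose s := [seq al r | r <- rs & r != 0].
have us : uniq s.
  rewrite map_inj_in_uniq ?filter_uniq// => r r'; rewrite !mem_filter.
  by move=> /andP[/alP[_ E] _] /andP[/alP[_ E'] _] H; rewrite -E -E' H.
have cs a : c a != 0 -> a \in s.
  rewrite /c; case: ifP => [/andP[/asboolP sa ars] _|]; last by rewrite eqxx.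
  apply/mapP; exists (lam a); first by rewrite mem_filter cexp_neq0.
  by have [sal alE] := alP _ (cexp_neq0 (2 * pi_i * a)); apply: strip_inj.
exists c; split; last first.
  move=> U sU UT Uv a; rewrite /c; case: ifP => _; last by case: sU.
  exact: pact_subspace.
split.
- exact: seq_finite_set cs.
- move=> a sa; rewrite /c; case: ifP => [/andP[_ ars]|_]; first exact: qk.
  by case: (gker_subspace (lam a)).
- by move=> a; rewrite /c; case: ifP => [/andP[/asboolP]|].
- rewrite (fsbigT_seqE us cs) big_map big_filter {1}vE.
  rewrite (bigID (fun r => r != 0))/= [X in _ + X]big_seq_cond [X in _ + X]big1 ?addr0.
    rewrite big_seq_cond [RHS]big_seq_cond; apply: eq_bigr => r /andP[rrs r0].
    by have [sal alE] := alP _ r0; rewrite /c alE rrs andbT asboolT.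
  by move=> r /andP[/qk + /negPn/eqP r0]; rewrite r0; apply: gker0_eq0.
Qed.

(** The strip meets every logarithm class exactly once, so each nonzero eigenvalue is counted
    once; injectivity of T excludes the eigenvalue 0. *)
Lemma geneig_direct : direct_sum strip (geneig T).
Proof.
apply: direct_sum_intro.
- by move=> a _; apply: gker_subspace.
- by move=> v; have [c [Hc _]] := geneig_decomp v; exists c.
- move=> s c us Hs; apply: (gker_indep (T := T) (lam := fun a => lam a)) => //.
    by move=> a b /Hs[sa _] /Hs[sb _]; apply: strip_inj.
  by move=> a /Hs[_].
Qed.

Local Notation cmp := (component strip (geneig T)).

(** The components are polynomials in T applied to the vector. *)
Lemma component_stable U v a : subspace U -> (forall u, U u -> U (T u)) -> U v -> U (cmp v a).
Proof.
move=> sU UT Uv; have [c [Hc cU]] := geneig_decomp v.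
by rewrite (component_uniq geneig_direct Hc); apply: cU.
Qed.

Lemma expS_seqE z v (s : seq C) : uniq s -> (forall a, cmp v a != 0 -> a \in s) ->
  expS T z v = \sum_(a <- s) cexp (z * a) *: cmp v a.
Proof.
move=> us Hs; apply: fsbigT_seqE => // a H; apply: Hs.
by apply: contraNneq H => ->; rewrite scaler0.
Qed.

Lemma expS_linear z : linear (expS T z).
Proof.
move=> a u v; have ds := geneig_direct.
have [s [us Hu Hv]] := finite_set_seq2 (component_finite ds u) (component_finite ds v).
rewrite (expS_seqE z us Hu) (expS_seqE z us Hv) (@expS_seqE z _ s)//.
  rewrite scaler_sumr -big_split; apply: eq_bigr => b _ /=.
  by rewrite component_linear// scalerDr !scalerA mulrC.
move=> b; rewrite component_linear//; have [->|/Hu//] := eqVneq (cmp u b) 0.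
by rewrite scaler0 add0r; apply: Hv.
Qed.

Lemma expS_homog z a v : strip a -> geneig T a v -> expS T z v = cexp (z * a) *: v.
Proof.
move=> sa Ha; rewrite (@expS_seqE z v [:: a])//.
  by rewrite big_seq1 (component_homog geneig_direct _ sa Ha) eqxx.
move=> b; rewrite (component_homog geneig_direct _ sa Ha) inE.
by case: ifP; rewrite ?eqxx.
Qed.

Lemma expS_stable z U v : subspace U -> (forall u, U u -> U (T u)) -> U v -> U (expS T z v).
Proof.
move=> sU UT Uv; have [s [us _ _]] := component_decomp geneig_direct v.
have [s' [us' sP']] := finite_set_seq (component_finite geneig_direct v).
rewrite (expS_seqE z us'); last by move=> a /sP'.
by apply: subspace_sum => // a _; apply: subspaceZ => //; apply: component_stable.
Qed.

(** The unipotent part of T, minus one: the variable of the logarithm series defining N. *)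
Definition unip (x : V) : V := expS T (- (2 * pi_i)) (T x) - x.

Lemma unip_linear : linear unip.
Proof.
move=> a u v; rewrite /unip linearP expS_linear scalerBr !opprD !addrA.
by congr (_ - _); rewrite addrAC.
Qed.

Lemma T_geneig a v : geneig T a v -> geneig T a (T v).
Proof.
move=> /gkerP[k Hk]; apply/gkerP; exists k.
by rewrite -(pactX T v) pact_comm Hk raddf0.
Qed.

Lemma unip_homog a v : strip a -> geneig T a v -> T v = lam a *: (v + unip v).
Proof.
move=> sa Ha; rewrite /unip (expS_homog _ sa (T_geneig Ha)) addrC subrK scalerA.
by rewrite mulNr cexpN divff ?cexp_neq0// scale1r.
Qed.

Lemma unip_stable U v : subspace U -> (forall u, U u -> U (T u)) -> U v -> U (unip v).
Proof. by move=> sU UT Uv; apply: subspaceB => //; apply: expS_stable => //; apply: UT. Qed.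

Lemma unip_nilp v : exists k, iter k unip v = 0.
Proof.
have hom a u : strip a -> geneig T a u -> exists k, iter k unip u = 0.
  move=> sa Ha; have [k Hk] := Ha.
  have E m x : geneig T a x -> iter m unip x =
      cexp (- (2 * pi_i) * a) ^+ m *: iter m (fun x => T x - lam a *: x) x.
    elim: m x => [|m IHm] x Hx /=; first by rewrite expr0 scale1r.
    have Hm : geneig T a (iter m (fun x => T x - lam a *: x) x).
      elim: m {IHm} => //= m IHm; apply: subspaceB; first exact: gker_subspace.
        exact: T_geneig.
      by apply: subspaceZ => //; apply: gker_subspace.
    rewrite IHm// (linZ _ _ unip_linear) exprSr -scalerA; congr (_ *: _).
    rewrite /unip (expS_homog _ sa (T_geneig Hm)) scalerBr scalerA mulNr cexpN.
    by rewrite mulVf ?cexp_neq0// scale1r.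
  by exists k; rewrite E// Hk scaler0.
have [s [us sD vE]] := component_decomp geneig_direct v.
have [|k Hk] := @nilp_common R V C s unip (cmp v) unip_linear.
  by move=> a /sD sa; apply: hom sa (component_in geneig_direct v sa).
exists k; rewrite {1}vE (lin_sum _ _ _ (iter_lin k unip_linear)) big_seq big1//.
Qed.

Lemma nilN_E v K : iter K unip v = 0 ->
  (2 * pi_i) *: nilN T v = \sum_(i < K) bet 0 1 i *: iter i unip v.
Proof.
move=> HK; rewrite /nilN scalerA divff ?mulf_neq0 ?pii_neq0 ?pnatr_eq0// scale1r.
rewrite -(big_mkord xpredT (fun i => bet 0 1 i *: iter i unip v)).
case: K HK => [|K] HK.
  rewrite big_nil fsbig1// => k _; rewrite -/unip.
  by rewrite (iter_zero (k := 0) unip_linear) ?scaler0.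
rewrite big_nat_recl// bet0 scale0r add0r.
rewrite (@fsbig_seqE _ _ _ _ [seq i.+1 | i <- iota 0 K]).
- rewrite big_map /index_iota subn0; apply: eq_bigr => i _.
  by rewrite bet01 !exprS !mulN1r opprK.
- by rewrite map_inj_uniq ?iota_uniq// => i j [].
- by move=> i /mapP[j _ ->].
- case=> // i _ H; apply/mapP; exists i => //; rewrite mem_iota/= add0n ltnNge.
  apply: contra H => Ki; rewrite -[X in iter _ X]/unip.
  by rewrite (iter_zero (k := K.+1) unip_linear) ?scaler0.
Qed.

Lemma nilN_linear : linear (nilN T).
Proof.
move=> a u v; have [k Hk] := unip_nilp u; have [l Hl] := unip_nilp v.
pose K := maxn k l; have lU := unip_linear.
have HuK : iter K unip u = 0 by apply: iter_zero (leq_maxl _ _) Hk.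
have HvK : iter K unip v = 0 by apply: iter_zero (leq_maxr _ _) Hl.
have p0 : 2 * pi_i != 0 :> C by rewrite mulf_neq0 ?pii_neq0 ?pnatr_eq0.
apply: (scalerI p0); rewrite (@nilN_E _ K); last first.
  by rewrite (iter_lin K lU) HuK HvK scaler0 addr0.
rewrite scalerDr scalerA mulrC -scalerA !(@nilN_E _ K)// scaler_sumr -big_split.
by apply: eq_bigr => i _; rewrite (iter_lin i lU) scalerDr !scalerA mulrC.
Qed.

Lemma nilN_stable U v : subspace U -> (forall u, U u -> U (T u)) -> U v -> U (nilN T v).
Proof.
move=> sU UT Uv; have [K HK] := unip_nilp v.
have p0 : 2 * pi_i != 0 :> C by rewrite mulf_neq0 ?pii_neq0 ?pnatr_eq0.
rewrite -[nilN T v](scalerK p0); apply: subspaceZ => //; rewrite (nilN_E HK).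
apply: subspace_sum => // i _; apply: subspaceZ => //.
by elim: (i : nat) => //= j; apply: unip_stable.
Qed.

(** The power series identity log(1 + t)^j / j! = sum_i bet 0 j i t^i, evaluated at the locally
    nilpotent operator unip. *)
Lemma iter_nilN v K j : iter K unip v = 0 ->
  ((2 * pi_i) ^+ j / (j`!)%:R) *: iter j (nilN T) v =
  \sum_(i < K) bet 0 j i *: iter i unip v.
Proof.
move=> HK; have lU := unip_linear; have lN := nilN_linear.
elim: j => [|j IHj] /=.
  rewrite expr0 fact0 divr1 scale1r; case: K HK => [|K] /= HK.
    by rewrite big_ord0.
  by rewrite big_ord_recl big1 ?addr0 ?bet0_0 ?scale1r// => i _; rewrite bet0_0 scale0r.
apply: (scalerI (natS_neq0 j)); rewrite scalerA.
have -> : j.+1%:R * ((2 * pi_i) ^+ j.+1 / (j.+1)`!%:R) =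
   (2 * pi_i) * ((2 * pi_i) ^+ j / j`!%:R) :> C.
  rewrite factS natrM exprS; have := @factC_neq0 R j; have := @natS_neq0 R j.
  by move: (_ ^+ j) (j.+1%:R) (j`!%:R) => z x y h1 h2; field; rewrite h1 h2.
have lNj i : linear (iter i unip) by apply: iter_lin.
rewrite -scalerA -(linZ _ _ lN) IHj (lin_sum _ _ _ lN) scaler_sumr.
transitivity (\sum_(i < K) \sum_(m < K | (i <= m)%N)
    (bet 0 j i * bet 0 1 (m - i)%N) *: iter m unip v).
  apply: eq_bigr => i _; rewrite (linZ _ _ lN) scalerA mulrC -scalerA.
  have iK : (i <= K)%N := ltnW (ltn_ord i).
  rewrite (@nilN_E _ (K - i)); last by rewrite -iterD subnK.
  rewrite scaler_sumr (sum_shift (fun m => (bet 0 j i * bet 0 1 (m - i)) *: iter m unip v) iK); apply: eq_bigr => m _.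
  by rewrite addnK scalerA iterD.
rewrite (exchange_big_dep xpredT)//= scaler_sumr; apply: eq_bigr => m _.
rewrite -scaler_suml scalerA; congr (_ *: _).
have := cprod_bet (0 : C) 0 j 1 m; rewrite addr0 addn1 binSn => <-.
have mK : (m.+1 <= K)%N by [].
rewrite /cprod (big_ord_widen K (fun i => bet 0 j i * bet 0 1 (m - i)) mK).
by apply: eq_bigl => i; rewrite ltnS.
Qed.

Lemma nilN_nilp v K : iter K unip v = 0 -> iter K (nilN T) v = 0.
Proof.
move=> HK; have p0 : (2 * pi_i) ^+ K / K`!%:R != 0 :> C.
  by rewrite mulf_neq0 ?invr_neq0 ?factC_neq0 ?expf_neq0 ?mulf_neq0 ?pii_neq0 ?pnatr_eq0.
apply: (scalerI p0); rewrite scaler0 (iter_nilN K HK) big1// => i _.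
by rewrite bet_big ?scale0r.
Qed.

(** The binomial theorem; the binomial coefficients are polynomials in m. *)
Lemma iter_unipotent v K m : iter K unip v = 0 ->
  iter m (fun x => x + unip x) v = \sum_(i < K) binC m%:R i *: iter i unip v.
Proof.
move=> HK; have lU := unip_linear; elim: m => [|m IHm] /=.
  case: K HK => [|K] HK; first by rewrite big_ord0.
  rewrite big_ord_recl binC0 scale1r big1 ?addr0// => i _.
  by rewrite (binC_nat 0) bin_small// scale0r.
rewrite IHm (lin_sum _ _ _ lU).
under [X in _ + X]eq_bigr do rewrite (linZ _ _ lU) -iterS.
case: K HK {IHm} => [|K] HK; first by rewrite !big_ord0 addr0.
rewrite [X in _ + X]big_ord_recr/= -[unip _]/(iter K.+1 unip v) HK scaler0 addr0.
rewrite !big_ord_recl !binC0 -addrA -big_split/=; congr (_ + _).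
by apply: eq_bigr => i _; rewrite -scalerDl -natr1 binC_pascal.
Qed.

(** On a generalized eigenspace g^m = e^{2 pi i a m} e^{2 pi i m N}: the binomial series in unip is
    rewritten in powers of N, and the dependence on m becomes polynomial. *)
Lemma iter_geneig a v K m : strip a -> geneig T a v -> iter K unip v = 0 ->
  iter m T v = lam a ^+ m *:
    \sum_(k < K) ((2 * pi_i * m%:R) ^+ k / k`!%:R) *: iter k (nilN T) v.
Proof.
move=> sa Ha HK; transitivity (lam a ^+ m *: iter m (fun x => x + unip x) v).
  have st i : geneig T a (iter i (fun x => x + unip x) v).
    elim: i => //= i IHi; apply: subspaceD => //; first exact: gker_subspace.
    by apply: unip_stable => //; [exact: gker_subspace|exact: T_geneig].
  elim: m => [|m IHm] /=; first by rewrite expr0 scale1r.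
  by rewrite IHm linearZ /= (unip_homog sa (st m)) exprS scalerA mulrC.
congr (_ *: _); rewrite (iter_unipotent m HK).
under [RHS]eq_bigr => k _.
  rewrite exprMn mulrAC mulrC -scalerA (iter_nilN k HK) scaler_sumr.
  under eq_bigr do rewrite scalerA.
  over.
rewrite exchange_big; apply: eq_bigr => i _ /=; rewrite -scaler_suml.
congr (_ *: _); rewrite -(bet_eval _ (ltn_ord i)).
by apply: eq_bigr => k _; rewrite mulrC.
Qed.

End LocallyFiniteOperators.

(** * Vertex superalgebras *)

Section VertexAlgebraFacts.
Context {R : realType}.
Local Notation C := R[i].
Local Notation lam a := (cexp (2 * pi_i * a)).
Context {V : lmodType C} (VA : vertex_superalgebra V) (g : automorphism VA).
Local Notation subspace := Defs.subspace.
Local Notation gr := (Vgr VA).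
Local Notation Y := (YV VA).

Lemma YVlin_l n w : linear (fun v => Y v n w). Proof. exact: YV_linearl. Qed.
Lemma YVlin_r v n : linear (Y v n). Proof. exact: YV_linearr. Qed.

Lemma Vgr_subspace h : subspace (gr h).
Proof. by have [H _] := Vgr_direct VA; apply: H. Qed.

(** The commutator formula determines the L(0)-eigenvalue of a mode applied to a vector; this
    turns the eigenvalue into a weight. *)
Lemma Vgr_eigen (c : int) (x : V) : LV0 VA x = (c%:~R / 2) *: x -> gr c x.
Proof.
move=> Lx; have ds := Vgr_direct VA.
have [s [us _ xE]] := component_decomp ds x.
have cg h : gr h (component [set: int] gr x h) by apply: (component_in ds).
move: (component [set: int] gr x) xE cg => cx xE cg.
have E : \sum_(h <- s) ((h%:~R - c%:~R) / 2) *: cx h = 0.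
  transitivity (LV0 VA x - (c%:~R / 2) *: x); last by rewrite Lx subrr.
  rewrite xE linear_sum scaler_sumr -sumrB; apply: eq_bigr => h _.
  by rewrite (LV0_gr (cg h)) mulrBl scalerBl.
have hom h k : component [set: int] gr (cx h) k = if k == h then cx h else 0.
  exact: component_homog.
have z h : h \in s -> h != c -> cx h = 0.
  move=> hs hc; have := congr1 (fun v => component [set: int] gr v h) E.
  rewrite (component0 ds) (component_bigsum ds) (bigD1_seq h)//= (componentZ ds) hom eqxx.
  rewrite big1 ?addr0 => [/eqP|k kh]; last first.
    by rewrite (componentZ ds) hom eq_sym (negPf kh) scaler0.
  rewrite scaler_eq0 mulf_eq0 invr_eq0 pnatr_eq0 orbF subr_eq0 (eqr_int C) (negPf hc) /=.
  by move/eqP.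
rewrite xE big_seq; apply: subspace_sum; first exact: Vgr_subspace.
move=> h hs; have [<-//|hc] := eqVneq h c.
by rewrite z//; case: (Vgr_subspace c).
Qed.

Lemma YV_gr h k n u v : gr h u -> gr k v -> gr (n *+ 2 + h + k) (Y u n v).
Proof.
move=> Hu Hv; apply: Vgr_eigen; have := LV0_comm VA u n v.
rewrite (LV0_gr Hu) (LV0_gr Hv) (linZ _ _ (YVlin_r u n)) (linZ _ _ (YVlin_l n v)).
move/eqP; rewrite subr_eq => /eqP ->; rewrite -!scalerDl; congr (_ *: _).
by rewrite mulr2n !intrD; field.
Qed.

Lemma Vdecomp (v : V) : exists s : seq int, exists c : int -> V,
  v = \sum_(h <- s) c h /\ forall h, gr h (c h).
Proof.
have ds := Vgr_direct VA; have [s [_ _ vE]] := component_decomp ds v.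
by exists s, (component [set: int] gr v); split=> // h; apply: (component_in ds).
Qed.

Lemma YV_trunc (u v : V) : exists N : int, forall n, n < N -> Y u n v = 0.
Proof.
have [L HL] := Vgr_lower VA.
have [s [c [-> Hc]]] := Vdecomp u; have [t [d [-> Hd]]] := Vdecomp v.
pose m : int := \sum_(h <- s) `|h| + \sum_(k <- t) `|k| + `|L|.
exists (- m) => n nm.
rewrite (lin_sum _ _ _ (YVlin_l n _)) big_seq big1// => h hs.
rewrite (lin_sum _ _ _ (YVlin_r _ n)) big_seq big1// => k kt.
apply: (HL (n *+ 2 + h + k)); last exact: YV_gr.
have h1 : `|h| <= \sum_(h <- s) `|h|.
  by rewrite (big_rem h)//= lerDl sumr_ge0// => *; apply: normr_ge0.
have k1 : `|k| <= \sum_(k <- t) `|k|.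
  by rewrite (big_rem k)//= lerDl sumr_ge0// => *; apply: normr_ge0.
move: h1 k1 nm; rewrite /m mulr2n; move: (\sum_(h <- s) _) (\sum_(k <- t) _) => A B.
by clear; lia.
Qed.

Local Notation T := (aut g).

Lemma aut_inj : injective T.
Proof. exact: bij_inj (aut_bij g). Qed.

Lemma aut_lfin v : exists2 p : {poly C}, p != 0 & pact T p v = 0.
Proof.
have [s [c [-> Hc]]] := Vdecomp v.
elim: s => [|h s [p p0 Hp]]; first by exists 1; rewrite ?oner_neq0// big_nil raddf0.
have [q q0 Hq] := finite_dim_annihilated (Vgr_findim VA h) (@aut_gr _ _ _ g h) (Hc h).
exists (p * q); first by rewrite mulf_neq0.
by rewrite big_cons raddfD /= [X in _ + X]pactM pact_comm Hp [X in X + _]pactM Hq !raddf0 addr0.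
Qed.

Local Notation N := (nilN T).
Local Notation E := (unip T).

Definition g_direct := geneig_direct aut_inj aut_lfin.
Definition N_linear : linear N := nilN_linear aut_inj aut_lfin.
Lemma Nlin k : linear (iter k N).
Proof. exact/iter_lin/N_linear. Qed.

Lemma N_gr h v : gr h v -> gr h (N v).
Proof.
apply: nilN_stable; [exact: aut_inj|exact: aut_lfin|exact: Vgr_subspace|].
exact: aut_gr.
Qed.

Lemma N_geneig a v : geneig T a v -> geneig T a (N v).
Proof.
apply: nilN_stable; [exact: aut_inj|exact: aut_lfin|exact: gker_subspace|].
by move=> u; apply: T_geneig.
Qed.

Lemma parity_subspace s : subspace (Vparity VA s).
Proof. by apply: coprod_subspace (Vgr_direct VA) _ _. Qed.

Lemma aut_parity s v : Vparity VA s v -> Vparity VA s (T v).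
Proof.
move=> Hv; have ds := Vgr_direct VA.
have [t [_ tD ->]] := coprod_decomp ds (@subsetT _ _) Hv.
rewrite linear_sum big_seq; apply: subspace_sum; first exact: parity_subspace.
move=> h /tD hs; apply: (coprod_homog ds (@subsetT _ _) hs); apply: aut_gr.
by apply: (component_in ds).
Qed.

Lemma N_parity s v : Vparity VA s v -> Vparity VA s (N v).
Proof.
apply: nilN_stable; [exact: aut_inj|exact: aut_lfin|exact: parity_subspace|].
by move=> u; apply: aut_parity.
Qed.

Lemma cmp_parity s v a : Vparity VA s v -> Vparity VA s (component strip (geneig T) v a).
Proof.
apply: component_stable; [exact: aut_inj|exact: aut_lfin|exact: parity_subspace|].
by move=> u; apply: aut_parity.
Qed.

Lemma cmp_gr h v a : gr h v -> gr h (component strip (geneig T) v a).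
Proof.
apply: component_stable; [exact: aut_inj|exact: aut_lfin|exact: Vgr_subspace|].
exact: aut_gr.
Qed.

Lemma iterN_parity s k v : Vparity VA s v -> Vparity VA s (iter k N v).
Proof. by elim: k => //= k IHk /IHk; apply: N_parity. Qed.

Lemma iterN_geneig a k v : geneig T a v -> geneig T a (iter k N v).
Proof. by elim: k => //= k IHk /IHk; apply: N_geneig. Qed.

Lemma iterN_gr h k v : gr h v -> gr h (iter k N v).
Proof. by elim: k => //= k IHk /IHk; apply: N_gr. Qed.

Lemma N_nilp v : exists K, iter K N v = 0.
Proof.
have [K HK] := unip_nilp aut_inj aut_lfin v; exists K.
exact: (nilN_nilp aut_inj aut_lfin).
Qed.

Lemma YV_parity s t n u v : Vparity VA s u -> Vparity VA t v -> Vparity VA (s (+) t) (Y u n v).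
Proof.
have ds := Vgr_direct VA; move=> Hu Hv.
have [su [_ suD ->]] := coprod_decomp ds (@subsetT _ _) Hu.
have [sv [_ svD ->]] := coprod_decomp ds (@subsetT _ _) Hv.
rewrite (lin_sum _ _ _ (YVlin_l n _)) big_seq; apply: subspace_sum; first exact: parity_subspace.
move=> h /suD hs; rewrite (lin_sum _ _ _ (YVlin_r _ n)) big_seq.
apply: subspace_sum; first exact: parity_subspace.
move=> k /svD kt; apply: (coprod_homog ds (@subsetT _ _) (i := n *+ 2 + h + k)).
  move: hs kt => /= <- <-; rewrite mulr2n; clear.
  lia.
by apply: YV_gr; apply: (component_in ds).
Qed.

Lemma iter_aut_YV m u n v : iter m T (Y u n v) = Y (iter m T u) n (iter m T v).
Proof. by elim: m => //= m ->; rewrite aut_Y. Qed.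

(** Leibniz rule: T (x) T - l l' = (T - l) (x) T + l (x) (T - l'), and induction on the two
    nilpotency orders. *)
Lemma YV_gker l l' u n v : gker T l u -> gker T l' v -> gker T (l * l') (Y u n v).
Proof.
move=> [k Hk] [k' Hk']; exists (k + k')%N.
have [s] := ubnP (k + k'); elim: s k k' u v Hk Hk' => // s IHs k k' u v Hk Hk' ks.
pose D := fun x => T x - (l * l') *: x.
have lD : linear D.
  by move=> a x y; rewrite /D linearP scalerBr scalerDr !scalerA opprD !addrA
    [a * _]mulrC; congr (_ - _); rewrite addrAC.
case: k Hk ks => [/= ->|k Hk]; first by rewrite (lin0 (YVlin_l n v)) (lin0 (iter_lin _ lD)).
case: k' Hk' => [/= ->|k' Hk'] ks.
  by rewrite (lin0 (YVlin_r u n)); exact: (lin0 (iter_lin (k + 0).+1 lD)).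
rewrite addSn iterSr -/D.
have -> : T (Y u n v) - (l * l') *: Y u n v = Y (T u - l *: u) n (T v) + l *: Y u n (T v - l' *: v).
  rewrite aut_Y.
  rewrite (linB _ _ (YVlin_l n (T v))) (linZ _ _ (YVlin_l n (T v))).
  rewrite (linB _ _ (YVlin_r u n)) (linZ _ _ (YVlin_r u n)).
  by rewrite scalerBr scalerA addrA subrK.
rewrite (linD _ _ (iter_lin _ lD)) (linZ _ _ (iter_lin _ lD)).
have TK' : iter k'.+1 (fun x => T x - l' *: x) (T v) = 0.
  by rewrite -pact_iter -(pactX T v) pact_comm pact_iter Hk' raddf0.
have H1 : iter (k + k'.+1) D (Y (T u - l *: u) n (T v)) = 0.
  by apply: IHs TK' _; [rewrite -[RHS]Hk iterSr|rewrite addSn in ks].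
have H2 : iter (k + k'.+1) D (Y u n (T v - l' *: v)) = 0.
  rewrite -addSnnS; apply: IHs Hk _ _; first by rewrite -[RHS]Hk' iterSr.
  by rewrite addSnnS -ltnS -addSn.
by rewrite H1 H2 scaler0 addr0.
Qed.

Lemma YV_geneig a b c n u v : strip a -> strip b -> strip c -> lam c = lam a * lam b ->
  geneig T a u -> geneig T b v -> geneig T c (Y u n v).
Proof. by move=> sa sb sc cE Hu Hv; rewrite /geneig /= cE; apply: YV_gker. Qed.

(** N is a derivation of Y_V. All powers of g are automorphisms, and for u, v homogeneous for the
    g-weights both sides of g^m Y(u)v = Y(g^m u) g^m v are, up to the same scalar, polynomials in m
    by the exponential form of g^m; comparing the coefficients of m^k gives the divided powers. *)
Lemma iterN_YV k n u v :
  (k`!%:R)^-1 *: iter k N (Y u n v) =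
  \sum_(i < k.+1) ((i`!%:R)^-1 * ((k - i)`!%:R)^-1) *: Y (iter i N u) n (iter (k - i) N v).
Proof.
have linL z : linear (fun u => Y u n z) by exact: YVlin_l.
have linR z : linear (Y z n) by exact: YVlin_r.
have [s [_ sD ->]] := component_decomp g_direct u.
have hu a : a \in s -> geneig T a (component strip (geneig T) u a).
  by move=> /sD; apply: (component_in g_direct).
move: (component strip (geneig T) u) hu => cu hu.
have [s' [_ sD' ->]] := component_decomp g_direct v.
have hv a : a \in s' -> geneig T a (component strip (geneig T) v a).
  by move=> /sD'; apply: (component_in g_direct).
move: (component strip (geneig T) v) hv => cv hv.
rewrite (lin_sum _ _ _ (linL _)) (lin_sum _ _ _ (Nlin k)) scaler_sumr.
under [RHS]eq_bigr => i _ do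
  rewrite (lin_sum _ _ _ (Nlin i)) (lin_sum _ _ _ (linL _)) scaler_sumr.
rewrite [RHS]exchange_big/= big_seq [RHS]big_seq; apply: eq_bigr => a as_.
rewrite (lin_sum _ _ _ (linR _)) (lin_sum _ _ _ (Nlin k)) scaler_sumr.
under [RHS]eq_bigr => i _ do
  rewrite (lin_sum _ _ _ (Nlin (k - i))) (lin_sum _ _ _ (linR _)) scaler_sumr.
rewrite [RHS]exchange_big/= big_seq [RHS]big_seq; apply: eq_bigr => b bs.
have {hu} Hu := hu a as_; have {hv} Hv := hv b bs.
have {as_} sa := sD a as_; have {bs} sb := sD' b bs.
move: (cu a) (cv b) Hu Hv => {cu cv u v}u v Hu Hv.
have [c sc cE] : exists2 c, strip c & lam c = lam a * lam b.
  by apply: cexp_strip; rewrite mulf_neq0 ?cexp_neq0.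
have HX := YV_geneig n sa sb sc cE Hu Hv.
have nilp := unip_nilp aut_inj aut_lfin; have lU := unip_linear aut_inj aut_lfin.
have [ku Ku] := nilp u; have [kv Kv] := nilp v; have [kx Kx] := nilp (Y u n v).
pose K := (k.+1 + ku + kv + kx)%N.
have HK k' w : iter k' E w = 0 -> (k' <= K)%N -> iter K E w = 0.
  by move=> H k'K; apply: iter_zero k'K H.
have Eu := iter_geneig aut_inj aut_lfin _ sa Hu (HK _ _ Ku _).
have Ev := iter_geneig aut_inj aut_lfin _ sb Hv (HK _ _ Kv _).
have Ex := iter_geneig aut_inj aut_lfin _ sc HX (HK _ _ Kx _).
have kK : (k < K)%N by rewrite /K; lia.
apply: functional_ext => f.
pose q : C := 2 * pi_i; have q0 : q != 0 by rewrite mulf_neq0 ?pii_neq0 ?pnatr_eq0.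
pose P1 : {poly C} := \poly_(j < K) (q ^+ j / j`!%:R * f (iter j N (Y u n v))).
pose P2 : {poly C} := \sum_(i < K) \sum_(j < K)
  (q ^+ i / i`!%:R * (q ^+ j / j`!%:R) * f (Y (iter i N u) n (iter j N v))) *: 'X^(i + j).
have PE : P1 = P2.
  apply/eqP; rewrite -subr_eq0; apply/eqP/poly_nat_roots => m.
  rewrite hornerD hornerN; apply/eqP; rewrite subr_eq0; apply/eqP.
  have cm : lam c ^+ m != 0 by rewrite expf_neq0 ?cexp_neq0.
  apply: (mulfI cm).
  have -> : lam c ^+ m * P1.[m%:R] = f (iter m T (Y u n v)).
    rewrite Ex ?linearZ /=; last by rewrite /K; lia.
    rewrite linear_sum horner_poly; congr (_ * _); apply: eq_bigr => i _.
    rewrite linearZ /= -/q (exprMn i q); move: (q ^+ i) (m%:R ^+ i) (f _) (i`!%:R^-1) => x y z r.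
    by ring.
  rewrite iter_aut_YV Eu; last by rewrite /K; lia.
  rewrite Ev; last by rewrite /K; lia.
  rewrite (linZ _ _ (linL _)) (lin_sum _ _ _ (linL _)) linearZ /= linear_sum.
  rewrite cE (exprMn m (lam a) (lam b)) -(mulrA (lam a ^+ m) (lam b ^+ m)); congr (_ * _).
  rewrite /P2.
  rewrite horner_sum mulr_sumr.
  apply: eq_bigr => i _; rewrite (linZ _ _ (linR _)) (lin_sum _ _ _ (linR _)).
  rewrite linearZ /=; congr (_ * _); rewrite linear_sum horner_sum; apply: eq_bigr => j _.
  rewrite (linZ _ _ (linL _)) (linZ _ _ (linR _)) linearZ /= linearZ /= hornerZ hornerXn exprD.
  rewrite -/q (exprMn i q) (exprMn j q).
  move: (q ^+ i) (m%:R ^+ i) (q ^+ j) (m%:R ^+ j) (f _) (i`!%:R^-1) (j`!%:R^-1) => x y z w h r t.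
  by ring.
have PEk : q ^+ k / k`!%:R * f (iter k N (Y u n v)) = \sum_(i < K) \sum_(j < K)
    q ^+ i / i`!%:R * (q ^+ j / j`!%:R) * f (Y (iter i N u) n (iter j N v)) * (k == i + j)%N%:R.
  have := congr1 (fun p : {poly C} => p`_k) PE.
  rewrite /P2 coef_poly kK coef_sum => ->; apply: eq_bigr => i _.
  by rewrite coef_sum; apply: eq_bigr => j _; rewrite coefZ coefXn.
apply: (mulfI (expf_neq0 k q0)).
rewrite linearZ /= mulrA PEk linear_sum mulr_sumr.
have kK1 : (k.+1 <= K)%N := kK.
rewrite [RHS](big_ord_widen K (fun i => q ^+ k * f (((i`!%:R)^-1 * ((k - i)`!%:R)^-1) *:
  Y (iter i N u) n (iter (k - i) N v))) kK1) [RHS]big_mkcond.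
apply: eq_bigr => i _; case: (ltnP i k.+1) => [|ki].
  rewrite ltnS => ik'.
  have jK : (k - i < K)%N by apply: leq_ltn_trans kK; apply: leq_subr.
  rewrite (bigD1 (Ordinal jK))//= subnKC // eqxx mulr1 big1 ?addr0.
    have -> : q ^+ k = q ^+ i * q ^+ (k - i) by rewrite -exprD subnKC.
    rewrite linearZ /=; move: (q ^+ i) (q ^+ (k - i)) (f _) (i`!%:R^-1) ((k - i)`!%:R^-1).
    by move=> *; ring.
  move=> j jk; case: eqVneq => [kE|]; rewrite ?mulr0//.
  by move: jk; rewrite -val_eqE /= kE addKn eqxx.
rewrite big1// => j _; case: eqVneq => [kE|]; rewrite ?mulr0//.
by move: ki; rewrite kE; lia.
Qed.

End VertexAlgebraFacts.

(** * Twisted modules: weights, equivariance and truncation *)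

Lemma sum_eq_const (I : eqType) (A : nmodType) (s : seq I) (x : I) (a : A) :
  uniq s -> x \in s -> \sum_(l <- s | x == l) a = a.
Proof.
move=> us xs; rewrite big_mkcond (bigD1_seq x)//= eqxx big1 ?addr0// => l.
by rewrite eq_sym => /negPf ->.
Qed.

Lemma ep_real_eq0 (R : realType) (s : seq (R[i] * nat * R[i])) :
  (forall y : R, ep s y%:C = 0) -> forall mu y, ep_part s mu y = 0.
Proof.
move=> H; apply: (@ep_small _ s (\sum_(p <- s) `|complex.Re p.1.1| + 1) 0 0) => [p ps|y _].
  have : `|complex.Re p.1.1| <= \sum_(p <- s) `|complex.Re p.1.1|.
    by rewrite (perm_big _ (perm_to_rem ps)) big_cons lerDl sumr_ge0.
  have : - `|complex.Re p.1.1| <= complex.Re p.1.1 by rewrite lerNl -normrN ler_norm.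
  by move=> ? ?; lra.
by rewrite H mul0r cmod0.
Qed.

Lemma sum_cat (I : Type) (A : nmodType) (r1 r2 : seq I) (F : I -> A) :
  \sum_(i <- r1 ++ r2) F i = \sum_(i <- r1) F i + \sum_(i <- r2) F i.
Proof. exact: big_cat. Qed.

Lemma sum_add (I : Type) (A : nmodType) (r : seq I) (F G : I -> A) :
  \sum_(i <- r) (F i + G i) = \sum_(i <- r) F i + \sum_(i <- r) G i.
Proof. exact: big_split. Qed.

Lemma sum_seq_only (I : eqType) (A : nmodType) (s : seq I) (b : I) (F : I -> A) :
  uniq s -> b \in s -> (forall c, c != b -> F c = 0) -> \sum_(c <- s) F c = F b.
Proof. by move=> us bs H; rewrite (bigD1_seq b)//= big1 ?addr0. Qed.

Lemma sum_nat_widen (A : nmodType) (K L : nat) (G : nat -> A) : (K <= L)%N ->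
  (forall k, (K <= k)%N -> G k = 0) -> \sum_(0 <= k < L) G k = \sum_(0 <= k < K) G k.
Proof.
move=> KL H; rewrite (big_cat_nat (leq0n K) KL) /= [X in _ + X]big1_seq ?addr0// => k /andP[_].
by rewrite mem_index_iota => /andP[kK _]; rewrite H.
Qed.

Lemma sum_nat_bounds (A : nmodType) (K L : nat) (G : nat -> A) :
  (forall k, (K <= k)%N -> G k = 0) -> (forall k, (L <= k)%N -> G k = 0) ->
  \sum_(k < K) G k = \sum_(k <- iota 0 L) G k.
Proof.
move=> HK HL; rewrite -(big_mkord xpredT G) -[L]subn0 -[iota _ _]/(index_iota 0 L).
by rewrite -(sum_nat_widen (leq_maxl K L) HK) -(sum_nat_widen (leq_maxr K L) HL).
Qed.

Lemma sum_ord_bounds (A : nmodType) (K L : nat) (G : nat -> A) :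
  (forall k, (K <= k)%N -> G k = 0) -> (forall k, (L <= k)%N -> G k = 0) ->
  \sum_(k < K) G k = \sum_(k < L) G k.
Proof. by move=> HK HL; rewrite (sum_nat_bounds HK HL) (sum_nat_bounds HL HL). Qed.

Lemma two_geometric (R : realType) (c : R[i]) (P Q : {poly R[i]}) : c != 0 ->
  (forall m : nat, c ^+ m * P.[m%:R] = Q.[m%:R]) ->
  c = 1 /\ P = Q \/ P = 0 /\ Q = 0.
Proof.
move=> c0 H; have [c1|c1] := eqVneq c 1.
  left; split=> //; apply/eqP; rewrite -subr_eq0; apply/eqP/poly_nat_roots => m.
  by rewrite hornerD hornerN -H c1 expr1n mul1r subrr.
right; pose l (i : 'I_2) : R[i] := if i == 0 then c else 1.
pose q (i : 'I_2) : {poly R[i]} := if i == 0 then P else - Q.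
pose rho : R := Num.min (cmod c) 1 / 2.
have m0 : 0 < Num.min (cmod c) 1 by rewrite lt_min ltr01 cmod_gt0 c0.
have := @exp_poly_eq0 R 2 l q rho 0.
have li : injective l.
  move=> i j; rewrite /l; case: i => [[|[|//]] hi]; case: j => [[|[|//]] hj] //= E;
  try exact: val_inj; by move: c1; rewrite E eqxx.
have lr i : rho < cmod (l i).
  have : rho < Num.min (cmod c) 1 by rewrite ltr_pdivrMr//; lra.
  by rewrite lt_min /l => /andP[h1 h2]; case: ifP => _ //; rewrite cmod1.
move=> /(_ li ltac:(by rewrite divr_gt0) lr) E.
have {}E : forall i, q i = 0.
  apply: E => m; rewrite mul0r big_ord_recl big_ord1 /l /q /= expr1n mul1r hornerN H subrr.
  by rewrite cmod0.
split; first exact: (E 0).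
by apply/eqP; rewrite -oppr_eq0; apply/eqP; apply: (E 1).
Qed.

Lemma expC_M (A : comRingType) (c d : A) k : (c * d) ^+ k = c ^+ k * d ^+ k.
Proof. exact: exprMn. Qed.

Lemma expC_NM (A : comRingType) (c d : A) k : (- (c * d)) ^+ k = (- c) ^+ k * d ^+ k.
Proof. by rewrite -mulNr exprMn. Qed.

Lemma exp_shift (R : realType) (A F E a y : R[i]) (k L : nat) : (k < L)%N ->
  \sum_(j <- iota 0 L) A * (F * ('C(k, j)%:R * a ^+ (k - j))) * E * y ^+ j =
  A * F * E * (y + a) ^+ k.
Proof.
move=> kL; rewrite -[L]subn0 -[iota _ _]/(index_iota 0 L) big_mkord [y + a]addrC.
rewrite (bigID (fun j : 'I_L => (j < k.+1)%N))/= [X in _ + X]big1 ?addr0; last first.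
  by move=> j; rewrite -leqNgt => kj; rewrite bin_small// mul0r mulr0 mulr0 !mul0r.
rewrite -(big_ord_widen L (fun j => A * (F * ('C(k, j)%:R * a ^+ (k - j))) * E * y ^+ j) kL).
rewrite exprDn !mulr_sumr; apply: eq_bigr => j _.
by rewrite -mulr_natl; ring.
Qed.

Section TwistedModuleFacts.
Context {R : realType}.
Local Notation C := R[i].
Local Notation lam a := (cexp (2 * pi_i * a)).
Context {V W : lmodType C} {VA : vertex_superalgebra V} {g : automorphism VA}.
Variable M : twisted_module g W.
Local Notation subspace := Defs.subspace.
Local Notation T := (aut g).
Local Notation N := (nilN T).
Local Notation Y := (YW M).
Local Notation L0 := (LW0 M).

Lemma YWlin_l n k w : linear (fun v => Y v n k w). Proof. exact: YW_linearl. Qed.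
Lemma YWlin_r v n k : linear (Y v n k). Proof. exact: YW_linearr. Qed.

Definition Wwt (n : C) : set W := Wpart (PW M) (Wgr M) [set i | i.1.1 = n].

Lemma Wpart_sub (Q : set (C * bool * C)) :
  [set i | PW M i.2 /\ Q i] `<=` [set i | PW M i.2].
Proof. by move=> i []. Qed.

Lemma Wpart_subspace Q : subspace (Wpart (PW M) (Wgr M) Q).
Proof. exact: (coprod_subspace (Wgr_direct M) (@Wpart_sub Q)). Qed.

Lemma Wgr_decomp (w : W) : exists (s : seq (C * bool * C)) (c : C * bool * C -> W),
  [/\ uniq s, w = \sum_(i <- s) c i & forall i, i \in s -> PW M i.2 /\ Wgr M i (c i)].
Proof.
have [s [us sD wE]] := component_decomp (Wgr_direct M) w.
exists s, (component [set i | PW M i.2] (Wgr M) w); split=> // i /sD Di; split=> //.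
exact: (component_in (Wgr_direct M) w Di).
Qed.

Lemma Wgr_Wwt i w : PW M i.2 -> Wgr M i w -> Wwt i.1.1 w.
Proof.
move=> Di Hw; apply: (coprod_homog (Wgr_direct M) (@Wpart_sub _) (i := i)) => //.
Qed.

Lemma Wwt_gker n w : Wwt n w -> gker L0 n w.
Proof. exact: LW0_nilpotent. Qed.

Lemma gker_Wwt n w : gker L0 n w -> Wwt n w.
Proof.
move=> Hw; have [s [c [us wE Hc]]] := Wgr_decomp w.
pose wt (l : C) : W := \sum_(i <- s | i.1.1 == l) c i.
have wtW l : Wwt l (wt l).
  rewrite /wt big_seq_cond; apply: subspace_sum; first exact: Wpart_subspace.
  by move=> i /andP[/Hc[Di Hi] /eqP <-]; apply: Wgr_Wwt.
pose ls := undup (n :: [seq i.1.1 | i <- s]).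
pose d l := wt l - (if l == n then w else 0).
have nls : n \in ls by rewrite mem_undup mem_head.
have sumwt : \sum_(l <- ls) wt l = w.
  rewrite [RHS]wE /wt (exchange_big_dep xpredT)//= [LHS]big_seq [RHS]big_seq.
  apply: eq_bigr => i is_; apply: sum_eq_const; first exact: undup_uniq.
  by rewrite mem_undup inE; apply/orP; right; apply/mapP; exists i.
have sumd : \sum_(l <- ls) d l = 0.
  rewrite sumrB sumwt (bigD1_seq n) ?undup_uniq//= eqxx big1 ?addr0 ?subrr//.
  by move=> l /negPf ->.
have dker l : l \in ls -> gker L0 l (d l).
  move=> _; apply: subspaceB; [exact: gker_subspace|exact: Wwt_gker|].
  by case: eqVneq => [->//|_]; case: (gker_subspace L0 l).
have /(_ n nls) := gker_indep (undup_uniq _) (fun x y _ _ => id) dker sumd.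
by rewrite /d eqxx => /eqP; rewrite subr_eq0 => /eqP <-.
Qed.

Lemma Wwt_decomp (w : W) : exists (s : seq C) (c : C -> W),
  w = \sum_(l <- s) c l /\ forall l, Wwt l (c l).
Proof.
have [s [c [us -> Hc]]] := Wgr_decomp w.
exists (undup [seq i.1.1 | i <- s]), (fun l => \sum_(i <- s | i.1.1 == l) c i); split.
  rewrite (exchange_big_dep xpredT)//= [LHS]big_seq [RHS]big_seq.
  apply: eq_bigr => i is_; apply/esym/sum_eq_const; first exact: undup_uniq.
  by rewrite mem_undup; apply/mapP; exists i.
move=> l; rewrite big_seq_cond; apply: subspace_sum; first exact: Wpart_subspace.
by move=> i /andP[/Hc[Di Hi] /eqP <-]; apply: Wgr_Wwt.
Qed.

Lemma shift_linear (U : lmodType C) (F : {linear U -> U}) (c : C) :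
  linear (fun x => F x - c *: x).
Proof.
move=> a x y; rewrite linearP scalerBr scalerDr !scalerA opprD !addrA [a * _]mulrC.
by congr (_ - _); rewrite addrAC.
Qed.

(** The commutator with L(0) lowers, at each step, either the nilpotency order of L(0) on w or
    the number of remaining powers of log x. *)
Lemma YW_wt h n u b k w : Vgr VA h u -> Wwt n w -> Wwt (n + h%:~R / 2 + b) (Y u b k w).
Proof.
move=> Hu Hw; apply: gker_Wwt.
pose c := n + h%:~R / 2 + b; pose D := fun x => L0 x - c *: x.
pose D0 := fun x => L0 x - n *: x.
have lD : linear D := shift_linear L0 c.
have lD0 : linear D0 := shift_linear L0 n.
have [a Ha] := Wwt_gker Hw.
have [K HK] : exists K, forall j k, (j < a)%N -> (K <= k)%N -> Y u b k (iter j D0 w) = 0.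
  elim: (a) => [|a' [K HK]]; first by exists 0%N.
  have [K' HK'] := YW_log M u (iter a' D0 w); exists (maxn K K') => j k0.
  rewrite ltnS leq_eqVlt geq_max => /predU1P[->|ja] /andP[k1 k2]; first exact: HK'.
  exact: HK.
have Dz m : iter m D 0 = 0 by apply/lin0/iter_lin.
suff H m j k0 : (a - j + (K - k0) <= m)%N -> iter m D (Y u b k0 (iter j D0 w)) = 0.
  by exists (a + K)%N; apply: (H (a + K)%N 0%N k); rewrite subn0 leq_add2l leq_subr.
have ja0 j' k' : (a <= j')%N -> Y u b k' (iter j' D0 w) = 0.
  by move=> aj; rewrite (iter_zero lD0 aj Ha) (lin0 (YWlin_r u b k')).
elim: m j k0 => [|m IHm] j k0 Hm; first by apply: ja0; lia.
have [ja|aj] := ltnP j a; last by rewrite ja0.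
have [kK|kK] := leqP K k0; first by rewrite HK.
rewrite iterSr; have -> : D (Y u b k0 (iter j D0 w)) =
    Y u b k0 (iter j.+1 D0 w) + k0.+1%:R *: Y u b k0.+1 (iter j D0 w).
  rewrite /= /D0 (linB _ _ (YWlin_r u b k0)) (linZ _ _ (YWlin_r u b k0)) -/D0.
  have := LW0_comm M u b k0 (iter j D0 w).
  rewrite (LV0_gr Hu) (linZ _ _ (YWlin_l b k0 _)) => /eqP; rewrite subr_eq => /eqP E.
  rewrite /D E /c !scalerDl; move: (Y u b k0 (L0 _)) (Y u b k0 _) (Y u b k0.+1 _).
  move=> x y z; move: (n *: y) (b *: y) ((h%:~R / 2) *: y) (k0.+1%:R *: z) => Ny B H Z.
  apply/eqP; rewrite subr_eq; apply/eqP.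
  rewrite [x - _ + _]addrAC -[RHS]addrA -[Ny + H + B]addrA addKr -!addrA.
  by rewrite [LHS]addrC [RHS]addrC -!addrA [x + B]addrC.
rewrite (linD _ _ (iter_lin m lD)) (linZ _ _ (iter_lin m lD)) !IHm ?scaler0 ?addr0//; lia.
Qed.


(** A nonzero homogeneous component of w is detected by a functional that vanishes on all
    vectors without this component; it belongs to the graded dual and sees a single weight. *)
Lemma Wdual_separates (w : W) : w != 0 -> exists (f : {scalar W}) (l0 : C),
  [/\ Wdual M f, f w != 0 & forall l x, l != l0 -> Wwt l x -> f x = 0].
Proof.
move=> w0; have ds := Wgr_direct M; pose cmp := component [set i | PW M i.2] (Wgr M).
have [i ci] : exists i, cmp w i != 0.
  apply: contrapT => /forallNP H; move/eqP: w0; apply.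
  have [s [_ _ ->]] := component_decomp ds w; rewrite big1// => i _.
  exact/eqP/negPn/negP/H.
have sU : subspace [set x | cmp x i = 0].
  split; first exact: component0.
  by move=> a x y; rewrite /= /cmp (component_linear ds) => -> ->; rewrite scaler0 addr0.
have [|f [fw fU]] := separating_functional (x := w) sU; first exact/eqP.
exists f, i.1.1; split; last 2 first.
- by rewrite fw oner_neq0.
- move=> l x li /(coprodP ds _ (@Wpart_sub _)) Hx; apply: fU => /=.
  by apply: Hx => -[_ /= E]; rewrite E eqxx in li.
exists [set i]; first exact: finite_set1.
move=> j x Dj ji Hx; apply: fU => /=; rewrite /cmp (component_homog ds _ Dj Hx).
by case: eqVneq => // ij; case: ji; rewrite ij.
Qed.

Lemma Wdual_ext (x y : W) : (forall (f : {scalar W}) (l0 : C), Wdual M f ->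
  (forall l x, l != l0 -> Wwt l x -> f x = 0) -> f x = f y) -> x = y.
Proof.
move=> H; apply/eqP; rewrite -subr_eq0; apply/negP => /negP xy.
have [f [l0 [f1 f2 f3]]] := Wdual_separates xy.
by move/eqP: f2; apply; rewrite linearB /= (H f l0) ?subrr.
Qed.

Lemma Wdual_finite (f : {scalar W}) : Wdual M f -> exists s : seq C,
  forall l x, l \notin s -> Wwt l x -> f x = 0.
Proof.
move=> [F fF HF]; have [s [us sP]] := finite_set_seq fF.
exists [seq i.1.1 | i <- s] => l x ls Hx.
have [t [_ tD ->]] := coprod_decomp (Wgr_direct M) (@Wpart_sub _) Hx.
rewrite linear_sum big_seq big1// => i /tD[/= Di il]; apply: (HF i) => //.
  by move=> /sP is_; move: ls; rewrite -il => /negP; apply; apply: map_f.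
exact: (component_in (Wgr_direct M)).
Qed.

(** The graded dual sees finitely many weights, and the power of x is the difference of the
    weights involved. *)
Lemma YW_support (f : {scalar W}) v w : Wdual M f -> exists s : seq C,
  forall b k, b \notin s -> f (Y v b k w) = 0.
Proof.
move=> /Wdual_finite[F HF].
have [s [c [-> Hc]]] := Vdecomp VA v; have [t [d [-> Hd]]] := Wwt_decomp w.
exists [seq l - hn | l <- F, hn <- [seq n + h%:~R / 2 | h <- s, n <- t]] => b k bs.
rewrite (lin_sum _ _ _ (YWlin_l b k _)) linear_sum big_seq big1// => h hs.
rewrite (lin_sum _ _ _ (YWlin_r _ b k)) linear_sum big_seq big1// => n nt.
apply: HF (YW_wt b k (Hc h) (Hd n)); apply: contra bs => H; apply/allpairsP.
exists (n + h%:~R / 2 + b, n + h%:~R / 2); split => //=.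
  by apply/allpairsP; exists (h, n).
by rewrite addrC addKr.
Qed.

Lemma YW_log2 v v' w : exists K, forall n k, (K <= k)%N -> Y v n k w = 0 /\ Y v' n k w = 0.
Proof.
have [K HK] := YW_log M v w; have [K' HK'] := YW_log M v' w.
exists (maxn K K') => n k; rewrite geq_max => /andP[k1 k2].
by rewrite HK// HK'.
Qed.

Lemma lp_real (p : int) (x : R) : 0 < x ->
  lp p x%:C = (ln x)%:C + 2 * pi_i * p%:~R.
Proof.
move=> x0; rewrite /lp /carg cmod_real gtr0_norm//= lexx divff ?gt_eqF// acos1.
rewrite -(rmorph_int (real_complex R)); apply/eqP; rewrite eq_complex /=.
by apply/andP; split; apply/eqP; ring.
Qed.

(** At positive real z both sides of the equivariance axiom are exponential polynomials in log z,
    and these determine their coefficients. The variable y plays the role of log z and is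
    arbitrary because the coefficients are polynomials. *)
Lemma YW_equivariant (f : {scalar W}) v w b K (y : C) : Wdual M f ->
  (forall k, (K <= k)%N -> Y v b k w = 0) ->
  (forall k, (K <= k)%N -> Y (T v) b k w = 0) ->
  cexp (2 * pi_i * b) * \sum_(k < K) f (Y (T v) b k w) * (y + 2 * pi_i) ^+ k =
  \sum_(k < K) f (Y v b k w) * y ^+ k.
Proof.
move=> Hf; have [s1 Hs1] := YW_support v w Hf; have [s2 Hs2] := YW_support (T v) w Hf.
have [L HL] := YW_log2 v (T v) w.
pose s := undup (b :: s1 ++ s2).
have us : uniq s := undup_uniq _.
have f0 (c : C) k : c \notin s -> f (Y v c k w) = 0 /\ f (Y (T v) c k w) = 0.
  rewrite mem_undup inE mem_cat !negb_or => /and3P[_ h1 h2].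
  by rewrite Hs1// Hs2.
pose e : seq (C * nat * C) :=
  [seq (c, i.1, lam c * (f (Y (T v) c i.2 w) * ('C(i.2, i.1)%:R * (2 * pi_i) ^+ (i.2 - i.1))))
     | c <- s, i <- [seq (j, k) | k <- iota 0 L, j <- iota 0 L]] ++
  [seq (c, k, - f (Y v c k w)) | c <- s, k <- iota 0 L].
have ep0 y' : ep e (y' : R)%:C = 0.
  rewrite /ep /e sum_cat !big_allpairs_dep -sum_add.
  pose x := expR y'; have x0 : 0 < x := expR_gt0 y'.
  have := @YW_equivariance _ _ _ _ _ M 0 x%:C v w f.
  rewrite eq_complex /= eqxx andbT gt_eqF// => /(_ isT Hf).
  have supp (v' : V) (G1 G2 : C * nat -> C) : v' = v \/ v' = T v ->
     \sum_(nk \in [set: C * nat]) f (Y v' nk.1 nk.2 w) * G1 nk * G2 nk =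
     \sum_(c <- s) \sum_(k <- iota 0 L) f (Y v' c k w) * G1 (c, k) * G2 (c, k).
    move=> vE; rewrite (@fsbigT_seqE _ _ _ [seq (c, k) | c <- s, k <- iota 0 L]).
    - by rewrite big_allpairs.
    - by apply: allpairs_uniq => //; rewrite ?iota_uniq// => -[? ?] [? ?].
    - move=> [c k] H; apply/allpairsP; exists (c, k); split => //=.
        apply: contraNT H => /(f0 c k)[h1 h2].
        by case: vE => ->; rewrite ?h1 ?h2 !mul0r.
      rewrite mem_iota /= add0n ltnNge; apply: contra H => /(HL c k)[h1 h2].
      by case: vE => ->; rewrite ?h1 ?h2 raddf0 !mul0r.
  have E1 := supp (T v) (fun nk => cpow (0 + 1) x%:C nk.1)
    (fun nk => lp (0 + 1) x%:C ^+ nk.2) (or_intror erefl).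
  have E2 := supp v (fun nk => cpow 0 x%:C nk.1) (fun nk => lp 0 x%:C ^+ nk.2) (or_introl erefl).
  move=> E; have {E1 E2 E} := etrans (esym E1) (etrans E E2).
  move/eqP; rewrite -subr_eq0 -sumrB => /eqP E; rewrite -[RHS]E.
  apply: eq_bigr => c _; rewrite /cpow !(lp_real _ x0) mulr0 addr0 add0r mulr1 expRK.
  rewrite big_allpairs_dep -sumrN; congr (_ + _).
    rewrite [LHS]big_seq [RHS]big_seq; apply: eq_bigr => k.
    rewrite mem_iota add0n => /andP[_ kL]; rewrite /= exp_shift// mulrDr cexpD [c * (2 * _)]mulrC.
    by move: (lam c) (f _) (cexp _) (_ ^+ k) => a1 a2 a3 a4; ring.
  by apply: eq_bigr => k _; rewrite !mulNr.
move=> HK1 HK2; have := ep_real_eq0 ep0 b y.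
have bs : b \in s by rewrite mem_undup mem_head.
rewrite /ep_part big_mkcond /e sum_cat !big_allpairs_dep.
rewrite (sum_seq_only us bs); last first.
  by move=> c /negPf cb; rewrite big1// => i _ /=; rewrite cb.
rewrite [X in _ + X](sum_seq_only us bs); last first.
  by move=> c /negPf cb; rewrite big1// => i _ /=; rewrite cb.
rewrite big_allpairs_dep /=.
under [X in _ + X]eq_bigr => i _ do rewrite eqxx mulNr.
rewrite sumrN => /eqP; rewrite subr_eq0 => /eqP E.
have sumL (v' : V) (G : nat -> C) : v' = v \/ v' = T v ->
    \sum_(k < K) f (Y v' b k w) * G k = \sum_(k <- iota 0 L) f (Y v' b k w) * G k.
  move=> vE; pose G' k := f (Y v' b k w) * G k.
  have z k : (K <= k)%N || (L <= k)%N -> G' k = 0.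
    rewrite /G' => /orP[Kk|/(HL b k)[h1 h2]]; last by case: vE => ->; rewrite ?h1 ?h2 raddf0 mul0r.
    by case: vE => ->; rewrite ?HK1 ?HK2// raddf0 mul0r.
  by apply: (sum_nat_bounds (G := G')) => k kK; rewrite z// kK ?orbT.
rewrite sumL; last by right.
rewrite (sumL v (fun k => y ^+ k)) -?E; last by left.
rewrite mulr_sumr [LHS]big_seq [RHS]big_seq; apply: eq_bigr => k.
rewrite mem_iota add0n => /andP[_ kL]; rewrite mulrA -[LHS](mulr1) mulrAC -(exp_shift _ _ _ _ _ kL).
by apply: eq_bigr => j _; rewrite eqxx mulr1.
Qed.

Lemma YW_equivariant_iter (f : {scalar W}) v w b m K (y : C) : Wdual M f ->
  (forall v' k, (exists2 j, (j <= m)%N & v' = iter j T v) -> (K <= k)%N -> Y v' b k w = 0) ->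
  lam b ^+ m * \sum_(k < K) f (Y (iter m T v) b k w) * (y + 2 * pi_i * m%:R) ^+ k =
  \sum_(k < K) f (Y v b k w) * y ^+ k.
Proof.
move=> Hf; elim: m v y => [|m IHm] v y HK.
  by rewrite mul1r mulr0 addr0.
rewrite -(YW_equivariant (v := v) y Hf (K := K)); last 2 first.
- by move=> k; apply: HK; exists 0%N.
- by move=> k; apply: HK; exists 1%N.
rewrite -(IHm (T v)) => [|v' k [j jm ->]]; last by apply: HK; exists j.+1; rewrite // iterSr.
rewrite exprS -mulrA; congr (_ * (_ * _)); apply: eq_bigr => k _.
by rewrite iterSr; congr (_ * _ ^+ _); rewrite -natr1; ring.
Qed.

Lemma YW_log_iter v w m : exists K, forall v' b k,
  (exists2 j, (j <= m)%N & v' = iter j T v) -> (K <= k)%N -> Y v' b k w = 0.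
Proof.
elim: m => [|m [K HK]].
  have [K HK] := YW_log M v w; exists K => v' b k [j + ->].
  by rewrite leqn0 => /eqP -> /=; apply: HK.
have [K' HK'] := YW_log M (iter m.+1 T v) w; exists (maxn K K') => v' b k [j + ->].
rewrite geq_max leq_eqVlt => /predU1P[->|jm] /andP[k1 k2]; first exact: HK'.
by apply: HK => //; exists j.
Qed.

(** Equivariance under all powers of g. On the weight space of al, g^m is e^{2 pi i al m} times a
    polynomial in m, and so the two sides are a geometric sequence times a polynomial and a
    polynomial in m. Either the ratio is 1 and the coefficients agree, or both vanish. Evaluation at
    y = - 2 pi i m makes the left side of the equivariance a single logarithm-free term. *)
Lemma YW_geneig (f : {scalar W}) al v w b : strip al -> geneig T al v -> Wdual M f ->
  (lam (b + al) = 1 /\ forall k, f (Y v b k w) = k`!%:R^-1 * (-1) ^+ k * f (Y (iter k N v) b 0 w))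
  \/ (forall k, f (Y v b k w) = 0 /\ f (Y (iter k N v) b 0 w) = 0).
Proof.
move=> sal Hv Hf; have [K HK] := YW_log M v w.
have [U HU] := unip_nilp (@aut_inj _ _ _ g) (@aut_lfin _ _ _ g) v.
have HN := nilN_nilp (@aut_inj _ _ _ g) (@aut_lfin _ _ _ g) HU.
pose P : {poly C} := \poly_(k < U) ((2 * pi_i) ^+ k / k`!%:R * f (Y (iter k N v) b 0 w)).
pose Q : {poly C} := \poly_(k < K) ((- (2 * pi_i)) ^+ k * f (Y v b k w)).
have PQ m : lam (b + al) ^+ m * P.[m%:R] = Q.[m%:R].
  have [L HL] := YW_log_iter v w m.
  have := @YW_equivariant_iter f v w b m L.+1 (- (2 * pi_i * m%:R)) Hf.
  move=> /(_ (fun v' k h1 h2 => HL v' b k h1 (ltnW h2))).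
  rewrite addNr big_ord_recl expr0 mulr1 big1 ?addr0 => [|k _]; last by rewrite expr0n mulr0.
  rewrite (@sum_ord_bounds _ L.+1 K (fun k => f (Y v b k w) * (- (2 * pi_i * m%:R)) ^+ k)); last 2 first.
  - by move=> k Lk; rewrite HL ?(ltnW Lk) ?raddf0 ?mul0r//; exists 0%N.
  - by move=> k Kk; rewrite HK// raddf0 mul0r.
  rewrite (iter_geneig (@aut_inj _ _ _ g) (@aut_lfin _ _ _ g) m sal Hv HU) => E.
  rewrite mulrDr cexpD (expC_M (lam b)) /P /Q !horner_poly.
  rewrite (_ : \sum_(i < K) _ = \sum_(k < K) f (Y v b k w) * (- (2 * pi_i * m%:R)) ^+ k); last first.
    apply: eq_bigr => k _; rewrite (expC_NM (2 * pi_i) m%:R) mulrA; congr (_ * _); exact: mulrC.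
  rewrite -E (linZ _ _ (YWlin_l b 0%N w)) linearZ /= mulrA; congr (_ * _).
  rewrite (lin_sum _ _ _ (YWlin_l b 0%N w)) linear_sum; apply: eq_bigr => k _.
  rewrite (linZ _ _ (YWlin_l b 0%N w)) linearZ /= (expC_M (2 * pi_i)); ring.
have coP k : P`_k = (2 * pi_i) ^+ k / k`!%:R * f (Y (iter k N v) b 0 w).
  rewrite coef_poly; case: ltnP => // Uk; rewrite (iter_zero (Nlin g 1) Uk HN).
  by rewrite (lin0 (YWlin_l b 0%N w)) raddf0 mulr0.
have coQ k : Q`_k = (- (2 * pi_i)) ^+ k * f (Y v b k w).
  by rewrite coef_poly; case: ltnP => // Kk; rewrite HK// raddf0 mulr0.
have p0 : 2 * pi_i != 0 :> C by rewrite mulf_neq0 ?pnatr_eq0 ?pii_neq0.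
have [|[l1 E]|[P0 Q0]] := two_geometric _ PQ; first exact: cexp_neq0.
  left; split=> // k; have := congr1 (fun p : {poly C} => p`_k) E; rewrite coP coQ => {}E.
  have pk : (- (2 * pi_i)) ^+ k != 0 :> C by rewrite expf_neq0// oppr_eq0.
  apply: (mulfI pk); rewrite -E.
  rewrite -[- (2 * pi_i)]mulN1r (expC_M (-1) (2 * pi_i)).
  have -> : (-1) ^+ k * (2 * pi_i) ^+ k * (k`!%:R^-1 * (-1) ^+ k * f (Y (iter k N v) b 0 w)) =
    ((-1) ^+ k * (-1) ^+ k) * ((2 * pi_i) ^+ k / k`!%:R * f (Y (iter k N v) b 0 w)) by ring.
  by rewrite -(expC_M (-1) (-1)) mulrNN mulr1 expr1n mul1r.
right => k; split.
  have := coQ k; rewrite Q0 coef0 => /esym/eqP; rewrite mulf_eq0 expf_eq0 oppr_eq0 (negPf p0) andbF.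
  by move/eqP.
have := coP k; rewrite P0 coef0 => /esym/eqP; rewrite mulf_eq0 mulf_eq0 expf_eq0 (negPf p0) andbF.
by rewrite invr_eq0 (negPf (factC_neq0 _)) => /eqP.
Qed.

(** Monodromy: the powers of x occurring for u of g-weight al lie in -al + Z. *)
Lemma YW_support_geneig al v w b k : strip al -> geneig T al v ->
  ~ (exists n : int, b + al = n%:~R) -> Y v b k w = 0.
Proof.
move=> sal Hv nb; apply: Wdual_ext => f _ Hf _; rewrite raddf0.
have [[l1 _]|H] := YW_geneig w b sal Hv Hf; last by case: (H k).
by case: nb; apply: cexp_2pii_eq1.
Qed.

(** Only the logarithm-free coefficients need to be studied: the others arise by inserting powers
    of the nilpotent part of g. *)
Lemma YW_logE v w b k : Y v b k w = (k`!%:R^-1 * (-1) ^+ k) *: Y (iter k N v) b 0 w.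
Proof.
have [s [_ sD ->]] := component_decomp (g_direct g) v.
have sS a : a \in s -> strip a by move=> /sD.
have {}sD a : a \in s -> geneig T a (component strip (geneig T) v a).
  by move=> /sD; apply: (component_in (g_direct g)).
have H a : a \in s -> Y (component strip (geneig T) v a) b k w =
   (k`!%:R^-1 * (-1) ^+ k) *: Y (iter k N (component strip (geneig T) v a)) b 0 w.
  move=> as_; apply: Wdual_ext => f _ Hf _; rewrite linearZ /=.
  have [[_ ->//]|H] := YW_geneig w b (sS a as_) (sD a as_) Hf.
  by have [-> ->] := H k; rewrite mulr0.
rewrite (lin_sum _ _ _ (YWlin_l b k w)) (lin_sum _ _ _ (Nlin g k)).
rewrite (lin_sum _ _ _ (YWlin_l b 0%N w)) scaler_sumr [LHS]big_seq [RHS]big_seq.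
exact: eq_bigr.
Qed.

Lemma Vgr_ind (Q : V -> Prop) : (forall x y, Q x -> Q y -> Q (x + y)) ->
  (forall h u, Vgr VA h u -> Q u) -> forall u, Q u.
Proof.
move=> QD Qh u; have [s [c [-> Hc]]] := Vdecomp VA u.
elim/big_ind: _ => [|//|h _]; last exact: Qh (Hc h).
by apply: (Qh 0); case: (Vgr_subspace VA 0).
Qed.

Lemma Wwt_ind (Q : W -> Prop) : (forall x y, Q x -> Q y -> Q (x + y)) ->
  (forall n w, Wwt n w -> Q w) -> forall w, Q w.
Proof.
move=> QD Qh w; have [s [c [-> Hc]]] := Wwt_decomp w.
elim/big_ind: _ => [|//|h _]; last exact: Qh (Hc h).
by apply: (Qh 0); case: (Wpart_subspace [set i | i.1.1 = 0]).
Qed.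

Definition wtbound (B : R) := forall n : C, complex.Re n < B -> forall w, Wwt n w -> w = 0.

Lemma lower_bounded_wt : lower_bounded M -> exists B, wtbound B.
Proof. by move=> [B HB]; exists B => n /HB H w /H. Qed.

Section Truncation.
Hypothesis Mlb : lower_bounded M.

Lemma Re_half (h : int) : complex.Re (h%:~R / 2 : C) = h%:~R / 2.
Proof.
have -> : (h%:~R / 2 : C) = (h%:~R / 2 : R)%:C.
  by rewrite rmorphM /= (rmorph_int (real_complex R)) fmorphV rmorphD /= rmorph1.
by [].
Qed.

Lemma Re_intr (h : int) : complex.Re (h%:~R : C) = h%:~R.
Proof. by rewrite -(rmorph_int (real_complex R)). Qed.

(** Lower-boundedness of the weights of W. *)
Lemma YW_trunc u w : exists B : R, forall b k, complex.Re b < B -> Y u b k w = 0.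
Proof.
have [B HB] := lower_bounded_wt Mlb.
move: u; apply: Vgr_ind => [x y [B1 H1] [B2 H2]|h u Hu].
  exists (Num.min B1 B2) => b k; rewrite lt_min => /andP[b1 b2].
  by rewrite (linD _ _ (YWlin_l b k w)) H1// H2// addr0.
move: w; apply: Wwt_ind => [x y [B1 H1] [B2 H2]|n w Hw].
  exists (Num.min B1 B2) => b k; rewrite lt_min => /andP[b1 b2].
  by rewrite (linD _ _ (YWlin_r u b k)) H1// H2// addr0.
exists (B - complex.Re n - h%:~R / 2) => b k Hb.
apply: (HB _ _ _ (YW_wt b k Hu Hw)); rewrite !Re_add Re_half; lra.
Qed.

End Truncation.

(** The L(-1)-commutator formula, with the coefficient of log x expressed through N. *)
Lemma LWm1_YW u b w : LWm1 M (Y u b 0 w) - Y u b 0 (LWm1 M w) =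
  Y ((b + 1) *: u - N u) (b + 1) 0 w.
Proof.
rewrite -LWm1_comm (YW_logE u w (b + 1) 1) /= (linB _ _ (YWlin_l _ _ _)).
rewrite (linZ (b + 1) u (YWlin_l _ _ _)) expr1 scale1r (_ : 1`!%:R = 1) // invr1 mul1r scaleN1r //.
Qed.

End TwistedModuleFacts.

(** * The Borcherds identity of a twisted module *)

Section ExpPolys.
Context {R : realType}.
Local Notation C := R[i].
Implicit Types (F G : R -> C).

(** The point x = 1 is excluded because duality says nothing on the circle |z1| = |z2|. *)
Definition is_ep F := exists s, forall x : R, 0 < x -> x != 1 -> F x = ep s (ln x)%:C.

Lemma is_ep_eq F G : (forall x, 0 < x -> x != 1 -> F x = G x) -> is_ep F -> is_ep G.
Proof. by move=> FG [s Hs]; exists s => x x0 x1; rewrite -FG// Hs. Qed.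

Lemma is_ep_add F G : is_ep F -> is_ep G -> is_ep (fun x => F x + G x).
Proof.
move=> [s Hs] [t Ht]; exists (s ++ t) => x x0 x1.
by rewrite Hs// Ht// /ep sum_cat.
Qed.

Lemma is_ep_mon F (c mu : C) k : is_ep F ->
  is_ep (fun x => c * cexp (mu * (ln x)%:C) * (ln x)%:C ^+ k * F x).
Proof.
move=> [s Hs]; exists [seq (mu + p.1.1, (k + p.1.2)%N, c * p.2) | p <- s] => x x0 x1.
rewrite Hs// /ep big_map mulr_sumr; apply: eq_bigr => p _ /=.
by rewrite mulrDl cexpD exprD; ring.
Qed.

Lemma is_ep0 : is_ep (fun=> 0).
Proof. by exists [::] => x _ _; rewrite /ep big_nil. Qed.

Lemma is_ep_sum (I : Type) (s : seq I) (F : I -> R -> C) :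
  (forall i, is_ep (F i)) -> is_ep (fun x => \sum_(i <- s) F i x).
Proof.
move=> H; elim: s => [|i s IHs].
  by apply: is_ep_eq is_ep0 => x _ _; rewrite big_nil.
by apply: is_ep_eq (is_ep_add (H i) IHs) => x _ _; rewrite big_cons.
Qed.

Lemma is_ep_one : is_ep (fun=> 1).
Proof. by exists [:: (0, 0%N, 1)] => x _ _; rewrite /ep big_seq1 /= mul0r cexp0 expr0 !mulr1. Qed.

Lemma is_ep_mulX F t : is_ep F -> is_ep (fun x => (x%:C - 1) ^+ t * F x).
Proof.
move=> HF; elim: t => [|t IHt]; first by apply: is_ep_eq HF => x _ _; rewrite mul1r.
have H := is_ep_add (is_ep_mon 1 1 0 IHt) (is_ep_mon (-1) 0 0 IHt).
apply: is_ep_eq H => x x0 _; have := cexp_ln 1 x0; rewrite expr1z => ->.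
by rewrite mul0r cexp0 !expr0 exprS; ring.
Qed.

Lemma lasy_asyM F G (c : int -> C) (b : nat -> C) J :
  (forall j : int, j < - J%:Z -> c j = 0) -> lasy F c -> asy G b ->
  lasy (fun t => G t * F t) (fun e => \sum_(i < (absz (e + J%:Z)%R).+1) b i * c (e - i%:Z)).
Proof.
move=> cJ [J' [J0 HJ]] HG.
have [L [LJ LJ' HL]] : exists L, [/\ (J <= L)%N, (J' <= L)%N & asy (fun t => t%:C ^+ L * F t) (fun i => c (i%:Z - L%:Z))].
  exists (J' + J)%N; split; rewrite ?leq_addr ?leq_addl//; exact: lasy_raise.
have E e M : (absz (e + J%:Z)%R <= M)%N ->
   \sum_(i < (absz (e + J%:Z)%R).+1) b i * c (e - i%:Z) = \sum_(i < M.+1) b i * c (e - i%:Z).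
  move=> eM; apply: (sum_ord_bounds (G := fun i => b i * c (e - i%:Z))) => k kk.
    by rewrite cJ ?mulr0//; lia.
  by rewrite cJ ?mulr0//; lia.
exists L; split=> [j jL|].
  by rewrite big1// => i _; rewrite cJ ?mulr0//; lia.
apply: (@asy_eqf _ (fun t => G t * (t%:C ^+ L * F t)) _ _ 0) => [t _ _|].
  by rewrite mulrCA.
apply: asy_eqc (asyM HG HL) => i; rewrite /cprod.
have -> : \sum_(i0 < i.+1) b i0 * c ((i - i0)%N%:Z - L%:Z) =
   \sum_(i0 < i.+1) b i0 * c (i%:Z - L%:Z - i0%:Z).
  by apply: eq_bigr => -[j jl] _ /=; congr (_ * c _); lia.
by apply: (sum_ord_bounds (G := fun i0 => b i0 * c (i%:Z - L%:Z - i0%:Z))) => k kk; rewrite cJ ?mulr0//; lia.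
Qed.

(** A square of indices may be summed along antidiagonals when nothing lies beyond the last one. *)
Lemma sum_triangle (A : nmodType) (K : nat) (H : nat -> nat -> A) :
  (forall i j, (K <= i + j)%N -> H i j = 0) ->
  \sum_(i < K) \sum_(j < K) H i j = \sum_(n < K) \sum_(i < n.+1) H i (n - i)%N.
Proof.
move=> HK; transitivity (\sum_(i < K) \sum_(n < K | (i <= n)%N) H i (n - i)%N).
  apply: eq_bigr => i _; rewrite (sum_shift (fun n => H i (n - i)%N)) ?(ltnW (ltn_ord i))//.
  transitivity (\sum_(k < K - i) H i k); last by apply: eq_bigr => k _; rewrite addnK.
  have -> : \sum_(k < K) H i k = \sum_(0 <= k < K) H i k by rewrite big_mkord.
  by rewrite (sum_nat_widen (leq_subr i K)) ?big_mkord// => k Kk; rewrite HK// -leq_subLR.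
rewrite (exchange_big_dep xpredT)//=; apply: eq_bigr => n _.
by rewrite -(big_ord_widen K (fun m => H m (n - m)%N) (ltn_ord n)).
Qed.

(** This is e^{L N} e^{- L N} = 1. *)
Lemma log_cancel (K : nat) (Lx : C) (G : nat -> C) : (0 < K)%N ->
  (forall n, (K <= n)%N -> G n = 0) ->
  \sum_(m < K) Lx ^+ m / m`!%:R * \sum_(k < K) k`!%:R^-1 * (-1) ^+ k * G (k + m)%N * Lx ^+ k = G 0%N.
Proof.
move=> K0 HG.
pose H m k := Lx ^+ m / m`!%:R * (k`!%:R^-1 * (-1) ^+ k * G (k + m)%N * Lx ^+ k).
transitivity (\sum_(m < K) \sum_(k < K) H m k).
  by apply: eq_bigr => m _; rewrite mulr_sumr.
rewrite sum_triangle => [|i j Kij]; last by rewrite /H HG ?mulr0 ?mul0r ?mulr0// addnC.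
transitivity (\sum_(n < K) Lx ^+ n / n`!%:R * G n * \sum_(k < n.+1) (1 : C) ^+ (n - k) * (-1) ^+ k *+ 'C(n, k)).
  apply: eq_bigr => n _; rewrite mulr_sumr (reindex_inj rev_ord_inj) /=.
  apply: eq_bigr => -[k kn] _ /=; rewrite subSS; have {}kn : (k <= n)%N by [].
  rewrite subKn// /H subnKC// expr1n mul1r -[(-1) ^+ k *+ _]mulr_natr.
  have := bin_fact kn => /(congr1 (fun n => n%:R : C)).
  rewrite !natrM => E; have := factC_neq0 (R := R) n; rewrite -E !mulf_eq0 !negb_or.
  move=> /andP[c0 /andP[k0 m0]]; have -> : Lx ^+ n = Lx ^+ (n - k) * Lx ^+ k by rewrite -exprD subnK.
  field.
  by rewrite k0 m0 c0.
rewrite (bigD1 (Ordinal K0))//= big_ord1 big1 ?addr0 => [|n n0].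
  by rewrite !expr0 bin0 fact0 divr1 !mulr1 mul1r.
by move: n0; rewrite -val_eqE /= => /negPf n0; rewrite -exprDn subrr expr0n n0 mulr0.
Qed.

Lemma Re_neg (z : C) : complex.Re (- z) = - complex.Re z.
Proof. by case: z. Qed.

Lemma ex_nat_gt (r : R) : exists J : nat, r < J%:R.
Proof.
by exists (Num.bound `|r|); apply: le_lt_trans (ler_norm r) _; apply: archi_boundP.
Qed.

End ExpPolys.

Section Borcherds.
Context {R : realType}.
Local Notation C := R[i].
Local Notation lam a := (cexp (2 * pi_i * a)).
Context {V W : lmodType C} {VA : vertex_superalgebra V} {g : automorphism VA}.
Variable M : twisted_module g W.
Local Notation T := (aut g).
Local Notation N := (nilN T).
Local Notation Y := (YW M).

(** The coefficient of X^s of (1 + X)^(c + N), applied to u. *)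
Definition obin (c : C) (s : nat) (u : V) : V := \sum_(k < s.+1) bet c k s *: iter k N u.

(** The commutator side: products of modes in the two orders, with the logarithm-free modes of
    Y_W. The sign sg records the parities. *)
Definition blhs (sg : bool) (u v : V) (w : W) (a0 : C) (a1 : int) (a2 : C) (I : nat) : W :=
  \sum_(i < I) nbin a1 i *: Y u (a0 + a1%:~R + 1 + i%:R) 0 (Y v (a2 - i%:R) 0 w) +
  ((-1) ^+ sg * (-1) ^ a1) *:
    \sum_(i < I) nbin a1 i *: Y v (a2 + a1%:~R + 1 + i%:R) 0 (Y u (a0 - i%:R) 0 w).

(** The iterate side. The operator binomial replaces the scalar binom(-1 - a0, i) of the untwisted
    case: it is the expansion of x^{- a0 - 1 + N} around x = 1. *)
Definition brhs (u v : V) (w : W) (a0 : C) (a1 : int) (a2 : C) (I : nat) : W :=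
  \sum_(i < I) Y (YV VA (obin (- 1 - a0) i u) (a1 - i%:Z) v) (a0 + a2 + 1 + i%:R) 0 w.

Lemma iterN_zero K k u : (K <= k)%N -> iter K N u = 0 -> iter k N u = 0.
Proof. exact: (iter_zero (Nlin g 1)). Qed.

Lemma obinE K c s u : iter K N u = 0 -> obin c s u = \sum_(k < K) bet c k s *: iter k N u.
Proof.
move=> HK; apply: (sum_ord_bounds (G := fun k => bet c k s *: iter k N u)) => k kk.
  by rewrite bet_big// scale0r.
by rewrite (iterN_zero kk HK) scaler0.
Qed.

Lemma fsum_log (K : nat) (H : nat -> nat -> C) (X X' L : C) :
  (forall k l, (K <= k)%N -> H k l = 0) ->
  \sum_(k \in [set: nat * nat]) H k.1 k.2 * X * L ^+ k.1 * X' * 0 ^+ k.2 =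
  \sum_(k < K) H k 0%N * X * L ^+ k * X'.
Proof.
move=> HK; rewrite (@fsbigT_seqE _ _ _ [seq (k, 0%N) | k <- iota 0 K]); last 2 first.
- by rewrite map_inj_uniq ?iota_uniq// => k l [].
- move=> [k [|l]] /=; last by rewrite expr0n mulr0 eqxx.
  move=> Hk; apply/mapP; exists k => //; rewrite mem_iota add0n /= ltnNge.
  by apply: contra Hk => /HK ->; rewrite !mul0r.
rewrite big_map -{1}[K]subn0 -[iota _ _]/(index_iota 0 K) big_mkord.
by apply: eq_bigr => k _ /=; rewrite mulr1.
Qed.

Lemma lp_real0 (x : R) : 0 < x -> lp 0 x%:C = (ln x)%:C.
Proof. by move=> x0; rewrite lp_real// mulr0 addr0. Qed.

Lemma lp_one : lp 0 (1 : R)%:C = 0.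
Proof. by rewrite lp_real0// ln1. Qed.

Lemma wsums_eq (I : choiceType) (F G : I -> C) s : F =1 G -> wsums F s -> wsums G s.
Proof. by move=> /funext ->. Qed.

Lemma cmod_pos (x : R) : 0 < x -> cmod (x%:C) = x.
Proof. by move=> x0; rewrite cmod_real gtr0_norm. Qed.

(** duality at z2 = 1 and positive real z1 = x, with the logarithms of
   Y_W(u, x) expressed by N *)
Lemma duality_real (f : {scalar W}) (K : nat) (s1 s2 : bool) u v w :
  Vparity VA s1 u -> Vparity VA s2 v -> Wdual M f -> iter K N u = 0 ->
  exists (F : R -> C) (t : nat), [/\ is_ep (fun x => (x%:C - 1) ^+ t * F x),
    forall x, 1 < x -> wsums (fun e : C * C => \sum_(k < K)
      k`!%:R^-1 * (-1) ^+ k * f (Y (iter k N u) e.1 0 (Y v e.2 0 w)) *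
      (ln x)%:C ^+ k * cexp (e.1 * (ln x)%:C)) (F x),
    forall x, 0 < x < 1 -> wsums (fun e : C * C => \sum_(k < K)
      k`!%:R^-1 * (-1) ^+ k * ((-1) ^+ (s1 && s2) * f (Y v e.2 0 (Y (iter k N u) e.1 0 w))) *
      (ln x)%:C ^+ k * cexp (e.1 * (ln x)%:C)) (F x) &
    forall x, 0 < x < 1 -> wsums (fun e : int * C =>
      f (Y (YV VA u e.1 v) e.2 0 w) * x%:C ^ e.1) (F (1 + x))].
Proof.
move=> Hu Hv Hf HK.
have Y0 k b x : (K <= k)%N -> Y u b k x = 0.
  by move=> Kk; rewrite YW_logE (iterN_zero Kk HK) (lin0 (YWlin_l M b 0%N x)) scaler0.
have [Nn [a [m [n [t [t0 H]]]]]] := YW_duality w Hu Hv Hf.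
exists (fun x => branch_pp Nn a m n t 0 x%:C (1 : R)%:C), t.
have {H} [H1 H2 _ H3] := H 0; split.
- apply: (@is_ep_eq _ (fun x => \sum_(i < Nn.+1) \sum_(j < Nn.+1) \sum_(k < Nn.+1) \sum_(l < Nn.+1)
    (a i j k l * 0 ^+ l) * cexp (m i * (ln x)%:C) * (ln x)%:C ^+ k * 1)); last first.
    do 4!(apply: is_ep_sum => ?); exact: is_ep_mon is_ep_one.
  move=> x x0 x1; rewrite /branch_pp /cpow lp_one lp_real0// !mulr_sumr.
  have x1' : x%:C - 1 != 0 :> C by rewrite -(rmorph1 (real_complex R)) -rmorphB /= fmorph_eq0 subr_eq0.
  do 4!(rewrite ?mulr_sumr; apply: eq_bigr => ? _).
  rewrite mulr0 cexp0 rmorph1; move: (expf_neq0 t x1').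
  move: ((x%:C - 1) ^+ t) (a _ _ _ _) (cexp _) (_ ^+ _) (_ ^+ _) => X A E L Z X0.
  by field.
- move=> x x1; have x0 : 0 < x by apply: lt_trans x1.
  have := abs_sums_wsums (H1 x%:C (1 : R)%:C _ _); rewrite !cmod_pos// => /(_ ltr01 x1).
  apply: wsums_eq => -[b c] /=; rewrite /cpow lp_one lp_real0// mulr0 cexp0.
  rewrite (@fsum_log K (fun k l => f (Y u b k (Y v c l w))) _ 1); last first.
    by move=> k l Kk; rewrite Y0// raddf0.
  by apply: eq_bigr => k _; rewrite YW_logE linearZ /= mulr1 mulrAC.
- move=> x /andP[x0 x1].
  have := abs_sums_wsums (H2 x%:C (1 : R)%:C _ _); rewrite !cmod_pos// => /(_ x0 x1).
  apply: wsums_eq => -[b c] /=; rewrite /cpow lp_one lp_real0// mulr0 cexp0.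
  rewrite (@fsum_log K (fun k l => f (Y v c l (Y u b k w))) _ 1); last first.
    by move=> k l Kk; rewrite Y0// (lin0 (YWlin_r M v c l)) raddf0.
  rewrite mulr_sumr; apply: eq_bigr => k _.
  by rewrite (YW_logE M u w b k) (linZ _ _ (YWlin_r M v c 0%N)) linearZ /= mulr1; ring.
move=> x /andP[x0 x1]; have x1x : 0 < 1 + x by rewrite addr_gt0.
have xE : (1 + x)%:C - (1 : R)%:C = x%:C :> C by rewrite -rmorphB /= addrAC subrr add0r.
have cE (y : R) : 0 < y -> carg (y%:C) = 0.
  by move=> y0; rewrite /carg cmod_pos//= lexx divff ?gt_eqF// acos1.
have := abs_sums_wsums (H3 (1 + x)%:C (1 : R)%:C _ _ _).
rewrite xE !cmod_pos// !cE// subrr normr0 divr_gt0 ?pi_gt0// => /(_ x0 x1 isT).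
apply: wsums_eq => -[b c] /=; rewrite /cpow lp_one mulr0 cexp0.
rewrite (@fsbigT_seqE _ _ _ [:: 0%N])// ?big_seq1 ?mulr1//.
by move=> [|k]//; rewrite expr0n mulr0 eqxx.
Qed.

Lemma obin_linear c s : linear (obin c s).
Proof.
move=> a x y; rewrite /obin scaler_sumr -sum_add; apply: eq_bigr => k _.
by rewrite (Nlin g k) scalerDr !scalerA mulrC.
Qed.

Lemma obin_gr h c s u : Vgr VA h u -> Vgr VA h (obin c s u).
Proof.
move=> Hu; apply: subspace_sum => [|k _]; first exact: Vgr_subspace.
by apply: subspaceZ; [exact: Vgr_subspace|exact: iterN_gr].
Qed.

Lemma YV_trunc_obin u v : exists J : int, forall c s j, j < J -> YV VA (obin c s u) j v = 0.
Proof.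
have [K HK] := N_nilp g u.
have [J HJ] : exists J : int, forall k j, (k < K)%N -> j < J -> YV VA (iter k N u) j v = 0.
  elim: (K) => [|k [J HJ]]; first by exists 0.
  have [J' HJ'] := YV_trunc VA (iter k N u) v.
  exists (Num.min J J') => l j; rewrite ltnS leq_eqVlt lt_min => /predU1P[->|lk] /andP[j1 j2].
    exact: HJ'.
  exact: HJ.
exists J => c s j jJ; rewrite (obinE _ _ HK) (lin_sum _ _ _ (YVlin_l VA j v)) big1// => k _.
by rewrite (linZ _ _ (YVlin_l VA j v)) HJ ?scaler0.
Qed.

Lemma sub_nat_Re (a : C) (B : R) : exists I : nat, forall i, (I <= i)%N -> complex.Re (a - i%:R) < B.
Proof.
have [I HI] := ex_nat_gt (complex.Re a - B); exists I => i Ii.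
rewrite Re_add Re_neg -(rmorph_nat (real_complex R)) /=.
have : (I%:R : R) <= i%:R by rewrite ler_nat.
lra.
Qed.

(** Truncation makes both sides independent of the summation bound; the bound is uniform in j
    because lowering a2 only improves the truncation in the modes of v, and the other bounds do
    not involve a2. *)
Lemma borcherds_stable (Mlb : lower_bounded M) sg u v w a0 a1 a2 : exists I1 : nat,
  forall (j I0 I : nat), (I1 <= I0)%N -> (I0 <= I)%N ->
    blhs sg u v w a0 a1 (a2 - j%:R) I = blhs sg u v w a0 a1 (a2 - j%:R) I0 /\
    brhs u v w a0 a1 (a2 - j%:R) I = brhs u v w a0 a1 (a2 - j%:R) I0.
Proof.
have [B HB] := YW_trunc Mlb v w; have [B' HB'] := YW_trunc Mlb u w.
have [J HJ] := YV_trunc_obin u v.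
have [I1 H1] := sub_nat_Re a2 B; have [I2 H2] := sub_nat_Re a0 B'.
exists (I1 + I2 + absz (a1 - J)%R).+1 => j I0 I I10 II.
have sumE (G : nat -> W) : (forall i, (I1 + I2 + absz (a1 - J)%R < i)%N -> G i = 0) ->
    \sum_(i < I) G i = \sum_(i < I0) G i.
  by move=> HG; apply: (sum_ord_bounds (G := G)) => k kk; apply: HG; lia.
rewrite /blhs /brhs; split; last first.
  rewrite (sumE (fun i => Y (YV VA (obin (-1 - a0) i u) (a1 - i%:Z) v) (a0 + (a2 - j%:R) + 1 + i%:R) 0 w))//.
  by move=> i Hi; rewrite HJ ?(lin0 (YWlin_l M _ 0%N w))//; lia.
rewrite (sumE (fun i => nbin a1 i *: Y u (a0 + a1%:~R + 1 + i%:R) 0 (Y v (a2 - j%:R - i%:R) 0 w))).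
  rewrite (sumE (fun i => nbin a1 i *: Y v (a2 - j%:R + a1%:~R + 1 + i%:R) 0 (Y u (a0 - i%:R) 0 w)))//.
  by move=> i Hi; rewrite (HB' _ 0%N) ?(lin0 (YWlin_r M v _ 0%N)) ?scaler0//; apply: H2; lia.
move=> i Hi; rewrite (HB _ 0%N) ?(lin0 (YWlin_r M u _ 0%N)) ?scaler0//.
by rewrite -addrA -opprD -natrD; apply: H1; lia.
Qed.

Section Homogeneous.
Variables (f : {scalar W}) (l0 : C) (h h' : int) (n al : C) (v : V) (w : W) (K : nat).
Hypothesis f_dual : Wdual M f.
Hypothesis f_wt : forall l x, l != l0 -> Wwt M l x -> f x = 0.
Hypotheses (v_gr : Vgr VA h' v) (w_wt : Wwt M n w).
Local Notation S := (l0 - n - h%:~R / 2 - h'%:~R / 2).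

Lemma f12_wt u b c : Vgr VA h u -> b + c != S -> f (Y u b 0 (Y v c 0 w)) = 0.
Proof.
move=> Hu bc; apply: f_wt (YW_wt b 0 Hu (YW_wt c 0 v_gr w_wt)).
by apply: contra bc => /eqP <-; apply/eqP; ring.
Qed.

Lemma f21_wt u b c : Vgr VA h u -> b + c != S -> f (Y v c 0 (Y u b 0 w)) = 0.
Proof.
move=> Hu bc; apply: f_wt (YW_wt c 0 v_gr (YW_wt b 0 Hu w_wt)).
by apply: contra bc => /eqP <-; apply/eqP; ring.
Qed.

Lemma fit_wt u (m : int) d : Vgr VA h u -> m%:~R + d != S -> f (Y (YV VA u m v) d 0 w) = 0.
Proof.
move=> Hu bc; apply: f_wt (YW_wt d 0 (YV_gr m Hu v_gr) w_wt).
apply: contra bc => /eqP <-; apply/eqP.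
have -> : (m *+ 2 + h + h')%:~R = 2 * m%:~R + h%:~R + h'%:~R :> C.
  by rewrite mulr2n !intrD; ring.
by field.
Qed.

(** Multiplication by x^{al + N} removes the logarithms and makes the powers of x integral. *)
Lemma combine_logs (x : R) (Gf : nat -> C * C -> C) (F : nat -> R -> C) : (0 < K)%N ->
  (forall m e, (K <= m)%N -> Gf m e = 0) ->
  (forall m, wsums (fun e : C * C => \sum_(k < K) k`!%:R^-1 * (-1) ^+ k * Gf (k + m)%N e *
     (ln x)%:C ^+ k * cexp (e.1 * (ln x)%:C)) (F m x)) ->
  wsums (fun e : C * C => cexp ((al + e.1) * (ln x)%:C) * Gf 0%N e)
    (\sum_(m < K) (cexp (al * (ln x)%:C) * ((ln x)%:C ^+ m / m`!%:R)) * F m x).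
Proof.
move=> K0 HG H.
have := wsums_sum (index_enum 'I_K)
  (fun m : 'I_K => wsumsZ (cexp (al * (ln x)%:C) * ((ln x)%:C ^+ m / m`!%:R)) (H m)).
apply: wsums_eq => e.
rewrite -[Gf 0%N e](log_cancel (ln x)%:C K0 (G := fun n => Gf n e)) => [|i]; last exact: HG.
rewrite mulrDl cexpD mulr_sumr; apply: eq_bigr => m _.
rewrite -mulr_suml; set s := \sum_(k < K) _; ring.
Qed.

Variable u : V.
Hypotheses (u_gr : Vgr VA h u) (al_strip : strip al) (u_al : geneig T al u)
  (uK : iter K N u = 0) (K0 : (0 < K)%N) (Mlb : lower_bounded M).
Variables s1 s2 : bool.
Hypotheses (u_par : Vparity VA s1 u) (v_par : Vparity VA s2 v).

(** Along z2 = 1 and z1 = x > 0 the function x |-> < f, Y_W(x^{al + N} u, x) Y_W(v, 1) w > is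
    single-valued. The two products and the iterate of the duality axiom give its expansions at
    infinity, 0 and 1; the factor x^{al + N} contributes the coefficients bet to the last one. *)
Lemma homogeneous_residues : exists J : nat,
  (forall k j, j < - J%:Z -> f (Y (YV VA (iter k N u) j v) (S - j%:~R) 0 w) = 0) /\
  residues (fun j => f (Y u (j%:~R - al) 0 (Y v (S + al - j%:~R) 0 w)))
    (fun j => (-1) ^+ (s1 && s2) * f (Y v (S + al - j%:~R) 0 (Y u (j%:~R - al) 0 w)))
    (fun e => \sum_(k < K) \sum_(i < (absz (e + J%:Z)%R).+1)
       bet al k i * f (Y (YV VA (iter k N u) (e - i%:Z) v) (S - (e - i%:Z)%:~R) 0 w)).
Proof.
have Y0 k b x : (K <= k)%N -> Y (iter k N u) b 0 x = 0.
  by move=> Kk; rewrite (iterN_zero Kk uK) (lin0 (YWlin_l M b 0%N x)).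
have ugr k : Vgr VA h (iter k N u) by apply: iterN_gr.
have /choice[Fm HF] : forall m : nat, exists Ft : (R -> C) * nat,
  [/\ is_ep (fun x => (x%:C - 1) ^+ Ft.2 * Ft.1 x),
    forall x, 1 < x -> wsums (fun e : C * C => \sum_(k < K)
      k`!%:R^-1 * (-1) ^+ k * f (Y (iter (k + m) N u) e.1 0 (Y v e.2 0 w)) *
      (ln x)%:C ^+ k * cexp (e.1 * (ln x)%:C)) (Ft.1 x),
    forall x, 0 < x < 1 -> wsums (fun e : C * C => \sum_(k < K)
      k`!%:R^-1 * (-1) ^+ k * ((-1) ^+ (s1 && s2) * f (Y v e.2 0 (Y (iter (k + m) N u) e.1 0 w))) *
      (ln x)%:C ^+ k * cexp (e.1 * (ln x)%:C)) (Ft.1 x) &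
    forall x, 0 < x < 1 -> wsums (fun e : int * C =>
      f (Y (YV VA (iter m N u) e.1 v) e.2 0 w) * x%:C ^ e.1) (Ft.1 (1 + x))].
  move=> m; have [|F [t [H1 H2 H3 H4]]] := @duality_real f K s1 s2 (iter m N u) v w
    (iterN_parity g m u_par) v_par f_dual.
    by rewrite -iterD; apply: iterN_zero uK; rewrite leq_addr.
  exists (F, t); split=> // x Hx.
    by apply: wsums_eq (H2 x Hx) => e; apply: eq_bigr => k _; rewrite -iterD.
  by apply: wsums_eq (H3 x Hx) => e; apply: eq_bigr => k _; rewrite -iterD.
pose Phi x := \sum_(m < K) (cexp (al * (ln x)%:C) * ((ln x)%:C ^+ m / m`!%:R)) * (Fm m).1 x.
have [Jit HJit] : exists J : nat, forall k j, j < - J%:Z ->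
    f (Y (YV VA (iter k N u) j v) (S - j%:~R) 0 w) = 0.
  have [J HJ] : exists J : nat, forall k j, (k < K)%N -> j < - J%:Z -> YV VA (iter k N u) j v = 0.
    elim: (K) => [|k [J HJ]]; first by exists 0%N.
    have [J' HJ'] := YV_trunc VA (iter k N u) v.
    exists (J + absz J')%N => l j; rewrite ltnS leq_eqVlt => /predU1P[->|lk] jJ.
      by apply: HJ'; lia.
    by apply: HJ => //; lia.
  exists J => k j jJ; have [kK|Kk] := ltnP k K.
    by rewrite HJ// (lin0 (YWlin_l M _ 0%N w)) raddf0.
  by rewrite (iterN_zero Kk uK) (lin0 (YVlin_l VA j v)) (lin0 (YWlin_l M _ 0%N w)) raddf0.
exists Jit; split=> //.
pose t_ m := (Fm m).2; pose T_ := (\sum_(m < K) t_ m)%N.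
have [s Hs] : is_ep (fun x => (x%:C - 1) ^+ T_ * Phi x).
  apply: (@is_ep_eq _ (fun x => \sum_(m < K) (m`!%:R^-1 * cexp (al * (ln x)%:C) * (ln x)%:C ^+ m *
     ((x%:C - 1) ^+ (T_ - t_ m) * ((x%:C - 1) ^+ t_ m * (Fm m).1 x))))) => [x _ _|].
    rewrite mulr_sumr; apply: eq_bigr => m _.
    have tm : (t_ m <= T_)%N by rewrite /T_ (bigD1 m)//= leq_addr.
    have -> : (x%:C - 1) ^+ T_ = (x%:C - 1) ^+ (T_ - t_ m) * (x%:C - 1) ^+ t_ m.
      by rewrite -exprD subnK.
    by ring.
  apply: is_ep_sum => m; apply: is_ep_mon; apply: is_ep_mulX.
  by have [H _ _ _] := HF m.
apply: (@laurent_residues _ T_ Phi s) Hs.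
- pose io (j : int) : C * C := (- j%:~R - al, S + al + j%:~R).
  have [B HB] := YW_trunc Mlb v w; have [J HJ] := ex_nat_gt (complex.Re (S + al) - B).
  apply: (@wsums_lasy _ _ (fun t e => cexp ((al + e.1) * (ln t^-1)%:C) * f (Y u e.1 0 (Y v e.2 0 w)))
     _ io _ J).
  + by move=> i j [/addIr/oppr_inj/eqP]; rewrite (eqr_int C) => /eqP.
  + move=> t /andP[t0 t1]; have t1' : 1 < t^-1 by rewrite invf_gt1.
    apply: (combine_logs (Gf := fun m e => f (Y (iter m N u) e.1 0 (Y v e.2 0 w)))
      (F := fun m => (Fm m).1)) => // [m e Km|m]; first by rewrite Y0// raddf0.
    by have [_ H _ _] := HF m; apply: H.
  + move=> t j /andP[t0 _]; rewrite /io /= [al + _]addrC subrK.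
    rewrite -(rmorphN (intmul 1)) cexp_ln ?invr_gt0// mulrC fmorphV -exprz_inv invrK.
    by rewrite [in RHS](_ : S + al - (- j)%:~R = S + al + j%:~R)// mulrNz opprK.
  + move=> t [b c] _ nio /=; have [bc|bc] := eqVneq (b + c) S; last first.
      by rewrite (f12_wt u_gr bc) mulr0.
    rewrite (YW_support_geneig M _ 0 al_strip u_al) ?raddf0 ?mulr0// => -[n' nE].
    move: (nio (- n')); rewrite /io -bc rmorphN /= opprK -nE; apply/negP; rewrite negbK.
    by apply/eqP; congr (_, _); ring.
  move=> j jJ; rewrite (HB _ 0%N) ?(lin0 (YWlin_r M u _ 0%N)) ?raddf0//.
  rewrite rmorphN /= opprK !Re_add Re_intr.
  have : (j%:~R : R) < (- J%:Z)%:~R by rewrite ltr_int.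
  rewrite rmorphN /= => jJ'; move: HJ; rewrite !Re_add; lra.
- pose io (j : int) : C * C := (j%:~R - al, S + al - j%:~R).
  have [B HB] := YW_trunc Mlb u w; have [J HJ] := ex_nat_gt (- complex.Re al - B).
  apply: (@wsums_lasy _ _ (fun t e => cexp ((al + e.1) * (ln t)%:C) *
     ((-1) ^+ (s1 && s2) * f (Y v e.2 0 (Y u e.1 0 w)))) _ io _ J).
  + by move=> i j [/addIr/eqP]; rewrite (eqr_int C) => /eqP.
  + move=> t t01.
    apply: (combine_logs (Gf := fun m e => (-1) ^+ (s1 && s2) * f (Y v e.2 0 (Y (iter m N u) e.1 0 w)))
      (F := fun m => (Fm m).1)) => // [m e Km|m].
      by rewrite Y0// (lin0 (YWlin_r M v _ 0%N)) raddf0 mulr0.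
    by have [_ _ H _] := HF m; apply: H.
  + move=> t j /andP[t0 _]; rewrite /io /= [al + _]addrC subrK.
    by rewrite cexp_ln// mulrC.
  + move=> t [b c] _ nio /=; have [bc|bc] := eqVneq (b + c) S; last first.
      by rewrite (f21_wt u_gr bc) !mulr0.
    rewrite (YW_support_geneig M _ 0 al_strip u_al) ?(lin0 (YWlin_r M v _ 0%N)) ?raddf0 ?mulr0// => -[n' nE].
    move: (nio n'); rewrite /io -bc -nE; apply/negP; rewrite negbK.
    by apply/eqP; congr (_, _); ring.
  move=> j jJ; rewrite (HB _ 0%N) ?(lin0 (YWlin_r M v _ 0%N)) ?raddf0 ?mulr0//.
  rewrite Re_add Re_neg Re_intr.
  have : (j%:~R : R) < (- J%:Z)%:~R by rewrite ltr_int.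
  by rewrite rmorphN /= => jJ'; lra.
apply: (@lasy_eqf _ (fun t => \sum_(m < K) Gfun al m t * (Fm m).1 (1 + t)) _ _ 0).
  by move=> t _ _.
apply: lasy_sum => m; apply: (@lasy_asyM _ (fun t => (Fm m).1 (1 + t)) (Gfun al m)
  (fun j => f (Y (YV VA (iter m N u) j v) (S - j%:~R) 0 w)) (bet al m) Jit).
- by move=> j; apply: HJit.
pose io (j : int) : int * C := (j, S - j%:~R).
apply: (@wsums_lasy _ _ (fun t e => f (Y (YV VA (iter m N u) e.1 v) e.2 0 w) * t%:C ^ e.1) _ io _ Jit).
  by move=> i j [].
  by have [_ _ _ H] := HF m.
  by move=> t j _.
  move=> t [b c] _ nio /=; rewrite (fit_wt (ugr m)) ?mul0r//.
  apply: contraNneq (nio b) => bc; rewrite /io -bc; apply/eqP; congr (_, _).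
  by rewrite addrC addKr.
  by move=> j; apply: HJit.
exact: asy_Gfun.
Qed.

(** The residue identity for the function above; the binomials of integral and of al-twisted
    argument combine by Vandermonde. Unless the modes match the weight seen by f everything is zero. *)
Lemma borcherds_functional (a0 a2 : C) (a1 q : int) : a0 + al = q%:~R ->
  exists I0 : nat, forall I, (I0 <= I)%N ->
  f (blhs (s1 && s2) u v w a0 a1 a2 I) = f (brhs u v w a0 a1 a2 I).
Proof.
move=> qE; rewrite /blhs /brhs.
have [SE|SE] := eqVneq (a0 + a1%:~R + 1 + a2) S; last first.
  exists 0%N => I _; rewrite linearD linearZ /= !linear_sum.
  rewrite big1 => [|i _]; last first.
    by rewrite linearZ /= f12_wt ?mulr0//; apply: contra SE => /eqP <-; apply/eqP; ring.
  rewrite big1 => [|i _]; last first.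
    by rewrite linearZ /= f21_wt ?mulr0//; apply: contra SE => /eqP <-; apply/eqP; ring.
  rewrite big1 => [|i _]; first by rewrite add0r mulr0.
  rewrite fit_wt//; first exact: obin_gr.
  by apply: contra SE => /eqP <-; apply/eqP; rewrite rmorphB /=; ring.
have [J [HJ /(_ q a1)[I0 HI]]] := homogeneous_residues.
exists (I0 + (absz (a1 + J%:Z)%R).+1)%N => I II.
have := HI I (leq_trans (leq_addr _ _) II); rewrite /residue_rel -SE => E.
rewrite linearD linearZ /= !linear_sum.
pose Ck k j := f (Y (YV VA (iter k N u) j v) (a0 + a1%:~R + 1 + a2 - j%:~R) 0 w).
have -> : \sum_(i < I) f (Y (YV VA (obin (- 1 - a0) i u) (a1 - i%:Z) v) (a0 + a2 + 1 + i%:R) 0 w) =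
   \sum_(k < K) \sum_(s < I) bet (- 1 - a0) k s * Ck k (a1 - s%:Z).
  rewrite exchange_big /=; apply: eq_bigr => s _.
  rewrite (obinE _ _ uK) (lin_sum _ _ _ (YVlin_l VA _ v)) (lin_sum _ _ _ (YWlin_l M _ 0%N w)) linear_sum.
  apply: eq_bigr => k _; rewrite (linZ _ _ (YVlin_l VA _ v)) (linZ _ _ (YWlin_l M _ 0%N w)) linearZ /=.
  by rewrite /Ck; congr (_ * f (Y _ _ _ _)); rewrite rmorphB /=; ring.
have -> : \sum_(k < K) \sum_(s < I) bet (- 1 - a0) k s * Ck k (a1 - s%:Z) =
   \sum_(k < K) \sum_(i < I) \sum_(j < I) binC ((- 1 - q)%:~R) i * (bet al k j * Ck k (a1 - i%:Z - j%:Z)).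
  apply: eq_bigr => k _; rewrite (sum_triangle (H := fun i j =>
     binC ((- 1 - q)%:~R) i * (bet al k j * Ck k (a1 - i%:Z - j%:Z)))); last first.
    by move=> i j Iij; rewrite /Ck SE HJ ?mulr0//; lia.
  apply: eq_bigr => s _.
  have -> : - 1 - a0 = (- 1 - q)%:~R + al by rewrite rmorphB rmorphN /= -qE; ring.
  rewrite -[bet _ k s]mul1r; have := cprod_bet ((- 1 - q)%:~R) al 0 k s; rewrite bin0 => <-.
  rewrite /cprod mulr_suml; apply: eq_bigr => -[i ij] _ /=; rewrite bet_binC -mulrA.
  by congr (_ * (_ * Ck _ _)); lia.
have -> : \sum_(k < K) \sum_(i < I) \sum_(j < I) binC ((- 1 - q)%:~R) i * (bet al k j * Ck k (a1 - i%:Z - j%:Z)) =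
   \sum_(i < I) binC ((- 1 - q)%:~R) i * \sum_(k < K) \sum_(j < (absz (a1 - i%:Z + J%:Z)%R).+1)
     bet al k j * Ck k (a1 - i%:Z - j%:Z).
  rewrite exchange_big; apply: eq_bigr => i _; rewrite mulr_sumr; apply: eq_bigr => k _.
  rewrite -mulr_sumr; congr (_ * _); have iI := ltn_ord i.
  by apply: (sum_ord_bounds (G := fun j => bet al k j * Ck k (a1 - i%:Z - j%:Z))) => j jj;
    rewrite /Ck SE HJ ?mulr0//; lia.
rewrite -[RHS]E; congr (_ + _).
  apply: eq_bigr => i _; rewrite linearZ /=; congr (_ * f (Y _ _ _ (Y _ _ _ _))).
    by rewrite !rmorphD /= -qE; ring.
  by rewrite !rmorphD /= -qE; ring.
rewrite !mulr_sumr; apply: eq_bigr => i _; rewrite linearZ /=.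
have -> : (a0 + a1%:~R + 1 + a2 + al - (q - i%:Z)%:~R) = a2 + a1%:~R + 1 + i%:R.
  by rewrite rmorphB /= -qE; ring.
have -> : (q - i%:Z)%:~R - al = a0 - i%:R by rewrite rmorphB /= -qE; ring.
by move: ((-1) ^+ _) ((-1) ^ a1) (nbin _ _) (f _) => b c d e; ring.
Qed.

End Homogeneous.

Lemma blhsDu sg x y v w a0 a1 a2 I :
  blhs sg (x + y) v w a0 a1 a2 I = blhs sg x v w a0 a1 a2 I + blhs sg y v w a0 a1 a2 I.
Proof.
rewrite /blhs addrACA -scalerDr -!sum_add; congr (_ + _ *: _); apply: eq_bigr => i _.
  by rewrite (linD _ _ (YWlin_l M _ 0%N _)) scalerDr.
by rewrite (linD _ _ (YWlin_l M _ 0%N w)) (linD _ _ (YWlin_r M v _ 0%N)) scalerDr.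
Qed.

Lemma blhsDv sg x y u w a0 a1 a2 I :
  blhs sg u (x + y) w a0 a1 a2 I = blhs sg u x w a0 a1 a2 I + blhs sg u y w a0 a1 a2 I.
Proof.
rewrite /blhs addrACA -scalerDr -!sum_add; congr (_ + _ *: _); apply: eq_bigr => i _.
  by rewrite (linD _ _ (YWlin_l M _ 0%N w)) (linD _ _ (YWlin_r M u _ 0%N)) scalerDr.
by rewrite (linD _ _ (YWlin_l M _ 0%N _)) scalerDr.
Qed.

Lemma blhsDw sg x y u v a0 a1 a2 I :
  blhs sg u v (x + y) a0 a1 a2 I = blhs sg u v x a0 a1 a2 I + blhs sg u v y a0 a1 a2 I.
Proof.
rewrite /blhs addrACA -scalerDr -!sum_add; congr (_ + _ *: _); apply: eq_bigr => i _.
  by rewrite (linD _ _ (YWlin_r M v _ 0%N)) (linD _ _ (YWlin_r M u _ 0%N)) scalerDr.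
by rewrite (linD _ _ (YWlin_r M u _ 0%N)) (linD _ _ (YWlin_r M v _ 0%N)) scalerDr.
Qed.

Lemma brhsDu x y v w a0 a1 a2 I :
  brhs (x + y) v w a0 a1 a2 I = brhs x v w a0 a1 a2 I + brhs y v w a0 a1 a2 I.
Proof.
rewrite /brhs -sum_add; apply: eq_bigr => i _.
by rewrite (linD _ _ (obin_linear _ i)) (linD _ _ (YVlin_l VA _ v)) (linD _ _ (YWlin_l M _ 0%N w)).
Qed.

Lemma brhsDv x y u w a0 a1 a2 I :
  brhs u (x + y) w a0 a1 a2 I = brhs u x w a0 a1 a2 I + brhs u y w a0 a1 a2 I.
Proof.
rewrite /brhs -sum_add; apply: eq_bigr => i _.
by rewrite (linD _ _ (YVlin_r VA _ _)) (linD _ _ (YWlin_l M _ 0%N w)).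
Qed.

Lemma brhsDw x y u v a0 a1 a2 I :
  brhs u v (x + y) a0 a1 a2 I = brhs u v x a0 a1 a2 I + brhs u v y a0 a1 a2 I.
Proof.
by rewrite /brhs -sum_add; apply: eq_bigr => i _; rewrite (linD _ _ (YWlin_r M _ _ 0%N)).
Qed.

Lemma nilp_pos u : exists K, (0 < K)%N /\ iter K N u = 0.
Proof. by have [K HK] := N_nilp g u; exists K.+1; split=> //; apply: iterN_zero HK. Qed.

Lemma half_parity_ind (s : bool) (Q : V -> Prop) : Q 0 -> (forall x y, Q x -> Q y -> Q (x + y)) ->
  (forall h u, Vgr VA h u -> Vparity VA s u -> Q u) -> forall u, Vparity VA s u -> Q u.
Proof.
move=> Q0 QD Qh u Hu.
have sub : [set h : int | odd `|h|%N = s] `<=` [set: int] by [].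
have [t [ut tD ->]] := coprod_decomp (Vgr_direct VA) sub Hu.
rewrite big_seq; apply: (big_ind Q Q0 QD) => h /tD sh.
have Hh := component_in (Vgr_direct VA) u (I : [set: int] h).
by apply: (Qh h) => //; apply: (coprod_homog (Vgr_direct VA) sub (i := h)).
Qed.

(** Both sides are trilinear, so the vectors may be taken homogeneous, and the functionals of the
    graded dual that see a single weight separate the points of W. *)
Theorem borcherds (Mlb : lower_bounded M) (s1 s2 : bool) al u v w (a0 a2 : C) (a1 q : int) :
  Vparity VA s1 u -> Vparity VA s2 v -> strip al -> a0 + al = q%:~R ->
  geneig T al u -> exists I0 : nat, forall I, (I0 <= I)%N ->
  blhs (s1 && s2) u v w a0 a1 a2 I = brhs u v w a0 a1 a2 I.
Proof.
move=> Hu Hv sal qE Hual.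
pose P u v w := exists I0 : nat, forall I, (I0 <= I)%N ->
  blhs (s1 && s2) u v w a0 a1 a2 I = brhs u v w a0 a1 a2 I.
pose cu x := component strip (geneig T) x al.
have cuu : cu u = u.
  by rewrite /cu (component_homog (g_direct g) _ sal Hual) eqxx.
rewrite -/(P u v w) -cuu.
have Pand (Q Q1 Q2 : nat -> Prop) : (forall I, Q1 I -> Q2 I -> Q I) ->
    (exists I0 : nat, forall I, (I0 <= I)%N -> Q1 I) ->
    (exists I0 : nat, forall I, (I0 <= I)%N -> Q2 I) ->
    exists I0 : nat, forall I, (I0 <= I)%N -> Q I.
  move=> HQ [I1 H1] [I2 H2]; exists (maxn I1 I2) => I; rewrite geq_max => /andP[II1 II2].
  by apply: HQ; [exact: H1|exact: H2].
have PDu x y v' w' : P x v' w' -> P y v' w' -> P (x + y) v' w'.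
  by apply: Pand => I; rewrite blhsDu brhsDu => -> ->.
have PDv x y u' w' : P u' x w' -> P u' y w' -> P u' (x + y) w'.
  by apply: Pand => I; rewrite blhsDv brhsDv => -> ->.
have PDw x y u' v' : P u' v' x -> P u' v' y -> P u' v' (x + y).
  by apply: Pand => I; rewrite blhsDw brhsDw => -> ->.
have P0u v' w' : P 0 v' w'.
  exists 0%N => I _; have := blhsDu (s1 && s2) 0 0 v' w' a0 a1 a2 I; rewrite addr0.
  rewrite -[X in X = _]addr0 => /addrI <-; have := brhsDu 0 0 v' w' a0 a1 a2 I.
  by rewrite addr0 -[X in X = _]addr0 => /addrI <-.
have P0v u' w' : P u' 0 w'.
  exists 0%N => I _; have := blhsDv (s1 && s2) 0 0 u' w' a0 a1 a2 I; rewrite addr0.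
  rewrite -[X in X = _]addr0 => /addrI <-; have := brhsDv 0 0 u' w' a0 a1 a2 I.
  by rewrite addr0 -[X in X = _]addr0 => /addrI <-.
move: {cuu Hual} u Hu; apply: half_parity_ind => [|x y Px Py|h u u_gr u_par].
- by rewrite /cu (component0 (g_direct g)).
- by rewrite /cu (componentD (g_direct g)); apply: PDu.
have c_gr : Vgr VA h (cu u) by apply: cmp_gr.
have c_par : Vparity VA s1 (cu u) by apply: cmp_parity.
have c_al : geneig T al (cu u) by apply: (component_in (g_direct g)).
move: (cu u) c_gr c_par c_al => {u_gr u_par}u u_gr u_par u_al.
move: v Hv; apply: half_parity_ind => [//|x y|h' v v_gr v_par]; first exact: PDv.
move: w; apply: Wwt_ind => [x y|n w w_wt]; first exact: PDw.
have [K [K0 uK]] := nilp_pos u.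
have [I1] := borcherds_stable Mlb (s1 && s2) u v w a0 a1 a2 => /(_ 0%N I1); rewrite subr0 => HI1.
exists I1 => I II; have [-> ->] := HI1 I (leqnn _) II; apply: Wdual_ext => f l0 f_dual f_wt.
have [I0 HI0] := @borcherds_functional f l0 h h' n al v w K f_dual f_wt v_gr w_wt u u_gr
  sal u_al uK K0 Mlb s1 s2 u_par v_par a0 a2 a1 q qE.
have [<- <-] := HI1 (I1 + I0)%N (leqnn _) (leq_addr _ _).
exact: HI0 (leq_addl _ _).
Qed.

End Borcherds.

(** * Formal series as locally finite families of monomials *)

Lemma sum_cat_cond (I : Type) (A : nmodType) (P : pred I) (r1 r2 : seq I) (F : I -> A) :
  \sum_(i <- r1 ++ r2 | P i) F i = \sum_(i <- r1 | P i) F i + \sum_(i <- r2 | P i) F i.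
Proof. exact: big_cat. Qed.

Section Representations.
Context {R : realType}.
Local Notation C := R[i].
Local Notation mono := (monomial R).

Definition covers (I : eqType) (A : nmodType) (a : I -> A) (e : I -> mono) (m : mono) (s : seq I) :=
  forall i, e i = m -> a i != 0 -> i \in s.

(** F is the sum of the terms a i X^(e i), where every monomial receives finitely many nonzero
    terms. Finiteness is given by explicit lists: this avoids finitely supported sums over
    infinite types, and definedness is proved together with the value of the coefficients. *)
Definition rep (A : nmodType) (F : fexpr R A) (I : eqType) (a : I -> A) (e : I -> mono) : Prop :=
  defined F /\ forall m, exists s : seq I, [/\ uniq s, covers a e m s &
    F m = \sum_(i <- s | e i == m) a i].

Lemma sum_covers (I : eqType) (A : nmodType) (P : pred I) (a : I -> A) (s s' : seq I) :
  uniq s -> uniq s' -> (forall i, P i -> a i != 0 -> i \in s) ->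
  (forall i, P i -> a i != 0 -> i \in s') ->
  \sum_(i <- s | P i) a i = \sum_(i <- s' | P i) a i.
Proof.
move=> us us' Hs Hs'.
rewrite (bigID (fun i => a i == 0)) [RHS](bigID (fun i => a i == 0)) /=.
rewrite [X in X + _ = _]big1 => [|i /andP[_ /eqP]//].
rewrite [X in _ = X + _]big1 => [|i /andP[_ /eqP]//].
congr (_ + _); rewrite -big_filter -[RHS]big_filter; apply: perm_big.
apply: uniq_perm; rewrite ?filter_uniq// => i; rewrite !mem_filter.
by case: (boolP (P i)) => //= Pi; case: (boolP (a i == 0)) => //= ai; rewrite Hs ?Hs'.
Qed.

Lemma rep_coef (A : nmodType) (F : fexpr R A) (I : eqType) (a : I -> A) (e : I -> mono) m s :
  rep F a e -> uniq s -> covers a e m s -> F m = \sum_(i <- s | e i == m) a i.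
Proof.
move=> [_ /(_ m)[s' [us' cs' ->]]] us cs.
by apply: sum_covers => // i /eqP; [apply: cs'|apply: cs].
Qed.

Lemma rep_coef0 (A : nmodType) (F : fexpr R A) (I : eqType) (a : I -> A) (e : I -> mono) m :
  rep F a e -> (forall i, e i = m -> a i = 0) -> F m = 0.
Proof.
move=> HF H; rewrite (rep_coef (s := [::]) HF) ?big_nil// => i /H ->.
by rewrite eqxx.
Qed.

(** All coefficients of the three sides are computed in this way: a parametrization of the fiber of
    a monomial by a list leaves an ordinary finite sum. *)
Lemma rep_coef_param (A : nmodType) (F : fexpr R A) (I P : eqType) (a : I -> A) (e : I -> mono) m
    (p : P -> I) (s : seq P) : rep F a e -> uniq (map p s) ->
  (forall x, x \in s -> e (p x) = m) ->
  (forall i, e i = m -> a i != 0 -> exists2 x, x \in s & i = p x) ->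
  F m = \sum_(x <- s) a (p x).
Proof.
move=> HF us ep H; rewrite (rep_coef (s := map p s) HF us) => [|i ei ai].
  rewrite big_map [LHS]big_seq_cond [RHS]big_seq; apply: eq_bigl => x.
  by case: (boolP (x \in s)) => //= /ep ->; rewrite eqxx.
by have [x xs ->] := H i ei ai; apply: map_f.
Qed.

Lemma rep_mono (A : nmodType) (x : A) (m0 : mono) :
  rep (fmono x m0) (fun _ : unit => x) (fun=> m0).
Proof.
split=> // m; exists [:: tt]; split=> //; try by case.
by rewrite big_mkcond big_seq1 /= eq_sym.
Qed.

(** Terms with the same image under phi are collected. The map need only respect the exponents of
    nonzero terms. *)
Lemma rep_regroup (A : nmodType) (F : fexpr R A) (I J : eqType) (a : I -> A) (e : I -> mono)
    (phi : I -> J) (b : J -> A) (e' : J -> mono) : rep F a e ->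
  (forall i, a i != 0 -> e i = e' (phi i)) ->
  (forall j, exists s : seq I, [/\ uniq s, forall i, phi i = j -> a i != 0 -> i \in s &
     b j = \sum_(i <- s | phi i == j) a i]) ->
  rep F b e'.
Proof.
move=> HF ephi Hb; split=> [|m]; first by case: HF.
have [_ /(_ m)[s [us cs Fs]]] := HF.
have bE j : e' j = m -> b j = \sum_(i <- s | phi i == j) a i.
  move=> jm; have [s' [us' cs' ->]] := Hb j; apply: sum_covers => // i /eqP ij ai.
    exact: cs'.
  by apply: cs => //; rewrite ephi// ij.
exists (undup (map phi s)); split; first exact: undup_uniq.
  move=> j jm bj; rewrite mem_undup; apply: contraNT bj => js.
  rewrite bE// big_seq_cond big1// => i /andP[is_ /eqP ij].
  by case/negP: js; rewrite -ij map_f.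
rewrite Fs.
transitivity (\sum_(j <- undup (map phi s) | e' j == m) \sum_(i <- s | phi i == j) a i); last first.
  by apply: eq_bigr => j /eqP jm; rewrite bE.
rewrite (exchange_big_dep xpredT)//= [LHS]big_mkcond [LHS]big_seq [RHS]big_seq.
apply: eq_bigr => i is_.
have [->|ai] := eqVneq (a i) 0; first by rewrite if_same big1.
rewrite ephi//; have [im|im] := eqVneq (e' (phi i)) m.
  rewrite (eq_bigl (fun j => phi i == j)) => [|j].
    by rewrite sum_eq_const ?undup_uniq// mem_undup map_f.
  by case: (eqVneq (phi i) j) => [<-|]; rewrite ?andbF// im eqxx.
rewrite big_pred0// => j; case: (eqVneq (phi i) j) => [<-|]; rewrite ?andbF// andbT.
exact/negbTE.
Qed.

Lemma rep_ext (A : nmodType) (F : fexpr R A) (I : eqType) (a a' : I -> A) (e e' : I -> mono) :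
  rep F a e -> a =1 a' -> (forall i, a i != 0 -> e i = e' i) -> rep F a' e'.
Proof.
move=> HF aa ee; apply: (rep_regroup (phi := id) HF) => // i.
exists [:: i]; split=> // [j -> _|]; first by rewrite mem_seq1.
by rewrite big_mkcond big_seq1 eqxx aa.
Qed.

Lemma rep_reindex (A : nmodType) (F : fexpr R A) (I J : eqType) (a : I -> A) (e : I -> mono)
    (phi : I -> J) (psi : J -> I) : rep F a e -> cancel phi psi -> cancel psi phi ->
  rep F (a \o psi) (e \o psi).
Proof.
move=> HF K1 K2; apply: (rep_regroup (phi := phi) HF) => [i _|j] /=; first by rewrite K1.
exists [:: psi j]; split=> // [i <- _|]; first by rewrite K1 mem_seq1.
by rewrite big_mkcond big_seq1 K2 eqxx.
Qed.

Lemma rep_map (A B : nmodType) (f : A -> B) (F : fexpr R A) (I : eqType) (a : I -> A) (e : I -> mono) :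
  f 0 = 0 -> (forall x y, f (x + y) = f x + f y) -> rep F a e ->
  rep (Defs.fmap f F) (f \o a) e.
Proof.
move=> f0 fD [dF HF]; split=> // m; have [s [us cs Fs]] := HF m; exists s; split=> //.
  by move=> i im fai; apply: cs => //; apply: contraNneq fai => /= ->; rewrite f0.
by rewrite /= Fs (big_morph f fD f0).
Qed.

Lemma rep_fsum (A : nmodType) (J : choiceType) (F : J -> fexpr R A) (I : eqType)
    (a : J -> I -> A) (e : J -> I -> mono) :
  (forall j, rep (F j) (a j) (e j)) ->
  (forall m, exists s : seq (J * I), covers (fun p => a p.1 p.2) (fun p => e p.1 p.2) m s) ->
  rep (fsum F) (fun p => a p.1 p.2) (fun p => e p.1 p.2).
Proof.
move=> HF Hs.
have FE m (s : seq (J * I)) : covers (fun p => a p.1 p.2) (fun p => e p.1 p.2) m s ->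
    forall j, F j m = \sum_(i <- undup (map snd s) | e j i == m) a j i.
  move=> cs j; apply: rep_coef (HF j) (undup_uniq _) _ => i im ai.
  by rewrite mem_undup; apply/mapP; exists (j, i) => //; apply: cs.
have F0 m (s : seq (J * I)) : covers (fun p => a p.1 p.2) (fun p => e p.1 p.2) m s ->
    forall j, F j m != 0 -> j \in undup (map fst s).
  move=> cs j; apply: contraNT => js; apply/eqP; rewrite (FE m s cs j) big1// => i /eqP im.
  apply/eqP; apply: contraNT js => ai; rewrite mem_undup; apply/mapP.
  by exists (j, i) => //; apply: cs.
split; first split=> [j|m]; first by case: (HF j).
  have [s cs] := Hs m; apply: (seq_finite_set (s := undup (map fst s))) => j /=.
  exact: F0 cs j.
move=> m; have [s cs] := Hs m.
exists (undup s); split; [exact: undup_uniq|by move=> i im ai; rewrite mem_undup cs|].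
rewrite /= (fsbigT_seqE (s := undup (map fst s)) (undup_uniq _)); last exact: F0.
rewrite (eq_bigr _ (fun j _ => FE m s cs j)).
transitivity (\sum_(p <- [seq (j, i) | j <- undup (map fst s), i <- undup (map snd s)] |
    e p.1 p.2 == m) a p.1 p.2).
  by rewrite [RHS]big_mkcond big_allpairs_dep; apply: eq_bigr => j _; rewrite -big_mkcond.
apply: sum_covers => [||p /eqP pm ap|p /eqP pm ap].
- by apply: allpairs_uniq; rewrite ?undup_uniq// => -[? ?] [? ?].
- exact: undup_uniq.
- apply/allpairsP; exists p; rewrite !mem_undup; split; last by case: (p).
    by apply: map_f; apply: cs.
  by apply: map_f; apply: cs.
by rewrite mem_undup; apply: cs.
Qed.

Section Bilinear.
Variables (A B D : nmodType) (op : A -> B -> fexpr R D) (K : eqType)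
  (o : A -> B -> K -> D) (eo : K -> mono).
Hypotheses (op_rep : forall x y, rep (op x y) (o x y) eo)
  (o0l : forall y k, o 0 y k = 0) (o0r : forall x k, o x 0 k = 0)
  (oDl : forall x x' y k, o (x + x') y k = o x y k + o x' y k)
  (oDr : forall x y y' k, o x (y + y') k = o x y k + o x y' k).

(** The operation is only assumed biadditive, with its values represented over a fixed index type;
    the finiteness hypothesis concerns the nonzero triples only, since infinitely many pairs of
    monomials may contribute before truncation. *)
Lemma rep_fbil (F : fexpr R A) (G : fexpr R B) (I J : eqType) (a : I -> A) (e : I -> mono)
    (b : J -> B) (e' : J -> mono) :
  rep F a e -> rep G b e' ->
  (forall m, exists s : seq (I * J * K),
     covers (fun p => o (a p.1.1) (b p.1.2) p.2) (fun p => e p.1.1 + e' p.1.2 + eo p.2) m s) ->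
  rep (fbil op F G) (fun p : I * J * K => o (a p.1.1) (b p.1.2) p.2)
    (fun p => e p.1.1 + e' p.1.2 + eo p.2).
Proof.
move=> HF HG Hs; pose c (p : I * J * K) := o (a p.1.1) (b p.1.2) p.2.
pose E (p : I * J * K) := (e p.1.1, e' p.1.2, eo p.2).
(* the coefficient of the operation on two coefficients *)
have opE t (s : seq (I * J * K)) : uniq s -> (forall p, E p = t -> c p != 0 -> p \in s) ->
    op (F t.1.1) (G t.1.2) t.2 = \sum_(p <- s | E p == t) c p.
  move=> us cs; case: t cs => [[t1 t2] t3] cs /=.
  have [_ /(_ t1)[sF [uF cF ->]]] := HF; have [_ /(_ t2)[sG [uG cG ->]]] := HG.
  set x := \sum_(i <- sF | _) _; set y := \sum_(i <- sG | _) _.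
  (* the list for o x y need not contain the indices of terms that cancel *)
  have [_ /(_ t3)[sK0 [_ cK0 _]]] := op_rep x y.
  pose sK := undup (sK0 ++ map snd s).
  have uK : uniq sK by exact: undup_uniq.
  rewrite (rep_coef (op_rep x y) uK); last first.
    by move=> k kt ok; rewrite mem_undup mem_cat cK0.
  transitivity (\sum_(p <- [seq (i, k) | i <- [seq (i, j) | i <- sF, j <- sG], k <- sK] |
      E p == (t1, t2, t3)) c p).
    rewrite [RHS]big_mkcond big_allpairs_dep big_allpairs_dep /=.
    rewrite [RHS](eq_bigr (fun i => if e i == t1 then
      \sum_(j <- sG) \sum_(k <- sK) if (e' j == t2) && (eo k == t3) then o (a i) (b j) k else 0 else 0)).
      rewrite -big_mkcond /=.
      transitivity (\sum_(k <- sK | eo k == t3) \sum_(i <- sF | e i == t1) \sum_(j <- sG | e' j == t2) o (a i) (b j) k).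
        apply: eq_bigr => k _.
        rewrite /x (big_morph (fun z => o z y k) (fun z z' => oDl z z' y k) (o0l y k)).
        apply: eq_bigr => i _.
        by rewrite /y (big_morph (fun z => o (a i) z k) (fun z z' => oDr (a i) z z' k) (o0r (a i) k)).
      rewrite exchange_big /=; apply: eq_bigr => i _.
      rewrite exchange_big /= big_mkcond; apply: eq_bigr => j _; rewrite -big_mkcond.
      by case: (e' j == t2) => //=; rewrite big_pred0.
    move=> i _; case: eqVneq => [ei|ei].
      apply: eq_bigr => j _; apply: eq_bigr => k _; rewrite /E /= !xpair_eqE ei eqxx.
      by [].
    rewrite big1// => j _; rewrite big1// => k _; rewrite /E /= !xpair_eqE.
    by rewrite (negPf ei).
  apply: sum_covers => // [|p /eqP pt cp|p /eqP]; last exact: cs.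
    by apply: allpairs_uniq => [|//|[? ?] [? ?]//]; apply: allpairs_uniq => // -[? ?] [? ?].
  case: p pt cp => [[i j] k] [ei ej ek] cp.
  apply/allpairsP; exists ((i, j), k); split => //=.
    apply/allpairsP; exists (i, j); split => //=.
      by apply: cF => //; apply: contraNneq cp; rewrite /c /= => ->; rewrite o0l.
    by apply: cG => //; apply: contraNneq cp; rewrite /c /= => ->; rewrite o0r.
  rewrite mem_undup mem_cat; apply/orP; right; apply/mapP; exists ((i, j), k) => //.
  by apply: cs => //; rewrite /E /= ei ej ek.
pose Es (t : mono * mono * mono) := t.1.1 + t.1.2 + t.2.
(* only finitely many monomial triples contribute to m *)
have tE m (s : seq (I * J * K)) : uniq s ->
    covers c (fun p => e p.1.1 + e' p.1.2 + eo p.2) m s ->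
    forall t, Es t = m -> op (F t.1.1) (G t.1.2) t.2 = \sum_(p <- s | E p == t) c p.
  by move=> us cs t tm; apply: opE => // p pt cp; apply: cs => //; rewrite -tm -pt.
have t0 m (s : seq (I * J * K)) : uniq s ->
    covers c (fun p => e p.1.1 + e' p.1.2 + eo p.2) m s ->
    forall t, Es t = m -> op (F t.1.1) (G t.1.2) t.2 != 0 -> t \in undup (map E s).
  move=> us cs t tm; apply: contraNT => ts; rewrite (tE m s us cs t tm) big_seq_cond big1// => p.
  by case/andP=> ps /eqP pt; case/negP: ts; rewrite mem_undup -pt map_f.
split; first split; [by case: HF|by case: HG|by move=> p q; case: (op_rep (F p) (G q))|move=> m|move=> m].
  have [s cs] := Hs m.
  have cs' : covers c (fun p => e p.1.1 + e' p.1.2 + eo p.2) m (undup s).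
    by move=> p pm cp; rewrite mem_undup; apply: cs.
  apply: (seq_finite_set (s := undup (map E (undup s)))) => t /= [tm t1].
  exact: t0 (undup_uniq s) cs' t tm t1.
have [s0 cs0] := Hs m; pose s := [seq p <- undup s0 | e p.1.1 + e' p.1.2 + eo p.2 == m].
have us : uniq s by rewrite filter_uniq ?undup_uniq.
have sm p : p \in s -> e p.1.1 + e' p.1.2 + eo p.2 = m by rewrite mem_filter => /andP[/eqP].
have cs : covers c (fun p => e p.1.1 + e' p.1.2 + eo p.2) m s.
  by move=> p pm cp; rewrite mem_filter pm eqxx mem_undup; apply: cs0.
exists s; split=> //=.
rewrite (fsbig_seqE (s := undup (map E s)) (undup_uniq _)); last 2 first.
- by move=> t; rewrite mem_undup => /mapP[p /sm pm ->].
- by move=> t tm t1; apply: (t0 m s us cs).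
rewrite big_seq (eq_bigr (fun t => \sum_(p <- s | E p == t) c p)) => [|t]; last first.
  by rewrite mem_undup => /mapP[p /sm pm ->]; apply: (tE m s us cs).
rewrite -big_seq (exchange_big_dep xpredT)//= [LHS]big_seq [RHS]big_seq_cond.
rewrite [RHS](eq_bigl (fun p => p \in s)) => [|p]; last first.
  by case: (boolP (p \in s)) => //= /sm ->; rewrite eqxx.
by apply: eq_bigr => p ps; rewrite sum_eq_const ?undup_uniq// mem_undup map_f.
Qed.

End Bilinear.

Lemma rep_fcst (A : nmodType) (x : A) : rep (fcst x : fexpr R A) (fun _ : unit => x) (fun=> 0).
Proof. exact: rep_mono. Qed.

Section Scale.
Variable A : lmodType C.

Lemma rep_fscale (F : fexpr R C) (G : fexpr R A) (I J : eqType) (a : I -> C) (e : I -> mono)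
    (b : J -> A) (e' : J -> mono) : rep F a e -> rep G b e' ->
  (forall m, exists s : seq (I * J), covers (fun p => a p.1 *: b p.2) (fun p => e p.1 + e' p.2) m s) ->
  rep (fscale F G) (fun p : I * J => a p.1 *: b p.2) (fun p => e p.1 + e' p.2).
Proof.
move=> HF HG Hs; pose o (x : C) (y : A) (_ : unit) := x *: y.
have H := @rep_fbil C A A (fun x y => fcst (x *: y)) unit o (fun=> 0)
  (fun x y => rep_fcst (x *: y)) (fun y _ => scale0r y) (fun x _ => scaler0 _ x)
  (fun x x' y _ => scalerDl y x x') (fun x y y' _ => scalerDr x y y') F G I J a e b e' HF HG.
have {}H := @rep_reindex A (fscale F G) _ (I * J)%type _ _ (fun p : I * J * unit => p.1)
  (fun p => (p, tt)) (H _) _ _.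
have {}H := H _ _ _; apply: (rep_ext (H _ _ _)) => //= [m|[[? ?] []]//|p _]; last by rewrite addr0.
have [s cs] := Hs m; exists [seq (p, tt) | p <- s] => -[p []] /= pm cp; apply: map_f.
by apply: cs => //; rewrite -pm addr0.
Qed.

Lemma rep_fscale_cstr (F : fexpr R C) (x : A) (I : eqType) (a : I -> C) (e : I -> mono) :
  rep F a e -> rep (fscale F (fcst x)) (fun i => a i *: x) e.
Proof.
move=> HF; have H := rep_fscale HF (rep_fcst x).
have {}H := @rep_reindex A _ _ I _ _ (fun p : I * unit => p.1) (fun i => (i, tt)) (H _) _ _.
apply: (rep_ext (H _ _ _)) => //= [m|[? []]//|p _]; last by rewrite addr0.
have [_ /(_ m)[s [_ cs _]]] := HF; exists [seq (p, tt) | p <- s] => -[p []] /= pm cp.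
apply/mapP; exists p => //; apply: cs; first by rewrite -pm addr0.
by apply: contraNneq cp => ->; rewrite scale0r.
Qed.

Lemma rep_fscale_cstl (c : C) (G : fexpr R A) (I : eqType) (b : I -> A) (e : I -> mono) :
  rep G b e -> rep (fscale (fcst c) G) (fun i => c *: b i) e.
Proof.
move=> HG; have H := rep_fscale (rep_fcst c) HG.
have {}H := @rep_reindex A _ _ I _ _ (fun p : unit * I => p.2) (fun i => (tt, i)) (H _) _ _.
apply: (rep_ext (H _ _ _)) => //= [m|[[] ?]//|p _]; last by rewrite add0r.
have [_ /(_ m)[s [_ cs _]]] := HG; exists [seq (tt, p) | p <- s] => -[[] p] /= pm cp.
apply/mapP; exists p => //; apply: cs; first by rewrite -pm add0r.
by apply: contraNneq cp => ->; rewrite scaler0.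
Qed.

Lemma rep_fscale_mono (c : C) (m0 m1 : mono) (G : fexpr R A) (I : eqType) (b : I -> A) (e : I -> mono) :
  m1 + m0 = 0 -> rep G b e -> rep (fscale (fmono c m0) G) (fun i => c *: b i) (fun i => m0 + e i).
Proof.
move=> m10 HG; have H := rep_fscale (rep_mono c m0) HG.
have {}H := @rep_reindex A _ _ I _ _ (fun p : unit * I => p.2) (fun i => (tt, i)) (H _) _ _.
apply: (rep_ext (H _ _ _)) => //= [m|[[] ?]//].
have [_ /(_ (m1 + m))[s [_ cs _]]] := HG; exists [seq (tt, p) | p <- s] => -[[] p] /= pm cp.
apply/mapP; exists p => //; apply: cs; first by rewrite -pm addrA m10 add0r.
by apply: contraNneq cp => ->; rewrite scaler0.
Qed.

End Scale.

Lemma rep_fmul (F G : fexpr R C) (I J : eqType) (a : I -> C) (e : I -> mono)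
    (b : J -> C) (e' : J -> mono) : rep F a e -> rep G b e' ->
  (forall m, exists s : seq (I * J), covers (fun p => a p.1 * b p.2) (fun p => e p.1 + e' p.2) m s) ->
  rep (fmul F G) (fun p : I * J => a p.1 * b p.2) (fun p => e p.1 + e' p.2).
Proof. exact: (@rep_fscale C^o). Qed.

Lemma rep_fmul_cstl (c : C) (G : fexpr R C) (I : eqType) (b : I -> C) (e : I -> mono) :
  rep G b e -> rep (fmul (fcst c) G) (fun i => c * b i) e.
Proof. exact: (@rep_fscale_cstl C^o). Qed.

Lemma rep_fmul_cstr (F : fexpr R C) (x : C) (I : eqType) (a : I -> C) (e : I -> mono) :
  rep F a e -> rep (fmul F (fcst x)) (fun i => a i * x) e.
Proof. exact: (@rep_fscale_cstr C^o). Qed.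

Lemma rep_fmul_monol (c : C) (m0 m1 : mono) (G : fexpr R C) (I : eqType) (b : I -> C) (e : I -> mono) :
  m1 + m0 = 0 -> rep G b e -> rep (fmul (fmono c m0) G) (fun i => c * b i) (fun i => m0 + e i).
Proof. exact: (@rep_fscale_mono C^o). Qed.

Lemma rep_fmul_monor (c : C) (m0 m1 : mono) (F : fexpr R C) (I : eqType) (a : I -> C) (e : I -> mono) :
  m1 + m0 = 0 -> rep F a e -> rep (fmul F (fmono c m0)) (fun i => a i * c) (fun i => e i + m0).
Proof.
move=> m10 HF; have H := rep_fmul HF (rep_mono c m0).
have {}H := @rep_reindex C _ _ I _ _ (fun p : I * unit => p.1) (fun i => (i, tt)) (H _) _ _.
apply: (rep_ext (H _ _ _)) => //= [m|[? []]//].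
have [_ /(_ (m + m1))[s [_ cs _]]] := HF; exists [seq (p, tt) | p <- s] => -[p []] /= pm cp.
apply/mapP; exists p => //; apply: cs; first by rewrite -pm -addrA [m0 + _]addrC m10 addr0.
by apply: contraNneq cp => ->; rewrite mul0r.
Qed.

Lemma rep_fadd (A : nmodType) (F G : fexpr R A) (I J : eqType) (a : I -> A) (e : I -> mono)
    (b : J -> A) (e' : J -> mono) : rep F a e -> rep G b e' ->
  rep (fadd F G) (fun p : I + J => match p with inl i => a i | inr j => b j end)
    (fun p => match p with inl i => e i | inr j => e' j end).
Proof.
move=> [dF HF] [dG HG]; split=> // m.
have [s [us cs Fs]] := HF m; have [t [ut ct Gt]] := HG m.
exists (map inl s ++ map inr t); split.
- rewrite cat_uniq !map_inj_uniq ?us ?ut; try by move=> ? ? [].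
  by rewrite andbT; apply/hasPn => _ /mapP[j _ ->]; apply/mapP => -[].
- move=> [i|j] pm ap; rewrite mem_cat; apply/orP; [left|right]; apply: map_f.
    exact: cs.
  exact: ct.
by rewrite sum_cat_cond !big_map /= Fs Gt.
Qed.

Lemma rep_fsub (A : zmodType) (F G : fexpr R A) (I J : eqType) (a : I -> A) (e : I -> mono)
    (b : J -> A) (e' : J -> mono) : rep F a e -> rep G b e' ->
  rep (Defs.fsub F G) (fun p : I + J => match p with inl i => a i | inr j => - b j end)
    (fun p => match p with inl i => e i | inr j => e' j end).
Proof.
move=> HF [dG HG].
have HN : rep (Defs.fmap -%R G) (-%R \o b) e'.
  by apply: rep_map; [exact: oppr0|exact: opprD|split].
by have := rep_fadd HF HN; apply.
Qed.

Lemma rep_fsum_mono (A : nmodType) (J : choiceType) (a : J -> A) (e : J -> mono) :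
  injective e -> rep (fsum (fun j => fmono (a j) (e j))) a e.
Proof.
move=> inj_e; have H := @rep_fsum A J _ unit _ _ (fun j => rep_mono (a j) (e j)).
have {}H := @rep_reindex A _ _ J _ _ (fun p : J * unit => p.1) (fun i => (i, tt)) (H _) _ _.
apply: (rep_ext (H _ _ _)) => //= [m|[? []]//].
have [[j jm]|nj] := EM (exists j, e j = m).
  by exists [:: (j, tt)] => -[i []] /= im _; rewrite mem_seq1 (inj_e i j) ?jm.
by exists [::] => -[i []] /= im; case: nj; exists i.
Qed.

End Representations.

(** * Complex powers and logarithms of formal binomials *)

Lemma nat_list n : exists s : seq nat, forall m, (m <= n)%N -> m \in s.
Proof. by exists (iota 0 n.+1) => m mn; rewrite mem_iota. Qed.

Lemma pair_list (X Y : eqType) (s : seq X) (t : seq Y) :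
  exists r : seq (X * Y), forall x y, x \in s -> y \in t -> (x, y) \in r.
Proof. by exists [seq (x, y) | x <- s, y <- t] => x y xs yt; apply/allpairsP; exists (x, y). Qed.

Lemma box_list a b c : exists s : seq (nat * nat * nat), forall p q r,
  (p <= a)%N -> (q <= b)%N -> (r <= c)%N -> (p, q, r) \in s.
Proof.
have [s Hs] := nat_list a; have [t Ht] := nat_list b; have [u Hu] := nat_list c.
have [v Hv] := pair_list s t; have [w Hw] := pair_list v u.
by exists w => p q r pa qb rc; apply: Hw; [apply: Hv; [exact: Hs|exact: Ht]|exact: Hu].
Qed.

Section LogBinomials.
Context {R : realType}.
Local Notation C := R[i].
Local Notation mono := (monomial R).

Lemma mono_ext (m m' : mono) : (forall l, m.1 l = m'.1 l) -> (forall l, m.2 l = m'.2 l) -> m = m'.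
Proof. by case: m m' => [a b] [c d] /= H1 H2; congr (_, _); apply/ffunP. Qed.

Lemma xmon1 (l i : 'I_3) (a : C) : (xmon i a).1 l = if l == i then a else 0.
Proof. by rewrite ffunE. Qed.
Lemma xmon2 (l i : 'I_3) (a : C) : (xmon i a).2 l = 0%N. Proof. by rewrite ffunE. Qed.
Lemma monoD1 (m m' : mono) l : (m + m').1 l = m.1 l + m'.1 l. Proof. by rewrite ffunE. Qed.
Lemma monoD2 (m m' : mono) l : (m + m').2 l = (m.2 l + m'.2 l)%N. Proof. by rewrite ffunE. Qed.
Lemma mono01 l : (0 : mono).1 l = 0. Proof. by rewrite ffunE. Qed.
Lemma mono02 l : (0 : mono).2 l = 0%N. Proof. by rewrite ffunE. Qed.
Lemma lmon1 (l i : 'I_3) : (lmon i : mono).1 l = 0. Proof. by rewrite ffunE. Qed.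
Lemma lmon2 (l i : 'I_3) : (lmon i : mono).2 l = (if l == i then 1 else 0)%N. Proof. by rewrite ffunE. Qed.

(** (log x_i)^p (log x_k)^q *)
Definition lmm (i k : 'I_3) (p q : nat) : mono :=
  (0, [ffun l => ((if l == i then p else 0) + (if l == k then q else 0))%N]).
Lemma lmm1 l i k p q : (lmm i k p q).1 l = 0. Proof. by rewrite ffunE. Qed.
Lemma lmm2 l i k p q : (lmm i k p q).2 l = ((if l == i then p else 0) + (if l == k then q else 0))%N.
Proof. by rewrite ffunE. Qed.

Definition monoE := (monoD1, monoD2, mono01, mono02, xmon1, xmon2, lmon1, lmon2, lmm1, lmm2).

Lemma xmonN (i : 'I_3) (a : C) : xmon i (- a) + xmon i a = 0.
Proof.
apply: mono_ext => l; rewrite !monoE//; by case: ifP => _; rewrite ?addNr ?addr0.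
Qed.

Lemma nat_of_C (c : C) : exists n : nat, forall m : nat, m%:R = c -> m = n.
Proof.
have [[n nc]|nn] := EM (exists n : nat, n%:R = c).
  by exists n => m mc; apply/eqP; rewrite -(eqr_nat C) mc nc.
by exists 0%N => m mc; case: nn; exists m.
Qed.

Lemma int_of_C (c : C) : exists n : int, forall m : int, m%:~R = c -> m = n.
Proof.
have [[n nc]|nn] := EM (exists n : int, n%:~R = c).
  by exists n => m mc; apply/eqP; rewrite -(eqr_int C) mc nc.
by exists 0 => m mc; case: nn; exists m.
Qed.

(** coefficients of the powers of log(x_i - x_j) + tau - log x_i *)
Section Coefficients.
Variable tau : C.

(** The expansion of tau + log(1 - t). The constant tau is 0 for x_i - x_j and pi i for - x_i + x_j. *)
Definition lamb (r : nat) : C := (-1) ^+ r * bet 0 1 r + (if r == 0%N then tau else 0).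

(** The expansion of (1 - t)^al (tau + log(1 - t))^l / l!. *)
Definition gam (al : C) (l r : nat) : C :=
  (-1) ^+ r * \sum_(s < l.+1) tau ^+ s / s`!%:R * bet al (l - s) r.

Lemma cprod_sign (a b : nat -> C) n :
  cprod (fun r => (-1) ^+ r * a r) (fun r => (-1) ^+ r * b r) n = (-1) ^+ n * cprod a b n.
Proof.
rewrite /cprod mulr_sumr; apply: eq_bigr => -[i ij] _ /=; have {}ij : (i <= n)%N by [].
by rewrite -{3}(subnKC ij) exprD; ring.
Qed.

Lemma cprod_sumr (a : nat -> C) (I : finType) (b : I -> nat -> C) n :
  cprod a (fun r => \sum_s b s r) n = \sum_s cprod a (b s) n.
Proof.
rewrite /cprod exchange_big; apply: eq_bigr => i _; exact: mulr_sumr.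
Qed.

Lemma cprod_lamb l r : cprod lamb (gam 0 l) r = l.+1%:R * gam 0 l.+1 r.
Proof.
have -> : cprod lamb (gam 0 l) r =
    cprod (fun n => (-1) ^+ n * bet 0 1 n) (gam 0 l) r + tau * gam 0 l r.
  rewrite /cprod big_ord_recl [in RHS]big_ord_recl /= /lamb /= subn0 mulrDl -!addrA.
  congr (_ + _); rewrite addrC; congr (_ + _).
  by apply: eq_bigr => i _; rewrite addr0.
rewrite /gam cprod_sign mulrCA -mulrDr [in RHS]mulrCA; congr (_ * _).
rewrite cprod_sumr mulr_sumr.
have H s : (s <= l)%N -> cprod (bet 0 1) (fun n => tau ^+ s / s`!%:R * bet 0 (l - s) n) r =
    tau ^+ s / s`!%:R * ((l - s).+1%:R * bet 0 (l.+1 - s) r).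
  move=> sl; have := cprod_bet (0 : C) 0 1 (l - s) r; rewrite addr0 add1n bin1 subSn// => <-.
    rewrite /cprod mulr_sumr.
  by apply: eq_bigr => i _; rewrite mulrCA.
rewrite (eq_bigr (fun s : 'I_l.+1 => tau ^+ s / s`!%:R * ((l - s).+1%:R * bet 0 (l.+1 - s) r))) => [|s _]; last by apply: H; rewrite -ltnS.
rewrite [in RHS]mulr_sumr [in RHS](eq_bigr (fun s : 'I_l.+2 => tau ^+ s / s`!%:R * ((l.+1 - s)%:R * bet 0 (l.+1 - s) r) +
   s%:R * (tau ^+ s / s`!%:R * bet 0 (l.+1 - s) r))); last first.
  move=> s _; have sl : (s <= l.+1)%N by rewrite -ltnS.
  have -> : l.+1%:R = (l.+1 - s)%:R + s%:R :> C by rewrite -natrD subnK.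
  ring.
rewrite sum_add; congr (_ + _).
  rewrite [in RHS]big_ord_recr /= subnn mul0r mulr0 addr0; apply: eq_bigr => s _.
  by rewrite -subSn// -ltnS.
rewrite [in RHS]big_ord_recl mul0r add0r; apply: eq_bigr => s _.
rewrite /= /bump !add1n subSS factS natrM exprS; have := factC_neq0 (R := R) s.
have := natS_neq0 (R := R) s => s0 f0; field.
by rewrite f0 nat1r s0.
Qed.

Lemma cprod_gam al l r : cprod (fun n => (-1) ^+ n * binC al n) (gam 0 l) r = gam al l r.
Proof.
rewrite /gam cprod_sign cprod_sumr; congr (_ * _); apply: eq_bigr => s _.
have := cprod_bet al 0 0 (l - s) r; rewrite addr0 bin0 mul1r add0n => <-.
rewrite /cprod mulr_sumr; apply: eq_bigr => i _; rewrite bet_binC; ring.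
Qed.

Lemma gam00 r : gam 0 0 r = (r == 0%N)%:R.
Proof.
rewrite /gam big_ord1 expr0 fact0 divr1 mul1r bet0_0.
by case: eqP => [->|]; rewrite ?mulr0 // mulr1.
Qed.

(** Multinomial expansion: the coefficient of (log x_i)^p (log x_k)^q t^r in
    (log x_i - log x_k + tau + log(1 - t))^K / K!. *)
Definition dco (K p q r : nat) : C :=
  if (p + q <= K)%N then (-1) ^+ q / (p`! * q`!)%:R * gam 0 (K - p - q) r else 0.

Lemma dco_rec K p q r : K.+1%:R * dco K.+1 p q r =
  cprod lamb (dco K p q) r + (if p is p'.+1 then dco K p' q r else 0) -
  (if q is q'.+1 then dco K p q' r else 0).
Proof.
have -> : cprod lamb (dco K p q) r =
    if (p + q <= K)%N then (-1) ^+ q / (p`! * q`!)%:R * ((K - p - q).+1%:R * gam 0 (K - p - q).+1 r) else 0.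
  rewrite /dco; case: ifP => _; last by rewrite /cprod big1// => i _; rewrite mulr0.
  by rewrite -cprod_lamb /cprod mulr_sumr; apply: eq_bigr => i _; rewrite mulrCA.
set G := gam 0 (K.+1 - p - q) r.
pose D := (-1) ^+ q / (p`! * q`!)%:R * G.
have Hp : (if p is p'.+1 then dco K p' q r else 0) = if (p + q <= K.+1)%N then p%:R * D else 0.
  case: p @G @D => [|p] G D; first by rewrite mul0r if_same.
  rewrite /dco addSn ltnS; case: ifP => // _; rewrite /D /G subSS factS.
  have := natS_neq0 (R := R) p => s0; have := factC_neq0 (R := R) p => f0; have := factC_neq0 (R := R) q => f1.
  rewrite !natrM; field; by rewrite nat1r s0 f0 f1.
have Hq : (if q is q'.+1 then dco K p q' r else 0) = if (p + q <= K.+1)%N then - (q%:R * D) else 0.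
  clear Hp; case: q @G @D => [|q] G D; first by rewrite mul0r oppr0 if_same.
  rewrite /dco addnS ltnS; case: ifP => // _; rewrite /D /G.
  have -> : (K.+1 - p - q.+1 = K - p - q)%N by lia.
  rewrite exprS factS.
  have := natS_neq0 (R := R) q => s0; have := factC_neq0 (R := R) p => f0; have := factC_neq0 (R := R) q => f1.
  rewrite !natrM; field; by rewrite nat1r s0 f0 f1.
rewrite Hp Hq /dco -/G; case: (ltngtP (p + q) K.+1) => [pq|pq|pq].
- have -> : (p + q <= K)%N by [].
  rewrite opprK -addrA -mulrDl -natrD; have -> : (K - p - q).+1 = (K.+1 - p - q)%N by lia.
  rewrite [X in X + _]mulrCA -mulrDl -natrD; congr (_%:R * _); lia.
- have -> : (p + q <= K)%N = false by lia.
  by rewrite oppr0 !addr0 mulr0.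
have -> : (p + q <= K)%N = false by lia.
by rewrite add0r opprK -mulrDl -natrD pq.
Qed.

End Coefficients.

Section Powers.
Variables (i j k : 'I_3) (tau : C).
Hypotheses (ij : i != j) (ik : i != k) (jk : j != k).

Definition mrat (al : C) (r : nat) : mono := xmon i (al - r%:R) + xmon j r%:R.

Definition logc (x : nat + bool) : C :=
  match x with inl r => lamb tau r | inr b => if b then 1 else -1 end.
Definition loge (x : nat + bool) : mono :=
  match x with inl r => mrat 0 r | inr b => if b then lmon i else lmon k end.

Definition lpe (p : nat * nat * nat) : mono := mrat 0 p.2 + lmm i k p.1.1 p.1.2.

Lemma lpeE p q r : lpe (p, q, r) = mrat 0 r + lmm i k p q. Proof. by []. Qed.
Lemma logeL r : loge (inl r) = mrat 0 r. Proof. by []. Qed.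
Lemma logeT : loge (inr true) = lmon i. Proof. by []. Qed.
Lemma logeF : loge (inr false) = lmon k. Proof. by []. Qed.
Lemma mrat1 al r l : (mrat al r).1 l = (if l == i then al - r%:R else 0) + (if l == j then r%:R else 0).
Proof. by rewrite /mrat !monoE. Qed.
Lemma mrat2 al r l : (mrat al r).2 l = 0%N.
Proof. by rewrite /mrat !monoE. Qed.
Definition logE := (lpeE, logeL, logeT, logeF, mrat1, mrat2, monoE, eqxx).

Lemma index3 (l : 'I_3) : [|| l == i, l == j | l == k].
Proof.
apply: contraT; rewrite !negb_or => /and3P[li lj lk].
have : uniq [:: l; i; j; k] by rewrite /= !inE !negb_or li lj lk ij ik jk.
by move/card_uniqP => /= E; have := max_card (mem [:: l; i; j; k]); rewrite E card_ord.
Qed.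

Lemma neqE : ((i == j = false) * (i == k = false) * (j == k = false) *
  (j == i = false) * (k == i = false) * (k == j = false))%type.
Proof. by rewrite !(eq_sym j i) !(eq_sym k i) !(eq_sym k j) (negPf ij) (negPf ik) (negPf jk). Qed.

Lemma mono_ext3 (m m' : mono) : (m.1 i = m'.1 i -> m.1 j = m'.1 j -> m.1 k = m'.1 k ->
  m.2 i = m'.2 i -> m.2 j = m'.2 j -> m.2 k = m'.2 k -> m = m').
Proof.
move=> a1 a2 a3 b1 b2 b3; apply: mono_ext => l; by case/or3P: (index3 l) => /eqP ->.
Qed.

(** Induction on the power; the recursion of the multinomial coefficients is the multiplication by
    one more logarithm. *)
Lemma rep_fpow_log (L : fexpr R C) K : rep L logc loge ->
  rep (fpow L K) (fun p : nat * nat * nat => K`!%:R * dco tau K p.1.1 p.1.2 p.2) lpe.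
Proof.
move=> HL; elim: K => [|K IHK].
  apply: (@rep_regroup _ _ _ _ _ _ _ (fun _ : unit => (0%N, 0%N, 0%N)) _ _ (rep_fcst (1 : C))).
    move=> _ _; rewrite /lpe /mrat; apply: mono_ext3; rewrite !monoE ?eqxx ?neqE //=;
    by rewrite ?subr0 ?addr0 ?add0r.
  move=> [[p q] r]; exists (if (p, q, r) == (0, 0, 0)%N then [:: tt] else [::]); split.
  - by case: ifP.
  - by move=> [] <-; rewrite eqxx.
  rewrite /= /dco mul1r leqn0 addn_eq0; case: p => [|p] //=; last by rewrite big_nil.
  case: q => [|q] //=; last by rewrite big_nil.
  rewrite gam00 expr0 fact0 divr1 mul1r; case: r => [|r] //=; last by rewrite big_nil.
  by rewrite big_mkcond big_seq1.
have H := rep_fmul HL IHK.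
apply: (@rep_regroup _ _ _ _ _ _ _ (fun x : (nat + bool) * (nat * nat * nat) =>
  match x.1 with
  | inl r => (x.2.1, (x.2.2 + r)%N)
  | inr b => if b then (x.2.1.1.+1, x.2.1.2, x.2.2) else (x.2.1.1, x.2.1.2.+1, x.2.2)
  end) _ _ (H _)).
- move=> m; have [n Hn] := nat_of_C (m.1 j).
  have [s1 Hs1] : exists s : seq (nat + bool), forall x : nat + bool,
      (if x is inl r then (r <= n)%N else true) -> x \in s.
    have [t Ht] := nat_list n; exists (map inl t ++ [:: inr true; inr false]).
    by case=> [r /Ht rt|[]] *; rewrite mem_cat ?map_f// orbT.
  have [s2 Hs2] := box_list (m.2 i) (m.2 k) n; have [s Hs] := pair_list s1 s2.
  exists s => -[x [[p q] r]] xm _.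
  have mi := congr1 (fun m : mono => m.2 i) xm; have mk := congr1 (fun m : mono => m.2 k) xm.
  have mj := congr1 (fun m : mono => m.1 j) xm.
  case: x {xm} mi mk mj => [r'|b] mi mk mj.
    rewrite !logE !neqE !(addn0, add0n, addr0, add0r) /= in mi mk mj.
    have rn : (r' + r)%N = n by apply: Hn; rewrite natrD.
    by apply: Hs; [apply: Hs1|apply: Hs2]; lia.
  have rn : r = n.
    apply: Hn; rewrite -mj.
    by case: b {mi mk mj}; rewrite !logE !neqE !(addr0, add0r).
  apply: Hs; first exact: Hs1.
  by apply: Hs2; rewrite ?rn// -?mi -?mk; case: b {mi mk mj}; rewrite !logE !neqE /=; lia.
- move=> [[r'|[]] [[p q] r]] _; rewrite [_.1]/= [_.2]/= ?logE.
  + by apply: mono_ext3; rewrite !logE ?neqE /= ?(addr0, add0r, natrD); first [done|ring|lia].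
  + by apply: mono_ext3; rewrite !logE ?neqE /= ?(addr0, add0r, natrD); first [done|ring|lia].
  by apply: mono_ext3; rewrite !logE ?neqE /= ?(addr0, add0r, natrD); first [done|ring|lia].
move=> [[p q] r].
pose A : seq ((nat + bool) * (nat * nat * nat)) :=
  [seq (inl r', (p, q, (r - r')%N)) | r' <- iota 0 r.+1].
pose B : seq ((nat + bool) * (nat * nat * nat)) :=
  if p is p'.+1 then [:: (inr true, (p', q, r))] else [::].
pose B' : seq ((nat + bool) * (nat * nat * nat)) :=
  if q is q'.+1 then [:: (inr false, (p, q', r))] else [::].
exists (A ++ (B ++ B')); split.
- rewrite !cat_uniq; apply/and3P; split.
  + by rewrite map_inj_uniq ?iota_uniq// => x y [].
  + apply/hasPn => x; rewrite mem_cat /B /B' => H1; apply/mapP => -[r' _ xE]; move: H1.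
    by rewrite xE; case: (p) => [|?]; case: (q) => [|?]; rewrite ?inE.
  by rewrite /B /B'; case: (p) => [|?]; case: (q) => [|?].
- move=> [[r'|[]] [[p' q'] r'']] E _; rewrite !mem_cat; case: E => pE qE rE.
  + apply/orP; left; apply/mapP; exists r'; first by rewrite mem_iota; lia.
    by rewrite -pE -qE -rE addnK.
  + by rewrite /B -pE -qE -rE mem_seq1 eqxx orbT.
  by rewrite /B' -pE -qE -rE mem_seq1 eqxx !orbT.
rewrite !sum_cat_cond factS natrM -mulrA mulrCA (dco_rec tau K p q r).
rewrite mulrDr mulrDr -addrA; congr (_ + (_ + _)).
- rewrite /A big_map big_mkcond -{1}[r.+1]subn0 -[iota _ _]/(index_iota 0 r.+1) big_mkord /cprod mulr_sumr.
  apply: eq_bigr => -[r' r'r] _ /=; rewrite subnK// eqxx; exact: mulrCA.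
- rewrite /B; case: (p) => [|p'] /=; first by rewrite mulr0 big_nil.
  by rewrite big_mkcond big_seq1 /= eqxx mul1r.
rewrite /B'; case: (q) => [|q'] /=; first by rewrite oppr0 mulr0 big_nil.
by rewrite big_mkcond big_seq1 /= eqxx mulN1r mulrN.
Qed.

(** The exponent of x_k determines the summation index of the delta function, which makes the
    family locally finite. *)
Lemma rep_fdelta (b : @Defs.binomial R) (h : C -> nat -> C) :
  (forall al, rep (bpow b al) (h al) (mrat al)) ->
  rep (fdelta k b) (fun p : int * nat => h p.1%:~R p.2)
    (fun p => xmon k (- p.1%:~R - 1) + mrat p.1%:~R p.2).
Proof.
move=> Hb; have xN (a : C) : xmon k (- a) + xmon k a = 0 by exact: xmonN.
have H n := rep_fmul_monol 1 (xN (- n%:~R - 1)) (Hb (n : int)%:~R).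
apply: rep_ext (rep_fsum (J := int) H _) _ _ => [m|[n r]|//] /=; last by rewrite mul1r.
have [n Hn] := int_of_C (- m.1 k - 1); have [r Hr] := nat_of_C (m.1 j).
exists [:: (n, r)] => -[n' r'] pm _; rewrite mem_seq1 xpair_eqE.
have mk := congr1 (fun m : mono => m.1 k) pm; have mj := congr1 (fun m : mono => m.1 j) pm.
rewrite !logE !neqE !(addr0, add0r) /= in mk mj.
by rewrite (Hr r' mj) (Hn n') ?eqxx// -mk; ring.
Qed.

Lemma mrat_inj al : injective (mrat al).
Proof.
move=> r r' /(congr1 (fun m : mono => m.1 j)); rewrite ?/mrat !monoE eqxx (eq_sym j i) (negPf ij) !add0r.
by move/eqP; rewrite (eqr_nat C) => /eqP.
Qed.

Lemma rep_binpow (c a : C) : rep (binpow i j c a) (fun m : nat => binC a m * c ^+ m) (mrat a).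
Proof. exact: rep_fsum_mono (@mrat_inj a). Qed.

Lemma rep_binlog (c : C) : rep (binlog i j c)
  (fun x : unit + nat => match x with inl _ => 1
     | inr m => (-1) ^+ m * c ^+ m.+1 / m.+1%:R end)
  (fun x => match x with inl _ => lmon i | inr m => mrat 0 m.+1 end).
Proof.
apply: rep_ext (rep_fadd (rep_mono (1 : C) (lmon i)) (rep_fsum_mono (e := fun m : nat => xmon i (- m.+1%:R) + xmon j m.+1%:R) _ _)) _ _.
- move=> r r' /(congr1 (fun m : mono => m.1 j)); rewrite ?/mrat !monoE eqxx (eq_sym j i) (negPf ij) !add0r.
  by move/eqP; rewrite (eqr_nat C) => /eqP[].
- by [].
by case=> [//|m] _; rewrite /mrat sub0r.
Qed.

End Powers.

Lemma rep_bpow_bsub (i j : 'I_3) al : i != j -> rep (bpow (bsub i j) al)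
  (fun r : nat => cexp (0 * al) * ((-1) ^+ r * binC al r)) (mrat i j al).
Proof.
by move=> ij; apply: rep_ext (rep_binpow ij (-1) al) _ _ => // r; rewrite mul0r cexp0 mul1r mulrC.
Qed.

Lemma rep_bpow_bnegadd (i j : 'I_3) al : i != j -> rep (bpow (bnegadd i j) al)
  (fun r : nat => cexp (pi_i * al) * ((-1) ^+ r * binC al r)) (mrat i j al).
Proof.
move=> ij; apply: rep_ext (rep_fmul_cstr _ (rep_binpow ij (-1) al)) _ _ => // r.
by rewrite mulrC [binC al r * _]mulrC.
Qed.

Lemma rep_bpow_badd (i j : 'I_3) al : i != j -> rep (bpow (badd i j) al)
  (fun r : nat => binC al r) (mrat i j al).
Proof.
by move=> ij; apply: rep_ext (rep_binpow ij 1 al) _ _ => // r; rewrite expr1n mulr1.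
Qed.

Lemma lambS tau m : lamb tau m.+1 = (-1) ^+ m * (-1) ^+ m.+1 / m.+1%:R.
Proof. by rewrite /lamb /= addr0 bet01; rewrite mulrA [(-1) ^+ m.+1 * _]mulrC. Qed.

Lemma lamb0 tau : lamb tau 0 = tau.
Proof. by rewrite /lamb bet0 mulr0 add0r. Qed.

Lemma rep_blog_bsub (i j k : 'I_3) : i != j ->
  rep (Defs.fsub (blog (bsub i j)) (flog k)) (logc 0) (loge i j k).
Proof.
move=> ij; have H := rep_fsub (rep_binlog ij (-1)) (rep_mono (1 : C) (lmon k)).
apply: (@rep_regroup _ _ _ _ _ _ _ (fun x : (unit + nat) + unit =>
  match x with inl (inl _) => inr true | inl (inr m) => inl m.+1 | inr _ => inr false end) _ _ H).
  by move=> [[[]|m]|[]].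
move=> [[|m]|[]].
- by exists [::]; split=> [//|[[[]|m]|[]] //|]; rewrite big_nil /= lamb0.
- exists [:: inl (inr m)]; split=> [//|[[[]|m']|[]] // [->] _|]; first by rewrite mem_seq1.
  by rewrite big_mkcond big_seq1 /= eqxx lambS.
- exists [:: inl (inl tt)]; split=> [//|[[[]|m']|[]] //|]; by rewrite big_mkcond big_seq1.
exists [:: inr tt]; split=> [//|[[[]|m']|[]] //|]; by rewrite big_mkcond big_seq1.
Qed.

Lemma rep_blog_bnegadd (i j k : 'I_3) : i != j ->
  rep (Defs.fsub (blog (bnegadd i j)) (flog k)) (logc pi_i) (loge i j k).
Proof.
move=> ij.
have H := rep_fsub (rep_fadd (rep_binlog ij (-1)) (rep_fcst (pi_i : C))) (rep_mono (1 : C) (lmon k)).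
apply: (@rep_regroup _ _ _ _ _ _ _ (fun x : ((unit + nat) + unit) + unit =>
  match x with inl (inl (inl _)) => inr true | inl (inl (inr m)) => inl m.+1
  | inl (inr _) => inl 0%N | inr _ => inr false end) _ _ H).
  move=> [[[[]|m]|[]]|[]] //= _; apply: mono_ext => l; rewrite !logE ?subr0 //.
  by rewrite !if_same addr0.
move=> [[|m]|[]].
- exists [:: inl (inr tt)]; split=> [//|[[[[]|m']|[]]|[]] //|]; by rewrite big_mkcond big_seq1 /= lamb0.
- exists [:: inl (inl (inr m))]; split=> [//|[[[[]|m']|[]]|[]] // [->] _|]; first by rewrite mem_seq1.
  by rewrite big_mkcond big_seq1 /= eqxx lambS.
- exists [:: inl (inl (inl tt))]; split=> [//|[[[[]|m']|[]]|[]] //|]; by rewrite big_mkcond big_seq1.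
exists [:: inr tt]; split=> [//|[[[[]|m']|[]]|[]] //|]; by rewrite big_mkcond big_seq1.
Qed.

End LogBinomials.

(** * The operator powers of a formal binomial *)

Lemma sum_iota0 (A : nmodType) n (F : nat -> A) :
  \sum_(l <- iota 0 n) F l = \sum_(l < n) F l.
Proof. by rewrite -{1}[n]subn0 -[iota _ _]/(index_iota 0 n) big_mkord. Qed.

Section PowersOfL.
Context {R : realType}.
Local Notation C := R[i].
Local Notation mono := (monomial R).
Context {V : lmodType C} {VA : vertex_superalgebra V} (g : automorphism VA).
Local Notation subspace := Defs.subspace.
Local Notation T := (aut g).
Local Notation N := (nilN T).
Local Notation ob := (@obin _ _ _ g).

(** The operator e^{tau N}, a finite sum on every vector. *)
Definition eN (tau : C) (x : V) : V :=
  \sum_(s < projT1 (cid (N_nilp g x))) (tau ^+ s / s`!%:R) *: iter s N x.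

Lemma eNE K tau x : iter K N x = 0 -> eN tau x = \sum_(s < K) (tau ^+ s / s`!%:R) *: iter s N x.
Proof.
move=> HK; apply: (sum_ord_bounds (G := fun s => (tau ^+ s / s`!%:R) *: iter s N x)) => s ss.
  by rewrite (iterN_zero ss (projT2 (cid (N_nilp g x)))) scaler0.
by rewrite (iterN_zero ss HK) scaler0.
Qed.

Lemma nilp2 x y : exists K, iter K N x = 0 /\ iter K N y = 0.
Proof.
have [K HK] := N_nilp g x; have [L HL] := N_nilp g y; exists (K + L)%N; split.
  by apply: iterN_zero HK; rewrite leq_addr.
by apply: iterN_zero HL; rewrite leq_addl.
Qed.

Lemma eN_linear tau : linear (eN tau).
Proof.
move=> a x y; have [K [Hx Hy]] := nilp2 x y.
rewrite (eNE _ Hx) (eNE _ Hy) (eNE (K := K)) ?(Nlin g) ?Hx ?Hy ?scaler0 ?addr0//.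
rewrite scaler_sumr -sum_add; apply: eq_bigr => s _.
by rewrite (Nlin g s) scalerDr !scalerA mulrC.
Qed.

Lemma iter_eN k tau x : iter k N (eN tau x) = eN tau (iter k N x).
Proof.
have [K HK] := N_nilp g x.
rewrite (eNE _ HK) (eNE (K := K)); last first.
  by rewrite -iterD addnC iterD HK (lin0 (Nlin g k)).
rewrite (lin_sum _ _ _ (Nlin g k)); apply: eq_bigr => s _.
by rewrite (linZ _ _ (Nlin g k)) -!iterD addnC.
Qed.

Lemma eN_zero K tau x : iter K N x = 0 -> iter K N (eN tau x) = 0.
Proof. by move=> H; rewrite iter_eN H (lin0 (eN_linear tau)). Qed.

Lemma eN_subspace (U : set V) tau x : subspace U -> (forall y, U y -> U (N y)) -> U x -> U (eN tau x).
Proof.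
move=> sU NU Ux; apply: subspace_sum => // s _; apply: subspaceZ => //.
by elim: {s}(s : nat) => //= s; apply: NU.
Qed.

Lemma sum_gam tau al r K x : iter K N x = 0 ->
  \sum_(l < K) gam tau al l r *: iter l N x = (-1) ^+ r *: ob al r (eN tau x).
Proof.
move=> HK; rewrite (obinE _ _ (eN_zero tau HK)) (eNE _ HK).
transitivity ((-1) ^+ r *: \sum_(t < K) \sum_(s < K)
    (tau ^+ s / s`!%:R * bet al t r) *: iter (s + t) N x); last first.
  congr (_ *: _); apply: eq_bigr => t _; rewrite (lin_sum _ _ _ (Nlin g t)) scaler_sumr.
  by apply: eq_bigr => s _; rewrite (linZ _ _ (Nlin g t)) -iterD scalerA mulrC addnC.
rewrite exchange_big /=.
rewrite (sum_triangle (H := fun s t => (tau ^+ s / s`!%:R * bet al t r) *: iter (s + t) N x)); last first.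
  by move=> s t st; rewrite (iterN_zero st HK) scaler0.
rewrite scaler_sumr; apply: eq_bigr => l _; rewrite /gam -scalerA scaler_suml; congr (_ *: _).
by apply: eq_bigr => -[s sl] _ /=; rewrite subnKC.
Qed.

Section Power.
Variables (i j k : 'I_3) (tau : C) (b : @Defs.binomial R).
Hypotheses (ij : i != j) (ik : i != k) (jk : j != k).
Hypothesis b_pow : forall al, rep (bpow b al)
  (fun r : nat => cexp (tau * al) * ((-1) ^+ r * binC al r)) (mrat i j al).
Hypothesis b_log : rep (Defs.fsub (blog b) (flog k)) (logc tau) (loge i j k).
Variable u : V.
Local Notation cmp := (component strip (geneig T) u).

(** The term of (b / x_k)^L u at the g-weight al, the r-th power of x_j, and the powers p and q of
    log x_i and log x_k. The factor e^{tau N} comes from the constant tau in the logarithm. *)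
Definition powc (x : C * nat * nat * nat) : V :=
  let: (al, r, p, q) := x in
  ((-1) ^+ q / (p`! * q`!)%:R) *: (((-1) ^+ r * cexp (tau * al)) *:
     ob al r (eN tau (iter (p + q) N (cmp al)))).

Definition powe (x : C * nat * nat * nat) : mono :=
  let: (al, r, p, q) := x in mrat i j al r + xmon k (- al) + lmm i k p q.

Lemma cmp_support : exists (s : seq C) (K : nat), forall al l, iter l N (cmp al) != 0 ->
  al \in s /\ (l < K)%N.
Proof.
have [s [us Hs]] := finite_set_seq (component_finite (g_direct g) u).
have [K HK] := nilp_common (s := s) (F := N) (f := cmp) (Nlin g 1) (fun al _ => N_nilp g (cmp al)).
exists s, K => al l H.
have als : al \in s.
  by apply/Hs => /=; apply: contraNneq H => ->; rewrite (lin0 (Nlin g l)).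
by split=> //; rewrite ltnNge; apply: contra H => Kl; rewrite (iterN_zero Kl (HK al als)).
Qed.

Lemma rep_fpowL : rep (fpowL T k b u) powc powe.
Proof.
have [n0 Hbox] := nat_list 0.
have xN al : xmon k al + xmon k (- al) = 0 :> mono by rewrite addrC xmonN.
have H1 al := rep_fmul_monor (1 : C) (xN al) (b_pow al).
have H2 l := rep_fmul_cstl ((l`!)%:R^-1 : C) (rep_fpow_log ij ik jk l b_log).
have H3 (x : C * nat) := rep_fmul (H1 x.1) (H2 x.2).
pose cf (x : C * nat) (y : nat * (nat * nat * nat)) : C :=
  cexp (tau * x.1) * ((-1) ^+ y.1 * binC x.1 y.1) * 1 *
  ((x.2)`!%:R^-1 * (x.2)`!%:R * dco tau x.2 y.2.1.1 y.2.1.2 y.2.2).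
pose ef (x : C * nat) (y : nat * (nat * nat * nat)) : mono :=
  mrat i j x.1 y.1 + xmon k (- x.1) + lpe i j k y.2.
have efE x y m : ef x y = m -> [/\ (y.1 + y.2.2)%N%:R = m.1 j :> C,
    y.2.1.1 = m.2 i & y.2.1.2 = m.2 k].
  move: y => [r [[p q] r']] <-; rewrite /ef !(logE, lpeE) !(neqE ij ik jk) /=.
  by rewrite !(addr0, add0r, addn0, add0n) natrD.
have cov m : exists s : seq (nat * (nat * nat * nat)), forall x y, ef x y = m -> y \in s.
  have [n Hn] := nat_of_C (m.1 j); have [s Hs] := nat_list n.
  have [t Ht] := box_list (m.2 i) (m.2 k) n; have [v Hv] := pair_list s t.
  exists v => x [r [[p q] r']] /efE[/= /Hn rr pE qE].
  by apply: Hv; [apply: Hs|apply: Ht]; rewrite -?rr -?pE -?qE ?leq_addr ?leq_addl.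
have {}H3 x : rep (fmul (fmul (bpow b x.1) (xpow k (- x.1)))
    (fmul (fcst (x.2)`!%:R^-1) (fpow (Defs.fsub (blog b) (flog k)) x.2))) (cf x) (ef x).
  apply: rep_ext (H3 x _) _ _ => [m|[r [[p q] r']]|//]; last by rewrite /cf /=; congr (_ * _); exact: mulrA.
  by have [s Hs] := cov m; exists s => y ym _; apply: Hs ym.
have H4 x := rep_fscale_cstr (iter x.2 N (cmp x.1)) (H3 x).
have [s [K HsK]] := cmp_support.
have H5 := rep_fsum (J := (C * nat)%type) H4 _.
apply: (@rep_regroup _ _ _ _ _ _ _ (fun x : (C * nat) * (nat * (nat * nat * nat)) =>
  (x.1.1, (x.2.1 + x.2.2.2)%N, x.2.2.1.1, x.2.2.1.2)) _ _ (H5 _)).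
- move=> m; have [t Ht] := cov m; have [v Hv] := nat_list K; have [z Hz] := pair_list s v.
  have [y Hy] := pair_list z t; exists y => -[[al l] y'] ym cn; apply: Hy; last exact: Ht ym.
  have [als lK] : al \in s /\ (l < K)%N.
    by apply: HsK; apply: contraNneq cn => /= ->; rewrite scaler0.
  by apply: Hz => //; apply: Hv; apply: ltnW.
- move=> [[al l] [r [[p q] r']]] _ /=; rewrite /ef /powe lpeE /mrat /=.
  apply: (mono_ext3 ij ik jk); rewrite !logE !(neqE ij ik jk) ?(addr0, add0r, natrD) //; ring.
move=> [[[al r] p] q].
exists [seq ((al, l), (r', (p, q, (r - r')%N))) | l <- iota 0 (K + (p + q)), r' <- iota 0 r.+1]; split.
- by apply: allpairs_uniq; rewrite ?iota_uniq// => -[a a'] [c c'] _ _ [-> ->].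
- move=> [[al' l] [r' [[p' q'] r'']]] [-> <- -> ->] cn.
  have [als lK] : al \in s /\ (l < K)%N.
    by apply: HsK; apply: contraNneq cn => /= ->; rewrite scaler0.
  apply/allpairsP; exists (l, r').
  by split; [rewrite mem_iota /=; lia|rewrite mem_iota /=; lia|rewrite /= addKn].
rewrite big_mkcond big_allpairs_dep.
rewrite [RHS]sum_iota0.
pose c0 : C := (-1) ^+ q / (p`! * q`!)%:R.
transitivity (\sum_(l < K + (p + q) | (p + q <= l)%N)
    (c0 * cexp (tau * al) * gam tau al (l - (p + q)) r) *: iter l N (cmp al)); last first.
  rewrite big_mkcond; apply: eq_bigr => l _; rewrite [RHS]sum_iota0.
  pose cc (r' : nat) := cf (al, nat_of_ord l) (r', (p, q, (r - r')%N)).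
  transitivity (\sum_(r' < r.+1) cc r' *: iter l N (cmp al)); last first.
    by apply: eq_bigr => -[r' r'r] _ /=; rewrite subnKC ?eqxx.
  rewrite -scaler_suml.
  have -> : \sum_(r' < r.+1) cc r' =
     cexp (tau * al) * cprod (fun n => (-1) ^+ n * binC al n) (dco tau l p q) r.
    rewrite /cprod mulr_sumr; apply: eq_bigr => r' _; rewrite /cc /cf /= mulVf ?factC_neq0//; ring.
  rewrite /dco; case: ifP => pq; last first.
    by rewrite /cprod big1 ?mulr0 ?scale0r// => i' _; rewrite mulr0.
  congr (_ *: _); rewrite -subnDA -(cprod_gam tau al) /cprod !mulr_sumr.
  by apply: eq_bigr => r' _; rewrite /c0; ring.
rewrite (sum_shift (fun l => (c0 * cexp (tau * al) * gam tau al (l - (p + q)) r) *: iter l N (cmp al))) ?leq_addl//.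
rewrite addnK /powc.
have HK : iter K N (iter (p + q) N (cmp al)) = 0.
  rewrite -iterD; apply/eqP; apply: contraT => /HsK[_]; lia.
rewrite [(-1) ^+ r * _]mulrC -(scalerA (cexp (tau * al)) ((-1) ^+ r)) -(sum_gam _ _ _ HK) scalerA scaler_sumr.
by apply: eq_bigr => l _; rewrite addnK (iterD l (p + q)) !scalerA.
Qed.

End Power.
End PowersOfL.

(** * Vertex operators and the twist map as families *)

Section PartialSums.
Context {R : realType}.
Local Notation C := R[i].
Context {U : lmodType C} {I : choiceType} {D : set I} {Us : I -> set U}.
Hypothesis ds : direct_sum D Us.
Local Notation cmp := (component D Us).
Variable Q : set I.

Definition part (v : U) : U := \sum_(i \in Q) cmp v i.

Lemma partE v (t : seq I) : uniq t -> (forall i, cmp v i != 0 -> i \in t) ->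
  part v = \sum_(i <- t) if `[< Q i >] then cmp v i else 0.
Proof.
move=> ut Ht; rewrite -big_mkcond -big_filter; apply: fsbig_seqE.
- by rewrite filter_uniq.
- by move=> i; rewrite mem_filter => /andP[/asboolP].
by move=> i Qi ci; rewrite mem_filter Ht// andbT; apply/asboolP.
Qed.

Lemma part_linear : linear part.
Proof.
move=> a x y; have [s [us Hx Hy]] := finite_set_seq2 (component_finite ds x) (component_finite ds y).
rewrite (partE us Hx) (partE us Hy) (partE us); last first.
  move=> i; rewrite (component_linear ds).
  have [->|/Hx//] := eqVneq (cmp x i) 0; rewrite scaler0 add0r; exact: Hy.
rewrite scaler_sumr -sum_add; apply: eq_bigr => i _; rewrite (component_linear ds).
by case: ifP => _; rewrite ?scaler0 ?addr0.
Qed.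

Lemma part_id v : (forall i, ~ Q i -> cmp v i = 0) -> part v = v.
Proof.
move=> H; have [s [us Hs]] := finite_set_seq (component_finite ds v).
rewrite (partE us) => [|i /Hs//]; rewrite [RHS](component_sum ds us) => [|i /Hs//].
by apply: eq_bigr => i _; case: asboolP => // /H ->.
Qed.

Lemma part_zero v : (forall i, Q i -> cmp v i = 0) -> part v = 0.
Proof.
move=> H; have [s [us Hs]] := finite_set_seq (component_finite ds v).
by rewrite (partE us) => [|i /Hs//]; apply: big1 => i _; case: asboolP => // /H ->.
Qed.

End PartialSums.

Section VertexSeries.
Context {R : realType}.
Local Notation C := R[i].
Local Notation mono := (monomial R).
Context {V W : lmodType C} {VA : vertex_superalgebra V} {g : automorphism VA}.
Variable M : twisted_module g W.
Local Notation T := (aut g).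
Local Notation N := (nilN T).
Local Notation L := (LWm1 M).
Hypothesis Mlb : lower_bounded M.

Definition lmo (i : 'I_3) (p : nat) : mono := (0, [ffun l => if l == i then p else 0%N]).
Lemma lmo1 i p l : (lmo i p).1 l = 0. Proof. by rewrite ffunE. Qed.
Lemma lmo2 i p l : (lmo i p).2 l = if l == i then p else 0%N. Proof. by rewrite ffunE. Qed.

Lemma lmoS i p : lmon i + lmo i p = lmo i p.+1.
Proof.
apply: mono_ext => l; first by rewrite /= !ffunE addr0.
by rewrite /= !ffunE; case: (l == i).
Qed.

Lemma rep_fpow_flog (i : 'I_3) k :
  rep (fpow (flog i : fexpr R C) k) (fun _ : unit => 1) (fun=> lmo i k).
Proof.
elim: k => [|k IHk].
  apply: rep_ext (rep_fcst (1 : C)) _ _ => // _ _; apply: mono_ext => l.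
    by rewrite [RHS]lmo1; exact: mono01.
  by rewrite [RHS]lmo2 if_same; exact: mono02.
have H := rep_fmul (rep_mono (1 : C) (lmon i)) IHk.
apply: (@rep_regroup _ _ _ _ _ _ _ (fun _ : unit * unit => tt) _ _ (H _)) => [m|[[] []] _|[]].
- by exists [:: (tt, tt)] => -[[] []].
- exact: lmoS.
by exists [:: (tt, tt)]; split=> [//|[[] []]//|]; rewrite big_mkcond big_seq1 /= mulr1.
Qed.

Lemma rep_fpow_flogc (i : 'I_3) (c : C) k :
  rep (fpow (fadd (flog i) (fcst c)) k) (fun p : nat => 'C(k, p)%:R * c ^+ (k - p)) (lmo i).
Proof.
elim: k => [|k IHk].
  apply: (@rep_regroup _ _ _ _ _ _ _ (fun _ : unit => 0%N) _ _ (rep_fcst (1 : C))).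
    move=> _ _; apply: mono_ext => l; first by rewrite [RHS]lmo1; exact: mono01.
    by rewrite [RHS]lmo2 if_same; exact: mono02.
  move=> [|p].
    exists [:: tt]; split=> [//|[]//|]; by rewrite big_mkcond big_seq1 /= bin0 mul1r.
  by exists [::]; split=> [//|[]//|]; rewrite big_nil /= mul0r.
have H := rep_fmul (rep_fadd (rep_mono (1 : C) (lmon i)) (rep_fcst c)) IHk.
apply: (@rep_regroup _ _ _ _ _ _ _ (fun x : (unit + unit) * nat =>
  match x.1 with inl _ => x.2.+1 | inr _ => x.2 end) _ _ (H _)) => [m|[[[]|[]] p] _|p].
- have [s Hs] := nat_list (m.2 i).
  have [t Ht] := pair_list [:: inl tt; inr tt : (unit + unit)%type] s.
  exists t => -[x p] pm _; apply: Ht; first by case: x {pm} => -[].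
  apply: Hs; rewrite -(congr1 (fun m : mono => m.2 i) pm).
  by case: x {pm} => -[]; rewrite !(lmo2, monoE) eqxx /= ?leq_addl.
- exact: lmoS.
- exact: add0r.
exists ((if p is p'.+1 then [:: (inl tt, p')] else [::]) ++ [:: (inr tt, p)]); split.
- by case: p.
- by move=> [[[]|[]] q] /= <- _; rewrite ?mem_cat !inE eqxx ?orbT.
rewrite sum_cat_cond big_mkcond [X in _ + X]big_mkcond big_seq1 /= eqxx.
case: p => [|p]; first by rewrite big_nil add0r !bin0 !subn0 !mul1r exprS.
rewrite big_seq1 /= eqxx mul1r binS subSS natrD mulrDl addrC; congr (_ + _).
have [pk|kp] := ltnP p k; last by rewrite bin_small// !mul0r mulr0.
by rewrite mulrCA -exprS; congr (_ * _ ^+ _); lia.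
Qed.

Lemma rep_YVser (i : 'I_3) (v w : V) :
  rep (YVser VA i v w) (fun n : int => YV VA v n w) (fun n => xmon i n%:~R).
Proof.
apply: rep_fsum_mono => n n' /(congr1 (fun m : mono => m.1 i)); rewrite !monoE eqxx.
by move/eqP; rewrite (eqr_int C) => /eqP.
Qed.

Definition ye (i : 'I_3) (x : C * nat) : mono := xmon i x.1 + lmo i x.2.

Lemma ye1 i x l : (ye i x).1 l = if l == i then x.1 else 0.
Proof. by rewrite /ye monoD1 xmon1 lmo1 addr0. Qed.
Lemma ye2 i x l : (ye i x).2 l = if l == i then x.2 else 0%N.
Proof. by rewrite /ye monoD2 xmon2 lmo2 add0n. Qed.

Lemma rep_YWser (i : 'I_3) (v : V) (w : W) :
  rep (YWser M i v w) (fun x : C * nat => YW M v x.1 x.2 w) (ye i).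
Proof.
have H (x : C * nat) := rep_fscale_cstr (YW M v x.1 x.2 w)
  (rep_fmul_monol (1 : C) (xmonN i x.1) (rep_fpow_flog i x.2)).
have {}H := rep_fsum (J := (C * nat)%type) H _.
apply: (@rep_regroup _ _ _ _ _ _ _ (fun x : (C * nat) * unit => x.1) _ _ (H _)) => [m|[x []]//|x].
  exists [:: ((m.1 i, m.2 i), tt)] => -[[b k] []] <- _.
  by rewrite -[xmon i _ + lmo i _]/(ye i (b, k)) ye1 ye2 eqxx mem_seq1.
exists [:: (x, tt)]; split=> [//|[y []] <- _|]; first by rewrite mem_seq1.
by rewrite big_mkcond big_seq1 /= eqxx mulr1 scale1r.
Qed.

(** The coefficient of x^b (log x)^k in Y_W(v, e^{pi i} x)w: the substitution of log x + pi i for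
    log x amounts to inserting e^{- pi i N}. *)
Definition yn (x : C * nat) (v : V) (w : W) : W := cexp (pi_i * x.1) *:
  YW M (((-1) ^+ x.2 / x.2`!%:R) *: iter x.2 N (eN g (- pi_i) v)) x.1 0 w.

Lemma yn_linl x w : linear (fun v => yn x v w).
Proof.
move=> a u v; rewrite /yn (eN_linear g _ a u v) (Nlin g) scalerDr.
rewrite (linD _ _ (YWlin_l M _ _ w)) scalerDr; congr (_ + _).
rewrite !scalerA !(linZ _ _ (YWlin_l M x.1 0%N w)) !scalerA; congr (_ *: _); ring.
Qed.

Lemma yn_linr x v : linear (yn x v).
Proof.
move=> a u w; rewrite /yn (YWlin_r M _ _ _) scalerDr !scalerA; congr (_ *: _ + _).
exact: mulrC.
Qed.

Lemma rep_YWneg (i : 'I_3) (v : V) (w : W) :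
  rep (YWneg M i v w) (fun x : C * nat => yn x v w) (ye i).
Proof.
have H (x : C * nat) := rep_fscale_cstr (YW M v x.1 x.2 w)
  (rep_fmul_monol (cexp (pi_i * x.1)) (xmonN i x.1) (rep_fpow_flogc i pi_i x.2)).
have {}H := rep_fsum (J := (C * nat)%type) H _.
have [K HK] := YW_log M v w; have [K' NK'] := N_nilp g v.
apply: (@rep_regroup _ _ _ _ _ _ _ (fun x : (C * nat) * nat => (x.1.1, x.2)) _ _ (H _)) => [m|[[b k] p] _ //|[b p]].
  have [s Hs] := nat_list K.
  exists [seq ((m.1 i, k), m.2 i) | k <- s] => -[[b k] p] <- cn.
  rewrite -[xmon i _ + lmo i _]/(ye i (b, p)) ye1 ye2 eqxx; apply/mapP; exists k => //; apply: Hs.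
  by rewrite ltnW// ltnNge; apply: contra cn => /= Kk; rewrite HK// scaler0.
exists [seq ((b, k), p) | k <- iota 0 (K + K' + p)]; split.
- by rewrite map_inj_uniq ?iota_uniq// => k k' [].
- move=> [[b' k] p'] [-> ->] cn; apply/mapP; exists k => //; rewrite mem_iota add0n /=.
  have : (k < K)%N by rewrite ltnNge; apply: contra cn => /= Kk; rewrite HK// scaler0.
  by lia.
rewrite big_map big_mkcond sum_iota0 /yn /=.
transitivity (\sum_(k < K + K' + p | (p <= k)%N) (cexp (pi_i * b) * ('C(k, p)%:R * pi_i ^+ (k - p))) *:
   YW M v b k w); last first.
  rewrite big_mkcond; apply: eq_bigr => k _; rewrite eqxx.
  by case: leqP => // kp; rewrite bin_small// mul0r mulr0 scale0r.
rewrite (sum_shift (fun k => (cexp (pi_i * b) * ('C(k, p)%:R * pi_i ^+ (k - p))) *: YW M v b k w)) ?leq_addl//.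
rewrite addnK (eNE (K := K + K')); last by apply: iterN_zero NK'; rewrite leq_addl.
rewrite (lin_sum _ _ _ (Nlin g p)) scaler_sumr (lin_sum _ _ _ (YWlin_l M b 0%N w)) scaler_sumr.
apply: eq_bigr => l _; rewrite (YW_logE M v w b (l + p)) (linZ _ _ (Nlin g p)) -iterD [(p + l)%N]addnC.
rewrite !(linZ _ _ (YWlin_l M b 0%N w)) !scalerA addnK; congr (_ *: _).
have := bin_fact (leq_addl l p); rewrite addnK => /(congr1 (fun n => n%:R : C)).
rewrite !natrM => E; have := factC_neq0 (R := R) (l + p)%N; rewrite -E !mulf_eq0 !negb_or.
move=> /andP[c0 /andP[p0 l0]]; rewrite exprD -[- pi_i]mulN1r (expC_M (-1) pi_i); field.
by rewrite c0 p0 l0.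
Qed.

(** The coefficients of e^{x L} Y_W(v, e^{pi i} x)w. *)
Definition Tc (x : C * nat) (v : V) (w : W) : W :=
  \sum_(j \in [set: nat]) (j`!%:R^-1) *: iter j L (yn (x.1 - j%:R, x.2) v w).

Lemma iterL_linear j : linear (iter j L).
Proof. by apply: iter_lin => a x y; exact: linearP. Qed.

Lemma yn_trunc v w : exists B : R, forall x, complex.Re x.1 < B -> yn x v w = 0.
Proof.
have [K HK] := N_nilp g (eN g (- pi_i) v).
have [B HB] : exists B : R, forall k b, (k < K)%N -> complex.Re b < B ->
    YW M (iter k N (eN g (- pi_i) v)) b 0 w = 0.
  elim: (K) => [|k [B HB]]; first by exists 0.
  have [B' HB'] := YW_trunc Mlb (iter k N (eN g (- pi_i) v)) w; exists (Num.min B B') => l b.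
  rewrite ltnS leq_eqVlt lt_min => /predU1P[->|lk] /andP[b1 b2]; first exact: HB'.
  exact: HB.
exists B => -[b k] bB; rewrite /yn (linZ _ _ (YWlin_l M _ _ w)) /=.
have [kK|Kk] := ltnP k K; first by rewrite HB ?scaler0.
by rewrite (iterN_zero Kk HK) (lin0 (YWlin_l M _ _ w)) !scaler0.
Qed.

(** Lower truncation makes the exponential series finite, uniformly in the exponent. *)
Lemma TcE v w : exists B : R, forall (x : C * nat) (J : nat), complex.Re x.1 - J%:R < B ->
  Tc x v w = \sum_(j < J) (j`!%:R^-1) *: iter j L (yn (x.1 - j%:R, x.2) v w).
Proof.
have [B HB] := yn_trunc v w; exists B => x J xJ; rewrite -(sum_iota0 J (fun j => (j`!%:R^-1) *: iter j L (yn (x.1 - j%:R, x.2) v w))).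
apply: fsbigT_seqE.
  exact: iota_uniq.
move=> j cn; rewrite mem_iota add0n /= ltnNge; apply: contra cn => Jj.
rewrite HB ?(lin0 (iterL_linear j)) ?scaler0//= Re_add Re_neg -(rmorph_nat (real_complex R)) /=.
have : (J%:R : R) <= j%:R by rewrite ler_nat.
by lra.
Qed.

Lemma TcDl x u v w : Tc x (u + v) w = Tc x u w + Tc x v w.
Proof.
have [B1 H1] := TcE u w; have [B2 H2] := TcE v w; have [B3 H3] := TcE (u + v) w.
have [J HJ] := ex_nat_gt (complex.Re x.1 - Num.min B1 (Num.min B2 B3)).
have : complex.Re x.1 - J%:R < Num.min B1 (Num.min B2 B3) by lra.
rewrite !lt_min => /and3P[b1 b2 b3]; rewrite (H1 x J b1) (H2 x J b2) (H3 x J b3) -sum_add; apply: eq_bigr => j _.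
by rewrite (linD _ _ (yn_linl _ w)) (linD _ _ (iterL_linear j)) scalerDr.
Qed.

Lemma TcDr x v u w : Tc x v (u + w) = Tc x v u + Tc x v w.
Proof.
have [B1 H1] := TcE v u; have [B2 H2] := TcE v w; have [B3 H3] := TcE v (u + w).
have [J HJ] := ex_nat_gt (complex.Re x.1 - Num.min B1 (Num.min B2 B3)).
have : complex.Re x.1 - J%:R < Num.min B1 (Num.min B2 B3) by lra.
rewrite !lt_min => /and3P[b1 b2 b3]; rewrite (H1 x J b1) (H2 x J b2) (H3 x J b3) -sum_add; apply: eq_bigr => j _.
by rewrite (linD _ _ (yn_linr _ v)) (linD _ _ (iterL_linear j)) scalerDr.
Qed.

Lemma Tc0l x w : Tc x 0 w = 0.
Proof. by apply: (addIr (Tc x 0 w)); rewrite -TcDl !add0r. Qed.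
Lemma Tc0r x v : Tc x v 0 = 0.
Proof. by apply: (addIr (Tc x v 0)); rewrite -TcDr !add0r. Qed.

Lemma rep_fexpL (i : 'I_3) v w : rep (fexpL L i (YWneg M i v w)) (fun x => Tc x v w) (ye i).
Proof.
have LD j : forall x y, iter j L (x + y) = iter j L x + iter j L y.
  by move=> x y; exact: (linD x y (iterL_linear j)).
have xN (j : nat) : xmon i (- j%:R) + xmon i j%:R = 0 :> mono by exact: xmonN.
have H (j : nat) := rep_fscale_mono ((j`!)%:R^-1 : C) (xN j)
  (rep_map (lin0 (iterL_linear j)) (LD j) (rep_YWneg i v w)).
have {}H := rep_fsum (J := nat) H _.
have [B HB] := yn_trunc v w; have [B' HB'] := TcE v w.
have jlt (b : C) k (J : nat) j : complex.Re b - J%:R < B -> iter j L (yn (b - j%:R, k) v w) != 0 -> (j < J)%N.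
  move=> bJ cn; rewrite ltnNge; apply: contra cn => Jj; rewrite HB ?(lin0 (iterL_linear j))//=.
  rewrite Re_add Re_neg -(rmorph_nat (real_complex R)) /=.
  have : (J%:R : R) <= j%:R by rewrite ler_nat.
  by lra.
apply: (@rep_regroup _ _ _ _ _ _ _ (fun x : nat * (C * nat) => (x.2.1 + x.1%:R, x.2.2)) _ _ (H _)) => [m|[j [b k]] _|[b k]].
- have [J HJ] := ex_nat_gt (complex.Re (m.1 i) - B); have [s Hs] := nat_list J.
  exists [seq (j, (m.1 i - j%:R, m.2 i)) | j <- s] => -[j [b k]] mE cn.
  have mE' : m = xmon i j%:R + ye i (b, k) by rewrite -mE.
  have bE : m.1 i = b + j%:R by rewrite mE' monoD1 xmon1 ye1 eqxx addrC.
  have kE : m.2 i = k by rewrite mE' monoD2 xmon2 ye2 eqxx.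
  apply/mapP; exists j; last by rewrite bE kE addrK.
  apply/Hs/ltnW/(jlt (m.1 i) k J); first by lra.
  by apply: contraNneq cn; rewrite bE addrK /= => ->; rewrite scaler0.
- apply: mono_ext => l; last by rewrite monoD2 xmon2 !ye2.
  by rewrite monoD1 xmon1 !ye1; case: (l == i); rewrite ?addr0// addrC.
have [J HJ] := ex_nat_gt (complex.Re b - Num.min B B').
have : complex.Re b - J%:R < Num.min B B' by lra.
rewrite lt_min => /andP[b1 b2].
exists [seq (j, (b - j%:R, k)) | j <- iota 0 J]; split.
- by rewrite map_inj_uniq ?iota_uniq// => j j' [].
- move=> [j [b' k']] /= [bE ->] cn; apply/mapP; exists j; last by rewrite -bE addrK.
  rewrite mem_iota add0n /=; apply: (jlt b k J) => //.
  by apply: contraNneq cn; rewrite -bE addrK => ->; rewrite scaler0.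
rewrite (HB' (b, k) J b2) big_map [RHS]big_mkcond [RHS]sum_iota0; apply: eq_bigr => j _ /=.
by rewrite subrK eqxx.
Qed.

(** The sum over parities extends the sign of the twist map bilinearly; on vectors of pure parity
    it has a single term. *)
Definition tw (w : W) (v : V) (x : C * nat) : W :=
  \sum_(st : bool * bool) (-1) ^+ (st.1 && st.2) *: Tc x (Vpart_of VA st.1 v) (Wpart_of M st.2 w).

Lemma Vpart_linear s : linear (Vpart_of VA s).
Proof. exact: (part_linear (Vgr_direct VA)). Qed.
Lemma Wpart_linear s : linear (Wpart_of M s).
Proof. exact: (part_linear (Wgr_direct M)). Qed.

Lemma rep_twist (i : 'I_3) w v : rep (twist M i w v) (tw w v) (ye i).
Proof.
have H (st : bool * bool) := rep_fscale_cstl ((-1) ^+ (st.1 && st.2))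
  (rep_fexpL i (Vpart_of VA st.1 v) (Wpart_of M st.2 w)).
have {}H := rep_fsum (J := (bool * bool)%type) H _.
apply: (@rep_regroup _ _ _ _ _ _ _ (fun x : (bool * bool) * (C * nat) => x.2) _ _ (H _)) => [m|[st x]//|x].
  exists [seq (st, (m.1 i, m.2 i)) | st <- index_enum (bool * bool)%type] => -[st [b k]] <- _.
  by rewrite ye1 ye2 eqxx; apply/mapP; exists st => //; exact: mem_index_enum.
exists [seq (st, x) | st <- index_enum (bool * bool)%type]; split.
- by rewrite map_inj_uniq ?index_enum_uniq// => st st' [].
- by move=> [st y] /= -> _; apply/mapP; exists st => //; exact: mem_index_enum.
by rewrite big_map big_mkcond; apply: eq_bigr => st _; rewrite /= eqxx.
Qed.

Lemma twDl w w' v x : tw (w + w') v x = tw w v x + tw w' v x.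
Proof.
rewrite /tw -sum_add; apply: eq_bigr => st _.
by rewrite (linD _ _ (Wpart_linear _)) TcDr scalerDr.
Qed.
Lemma twDr w v v' x : tw w (v + v') x = tw w v x + tw w v' x.
Proof.
rewrite /tw -sum_add; apply: eq_bigr => st _.
by rewrite (linD _ _ (Vpart_linear _)) TcDl scalerDr.
Qed.
Lemma tw0l v x : tw 0 v x = 0.
Proof. by apply: (addIr (tw 0 v x)); rewrite -twDl !add0r. Qed.
Lemma tw0r w x : tw w 0 x = 0.
Proof. by apply: (addIr (tw w 0 x)); rewrite -twDr !add0r. Qed.

Lemma Vpart_ofE s t v : Vparity VA t v -> Vpart_of VA s v = if s == t then v else 0.
Proof.
move=> Hv; have sub : [set h : int | odd `|h|%N = t] `<=` [set: int] by [].
have c0 := (coprodP (Vgr_direct VA) v sub).1 Hv.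
case: eqVneq => [->|st]; first exact: (part_id (Vgr_direct VA) c0).
apply: (part_zero (Vgr_direct VA)) => h /= hs; apply: c0 => /= ht.
by move: st; rewrite -hs -ht eqxx.
Qed.

Lemma Wpart_ofE s t w : Wparity M t w -> Wpart_of M s w = if s == t then w else 0.
Proof.
move=> Hw; have c0 := (coprodP (Wgr_direct M) w (@Wpart_sub _ _ _ _ _ M [set i | i.1.2 = t])).1 Hw.
case: eqVneq => [->|st].
  have [s' [us' Hs']] := finite_set_seq (component_finite (Wgr_direct M) w).
  apply: (part_id (Wgr_direct M)) => i /= it; apply: c0 => -[_ /= H]; exact: it.
apply: (part_zero (Wgr_direct M)) => i /= hs; apply: c0 => -[_ /= ht].
by move: st; rewrite -hs -ht eqxx.
Qed.

Lemma twE (pv pw : bool) w v x : Vparity VA pv v -> Wparity M pw w ->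
  tw w v x = (-1) ^+ (pv && pw) *: Tc x v w.
Proof.
move=> Hv Hw; rewrite /tw (bigD1 (pv, pw))//= big1 ?addr0 => [|[s t] st]; last first.
  rewrite /= (Vpart_ofE _ Hv) (Wpart_ofE _ Hw); move: st; rewrite xpair_eqE.
  by case: (s == pv); case: (t == pw) => //= _; rewrite ?Tc0l ?Tc0r ?scaler0.
by rewrite (Vpart_ofE _ Hv) (Wpart_ofE _ Hw) !eqxx.
Qed.

End VertexSeries.

(** * Binomials in the nilpotent part *)

Section OperatorBinomials.
Context {R : realType}.
Local Notation C := R[i].
Context {V : lmodType C} {VA : vertex_superalgebra V} (g : automorphism VA).
Local Notation T := (aut g).
Local Notation N := (nilN T).
Local Notation ob := (@obin _ _ _ g).

HB.instance Definition _ := GRing.isLinear.Build C V V *:%R (nilN (aut g)) (N_linear g).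

Lemma ob_pact c i x : ob c i x = pact N (binp (c%:P + 'X) i) x.
Proof.
rewrite (@pactE _ _ _ _ x (i.+1 + size (binp (c%:P + 'X) i))%N) ?leq_addl// /obin.
apply: (sum_ord_bounds (G := fun k => bet c k i *: iter k N x)) => k kk.
  by rewrite bet_big ?scale0r.
by rewrite -/(bet c k i) bet_big ?scale0r//; apply: leq_trans kk; rewrite leq_addr.
Qed.

(** Vandermonde: binom(c + a + N, r) is the convolution of binom(c, -) and binom(a + N, -). *)
Lemma ob_binC c a r x :
  \sum_(i < r.+1) binC c i *: ob a (r - i) x = ob (c + a) r x.
Proof.
rewrite ob_pact polyCD -addrA -binp_vandermonde pact_sum; apply: eq_bigr => i _.
by rewrite pactM binpC pactC ob_pact.
Qed.

(** The recursion of binom(c + N, -) in the lower index, read from the right. *)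
Lemma ob_rec c i x : i.+1%:R *: ob c i.+1 x = ob (c - 1) i (c *: x + N x).
Proof.
have H (p : {poly C}) : i.+1%:R *: binp p i.+1 = binp (p - 1) i * p.
  elim: i p => [|n IHn] p; first by rewrite binpS !binp0 ?mulr0n ?polyC0 subr0 mulr1 mul1r.
  have E := binpS (p - 1) n; rewrite (binpS p n.+1).
  apply: (scalerI (natS_neq0 (R := R) n)); rewrite scalerAr IHn scalerAl E mulrA.
  by congr (_ * _ * _); rewrite -natr1 polyCD polyC1; ring.
rewrite !ob_pact -pactZ H pactM polyCB addrAC; congr (pact _ _ _).
by rewrite pactD pactC pactX.
Qed.

(** The operators N and - N cancel in the Vandermonde convolution, after upper negation of one of
    the binomials; what remains is a scalar. *)
Lemma ob_cancel d c s x :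
  \sum_(i < s.+1) (-1) ^+ i *: ob (- d - 1 + i%:R) i (ob c (s - i) x) = binC (d + c) s *: x.
Proof.
have refl (p : {poly C}) i : (-1) ^+ i *: binp (- p - 1 + i%:R%:P) i = binp p i.
  rewrite /binp scalerA mulrC -scalerA; congr (_ *: _).
  rewrite (reindex_inj rev_ord_inj) /= -mul_polyC rmorphXn /= rmorphN rmorph1.
  rewrite -[X in (-1) ^+ X](card_ord i) -prodrN; apply: eq_bigr => -[j ji] _ /=.
  by rewrite natrB// -natr1 polyCB polyCD polyC1; ring.
rewrite -(pactC N) -binpC polyCD.
have -> : d%:P + c%:P = (d%:P - 'X) + (c%:P + 'X) :> {poly C} by ring.
rewrite -binp_vandermonde pact_sum; apply: eq_bigr => i _; rewrite pactM !ob_pact -pactZ.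
have -> : (- d - 1 + i%:R)%:P + 'X = - (d%:P - 'X) - 1 + i%:R%:P :> {poly C}.
  by rewrite !polyCD !polyCN polyC1; ring.
by rewrite refl.
Qed.

Lemma iter_ob k c i x : iter k N (ob c i x) = ob c i (iter k N x).
Proof.
rewrite /obin (lin_sum _ _ _ (Nlin g k)); apply: eq_bigr => l _.
by rewrite (linZ _ _ (Nlin g k)) -!iterD addnC.
Qed.

Lemma eN_ob tau c i x : eN g tau (ob c i x) = ob c i (eN g tau x).
Proof.
rewrite /obin (lin_sum _ _ _ (eN_linear g tau)); apply: eq_bigr => l _.
by rewrite (linZ _ _ (eN_linear g tau)) iter_eN.
Qed.

Lemma eN0 x : eN g 0 x = x.
Proof.
have [K [K0 HK]] := @nilp_pos _ _ _ g x; rewrite (eNE _ HK) (bigD1 (Ordinal K0))//= big1 ?addr0.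
  by rewrite expr0 fact0 divr1 scale1r.
by move=> i; rewrite -val_eqE /= => /negPf i0; rewrite expr0n i0 mul0r scale0r.
Qed.

(** (1 - 1)^n. *)
Lemma alt_sum n : \sum_(k < n.+1) (k`!%:R^-1 * ((-1) ^+ (n - k) / (n - k)`!%:R)) = (n == 0%N)%:R :> C.
Proof.
have F := factC_neq0 (R := R) n; apply: (mulfI F).
transitivity (\sum_(k < n.+1) (-1) ^+ (n - k) * 1 ^+ k *+ 'C(n, k) : C).
  rewrite mulr_sumr; apply: eq_bigr => -[k kn] _ /=; have {}kn : (k <= n)%N by [].
  rewrite expr1n mulr1 -[RHS]mulr_natr -(bin_fact kn) !natrM.
  have := factC_neq0 (R := R) k; have := factC_neq0 (R := R) (n - k)%N => f1 f2; field.
  by rewrite f1 f2.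
rewrite -exprDn addNr expr0n; case: eqP => [->|_]; last by rewrite mulr0.
by rewrite fact0 mulr1.
Qed.

Lemma eN_inv x : eN g (- pi_i) (eN g pi_i x) = x.
Proof.
have [K [K0 HK]] := @nilp_pos _ _ _ g x; rewrite (eNE _ (eN_zero pi_i HK)) (eNE _ HK).
transitivity (\sum_(s < K) \sum_(t < K)
    ((- pi_i) ^+ s / s`!%:R * (pi_i ^+ t / t`!%:R)) *: iter (s + t) N x).
  apply: eq_bigr => s _; rewrite (lin_sum _ _ _ (Nlin g s)) scaler_sumr; apply: eq_bigr => t _.
  by rewrite (linZ _ _ (Nlin g s)) -iterD scalerA.
rewrite (sum_triangle (H := fun s t => ((- pi_i) ^+ s / s`!%:R * (pi_i ^+ t / t`!%:R)) *: iter (s + t) N x)); last first.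
  by move=> s t st; rewrite (iterN_zero st HK) scaler0.
transitivity (\sum_(n < K) (pi_i ^+ n * (n == 0%N :> nat)%:R) *: iter n N x).
  apply: eq_bigr => n _; rewrite -alt_sum mulr_sumr scaler_suml (reindex_inj rev_ord_inj) /=.
  apply: eq_bigr => -[s sn] _ /=; have {}sn : (s <= n)%N by [].
  rewrite subSS subKn// subnK//; congr (_ *: _).
  have -> : pi_i ^+ n = pi_i ^+ (n - s) * pi_i ^+ s :> C by rewrite -exprD subnK.
  rewrite -[- pi_i]mulN1r (expC_M (-1) pi_i); ring.
rewrite (bigD1 (Ordinal K0))//= big1 ?addr0 => [|i]; first by rewrite expr0 mulr1 scale1r.
by rewrite -val_eqE /= => /negPf ->; rewrite mulr0 scale0r.
Qed.

(** The exponential of a derivation is an automorphism. *)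
Lemma eN_YV tau u n v : eN g tau (YV VA u n v) = YV VA (eN g tau u) n (eN g tau v).
Proof.
have [K1 H1] := N_nilp g u; have [K2 H2] := N_nilp g v; have [K3 H3] := N_nilp g (YV VA u n v).
pose K := (K1 + K2 + K3)%N.
have Hu l : (K <= l)%N -> iter l N u = 0 by move=> Kl; apply: iterN_zero H1; lia.
have Hv l : (K <= l)%N -> iter l N v = 0 by move=> Kl; apply: iterN_zero H2; lia.
have HY l : (K <= l)%N -> iter l N (YV VA u n v) = 0 by move=> Kl; apply: iterN_zero H3; lia.
rewrite (eNE (K := K + K)) ?HY ?leq_addl// (eNE (K := K + K) _ (x := u)) ?Hu ?leq_addl//.
rewrite (eNE (K := K + K) _ (x := v)) ?Hv ?leq_addl//.
rewrite (lin_sum _ _ _ (YVlin_l VA n _)).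
transitivity (\sum_(i < K + K) \sum_(j < K + K)
    (tau ^+ i / i`!%:R * (tau ^+ j / j`!%:R)) *: YV VA (iter i N u) n (iter j N v)); last first.
  apply: eq_bigr => i _; rewrite (linZ _ _ (YVlin_l VA n _)) (lin_sum _ _ _ (YVlin_r VA _ n)) scaler_sumr.
  by apply: eq_bigr => j _; rewrite (linZ _ _ (YVlin_r VA _ n)) scalerA.
rewrite (sum_triangle (H := fun i j =>
  (tau ^+ i / i`!%:R * (tau ^+ j / j`!%:R)) *: YV VA (iter i N u) n (iter j N v))); last first.
  move=> i j ij; have [Ki|iK] := leqP K i.
    by rewrite Hu// (lin0 (YVlin_l VA n _)) scaler0.
  by rewrite (Hv j) ?(lin0 (YVlin_r VA _ n)) ?scaler0//; lia.
apply: eq_bigr => k _; rewrite -scalerA iterN_YV scaler_sumr; apply: eq_bigr => -[i ik] _ /=.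
have {}ik : (i <= k)%N by [].
rewrite scalerA; congr (_ *: _).
have -> : tau ^+ k = tau ^+ i * tau ^+ (k - i) :> C by rewrite -exprD subnKC.
ring.
Qed.

(** The coefficient of a power of a formal logarithm h in e^{- h N} Y_V(e^{h N} u)v = Y_V(u) e^{- h N} v. *)
Lemma alt_YV u n v k :
  \sum_(p < k.+1) ((-1) ^+ (k - p) / (k - p)`!%:R) *: iter (k - p) N (YV VA (p`!%:R^-1 *: iter p N u) n v) =
  YV VA u n (((-1) ^+ k / k`!%:R) *: iter k N v).
Proof.
pose H p i : V := ((-1) ^+ (k - p) * (p`!%:R^-1 * (i`!%:R^-1 * (k - p - i)`!%:R^-1))) *:
  YV VA (iter (i + p) N u) n (iter (k - p - i) N v).
transitivity (\sum_(p < k.+1) \sum_(i < (k - p).+1) H p i).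
  apply: eq_bigr => p _; rewrite (linZ _ _ (YVlin_l VA n v)) (linZ _ _ (Nlin g (k - p))) -scalerA.
  rewrite [(k - p)`!%:R^-1 *: _]scalerA [_^-1 * _]mulrC -scalerA iterN_YV !scaler_sumr.
  by apply: eq_bigr => i _; rewrite !scalerA -iterD /H; congr (_ *: _); ring.
pose G p i : V := if (p + i <= k)%N then H p i else 0.
transitivity (\sum_(p < k.+1) \sum_(i < k.+1) G p i).
  apply: eq_bigr => p _; have pk : (p <= k)%N by rewrite -ltnS.
  transitivity (\sum_(i < (k - p).+1) G p i).
    by apply: eq_bigr => -[i ik] _ /=; rewrite /G; case: ifP => //; lia.
  apply: (sum_ord_bounds (G := G p)) => i ki; rewrite /G; case: ifP => //; lia.
rewrite sum_triangle => [|p i pik]; last by rewrite /G; case: ifP => //; lia.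
transitivity (\sum_(s < k.+1) ((-1) ^+ (k - s) / (k - s)`!%:R * (s == 0%N :> nat)%:R) *:
   YV VA (iter s N u) n (iter (k - s) N v)).
  apply: eq_bigr => -[s sk] _ /=; rewrite -alt_sum mulr_sumr scaler_suml; apply: eq_bigr => -[p ps] _ /=.
  rewrite /G; case: ifP => [_|]; last lia.
  rewrite /H subnK//; have -> : (k - p - (s - p) = k - s)%N by lia.
  congr (_ *: _); have -> : (-1) ^+ (k - p) = (-1) ^+ (k - s) * (-1) ^+ (s - p) :> C.
    by rewrite -exprD; congr (_ ^+ _); lia.
  ring.
rewrite big_ord_recl big1 => [|i _]; last by rewrite mulr0 scale0r.
by rewrite addr0 subn0 mulr1 (linZ _ _ (YVlin_r VA u n)).
Qed.

End OperatorBinomials.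

Section Commutation.
Context {R : realType}.
Local Notation C := R[i].
Context {V W : lmodType C} {VA : vertex_superalgebra V} {g : automorphism VA}.
Variable M : twisted_module g W.
Local Notation N := (nilN (aut g)).
Local Notation ob := (@obin _ _ _ g).
Local Notation L := (LWm1 M).

Definition Ld (j : nat) (w : W) : W := j`!%:R^-1 *: iter j L w.

Lemma Ld_linear j : linear (Ld j).
Proof.
move=> a x y; rewrite /Ld (iterL_linear M j a x y) scalerDr !scalerA; congr (_ *: _ + _).
exact: mulrC.
Qed.

Lemma LdS j w : j.+1%:R *: Ld j.+1 w = L (Ld j w).
Proof.
rewrite /Ld [RHS]linearZ /= scalerA; congr (_ *: _); rewrite factS natrM.
have := natS_neq0 (R := R) j => s0; have := factC_neq0 (R := R) j => f0; field.
by rewrite f0 nat1r s0.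
Qed.

(** Moving L(-1) to the left of a mode shifts the mode and multiplies by its index twisted by N;
    iteration produces operator binomials. *)
Lemma YW_Ld j u b w : YW M u b 0 (Ld j w) =
  \sum_(i < j.+1) Ld (j - i) (YW M (ob (- b - 1) i u) (b + i%:R) 0 w).
Proof.
have Ld0 x : Ld 0 x = x by rewrite /Ld fact0 invr1 scale1r.
elim: j u b => [|j IHj] u b.
  rewrite big_ord1 !Ld0 addr0; congr (YW M _ _ _ _).
  by rewrite /obin big_ord1 bet0 scale1r.
apply: (scalerI (natS_neq0 (R := R) j)).
rewrite -(linZ _ _ (YWlin_r M u b 0%N)) LdS.
have /eqP := LWm1_YW M u b (Ld j w); rewrite subr_eq addrC -subr_eq => /eqP <-.
rewrite !IHj linear_sum.
pose A i := Ld (j.+1 - i) (YW M (ob (- b - 1) i u) (b + i%:R) 0 w).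
have -> : \sum_(i < j.+1) L (Ld (j - i) (YW M (ob (- b - 1) i u) (b + i%:R) 0 w)) =
    \sum_(i < j.+2) (j.+1 - i)%:R *: A i.
  rewrite [RHS]big_ord_recr /= subnn scale0r addr0; apply: eq_bigr => -[i ij] _ /=.
  by rewrite -LdS /A subSn.
have -> : \sum_(i < j.+1) Ld (j - i) (YW M (ob (- (b + 1) - 1) i ((b + 1) *: u - N u)) (b + 1 + i%:R) 0 w) =
    - \sum_(i < j.+2) i%:R *: A i.
  rewrite [in RHS]big_ord_recl scale0r add0r -sumrN; apply: eq_bigr => -[i ij] _ /=.
  rewrite /A /bump add1n subSS -(linZ _ _ (Ld_linear _)) -(linZ _ _ (YWlin_l M _ 0%N w)) ob_rec.
  rewrite -[- Ld _ _]scaleN1r -(linZ (-1) _ (Ld_linear (j - i))) -(linZ (-1) _ (YWlin_l M _ 0%N w)).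
  rewrite -(linZ (-1) _ (obin_linear _ i)).
  have -> : -1 *: ((- b - 1) *: u + N u) = (b + 1) *: u - N u.
    by rewrite scalerDr scalerA scaleN1r; congr (_ *: _ - _); ring.
  have -> : b + i.+1%:R = b + 1 + i%:R by rewrite -natr1; ring.
  by have -> : - b - 1 - 1 = - (b + 1) - 1 by ring.
rewrite opprK -sum_add scaler_sumr; apply: eq_bigr => -[i ij] _ /=.
by rewrite -scalerDl -natrD subnK.
Qed.

End Commutation.

(** * The three sides of the Jacobi identity as families *)

Section Scaling.
Context {R : realType}.
Local Notation C := R[i].
Local Notation mono := (monomial R).

Lemma dep_list (X Y : eqType) (s : seq X) (t : X -> seq Y) :
  exists r : seq (X * Y), forall x y, x \in s -> y \in t x -> (x, y) \in r.
Proof. by exists [seq (x, y) | x <- s, y <- t x] => x y xs yt; apply/allpairsPdep; exists x, y. Qed.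

(** Since the monomials of the first factor are invertible, its index and the target monomial
    determine that of the second factor; finiteness has to be checked in the first index only. *)
Lemma rep_fscale_inv (A : lmodType C) (F : fexpr R C) (G : fexpr R A) (I J : eqType) (a : I -> C)
    (e e'' : I -> mono) (b : J -> A) (e' : J -> mono) : rep F a e -> rep G b e' ->
  (forall i, e'' i + e i = 0) ->
  (forall m, exists s : seq I, forall i j, e i + e' j = m -> b j != 0 -> i \in s) ->
  rep (fscale F G) (fun p : I * J => a p.1 *: b p.2) (fun p => e p.1 + e' p.2).
Proof.
move=> HF HG inv Hs; apply: rep_fscale => // m; have [s cs] := Hs m.
have /choice[t Ht] : forall i, exists t : seq J, covers b e' (e'' i + m) t.
  by move=> i; have [_ /(_ (e'' i + m))[t [_ ct _]]] := HG; exists t.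
have [r Hr] := dep_list s t; exists r => -[i j] /= ijm ab.
have b0 : b j != 0 by apply: contraNneq ab => ->; rewrite scaler0.
apply: Hr; first exact: cs ijm b0.
by apply: Ht => //; rewrite -ijm addrA inv add0r.
Qed.

Lemma rep_delta_scale (A : lmodType C) (i j k : 'I_3) (b : @Defs.binomial R) (h : C -> nat -> C)
    (G : fexpr R A) (J : eqType) (c : J -> A) (e' : J -> mono) :
  i != j -> i != k -> j != k ->
  (forall al, rep (bpow b al) (h al) (mrat i j al)) -> rep G c e' ->
  (forall m, exists s : seq (int * nat), forall n r y,
     xmon k (- n%:~R - 1) + mrat i j n%:~R r + e' y = m -> c y != 0 -> (n, r) \in s) ->
  rep (fscale (fdelta k b) G) (fun p : (int * nat) * J => h p.1.1%:~R p.1.2 *: c p.2)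
    (fun p => xmon k (- p.1.1%:~R - 1) + mrat i j p.1.1%:~R p.1.2 + e' p.2).
Proof.
move=> ij ik jk Hb HG Hs.
have HF := rep_fdelta ij ik jk Hb.
apply: (@rep_fscale_inv A _ _ _ _ (fun p : int * nat => h p.1%:~R p.2) _
  (fun p => xmon k (p.1%:~R + 1) + (xmon i (p.2%:R - p.1%:~R) + xmon j (- p.2%:R))) _ _ HF HG).
  move=> [n r]; apply: mono_ext => l; rewrite /mrat !monoE //=.
  by case: (l == k); case: (l == i); case: (l == j); ring.
by move=> m; have [s Hm] := Hs m; exists s => -[n r] y; apply: Hm.
Qed.

(** the exponents of x_0, x_1, x_2 and of their logarithms *)
Definition co (m : mono) := (m.1 x0, m.1 x1, m.1 x2, m.2 x0, m.2 x1, m.2 x2).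

Lemma co_inj : injective co.
Proof.
move=> m m' [a1 a2 a3 b1 b2 b3].
by apply: (@mono_ext3 _ x1 x2 x0); rewrite ?a1 ?a2 ?a3 ?b1 ?b2 ?b3.
Qed.

Lemma nat_bound (Mx c : C) (B : R) (J r : nat) : r%:R + c = Mx -> ~ (complex.Re c < B) ->
  complex.Re Mx - B < J%:R -> (r <= J)%N.
Proof.
move=> <- /negP; rewrite -leNgt Re_add -(rmorph_nat (real_complex R)) /= => cB rJ.
have : (r%:R : R) < J%:R by lra.
by rewrite ltr_nat => /ltnW.
Qed.

End Scaling.

Section Sides.
Context {R : realType}.
Local Notation C := R[i].
Local Notation mono := (monomial R).
Context {V W : lmodType C} {VA : vertex_superalgebra V} {g : automorphism VA}.
Variable M : twisted_module g W.
Local Notation T := (aut g).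
Local Notation N := (nilN T).
Local Notation ob := (@obin _ _ _ g).
Hypothesis Mlb : lower_bounded M.
Variables (pu pv pw : bool) (u v : V) (w : W).
Hypotheses (hu : Vparity VA pu u) (hv : Vparity VA pv v) (hw : Wparity M pw w).
Local Notation cmp := (component strip (geneig T) u).
Local Notation pidx := (C * nat * nat * nat)%type.

Lemma tw_trunc : exists B : R, forall x, complex.Re x.1 < B -> tw M w v x = 0.
Proof.
have [B HB] := TcE Mlb v w; exists B => x xB; rewrite (twE Mlb x hv hw) (HB x 0%N) ?subr0//.
by rewrite big_ord0 scaler0.
Qed.

Lemma powc0 tau (x : pidx) : cmp x.1.1.1 = 0 -> powc g tau u x = 0.
Proof.
move: x => [[[al r] p] q] /= ->; rewrite (lin0 (Nlin g _)) (lin0 (eN_linear g _)).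
by rewrite (lin0 (obin_linear _ _)) !scaler0.
Qed.

Lemma cmp_list : exists s : seq C, forall al, cmp al != 0 -> al \in s.
Proof.
have [s [_ Hs]] := finite_set_seq (component_finite (g_direct g) u).
by exists s => al /Hs.
Qed.

Definition e1 (y : pidx * (C * nat) * (C * nat)) : mono :=
  powe x1 x2 x0 y.1.1 + ye x2 y.1.2 + ye x1 y.2.

Lemma co_e1 al r p q c k d l : co (e1 ((al, r, p, q), (c, k), (d, l))) =
  (- al, al - r%:R + d, r%:R + c, q, (p + l)%N, k).
Proof.
rewrite /co /e1 /powe /mrat !(monoE, ye1, ye2) /=.
by rewrite !(addr0, add0r, addn0, add0n).
Qed.

Lemma rep_inner1 : rep (fbil (YWser M x1) (fpowL g x0 (bsub x1 x2) u) (twist M x2 w v))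
  (fun y => YW M (powc g 0 u y.1.1) y.2.1 y.2.2 (tw M w v y.1.2)) e1.
Proof.
have HP := @rep_fpowL _ _ _ g x1 x2 x0 0 (bsub x1 x2) isT isT isT
  (fun al => @rep_bpow_bsub R x1 x2 al isT) (@rep_blog_bsub R x1 x2 x0 isT) u.
apply: (@rep_fbil _ _ _ _ (YWser M x1) _ (fun a b x => YW M a x.1 x.2 b) (ye x1)
  (rep_YWser M x1) _ _ _ _ _ _ _ _ _ _ _ _ HP (rep_twist Mlb x2 w v)).
- by move=> y x; apply: lin0 (YWlin_l M _ _ y).
- by move=> y x; apply: lin0 (YWlin_r M y _ _).
- by move=> x x' y k; apply: linD (YWlin_l M _ _ y).
- by move=> x y y' k; apply: linD (YWlin_r M x _ _).
move=> m; have [B HB] := tw_trunc; have [J HJ] := ex_nat_gt (complex.Re (m.1 x2) - B).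
have [rl Hrl] := nat_list J; have [pl Hpl] := nat_list (m.2 x1); have [s Hs] := pair_list rl pl.
exists [seq ((- m.1 x0, x.1, x.2, m.2 x0), (m.1 x2 - x.1%:R, m.2 x2),
   (m.1 x1 + m.1 x0 + x.1%:R, (m.2 x1 - x.2)%N)) | x <- s].
move=> [[[[[al r] p] q] [c k]] [d l]] /(congr1 co); rewrite (co_e1 al r p q c k d l).
move=> [E0 E1 E2 L0 L1 L2] cn; apply/mapP; exists (r, p).
  apply: Hs; last by apply: Hpl; rewrite -L1 leq_addr.
  apply: Hrl; apply: nat_bound E2 _ HJ => /(HB (c, k)) t0; move: cn.
  by rewrite /= t0 (lin0 (YWlin_r M _ _ _)) eqxx.
rewrite /= -E0 -E1 -E2 -L0 -L1 -L2 addKn; congr ((_, _, _, _), (_, _), (_, _)); ring.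
Qed.

Definition f1 (y : (int * nat) * (pidx * (C * nat) * (C * nat))) : mono :=
  xmon x0 (- y.1.1%:~R - 1) + mrat x1 x2 y.1.1%:~R y.1.2 + e1 y.2.

Lemma coD (m m' : mono) : co (m + m') =
  (m.1 x0 + m'.1 x0, m.1 x1 + m'.1 x1, m.1 x2 + m'.1 x2,
   (m.2 x0 + m'.2 x0)%N, (m.2 x1 + m'.2 x1)%N, (m.2 x2 + m'.2 x2)%N).
Proof. by rewrite /co !monoE. Qed.

Lemma co_f1 n r' al r p q c k d l : co (f1 ((n, r'), ((al, r, p, q), (c, k), (d, l)))) =
  (- n%:~R - 1 - al, n%:~R - r'%:R + (al - r%:R + d), r'%:R + (r%:R + c), q, (p + l)%N, k).
Proof.
have [E0 E1 E2 L0 L1 L2] := co_e1 al r p q c k d l.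
rewrite /f1 coD E0 E1 E2 L0 L1 L2 /mrat !monoE /=.
by rewrite !(addr0, add0r, addn0, add0n).
Qed.

(** The exponent of x_0 leaves one index of the delta function for each of the finitely many g-weights of u,
    and the truncation of the twist map bounds the powers of x_2 that expand the binomials. *)
Lemma rep_lhs1 : rep (fscale (fdelta x0 (bsub x1 x2))
    (fbil (YWser M x1) (fpowL g x0 (bsub x1 x2) u) (twist M x2 w v)))
  (fun y : (int * nat) * (pidx * (C * nat) * (C * nat)) =>
     (cexp (0 * y.1.1%:~R) * ((-1) ^+ y.1.2 * binC y.1.1%:~R y.1.2)) *:
     YW M (powc g 0 u y.2.1.1) y.2.2.1 y.2.2.2 (tw M w v y.2.1.2)) f1.
Proof.
apply: (@rep_delta_scale _ _ x1 x2 x0 _ (fun al r => cexp (0 * al) * ((-1) ^+ r * binC al r)) _ _ _ _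
   isT isT isT (fun al => @rep_bpow_bsub R x1 x2 al isT) rep_inner1) => m.
have [B HB] := tw_trunc; have [J HJ] := ex_nat_gt (complex.Re (m.1 x2) - B).
have [s Hs] := cmp_list; have [rl Hrl] := nat_list J.
have /choice[nf Hn] : forall al : C, exists n : int, forall n' : int, n'%:~R = - m.1 x0 - 1 - al -> n' = n.
  by move=> al; apply: int_of_C.
have [t Ht] := pair_list (map nf s) rl; exists t => n r' [[[[[al r] p] q] [c k]] [d l]].
move=> /(congr1 co); rewrite (co_f1 n r' al r p q c k d l) => -[E0 E1 E2 L0 L1 L2] cn.
apply: Ht.
  rewrite (Hn al n); last by rewrite -E0; ring.
  apply: map_f; apply: Hs; apply: contraNneq cn => a0.
  rewrite -[X in X == 0]/(YW M (powc g 0 u (al, r, p, q)) d l (tw M w v (c, k))).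
  by rewrite (powc0 _ (x := (al, r, p, q)) a0) (lin0 (YWlin_l M _ _ _)).
apply: Hrl; apply: leq_trans (leq_addr r r') _.
rewrite addrA -natrD in E2; apply: nat_bound E2 _ HJ => /(HB (c, k)) t0; move: cn.
by rewrite /= t0 (lin0 (YWlin_r M _ _ _)) eqxx.
Qed.

Definition e2 (y : unit * (pidx * unit * int) * (C * nat)) : mono :=
  0 + (powe x2 x1 x0 y.1.2.1.1 + 0 + xmon x1 y.1.2.2%:~R) + ye x2 y.2.

Lemma co_e2i (al : C) r p q (d : int) : co (powe x2 x1 x0 (al, r, p, q) + 0 + xmon x1 d%:~R) =
  (- al, r%:R + d%:~R, al - r%:R, q, 0%N, p).
Proof.
rewrite /co /powe /mrat !monoE /=.
by rewrite !(addr0, add0r, addn0, add0n).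
Qed.

Lemma co_e2 al r p q (d : int) c k : co (e2 ((tt, ((al, r, p, q), tt, d)), (c, k))) =
  (- al, r%:R + d%:~R, al - r%:R + c, q, 0%N, (p + k)%N).
Proof.
rewrite /co /e2 /powe /mrat !(monoE, ye1, ye2) /=.
by rewrite !(addr0, add0r, addn0, add0n).
Qed.

(** Only finitely many powers of N act nontrivially on u, so the truncation of Y_V can be chosen
    independently of the binomial index. *)
Lemma powc_trunc : exists Jf : C -> nat -> nat -> int, forall al r p q d,
  YV VA (powc g pi_i u (al, r, p, q)) d v != 0 -> Jf al p q <= d.
Proof.
have /choice[Jf HJ] : forall y : V, exists J : int, forall c s j, j < J -> YV VA (ob c s y) j v = 0.
  by move=> y; apply: YV_trunc_obin.
exists (fun al p q => Jf (eN g pi_i (iter (p + q) N (cmp al)))) => al r p q d cn.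
rewrite leNgt; apply: contra cn => dJ; rewrite /powc.
by rewrite !(linZ _ _ (YVlin_l VA d v)) HJ ?scaler0.
Qed.

Lemma rep_inner2i : rep (fbil (YVser VA x1) (fpowL g x0 (bnegadd x2 x1) u) (fcst v))
  (fun y : pidx * unit * int => YV VA (powc g pi_i u y.1.1) y.2 v)
  (fun y => powe x2 x1 x0 y.1.1 + 0 + xmon x1 y.2%:~R).
Proof.
have HP := @rep_fpowL _ _ _ g x2 x1 x0 pi_i (bnegadd x2 x1) isT isT isT
  (fun al => @rep_bpow_bnegadd R x2 x1 al isT) (@rep_blog_bnegadd R x2 x1 x0 isT) u.
apply: (@rep_fbil _ _ _ _ (YVser VA x1) _ (fun a b x => YV VA a x b) (fun n => xmon x1 n%:~R)
  (rep_YVser x1) _ _ _ _ _ _ _ _ _ _ _ _ HP (rep_fcst v)).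
- by move=> y x; apply: lin0 (YVlin_l VA _ y).
- by move=> y x; apply: lin0 (YVlin_r VA y _).
- by move=> x x' y k; apply: linD (YVlin_l VA _ y).
- by move=> x y y' k; apply: linD (YVlin_r VA x _).
move=> m; have [Jf HJ] := powc_trunc; have [z Hz] := int_of_C (m.1 x1).
pose al0 := - m.1 x0; pose p0 := m.2 x2; pose q0 := m.2 x0.
have [rl Hrl] := nat_list (absz (z - Jf al0 p0 q0)%R).
exists [seq ((al0, r, p0, q0), tt, z - r%:Z) | r <- rl].
move=> [[[[[al r] p] q] []] d] /(congr1 co); rewrite (co_e2i al r p q d).
move=> [E0 E1 E2 L0 L1 L2] cn; have dJ : Jf al p q <= d := HJ al r p q d cn.
have rd : r%:Z + d = z by apply: Hz; rewrite rmorphD /= -E1.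
apply/mapP; exists r; last by rewrite /al0 /p0 /q0 -E0 -L0 -L2 opprK -rd addrC addKr.
by apply: Hrl; rewrite /al0 /p0 /q0 -E0 -L0 -L2 opprK; lia.
Qed.

Lemma rep_inner2 : rep (fbil (twist M x2) (fcst w)
    (fbil (YVser VA x1) (fpowL g x0 (bnegadd x2 x1) u) (fcst v)))
  (fun y => tw M w (YV VA (powc g pi_i u y.1.2.1.1) y.1.2.2 v) y.2) e2.
Proof.
apply: (@rep_fbil _ _ _ _ (twist M x2) _ (fun a b x => tw M a b x) (ye x2)
  (rep_twist Mlb x2) _ _ _ _ _ _ _ _ _ _ _ _ (rep_fcst w) rep_inner2i).
- by move=> y x; apply: tw0l.
- by move=> y x; apply: tw0r.
- by move=> x x' y k; apply: twDl.
- by move=> x y y' k; apply: twDr.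
move=> m; have [Jf HJ] := powc_trunc; have [z Hz] := int_of_C (m.1 x1).
pose al0 := - m.1 x0; pose q0 := m.2 x0.
have [pl Hpl] := nat_list (m.2 x2).
have [t Ht] := dep_list pl (fun p => iota 0 (absz (z - Jf al0 p q0)%R).+1).
exists [seq ((tt, ((al0, x.2, x.1, q0), tt, z - x.2%:Z)), (m.1 x2 - al0 + x.2%:R, (m.2 x2 - x.1)%N)) | x <- t].
move=> [[[] [[[[[al r] p] q] []] d]] [c k]] /(congr1 co); rewrite (co_e2 al r p q d c k).
move=> [E0 E1 E2 L0 L1 L2] cn.
have /HJ dJ : YV VA (powc g pi_i u (al, r, p, q)) d v != 0.
  by apply: contraNneq cn => /= ->; rewrite tw0r.
have rd : r%:Z + d = z by apply: Hz; rewrite rmorphD /= -E1.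
apply/mapP; exists (p, r).
  apply: Ht; first by apply: Hpl; rewrite -L2 leq_addr.
  by rewrite mem_iota /al0 /q0 -E0 -L0 opprK; lia.
rewrite /al0 /q0 /= -E0 -L0 -L2 -E2 opprK -rd addKn.
congr ((tt, ((_, _, _, _), tt, _)), (_, _)); ring.
Qed.

Definition f2 (y : (int * nat) * (unit * (pidx * unit * int) * (C * nat))) : mono :=
  xmon x0 (- y.1.1%:~R - 1) + mrat x2 x1 y.1.1%:~R y.1.2 + e2 y.2.

Lemma co_f2 n r' al r p q d c k : co (f2 ((n, r'), ((tt, ((al, r, p, q), tt, d)), (c, k)))) =
  (- n%:~R - 1 - al, r'%:R + (r%:R + d%:~R), n%:~R - r'%:R + (al - r%:R + c), q, 0%N, (p + k)%N).
Proof.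
have [E0 E1 E2 L0 L1 L2] := co_e2 al r p q d c k.
rewrite /f2 coD E0 E1 E2 L0 L1 L2 /mrat !monoE /=.
by rewrite !(addr0, add0r, addn0, add0n).
Qed.

(** Here the truncation of Y_V bounds the powers of x_1 that expand the binomials. *)
Lemma rep_lhs2 : rep (fscale (fcst ((-1) ^+ (pu && pw))) (fscale (fdelta x0 (bnegadd x2 x1))
    (fbil (twist M x2) (fcst w)
      (fbil (YVser VA x1) (fpowL g x0 (bnegadd x2 x1) u) (fcst v)))))
  (fun y : (int * nat) * (unit * (pidx * unit * int) * (C * nat)) => (-1) ^+ (pu && pw) *:
     ((cexp (pi_i * y.1.1%:~R) * ((-1) ^+ y.1.2 * binC y.1.1%:~R y.1.2)) *:
      tw M w (YV VA (powc g pi_i u y.2.1.2.1.1) y.2.1.2.2 v) y.2.2)) f2.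
Proof.
apply: rep_fscale_cstl.
apply: (@rep_delta_scale _ _ x2 x1 x0 _ (fun al r => cexp (pi_i * al) * ((-1) ^+ r * binC al r)) _ _ _ _
   isT isT isT (fun al => @rep_bpow_bnegadd R x2 x1 al isT) rep_inner2) => m.
have [Jf HJ] := powc_trunc; have [z Hz] := int_of_C (m.1 x1); pose q0 := m.2 x0.
have [s Hs] := cmp_list; have [pl Hpl] := nat_list (m.2 x2).
have /choice[nf Hn] : forall al : C, exists n : int, forall n' : int, n'%:~R = - m.1 x0 - 1 - al -> n' = n.
  by move=> al; apply: int_of_C.
have [t Ht] := pair_list s pl.
have [t' Ht'] := dep_list t (fun x => iota 0 (absz (z - Jf x.1 x.2 q0)%R).+1).
exists [seq (nf x.1.1, x.2) | x <- t'] => n r' [[[] [[[[[al r] p] q] []] d]] [c k]].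
move=> /(congr1 co); rewrite (co_f2 n r' al r p q d c k) => -[E0 E1 E2 L0 L1 L2] cn.
have y0 : YV VA (powc g pi_i u (al, r, p, q)) d v != 0.
  by apply: contraNneq cn => /= ->; rewrite tw0r.
have dJ := HJ _ _ _ _ _ y0.
have rd : r'%:Z + (r%:Z + d) = z by apply: Hz; rewrite !rmorphD /= -E1.
apply/mapP; exists ((al, p), r'); last by rewrite /= (Hn al n) // -E0; ring.
apply: Ht'; last by rewrite mem_iota /q0 -L0 /=; lia.
apply: Ht; last by apply: Hpl; rewrite -L2 leq_addr.
apply: Hs; apply: contraNneq y0 => a0.
by rewrite (powc0 _ (x := (al, r, p, q)) a0) (lin0 (YVlin_l VA d v)).
Qed.

Definition e3 (y : (C * nat) * unit * (C * nat)) : mono := ye x0 y.1.1 + 0 + ye x2 y.2.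

Lemma co_e3 b l c k : co (e3 (((b, l), tt), (c, k))) = (b, 0, c, l, 0%N, k).
Proof.
by rewrite /co /e3 !(monoE, ye1, ye2) /= !(addr0, add0r, addn0, add0n).
Qed.

Lemma rep_inner3 : rep (fbil (twist M x2) (YWser M x0 u w) (fcst v))
  (fun y => tw M (YW M u y.1.1.1 y.1.1.2 w) v y.2) e3.
Proof.
apply: (@rep_fbil _ _ _ _ (twist M x2) _ (fun a b x => tw M a b x) (ye x2)
  (rep_twist Mlb x2) _ _ _ _ _ _ _ _ _ _ _ _ (rep_YWser M x0 u w) (rep_fcst v)).
- by move=> y x; apply: tw0l.
- by move=> y x; apply: tw0r.
- by move=> x x' y k; apply: twDl.
- by move=> x y y' k; apply: twDr.
move=> m; exists [:: (((m.1 x0, m.2 x0), tt), (m.1 x2, m.2 x2))].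
move=> [[[b l] []] [c k]] /(congr1 co); rewrite (co_e3 b l c k) => -[<- _ <- <- _ <-] _.
by rewrite mem_seq1.
Qed.

Definition f3 (y : (int * nat) * ((C * nat) * unit * (C * nat))) : mono :=
  xmon x1 (- y.1.1%:~R - 1) + mrat x2 x0 y.1.1%:~R y.1.2 + e3 y.2.

Lemma co_f3 n r' b l c k : co (f3 ((n, r'), (((b, l), tt), (c, k)))) =
  (r'%:R + b, - n%:~R - 1, n%:~R - r'%:R + c, l, 0%N, k).
Proof.
have [E0 E1 E2 L0 L1 L2] := co_e3 b l c k.
rewrite /f3 coD E0 E1 E2 L0 L1 L2 /mrat !monoE /=.
by rewrite !(addr0, add0r, addn0, add0n).
Qed.

(** The truncation of Y_W(u, x_0)w bounds the powers of x_0 that expand the delta function. *)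
Lemma rep_rhs : rep (fscale (fdelta x1 (badd x2 x0))
    (fbil (twist M x2) (YWser M x0 u w) (fcst v)))
  (fun y : (int * nat) * ((C * nat) * unit * (C * nat)) => binC y.1.1%:~R y.1.2 *:
     tw M (YW M u y.2.1.1.1 y.2.1.1.2 w) v y.2.2) f3.
Proof.
apply: (@rep_delta_scale _ _ x2 x0 x1 _ (fun al r => binC al r) _ _ _ _
   isT isT isT (fun al => @rep_bpow_badd R x2 x0 al isT) rep_inner3) => m.
have [B HB] := YW_trunc Mlb u w; have [J HJ] := ex_nat_gt (complex.Re (m.1 x0) - B).
have [n0 Hn] := int_of_C (- m.1 x1 - 1); have [rl Hrl] := nat_list J.
exists [seq (n0, r) | r <- rl] => n r' [[[b l] []] [c k]].
move=> /(congr1 co); rewrite (co_f3 n r' b l c k) => -[E0 E1 E2 L0 L1 L2] cn.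
apply/mapP; exists r'; last by rewrite (Hn n) // -E1; ring.
apply: Hrl; apply: nat_bound E0 _ HJ => /HB b0; case/eqP: cn.
by rewrite /= b0 tw0l.
Qed.

End Sides.

(** * The coefficients of the three sides *)

Lemma ex_max (P : nat -> nat -> Prop) :
  (forall r, exists J, forall J', (J <= J')%N -> P r J') ->
  forall K, exists J, forall r J', (r < K)%N -> (J <= J')%N -> P r J'.
Proof.
move=> H; elim=> [|K [J HJ]]; first by exists 0%N.
have [J1 HJ1] := H K; exists (maxn J J1) => r J'; rewrite ltnS leq_eqVlt geq_max.
by move=> /predU1P[->|rK] /andP[h1 h2]; [exact: HJ1|exact: HJ].
Qed.

(** The common index set of the first two sides: the expansion index of the delta function, the one
    of the complex power of the binomial, and a power of a logarithm. *)
Definition box (K k : nat) : seq (nat * (nat * nat)) :=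
  [seq (r', x) | r' <- iota 0 K, x <- [seq (r, p) | r <- iota 0 K, p <- iota 0 k]].

Lemma box_uniq K k : uniq (box K k).
Proof.
apply: allpairs_uniq; [exact: iota_uniq| |by move=> [? ?] [? ?] _ _ /= [-> ->]].
by apply: allpairs_uniq; [exact: iota_uniq|exact: iota_uniq|move=> [? ?] [? ?] _ _ /= [-> ->]].
Qed.

Lemma mem_box K k a b c : ((a, (b, c)) \in box K k) = [&& (a < K)%N, (b < K)%N & (c < k)%N].
Proof.
apply/idP/idP.
  move=> /allpairsP[[a1 [b1 c1]] /= [ha /allpairsP[[b2 c2] /= [hb hc [-> ->]]] [-> -> ->]]].
  by move: ha hb hc; rewrite !mem_iota; lia.
move=> /and3P[ha hb hc]; apply/allpairsP; exists (a, (b, c)); split; rewrite ?mem_iota//=.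
by apply/allpairsP; exists (b, c); split; rewrite ?mem_iota.
Qed.

Lemma sum_box (A : nmodType) K k (F : nat * (nat * nat) -> A) :
  \sum_(x <- box K k) F x = \sum_(r' < K) \sum_(r < K) \sum_(p < k) F (nat_of_ord r', (nat_of_ord r, nat_of_ord p)).
Proof.
rewrite big_allpairs_dep sum_iota0; apply: eq_bigr => r' _.
rewrite big_allpairs_dep sum_iota0; apply: eq_bigr => r _; exact: sum_iota0.
Qed.

Section Values.
Context {R : realType}.
Local Notation C := R[i].
Local Notation mono := (monomial R).
Context {V W : lmodType C} {VA : vertex_superalgebra V} {g : automorphism VA}.
Variable M : twisted_module g W.
Local Notation T := (aut g).
Local Notation N := (nilN T).
Local Notation ob := (@obin _ _ _ g).
Local Notation subspace := Defs.subspace.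
Hypothesis Mlb : lower_bounded M.
Variables (pu pv pw : bool) (u v : V) (w : W).
Hypotheses (hu : Vparity VA pu u) (hv : Vparity VA pv v) (hw : Wparity M pw w).
Local Notation cmp := (component strip (geneig T) u).

Lemma cexp_subn (a : C) n : cexp (pi_i * (a - n%:R)) = cexp (pi_i * a) * (-1) ^+ n.
Proof.
rewrite mulrBr cexpD cexpN; congr (_ * _).
have := cexp_pii_int (R := R) n; rewrite -[n%:~R]/(n%:R : C) => ->.
by rewrite -exprnP invr_sign.
Qed.

Lemma cexp_addn (a : C) n : cexp (pi_i * (a + n%:R)) = cexp (pi_i * a) * (-1) ^+ n.
Proof.
rewrite mulrDr cexpD; congr (_ * _).
by have := cexp_pii_int (R := R) n; rewrite -[n%:~R]/(n%:R : C) => ->.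
Qed.

Lemma sgn2 n : (-1) ^+ n * (-1) ^+ n = 1 :> C.
Proof. by rewrite -expr2 sqrr_sign. Qed.

(** The g-weight al is the fractional part selected by the power of x_0. *)
Lemma int_strip (c : C) : exists n : int, strip (c - n%:~R).
Proof.
exists (Num.floor (complex.Re c)); rewrite /strip /= Re_add Re_neg Re_intr.
have := Num.Theory.floor_itv (complex.Re c); rewrite intrD.
by move=> /andP[h1 h2]; apply/andP; split; lra.
Qed.

Lemma strip_uniq (al al' : C) (n n' : int) : strip al -> strip al' ->
  al + n%:~R = al' + n'%:~R -> al = al' /\ n = n'.
Proof.
move=> s1 s2 E; have ee : al = al'.
  apply: strip_inj => //.
  have -> : al = al' + (n' - n)%:~R by rewrite rmorphB /= addrA -E; ring.
  by rewrite mulrDr cexpD cexp_2pii_int mulr1.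
split=> //; apply/eqP; rewrite -(eqr_int C); apply/eqP.
by move: E; rewrite ee => /addrI.
Qed.

Lemma TcZl x a y z : Tc M x (a *: y) z = a *: Tc M x y z.
Proof.
have [B1 H1] := TcE Mlb y z; have [B3 H3] := TcE Mlb (a *: y) z.
have [J HJ] := ex_nat_gt (complex.Re x.1 - Num.min B1 B3).
have : complex.Re x.1 - J%:R < Num.min B1 B3 by lra.
rewrite lt_min => /andP[b1 b3]; rewrite (H1 x J b1) (H3 x J b3) scaler_sumr; apply: eq_bigr => j _.
rewrite (linZ _ _ (yn_linl M _ z)) (linZ _ _ (iterL_linear M j)) !scalerA; congr (_ *: _).
exact: mulrC.
Qed.

(** The twist map with its logarithms and the factor e^{- pi i N} moved into the vector. *)
Definition Tg (c : C) (y : V) (z : W) : W := Tc M (c, 0%N) (eN g pi_i y) z.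

Lemma Tg_linear c z : linear (fun y => Tg c y z).
Proof. by move=> a x y; rewrite /Tg (eN_linear g) TcDl// TcZl. Qed.

Lemma yn0 b y z : yn M (b, 0%N) (eN g pi_i y) z = cexp (pi_i * b) *: YW M y b 0 z.
Proof. by rewrite /yn /= expr0 fact0 divr1 scale1r eN_inv. Qed.

Lemma Tc_Tg c k y z : Tc M (c, k) y z = Tg c (((-1) ^+ k / k`!%:R) *: iter k N (eN g (- pi_i) y)) z.
Proof. by rewrite /Tg /Tc; apply: eq_fsbigr => j _; rewrite /= yn0. Qed.

Lemma TgE y z c : exists J0 : nat, forall r J : nat, (J0 <= J)%N ->
  Tg (c - r%:R) y z = \sum_(j < J) Ld M j (cexp (pi_i * (c - r%:R - j%:R)) *: YW M y (c - r%:R - j%:R) 0 z).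
Proof.
have [B HB] := TcE Mlb (eN g pi_i y) z; have [J0 HJ0] := ex_nat_gt (complex.Re c - B).
exists J0 => r J J0J; rewrite /Tg (HB _ J); last first.
  rewrite /= Re_add Re_neg -(rmorph_nat (real_complex R)) /=.
  have : (J0%:R : R) <= J%:R by rewrite ler_nat.
  have : (0 : R) <= r%:R by [].
  by lra.
by apply: eq_bigr => j _; rewrite /= yn0.
Qed.

(** One bound serves for a family of values almost all of which vanish. *)
Lemma Tg_unif (y : nat -> V) (z : nat -> W) (c : nat -> C) (S0 : nat) :
  (forall s, (S0 <= s)%N -> y s = 0 \/ z s = 0) ->
  exists K1 : nat, forall K s, (K1 <= K)%N -> Tg (c s) (y s) (z s) =
    \sum_(j < K) Ld M j (cexp (pi_i * (c s - j%:R)) *: YW M (y s) (c s - j%:R) 0 (z s)).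
Proof.
move=> H0; pose P s J := Tg (c s) (y s) (z s) =
    \sum_(j < J) Ld M j (cexp (pi_i * (c s - j%:R)) *: YW M (y s) (c s - j%:R) 0 (z s)).
have HP s : exists J, forall J', (J <= J')%N -> P s J'.
  have [J HJ] := TgE (y s) (z s) (c s); exists J => J' JJ'; have := HJ 0%N J' JJ'.
  by rewrite /P subr0.
have [K1 HK1] := ex_max HP S0; exists K1 => K s KK.
have [sS|Ss] := ltnP s S0; first exact: HK1.
have [e|e] := H0 s Ss; rewrite e.
  rewrite (lin0 (Tg_linear _ _)) big1// => j _.
  by rewrite (lin0 (YWlin_l M _ _ _)) scaler0 (lin0 (Ld_linear M j)).
rewrite /Tg (Tc0r Mlb) big1// => j _.
by rewrite (lin0 (YWlin_r M _ _ _)) scaler0 (lin0 (Ld_linear M j)).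
Qed.

Variables (a0 a1 a2 : C) (k0 k1 k2 : nat) (al0 : C) (n0 : int).
Hypotheses (al0_strip : strip al0) (al0E : - a0 - 1 = n0%:~R + al0).
Lemma n0E : n0%:~R = - a0 - 1 - al0.
Proof. by rewrite al0E addrK. Qed.

(** The vector through which u enters: its component of g-weight al0, with the power of - N
    corresponding to the power of log x_0. *)
Definition up : V := ((-1) ^+ k0 / k0`!%:R) *: iter k0 N (cmp al0).
(** The vector through which v enters, with the power of - N corresponding to the power of log x_2. *)
Definition vp : V := ((-1) ^+ k2 / k2`!%:R) *: iter k2 N (eN g (- pi_i) v).

Lemma cmp_geneig al : geneig T al (cmp al).
Proof.
have [s|ns] := EM (strip al); first exact: (component_in (g_direct g)).
have -> : cmp al = 0 := component_out (g_direct g) u ns.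
by exists 0%N.
Qed.

Lemma up_geneig : geneig T al0 up.
Proof.
apply: subspaceZ; first exact: gker_subspace.
by apply: iterN_geneig; apply: cmp_geneig.
Qed.

Lemma up_parity : Vparity VA pu up.
Proof.
by apply: subspaceZ; [exact: parity_subspace|apply: iterN_parity; apply: cmp_parity].
Qed.

Lemma vp_parity : Vparity VA pv vp.
Proof.
apply: subspaceZ; first exact: parity_subspace.
apply: iterN_parity; apply: eN_subspace => //; first exact: parity_subspace.
by move=> y; apply: N_parity.
Qed.

Lemma ob_geneig al c s x : geneig T al x -> geneig T al (ob c s x).
Proof.
move=> Hx; apply: subspace_sum => [|k _]; first exact: gker_subspace.
by apply: subspaceZ; [exact: gker_subspace|exact: iterN_geneig].
Qed.

Lemma ob_parity c s x : Vparity VA pu x -> Vparity VA pu (ob c s x).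
Proof.
move=> Hx; apply: subspace_sum => [|k _]; first exact: parity_subspace.
by apply: subspaceZ; [exact: parity_subspace|exact: iterN_parity].
Qed.

Lemma powc_parity tau x : Vparity VA pu (powc g tau u x).
Proof.
move: x => [[[al r] p] q] /=; apply: subspaceZ; first exact: parity_subspace.
apply: subspaceZ; first exact: parity_subspace.
apply: ob_parity; apply: eN_subspace; [exact: parity_subspace|by move=> y; apply: N_parity|].
by apply: iterN_parity; apply: cmp_parity.
Qed.

(** The power of x_0 selects one g-weight of u and one index of the delta function. *)
Lemma al_uniq al (n : int) : cmp al != 0 -> - n%:~R - 1 - al = a0 -> al = al0 /\ n = n0.
Proof.
move=> c0 E; have sal : strip al by exact: (component_D (g_direct g) c0).
by apply: strip_uniq => //; rewrite [RHS]addrC -al0E -E; ring.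
Qed.

Definition mm : mono := (xmon x0 a0 + xmon x1 a1 + xmon x2 a2 + lmm x0 x1 k0 k1 + lmo x2 k2).

Lemma co_mm : co mm = (a0, a1, a2, k0, k1, k2).
Proof. by rewrite /co /mm !(monoE, lmo1, lmo2) /= !(addr0, add0r, addn0, add0n). Qed.

Section Lhs1.
Local Notation F1 := (fscale (fdelta x0 (bsub x1 x2))
    (fbil (YWser M x1) (fpowL g x0 (bsub x1 x2) u) (twist M x2 w v))).

(** The sums over the powers of log x_1 cancel, as (1 - 1)^k1, unless k1 = 0: the argument
    (x_1 - x_2)^N of Y_W absorbs the logarithms of Y_W(u, x_1). The two binomial expansions combine
    by Vandermonde. *)
Lemma value1 : exists K1 : nat, forall K, (K1 <= K)%N ->
  F1 mm = (k1 == 0%N)%:R *: \sum_(s < K) (-1) ^+ s *: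
     YW M (ob (- a0 - 1) s up) (a0 + a1 + 1 + s%:R) 0 (tw M w v (a2 - s%:R, k2)).
Proof.
have [B HB] := tw_trunc Mlb hv hw; have [K1 HK1] := ex_nat_gt (complex.Re a2 - B).
have twz s : (K1 <= s)%N -> tw M w v (a2 - s%:R, k2) = 0.
  move=> Ks; apply: HB; rewrite /= Re_add Re_neg -(rmorph_nat (real_complex R)) /=.
  have : (K1%:R : R) <= s%:R by rewrite ler_nat.
  by lra.
exists K1 => K KK.
pose pp (x : nat * (nat * nat)) : (int * nat) * ((C * nat * nat * nat) * (C * nat) * (C * nat)) :=
  ((n0, x.1), ((al0, x.2.1, x.2.2, k0), (a2 - (x.1 + x.2.1)%:R, k2),
     (a0 + a1 + 1 + (x.1 + x.2.1)%:R, (k1 - x.2.2)%N))).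
rewrite (rep_coef_param (p := pp) (s := box K k1.+1) (rep_lhs1 Mlb u hv hw)); last 3 first.
- by rewrite map_inj_uniq ?box_uniq// => -[a [b c]] [a' [b' c']]; case=> -> -> ->.
- move=> [r' [r p]]; rewrite mem_box => /and3P[_ _]; rewrite ltnS => pk; apply: co_inj; rewrite co_mm /pp /= co_f1 subnKC//.
  by rewrite n0E !natrD; congr (_, _, _, _, _, _); ring.
- move=> [[n r'] [[[[[al r] p] q] [c k]] [d l]]] /(congr1 co); rewrite co_mm co_f1.
  move=> [E0 E1 E2 L0 L1 L2] cn.
  have c0 : cmp al != 0.
    apply: contraNneq cn => a0'.
    rewrite -[X in X == 0]/((cexp (0 * n%:~R) * ((-1) ^+ r' * binC n%:~R r')) *:
      YW M (powc g 0 u (al, r, p, q)) d l (tw M w v (c, k))).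
    by rewrite (powc0 _ (x := (al, r, p, q)) a0') (lin0 (YWlin_l M _ _ _)) scaler0.
  have [alE nE] := al_uniq c0 E0.
  have cE : c = a2 - (r' + r)%:R by rewrite -E2 natrD; ring.
  have rK : (r' + r < K)%N.
    rewrite ltnNge; apply: contraNN cn => Kr.
    rewrite -[X in X == 0]/((cexp (0 * n%:~R) * ((-1) ^+ r' * binC n%:~R r')) *:
      YW M (powc g 0 u (al, r, p, q)) d l (tw M w v (c, k))).
    by rewrite L2 cE twz ?(leq_trans KK Kr)// (lin0 (YWlin_r M _ _ _)) scaler0.
  exists (r', (r, p)).
    by rewrite mem_box; lia.
  rewrite /pp /= -alE -nE -cE -L0 -L1 -L2 addKn; congr (_, (_, _, (_, _))).
  rewrite -E1 -E0 natrD; ring.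
rewrite sum_box.
pose G r' r : W := ((-1) ^+ (r' + r) * binC n0%:~R r') *:
  ((k1 == 0%N)%:R *: YW M (ob al0 r up) (a0 + a1 + 1 + (r' + r)%:R) 0 (tw M w v (a2 - (r' + r)%:R, k2))).
transitivity (\sum_(r' < K) \sum_(r < K) G r' r).
  apply: eq_bigr => r' _; apply: eq_bigr => r _.
  rewrite /G; set b := a0 + a1 + 1 + _; set y := tw M w v _.
  transitivity (\sum_(p < k1.+1) ((-1) ^+ (r' + r) * binC n0%:~R r' *
      (p`!%:R^-1 * ((-1) ^+ (k1 - p) / (k1 - p)`!%:R)) * ((-1) ^+ k0 / k0`!%:R)) *:
      YW M (ob al0 r (iter (k1 + k0) N (cmp al0))) b 0 y).
    apply: eq_bigr => p _; have pk : (p <= k1)%N by have := ltn_ord p; rewrite ltnS.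
    rewrite -[LHS]/((cexp (0 * n0%:~R) * ((-1) ^+ r' * binC n0%:~R r')) *:
      YW M (powc g 0 u (al0, nat_of_ord r, nat_of_ord p, k0)) b (k1 - nat_of_ord p) y).
    rewrite (YW_logE M _ y b (k1 - p)) /powc !(linZ _ _ (Nlin g (k1 - p))) iter_ob eN0 -iterD.
    rewrite !(linZ _ _ (YWlin_l M b 0%N y)) !scalerA addnA subnK// !mul0r cexp0; congr (_ *: _).
    rewrite natrM invfM exprD; ring.
  rewrite -scaler_suml -mulr_suml -mulr_sumr alt_sum.
  have [->|k1n] := eqVneq k1 0%N; last by rewrite mulr0 mul0r !scale0r scaler0.
  rewrite scale1r mulr1 /up (linZ _ _ (obin_linear _ _)) (linZ _ _ (YWlin_l M b 0%N y)).
  by rewrite scalerA add0n.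
rewrite sum_triangle => [|r' r Kr]; last first.
  by rewrite /G twz ?(leq_trans KK Kr)// (lin0 (YWlin_r M _ _ _)) !scaler0.
rewrite scaler_sumr; apply: eq_bigr => s' _.
rewrite al0E -ob_binC (lin_sum _ _ _ (YWlin_l M _ 0%N _)) !scaler_sumr; apply: eq_bigr => -[r' rs] _ /=.
rewrite /G subnKC// (linZ _ _ (YWlin_l M _ 0%N _)) !scalerA; congr (_ *: _); ring.
Qed.

End Lhs1.

(** The scalar common to the three sides: a sign, and the phase of x_2^a2 under x_2 -> e^{pi i} x_2. *)
Definition sgc : C := (-1) ^+ (pv && pw) * cexp (pi_i * a2).

(** All powers of L(-1) are moved to the left of the modes of u. The binomials this produces cancel the
    operator part of those from (x_1 - x_2)^{al + N}, and the scalar binomials of the commutator side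
    of the Borcherds identity are left. *)
Lemma value1_int z : a1 = z%:~R -> exists K1 : nat, forall K, (K1 <= K)%N ->
  \sum_(s < K) (-1) ^+ s *:
     YW M (ob (- a0 - 1) s up) (a0 + a1 + 1 + s%:R) 0 (tw M w v (a2 - s%:R, k2)) =
  sgc *: \sum_(j < K) (-1) ^+ j *: Ld M j (\sum_(s < K) nbin z s *:
     YW M up (a0 + z%:~R + 1 + s%:R) 0 (YW M vp (a2 - j%:R - s%:R) 0 w)).
Proof.
move=> a1E; have [J0 HJ0] := TgE vp w a2.
have [B HB] := YW_trunc Mlb vp w; have [K1 HK1] := sub_nat_Re a2 B.
exists (J0 + K1)%N => K KK.
pose G r i j : W := ((-1) ^+ (i + j)) *: Ld M j (YW M (ob (- (a0 + a1 + 1 + r%:R) - 1) i (ob (- a0 - 1) r up))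
   (a0 + a1 + 1 + (r + i)%:R) 0 (YW M vp (a2 - (r + i + j)%:R) 0 w)).
have G0 r i j : (K <= r + i + j)%N -> G r i j = 0.
  move=> Kr; rewrite /G HB ?(lin0 (YWlin_r M _ _ _)) ?(lin0 (Ld_linear M _)) ?scaler0//.
  by apply: HK1; lia.
transitivity (sgc *: \sum_(r < K) \sum_(j < K) \sum_(i < j.+1) G r i (j - i)%N).
  rewrite scaler_sumr; apply: eq_bigr => r _; rewrite (twE Mlb _ hv hw) Tc_Tg (HJ0 r K); last by lia.
  rewrite (linZ _ _ (YWlin_r M _ _ _)) (lin_sum _ _ _ (YWlin_r M _ _ _)) !scaler_sumr.
  apply: eq_bigr => j _; rewrite -/vp YW_Ld !scaler_sumr; apply: eq_bigr => -[i ij] _ /=.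
  rewrite /G -[(r + i + _)%N]addnA subnKC// (linZ _ _ (YWlin_r M _ _ _)) (linZ _ _ (Ld_linear M _)).
  rewrite [LHS]scalerA [LHS]scalerA [RHS]scalerA.
  rewrite (_ : a2 - r%:R - j%:R = a2 - (r + j)%:R); last by rewrite natrD opprD addrA.
  rewrite (_ : a0 + a1 + 1 + (r + i)%:R = a0 + a1 + 1 + r%:R + i%:R); last by rewrite natrD addrA.
  congr (_ *: _); rewrite cexp_subn exprD.
  rewrite /sgc; have := sgn2 r; move: ((-1) ^+ r : C) ((-1) ^+ j : C) (cexp _) ((-1) ^+ (pv && pw) : C) => x y e f xx.
  by transitivity (f * e * y * (x * x)); [ring|rewrite xx; ring].
congr (_ *: _).
transitivity (\sum_(r < K) \sum_(i < K) \sum_(j < K) G r i j).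
  by apply: eq_bigr => r _; rewrite -(sum_triangle (H := G r))// => i j ij; apply: G0; lia.
transitivity (\sum_(j < K) \sum_(r < K) \sum_(i < K) G r i j).
  by rewrite [RHS]exchange_big; apply: eq_bigr => r _; exact: exchange_big.
apply: eq_bigr => j _; rewrite (sum_triangle (H := fun r i => G r i j)) => [|r i ri]; last by apply: G0; lia.
rewrite (lin_sum _ _ _ (Ld_linear M j)) scaler_sumr; apply: eq_bigr => s' _.
set b := a0 + z%:~R + 1 + s'%:R; set y := YW M vp _ 0 w.
have -> : nbin z s' *: YW M up b 0 y = \sum_(i < s'.+1) (-1) ^+ i *:
    YW M (ob (- (a0 + a1 + 1 + s'%:R) - 1 + i%:R) i (ob (- a0 - 1) (s' - i) up)) b 0 y.
  rewrite -(linZ _ _ (YWlin_l M b 0%N y)).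
  rewrite (_ : nbin z s' = binC (a0 + a1 + 1 + s'%:R + (- a0 - 1)) s'); last first.
    by rewrite /nbin a1E; congr binC; ring.
  rewrite -(@ob_cancel _ _ _ g) (lin_sum _ _ _ (YWlin_l M b 0%N y)); apply: eq_bigr => i _.
  by rewrite (linZ _ _ (YWlin_l M b 0%N y)).
rewrite (lin_sum _ _ _ (Ld_linear M j)) scaler_sumr (reindex_inj rev_ord_inj) /=.
apply: eq_bigr => -[i is'] _ /=; have {}is' : (i <= s')%N by [].
rewrite (linZ _ _ (Ld_linear M j)) scalerA /G ?subSS subKn// subnK// /y.
congr (_ *: Ld M _ (YW M (ob _ _ _) _ _ (YW M vp _ _ w))).
- by rewrite addnC exprD.
- by rewrite natrB//; ring.
- by rewrite /b a1E.
- by rewrite natrD opprD addrA addrAC.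
Qed.

Section Lhs2.
Local Notation F2 := (fscale (fcst ((-1) ^+ (pu && pw))) (fscale (fdelta x0 (bnegadd x2 x1))
    (fbil (twist M x2) (fcst w) (fbil (YVser VA x1) (fpowL g x0 (bnegadd x2 x1) u) (fcst v))))).

Lemma powc_eN r p : eN g (- pi_i) (powc g pi_i u (al0, r, p, k0)) =
  ((-1) ^+ r * cexp (pi_i * al0)) *: (p`!%:R^-1 *: iter p N (ob al0 r up)).
Proof.
rewrite /powc !(linZ _ _ (eN_linear g (- pi_i))) eN_ob eN_inv /up.
rewrite (linZ _ _ (obin_linear _ _)) (linZ _ _ (Nlin g p)) iter_ob -iterD !scalerA; congr (_ *: _).
rewrite natrM invfM; ring.
Qed.

(** The powers of log x_2 coming from the twist map and from the complex power recombine: N is a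
    derivation, so the part acting on u cancels and only v carries logarithms. *)
Lemma tw_sum c r (d : int) :
  \sum_(p < k2.+1) Tc M (c, (k2 - p)%N) (YV VA (powc g pi_i u (al0, r, nat_of_ord p, k0)) d v) w =
  ((-1) ^+ r * cexp (pi_i * al0)) *: Tg c (YV VA (ob al0 r up) d vp) w.
Proof.
transitivity (\sum_(p < k2.+1) ((-1) ^+ r * cexp (pi_i * al0)) *: Tg c (((-1) ^+ (k2 - p) / (k2 - p)`!%:R) *:
   iter (k2 - p) N (YV VA (p`!%:R^-1 *: iter p N (ob al0 r up)) d (eN g (- pi_i) v))) w).
  apply: eq_bigr => p _; rewrite Tc_Tg eN_YV powc_eN.
  rewrite (linZ _ _ (YVlin_l VA d _)) (linZ _ _ (Nlin g (k2 - p))).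
  by rewrite scalerA [X in Tg _ (X *: _) _]mulrC -(linZ _ _ (Tg_linear c w)) scalerA.
by rewrite -scaler_sumr -(lin_sum _ _ _ (Tg_linear c w)) alt_YV.
Qed.

(** The two binomial expansions combine into binom(- 1 - a0 + N, -), the operator binomial of the
    iterate side of the Borcherds identity; the phases e^{pi i n} and e^{pi i al} of - x_2 + x_1 and
    those of the twist map multiply to the common one. *)
Lemma value2 z : a1 = z%:~R -> k1 = 0%N -> exists K1 : nat, forall K, (K1 <= K)%N ->
  F2 mm = sgc *: \sum_(j < K) (-1) ^+ j *: Ld M j (brhs M up vp w a0 z (a2 - j%:R) K).
Proof.
move=> a1E k1E; have [Jf HJf] := powc_trunc (g := g) u v.
have [Jm HJm] : exists J : nat, forall p J' : nat, (p < k2.+1)%N -> (J <= J')%N -> - J'%:Z <= Jf al0 p k0.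
  apply: (ex_max (P := fun p J' => - J'%:Z <= Jf al0 p k0)) => p.
  by exists (absz (Jf al0 p k0)) => J' ?; lia.
have [J HJ] := YV_trunc_obin (g := g) up vp.
pose S0 := (absz z + absz J).+1.
have y0 c s t : (S0 <= s)%N -> YV VA (ob c t up) (z - s%:Z) vp = 0.
  by rewrite /S0 => S0s; apply: HJ; lia.
pose ys s := YV VA (ob (- 1 - a0) s up) (z - s%:Z) vp.
have [K1 HK1] := Tg_unif (y := ys) (z := fun=> w) (fun s => a2 + a0 + 1 + s%:R)
  (fun s h => or_introl (y0 _ s s h)).
exists (K1 + S0 + absz z + Jm).+1 => K KK.
pose pp (x : nat * (nat * nat)) : (int * nat) * (unit * ((C * nat * nat * nat) * unit * int) * (C * nat)) :=
  ((n0, x.1), ((tt, ((al0, x.2.1, x.2.2, k0), tt, z - (x.1 + x.2.1)%N%:Z)),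
     (a2 + a0 + 1 + (x.1 + x.2.1)%:R, (k2 - x.2.2)%N))).
rewrite (rep_coef_param (p := pp) (s := box K k2.+1) (rep_lhs2 Mlb pu pw u v w)); last 3 first.
- by rewrite map_inj_uniq ?box_uniq// => -[a [b c]] [a' [b' c']]; case=> -> -> ->.
- move=> [r' [r p]]; rewrite mem_box => /and3P[_ _]; rewrite ltnS => pk; apply: co_inj; rewrite co_mm /pp co_f2 subnKC// k1E a1E n0E.
  by rewrite intrB -[((r' + r)%N : int)%:~R]/((r' + r)%:R : C) !natrD; congr (_, _, _, _, _, _); ring.
- move=> [[n r'] [[[] [[[[[al r] p] q] []] d]] [c k]]] /(congr1 co).
  rewrite co_mm (co_f2 n r' al r p q d c k) => -[E0 E1 E2 L0 L1 L2] cn.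
  have yn0 : YV VA (powc g pi_i u (al, r, p, q)) d v != 0.
    by apply: contraNneq cn => /= ->; rewrite (tw0r Mlb) !scaler0.
  have c0 : cmp al != 0.
    apply: contraNneq yn0 => h.
    by rewrite (powc0 _ (x := (al, r, p, q)) h) (lin0 (YVlin_l VA d v)).
  have [alE nE] := al_uniq c0 E0.
  have dE : d = z - (r' + r)%N%:Z.
    apply/eqP; rewrite -(eqr_int C); apply/eqP; rewrite intrB -a1E -E1.
    rewrite -[((r' + r)%N : int)%:~R]/((r' + r)%:R : C) natrD; ring.
  have pk : (p < k2.+1)%N by rewrite ltnS -L2 leq_addr.
  have dJ := HJf _ _ _ _ _ yn0; have mJ := HJm p Jm pk (leqnn _).
  have rK : (r' + r < K)%N by move: dJ; rewrite alE L0 dE; lia.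
  exists (r', (r, p)).
    by rewrite mem_box; lia.
  rewrite /pp /= -alE -nE -dE -L0 -L2 addKn.
  by rewrite (_ : a2 + a0 + 1 + (r' + r)%:R = c)//; rewrite -E2 -E0 natrD; ring.
rewrite sum_box.
pose sg : C := (-1) ^+ (pv && pw) * cexp (pi_i * (- a0 - 1)).
pose H r' r : W := (sg * ((-1) ^+ (r' + r) * binC n0%:~R r')) *:
  Tg (a2 + a0 + 1 + (r' + r)%:R) (YV VA (ob al0 r up) (z - (r' + r)%N%:Z) vp) w.
transitivity (\sum_(r' < K) \sum_(r < K) H r' r).
  apply: eq_bigr => r' _; apply: eq_bigr => r _.
  transitivity (((-1) ^+ (pv && pw) * (cexp (pi_i * n0%:~R) * ((-1) ^+ r' * binC n0%:~R r'))) *: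
    \sum_(p < k2.+1) Tc M (a2 + a0 + 1 + (r' + r)%:R, (k2 - p)%N)
      (YV VA (powc g pi_i u (al0, nat_of_ord r, nat_of_ord p, k0)) (z - (r' + r)%N%:Z) v) w).
    rewrite scaler_sumr; apply: eq_bigr => p _.
    rewrite -[LHS]/((-1) ^+ (pu && pw) *: ((cexp (pi_i * n0%:~R) * ((-1) ^+ r' * binC n0%:~R r')) *:
      tw M w (YV VA (powc g pi_i u (al0, nat_of_ord r, nat_of_ord p, k0)) (z - (r' + r)%N%:Z) v)
        (a2 + a0 + 1 + (r' + r)%:R, (k2 - p)%N))).
    rewrite (twE Mlb _ (YV_parity _ (powc_parity _ _) hv) hw) !scalerA; congr (_ *: _).
    by move: (cexp _ * _) => X; case: (pu); case: (pv); case: (pw); rewrite /= ?expr0 ?expr1; ring.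
  rewrite tw_sum scalerA; congr (_ *: _); rewrite /sg al0E mulrDr cexpD exprD; ring.
rewrite sum_triangle => [|r' r Kr]; last first.
  by rewrite /H y0 ?(lin0 (Tg_linear _ w)) ?scaler0//; rewrite /S0; lia.
transitivity (\sum_(s < K) (sg * (-1) ^+ s) *: Tg (a2 + a0 + 1 + s%:R) (ys s) w).
  apply: eq_bigr => s' _.
  rewrite /ys (_ : - 1 - a0 = n0%:~R + al0); last by rewrite -al0E addrC.
  rewrite -ob_binC (lin_sum _ _ _ (YVlin_l VA _ vp)) (lin_sum _ _ _ (Tg_linear _ w)) scaler_sumr.
  apply: eq_bigr => -[r' rs] _ /=; rewrite /H subnKC//.
  rewrite (linZ _ _ (YVlin_l VA _ vp)) (linZ _ _ (Tg_linear _ w)) scalerA; congr (_ *: _); ring.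
transitivity (\sum_(s < K) \sum_(j < K) (sgc * (-1) ^+ j) *:
    Ld M j (YW M (ys s) (a0 + (a2 - j%:R) + 1 + s%:R) 0 w)).
  apply: eq_bigr => s' _; rewrite (HK1 K s'); last by lia.
  rewrite scaler_sumr; apply: eq_bigr => j _; rewrite (linZ _ _ (Ld_linear M j)) scalerA.
  rewrite (_ : a2 + a0 + 1 + s'%:R - j%:R = a0 + (a2 - j%:R) + 1 + s'%:R); last by ring.
  congr (_ *: _); have := sgn2 s'.
  have : cexp (pi_i * (- a0 - 1)) * cexp (pi_i * (a0 + (a2 - j%:R) + 1 + s'%:R)) =
      cexp (pi_i * a2) * (-1) ^+ s' * (-1) ^+ j.
    rewrite -cexpD -cexp_addn -cexp_subn; congr cexp; ring.
  rewrite /sg /sgc; move: (cexp (pi_i * (- a0 - 1))) (cexp (pi_i * (a0 + (a2 - j%:R) + 1 + s'%:R))) ((-1) ^+ s' : C)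
    ((-1) ^+ j : C) ((-1) ^+ (pv && pw) : C) (cexp (pi_i * a2)).
  move=> A B x y f e AB xx.
  by transitivity (f * x * (A * B)); [ring|rewrite AB; transitivity (f * e * y * (x * x)); [ring|rewrite xx; ring]].
rewrite exchange_big scaler_sumr /=; apply: eq_bigr => j _.
by rewrite /brhs (lin_sum _ _ _ (Ld_linear M j)) !scaler_sumr; apply: eq_bigr => s' _; rewrite -scalerA.
Qed.

End Lhs2.

Section Rhs.
Local Notation F3 := (fscale (fdelta x1 (badd x2 x0)) (fbil (twist M x2) (YWser M x0 u w) (fcst v))).

(** The other g-weight components of u contribute to other powers of x_0. *)
Lemma YW_up (r : nat) y : YW M u (a0 - r%:R) k0 y = YW M up (a0 - r%:R) 0 y.
Proof.
set b := a0 - r%:R; have [s [us Hs]] := finite_set_seq (component_finite (g_direct g) u).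
have uE : u = \sum_(al <- s) cmp al by apply: (component_sum (g_direct g) us) => al /Hs.
have vanish al : al != al0 -> YW M (iter k0 N (cmp al)) b 0 y = 0.
  move=> ne; have [c0|c0] := eqVneq (cmp al) 0.
    by rewrite c0 (lin0 (Nlin g k0)) (lin0 (YWlin_l M _ _ _)).
  have sal : strip al := component_D (g_direct g) c0.
  apply: (YW_support_geneig M _ 0 sal (iterN_geneig k0 (cmp_geneig al))) => -[n nE].
  have E : al + (0 : int)%:~R = al0 + (n + r%:Z + n0 + 1)%:~R.
    rewrite mulr0z !intrD -nE n0E /b -[(r : int)%:~R]/(r%:R : C); ring.
  by case/eqP: ne; case: (strip_uniq sal al0_strip E).
rewrite YW_logE {1}uE (lin_sum _ _ _ (Nlin g k0)) (lin_sum _ _ _ (YWlin_l M b 0%N y)).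
rewrite /up (linZ _ _ (YWlin_l M b 0%N y)) mulrC.
have [is'|ns] := boolP (al0 \in s).
  by rewrite (bigD1_seq al0)//= big1 ?addr0// => al; apply: vanish.
rewrite big1_seq => [|al /andP[_ als]]; last by apply: vanish; apply: contraNneq ns => <-.
have -> : cmp al0 = 0 by apply/eqP; apply: contraNT ns => /Hs.
by rewrite (lin0 (Nlin g k0)) (lin0 (YWlin_l M _ _ _)).
Qed.

(** The binomials of (x_2 + x_0)^n are upper negations of those on the commutator side; the parity
    of Y_W(u, x_0)w produces the sign of the transposition. *)
Lemma value3 z : a1 = z%:~R -> k1 = 0%N -> exists K1 : nat, forall K, (K1 <= K)%N ->
  F3 mm = - (sgc *: \sum_(j < K) (-1) ^+ j *: Ld M j (((-1) ^+ (pu && pv) * (-1) ^ z) *: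
    \sum_(i < K) nbin z i *: YW M vp (a2 - j%:R + z%:~R + 1 + i%:R) 0 (YW M up (a0 - i%:R) 0 w))).
Proof.
move=> a1E k1E; have [B HB] := YW_trunc Mlb u w; have [S0 HS] := sub_nat_Re a0 B.
have zs0 s : (S0 <= s)%N -> YW M up (a0 - s%:R) 0 w = 0.
  by move=> Ss; rewrite -YW_up HB//; apply: HS.
have [K1 HK1] := Tg_unif (y := fun=> vp) (z := fun s => YW M up (a0 - s%:R) 0 w)
  (fun s => a2 + z%:~R + 1 + s%:R) (fun s h => or_intror (zs0 s h)).
exists (K1 + S0).+1 => K KK.
pose pp (x : nat) : (int * nat) * ((C * nat) * unit * (C * nat)) :=
  ((- z - 1, x), (((a0 - x%:R, k0), tt), (a2 + z%:~R + 1 + x%:R, k2))).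
have nE0 : (- z - 1)%:~R = - z%:~R - 1 :> C by rewrite intrB intrN.
rewrite (rep_coef_param (p := pp) (s := iota 0 K) (rep_rhs Mlb u v w)); last 3 first.
- by rewrite map_inj_uniq ?iota_uniq// => a b; case.
- move=> r _; apply: co_inj; rewrite co_mm /pp co_f3 k1E a1E nE0.
  by congr (_, _, _, _, _, _); ring.
- move=> [[n r'] [[[b l] []] [c k]]] /(congr1 co).
  rewrite co_mm (co_f3 n r' b l c k) => -[E0 E1 E2 L0 L1 L2] cn.
  have bE : b = a0 - r'%:R by rewrite -E0; ring.
  have nE : n = - z - 1.
    apply/eqP; rewrite -(eqr_int C) nE0 -a1E -E1; apply/eqP; ring.
  have rK : (r' < K)%N.
    rewrite ltnNge; apply: contraNN cn => Kr.
    rewrite -[X in X == 0]/(binC n%:~R r' *: tw M (YW M u b l w) v (c, k)).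
    by rewrite bE HB ?(tw0l Mlb) ?scaler0//; apply: HS; lia.
  exists r'; first by rewrite mem_iota; lia.
  rewrite /pp -nE -bE -L0 -L2 -a1E -E1 -E2; congr (_, (_, (_, _))); ring.
rewrite sum_iota0.
transitivity (\sum_(r < K) (((-1) ^+ (pv && pw) * (-1) ^+ (pu && pv)) * ((-1) ^+ r * nbin z r)) *:
    Tg (a2 + z%:~R + 1 + r%:R) vp (YW M up (a0 - r%:R) 0 w)).
  apply: eq_bigr => r _.
  rewrite -[LHS]/(binC (- z - 1)%:~R r *: tw M (YW M u (a0 - r%:R) k0 w) v (a2 + z%:~R + 1 + r%:R, k2)).
  have hb : Wparity M (pu (+) pw) (YW M u (a0 - r%:R) k0 w) by apply: YW_parity.
  rewrite (twE Mlb _ hv hb) Tc_Tg -/vp YW_up scalerA; congr (_ *: _).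
  rewrite nE0 binC_neg -/(nbin z r); move: ((-1) ^+ r * _) => X.
  by case: (pu); case: (pv); case: (pw); rewrite /= ?expr0 ?expr1; ring.
transitivity (\sum_(r < K) \sum_(j < K) (- (sgc * ((-1) ^+ j * (((-1) ^+ (pu && pv) * (-1) ^ z) * nbin z r)))) *:
    Ld M j (YW M vp (a2 - j%:R + z%:~R + 1 + r%:R) 0 (YW M up (a0 - r%:R) 0 w))).
  apply: eq_bigr => r _; rewrite (HK1 K r); last by lia.
  rewrite scaler_sumr; apply: eq_bigr => j _; rewrite (linZ _ _ (Ld_linear M j)) scalerA.
  have -> : cexp (pi_i * (a2 + z%:~R + 1 + r%:R - j%:R)) =
      - (cexp (pi_i * a2) * (-1) ^ z * (-1) ^+ r * (-1) ^+ j).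
    rewrite cexp_subn cexp_addn !mulrDr mulr1 !cexpD cexp_pii_int cexp_pii; ring.
  rewrite (_ : a2 + z%:~R + 1 + r%:R - j%:R = a2 - j%:R + z%:~R + 1 + r%:R); last by ring.
  congr (_ *: _); have := sgn2 r.
  rewrite /sgc; move: ((-1) ^+ r : C) (cexp _) ((-1) ^ z : C) ((-1) ^+ j : C) (nbin z r : C) => x e t y b xx.
  by transitivity (- ((-1) ^+ (pv && pw) * (-1) ^+ (pu && pv) * b * e * t * y * (x * x))); [ring|rewrite xx; ring].
rewrite exchange_big scaler_sumr -sumrN /=; apply: eq_bigr => j _.
rewrite (linZ _ _ (Ld_linear M j)) (lin_sum _ _ _ (Ld_linear M j)) !scaler_sumr -sumrN; apply: eq_bigr => r _.
by rewrite (linZ _ _ (Ld_linear M j)) scaleNr -!scalerA.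
Qed.

End Rhs.

Local Notation F1 := (fscale (fdelta x0 (bsub x1 x2))
    (fbil (YWser M x1) (fpowL g x0 (bsub x1 x2) u) (twist M x2 w v))).
Local Notation F2 := (fscale (fcst ((-1) ^+ (pu && pw))) (fscale (fdelta x0 (bnegadd x2 x1))
    (fbil (twist M x2) (fcst w) (fbil (YVser VA x1) (fpowL g x0 (bnegadd x2 x1) u) (fcst v))))).
Local Notation F3 := (fscale (fdelta x1 (badd x2 x0)) (fbil (twist M x2) (YWser M x0 u w) (fcst v))).

(** The second and third sides contain only integral powers of x_1 and no logarithm of x_1; on the
    first side the logarithms cancel and the nonintegral powers vanish by the monodromy of Y_W. *)
Lemma sides0 : ~ ((exists z : int, a1 = z%:~R) /\ k1 = 0%N) ->
  [/\ F1 mm = 0, F2 mm = 0 & F3 mm = 0].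
Proof.
move=> H; split.
- have [K1 H1] := value1; rewrite (H1 K1 (leqnn K1)); have [k10|_] := eqVneq k1 0%N; last by rewrite scale0r.
  rewrite big1 ?scaler0// => s _.
  rewrite (YW_support_geneig M _ 0 al0_strip (ob_geneig _ _ up_geneig)) ?scaler0// => -[n nE].
  apply: H; split=> //; exists (n + n0 - (s : nat)%:Z).
  rewrite intrB intrD -nE n0E -[((s : nat) : int)%:~R]/(s%:R : C); ring.
- apply: (rep_coef0 (rep_lhs2 Mlb pu pw u v w)) => -[[n r'] [[[] [[[[[al r] p] q] []] d]] [c k]]].
  move=> /(congr1 co); rewrite co_mm (co_f2 n r' al r p q d c k) => -[E0 E1 E2 L0 L1 L2].
  by case: H; split; [exists (r'%:Z + (r%:Z + d)); rewrite -E1 !intrD|].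
- apply: (rep_coef0 (rep_rhs Mlb u v w)) => -[[n r'] [[[b l] []] [c k]]].
  move=> /(congr1 co); rewrite co_mm (co_f3 n r' b l c k) => -[E0 E1 E2 L0 L1 L2].
  by case: H; split; [exists (- n - 1); rewrite -E1 intrB intrN|].
Qed.

(** Term by term in the power of L(-1), the difference is the Borcherds identity at a2 - j. *)
Lemma coef_identity : F1 mm - F2 mm = F3 mm.
Proof.
have [[[z a1E] k1E]|/sides0[-> -> ->]] := EM ((exists z : int, a1 = z%:~R) /\ k1 = 0%N); last exact: subr0.
have [K1 H1] := value1; have [K2 H2] := value1_int a1E.
have [K3 H3] := value2 a1E k1E; have [K4 H4] := value3 a1E k1E.
have [I1 HI1] := borcherds_stable Mlb (pu && pv) up vp w a0 z a2.
pose K := (K1 + K2 + K3 + K4 + I1)%N.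
rewrite (H1 K) ?(H2 K) ?(H3 K) ?(H4 K); try by rewrite /K; lia.
rewrite k1E eqxx scale1r; apply/eqP; rewrite -addr_eq0 -scalerBr -scalerDr -sumrB -big_split /=.
rewrite big1 ?scaler0// => j _.
have q_eq : a0 + al0 = (- n0 - 1)%:~R by rewrite intrB intrN n0E; ring.
have key : blhs M (pu && pv) up vp w a0 z (a2 - j%:R) K = brhs M up vp w a0 z (a2 - j%:R) K.
  have [I0 HI0] := @borcherds _ _ _ _ _ M Mlb pu pv al0 up vp w a0 (a2 - j%:R) z (- n0 - 1)
    up_parity vp_parity al0_strip q_eq up_geneig.
  have [S1 S2] := HI1 j K (K + I0)%N ltac:(rewrite /K; lia) ltac:(lia).
  by rewrite -S1 -S2; apply: HI0; lia.
rewrite -key /blhs (linD _ _ (Ld_linear M j)) scalerDr opprD addrA subrr add0r.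
exact: addNr.
Qed.

End Values.

(* fsub denotes the difference of formal series again, not an operation on finite sets *)
Import Defs.

Theorem theorem4p6 (R : realType) (V W : lmodType R[i])
    (VA : vertex_superalgebra V) (g : automorphism VA)
    (M : twisted_module g W) (Mlb : lower_bounded M)
    (pu pv pw : bool) (u v : V) (w : W)
    (hu : Vparity VA pu u) (hv : Vparity VA pv v) (hw : Wparity M pw w) :
  let lhs1 :=
    fscale (fdelta x0 (bsub x1 x2))
      (fbil (YWser M x1) (fpowL g x0 (bsub x1 x2) u) (twist M x2 w v)) in
  let lhs2 :=
    fscale (fcst ((-1) ^+ (pu && pw)))
      (fscale (fdelta x0 (bnegadd x2 x1))
        (fbil (twist M x2) (fcst w)
          (fbil (YVser VA x1) (fpowL g x0 (bnegadd x2 x1) u)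
            (fcst v)))) in
  let rhs :=
    fscale (fdelta x1 (badd x2 x0))
      (fbil (twist M x2) (YWser M x0 u w) (fcst v)) in
  [/\ defined lhs1, defined lhs2, defined rhs &
      forall m, fsub lhs1 lhs2 m = rhs m].
Proof.
split.
- exact: (rep_lhs1 Mlb u hv hw).1.
- exact: (rep_lhs2 Mlb pu pw u v w).1.
- exact: (rep_rhs Mlb u v w).1.
move=> m; have [n0 s0] := int_strip (- m.1 x0 - 1).
have mE : m = mm (m.1 x0) (m.1 x1) (m.1 x2) (m.2 x0) (m.2 x1) (m.2 x2).
  by apply: co_inj; rewrite co_mm.
have E : - m.1 x0 - 1 = n0%:~R + (- m.1 x0 - 1 - n0%:~R) by ring.
rewrite mE; exact: (coef_identity Mlb hu hv hw _ _ _ _ _ s0 E).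
Qed.
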